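(* Let $\mathcal{X}=[(\mathbb{P}^9\setminus\Delta)/\mathrm{PGL}_3]$ be the moduli stack of smooth plane cubics over $\mathbb{C}$ up to projective equivalence, let $\mathcal{Y}$ be the moduli stack of pairs $(C\subset\mathbb{P}^2,p)$ where $C$ is a smooth plane cubic and $p\in C$ is a flex, and let $f:\mathcal{Y}\to\mathcal{X}$ be the degree 9 cover forgetting the flex. Then the monodromy group of $f$ is $\mathrm{Mon}_f=\mathrm{ASL}_2(\mathbb{F}_3)$.
   Context: $\mathbb{P}^9$ is the projective space of plane cubic forms over $\mathbb{C}$ and $\Delta$ is the locus of singular cubics. Arrows in $\mathcal{Y}$ are projective transformations preserving the marked flex. The map $f$ is representable, finite and étale of degree 9. $\mathrm{ASL}_2(\mathbb{F}_3)=\mathbb{F}_3^2\rtimes\mathrm{SL}_2(\mathbb{F}_3)$ is the affine special linear group, of order 216. Monodromy group: for a connected representable finite étale cover $f:(\mathcal{Y},y)\to(\mathcal{X},x)$ of connected algebraic stacks, $\mathrm{Mon}_f:=\pi_1(\mathcal{X},x)/N_f$, where $\pi_1$ is the étale fundamental group (automorphisms of the fiber functor on the Galois category of representable finite étale covers) and $N_f$ is the largest normal subgroup contained in the image of $\pi_1(\mathcal{Y},y)$. *)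

(* Defs.v *)
From HB Require Import structures.
From mathcomp Require Import all_boot all_order all_algebra all_fingroup.
From mathcomp Require Import mpoly.
From mathcomp Require Import boolp classical_sets reals.
From mathcomp Require Import complex.

Set Implicit Arguments.
Unset Strict Implicit.
Unset Printing Implicit Defensive.

Import GRing.Theory.
Local Open Scope classical_set_scope.
Local Open Scope ring_scope.

(* Groups in an arbitrary universe. The carrier of a groupType is as small as
   that of a ring, while an element of a fundamental group is a family indexed
   by all covers, hence by structures over all rings. *)
Record largeGroup := LargeGroup {
  lg_sort :> Type;
  lg_mul : lg_sort -> lg_sort -> lg_sort;
  lg_one : lg_sort;
  lg_inv : lg_sort -> lg_sort;
  lg_mulA : associative lg_mul;
  lg_mul1g : left_id lg_one lg_mul;
  lg_mulVg : left_inverse lg_one lg_inv lg_mul }.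

Declare Scope large_group_scope.
Delimit Scope large_group_scope with lg.
Notation "x * y" := (lg_mul x y) : large_group_scope.
Notation "1" := (lg_one _) : large_group_scope.
Notation "x ^-1" := (lg_inv x) : large_group_scope.
Notation "x ^ g" := (g^-1 * x * g)%lg : large_group_scope.

Section LargeGroupTheory.
Local Open Scope large_group_scope.
Variable G : largeGroup.
Implicit Types x y z : G.

Lemma lg_mulKg x y : x^-1 * (x * y) = y.
Proof. by rewrite lg_mulA lg_mulVg lg_mul1g. Qed.

Lemma lg_mulI x y z : x * y = x * z -> y = z.
Proof. by move=> E; rewrite -(lg_mulKg x y) E lg_mulKg. Qed.

Lemma lg_mulgV x : x * x^-1 = 1.
Proof.
apply: (@lg_mulI x^-1); rewrite lg_mulA lg_mulVg lg_mul1g.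
by apply: (@lg_mulI x^-1^-1); rewrite lg_mulA lg_mulVg lg_mul1g.
Qed.

Lemma lg_mulg1 x : x * 1 = x.
Proof. by rewrite -(lg_mulVg x) lg_mulA lg_mulgV lg_mul1g. Qed.

Lemma lg_mulVKg x y : x * (x^-1 * y) = y.
Proof. by rewrite lg_mulA lg_mulgV lg_mul1g. Qed.

Lemma lg_invgK x : x^-1^-1 = x.
Proof. by apply: (@lg_mulI x^-1); rewrite lg_mulgV lg_mulVg. Qed.

Lemma lg_invg1 : 1^-1 = 1 :> G.
Proof. by apply: (@lg_mulI 1); rewrite lg_mulgV lg_mul1g. Qed.

Lemma lg_invMg x y : (x * y)^-1 = y^-1 * x^-1.
Proof.
by apply: (@lg_mulI (x * y)); rewrite lg_mulgV -lg_mulA lg_mulVKg lg_mulgV.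
Qed.

Lemma lg_conjg1 x : x ^ 1 = x.
Proof. by rewrite lg_invg1 lg_mul1g lg_mulg1. Qed.

Lemma lg_conj1g x : 1 ^ x = 1.
Proof. by rewrite lg_mulg1 lg_mulVg. Qed.

Lemma lg_conjMg x y z : (x * y) ^ z = x ^ z * y ^ z.
Proof. by rewrite -!lg_mulA lg_mulVKg. Qed.

Lemma lg_conjVg x y : x^-1 ^ y = (x ^ y)^-1.
Proof. by rewrite !lg_invMg lg_invgK !lg_mulA. Qed.

Lemma lg_conjgM x y z : x ^ (y * z) = (x ^ y) ^ z.
Proof. by rewrite lg_invMg !lg_mulA. Qed.

End LargeGroupTheory.

Record subgroup (G : largeGroup) := Subgroup {
  sset :> G -> Prop;
  sset1 : sset 1%lg;
  ssetM : forall a b, sset a -> sset b -> sset (a * b)%lg;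
  ssetV : forall a, sset a -> sset a^-1%lg }.

Record normalSubgroup (G : largeGroup) := NormalSubgroup {
  nset :> subgroup G;
  nsetJ : forall a g, sset nset a -> sset nset (a ^ g)%lg }.

Section Quotient.
Local Open Scope large_group_scope.
Variables (G : largeGroup) (N : normalSubgroup G).

Definition coset_set (g : G) : G -> Prop := fun x => sset N (g^-1 * x).

Record quotient_sort := Coset {
  qset : G -> Prop;
  qsetP : exists g, qset = coset_set g }.

Definition qproj (g : G) : quotient_sort := Coset (ex_intro _ g erefl).

Lemma quotient_inj (A B : quotient_sort) : qset A = qset B -> A = B.
Proof.
case: A B => [A hA] [B hB] /= E; subst B.
by congr Coset; exact: Prop_irrelevance.
Qed.

Lemma qproj_surj (A : quotient_sort) : exists g, qproj g = A.
Proof. by case: (qsetP A) => g E; exists g; apply: quotient_inj. Qed.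

Lemma qproj_eqP (g h : G) : qproj g = qproj h <-> sset N (g^-1 * h).
Proof.
split=> [E|Ngh].
  suff : qset (qproj h) h by rewrite -E.
  by rewrite /= /coset_set /= lg_mulVg; exact: sset1.
apply: quotient_inj; apply/funext => x; apply/propext.
rewrite /= /coset_set; split=> Nx.
  rewrite (_ : h^-1 * x = (g^-1 * h)^-1 * (g^-1 * x)).
    by apply: ssetM => //; apply: ssetV.
  by rewrite lg_invMg lg_invgK -!lg_mulA lg_mulVKg.
rewrite (_ : g^-1 * x = (g^-1 * h) * (h^-1 * x)); first exact: ssetM.
by rewrite -!lg_mulA lg_mulVKg.
Qed.

Definition qrepr (A : quotient_sort) : G := sval (cid (qproj_surj A)).

Lemma qreprK A : qproj (qrepr A) = A.
Proof. exact: (svalP (cid (qproj_surj A))). Qed.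

Definition qmul (A B : quotient_sort) := qproj (qrepr A * qrepr B).
Definition qinv (A : quotient_sort) := qproj (qrepr A)^-1.

Lemma qprojM (g h : G) : qproj (g * h) = qmul (qproj g) (qproj h).
Proof.
rewrite /qmul; set g' := qrepr (qproj g); set h' := qrepr (qproj h).
have Ng : sset N (g^-1 * g') by apply/qproj_eqP; rewrite qreprK.
have Nh : sset N (h^-1 * h') by apply/qproj_eqP; rewrite qreprK.
apply/qproj_eqP.
rewrite (_ : (g * h)^-1 * (g' * h') = (g^-1 * g') ^ h * (h^-1 * h')).
  by apply: ssetM => //; exact: nsetJ.
by rewrite lg_invMg -!lg_mulA lg_mulVKg.
Qed.

Lemma qmulA : associative qmul.
Proof.
move=> A B D; rewrite -[A]qreprK -[B]qreprK -[D]qreprK.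
by rewrite -!qprojM lg_mulA.
Qed.

Lemma qmul1 : left_id (qproj 1) qmul.
Proof. by move=> A; rewrite -[A]qreprK -qprojM lg_mul1g. Qed.

Lemma qmulV : left_inverse (qproj 1) qinv qmul.
Proof. by move=> A; rewrite -[X in qmul _ X]qreprK -qprojM lg_mulVg. Qed.

Definition quotient : largeGroup := LargeGroup qmulA qmul1 qmulV.

End Quotient.

Section NormalCore.
Local Open Scope large_group_scope.
Variables (G : largeGroup) (H : subgroup G).

Definition core_set (a : G) : Prop :=
  exists2 N : normalSubgroup G, (forall b, sset N b -> sset H b) & sset N a.

Lemma core_setP a : core_set a <-> forall g, sset H (a ^ g).
Proof.
split=> [[N NH Na] g|Ha]; first by apply: NH; exact: nsetJ.
pose D b := forall g, sset H (b ^ g).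
have D1 : D 1 by move=> g; rewrite lg_conj1g; exact: sset1.
have DM b c : D b -> D c -> D (b * c).
  by move=> Kb Kc g; rewrite lg_conjMg; apply: ssetM; [exact: Kb|exact: Kc].
have DV b : D b -> D b^-1.
  by move=> Kb g; rewrite lg_conjVg; apply: ssetV; exact: Kb.
have DJ b h : D b -> D (b ^ h) by move=> Kb g; rewrite -lg_conjgM; exact: Kb.
exists (@NormalSubgroup G (Subgroup D1 DM DV) DJ) => //= b Db.
by rewrite -(lg_conjg1 b); exact: Db.
Qed.

Lemma core_set1 : core_set 1.
Proof. by apply/core_setP => g; rewrite lg_conj1g; exact: sset1. Qed.

Lemma core_setM a b : core_set a -> core_set b -> core_set (a * b).
Proof.
move=> /core_setP Ka /core_setP Kb; apply/core_setP => g.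
by rewrite lg_conjMg; exact: ssetM.
Qed.

Lemma core_setV a : core_set a -> core_set a^-1.
Proof.
move=> /core_setP Ka; apply/core_setP => g.
by rewrite lg_conjVg; exact: ssetV.
Qed.

Lemma core_setJ a g : core_set a -> core_set (a ^ g).
Proof.
by move=> /core_setP Ka; apply/core_setP => h; rewrite -lg_conjgM; exact: Ka.
Qed.

(* The union of all normal subgroups contained in H is itself one: it is the
   largest normal subgroup contained in H. *)
Definition normal_core : normalSubgroup G :=
  @NormalSubgroup G (Subgroup core_set1 core_setM core_setV) core_setJ.

End NormalCore.

(* Finite etale = finite locally free (the dual basis form of "finitely
   generated projective module") and unramified (Omega_{B/R} = 0, that is, every
   R-linear derivation of B vanishes). B may be the zero ring: the empty cover. *)
Record finite_etale (R : comNzRingType) (B : comPzRingType)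
    (s : {rmorphism R -> B}) : Prop := FiniteEtale {
  fet_projective : exists n (b : 'I_n -> B) (l : 'I_n -> B -> R),
    [/\ forall i x y, l i (x + y) = l i x + l i y,
        forall i r x, l i (s r * x) = r * l i x
      & forall x, x = \sum_(i < n) s (l i x) * b i];
  fet_unramified : forall (M : lmodType B) (D : B -> M),
    (forall x y, D (x + y) = D x + D y) ->
    (forall x y, D (x * y) = x *: D y + y *: D x) ->
    (forall r, D (s r) = 0) ->
    forall x, D x = 0 }.

Section Stacks.
Variable C : fieldType.

(* The data of a category fibered in groupoids over the nonempty affine
   C-schemes. For f : R -> S, b over S and a over R, hom f b a is the type of
   arrows b -> a lying over Spec f : Spec S -> Spec R. Composition is given by
   its graph: comp v u w says that w : c -> a is the composite of v : c -> b and
   u : b -> a.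
   A stack is handled through any prestack of which it is the stackification:
   finite etale algebras form a stack for the etale topology, so finite etale
   covers of a prestack and of its stackification are the same thing. *)
Record prestack := Prestack {
  ob : comAlgType C -> Type;
  hom : forall R S : comAlgType C, {lrmorphism R -> S} -> ob S -> ob R -> Type;
  comp : forall (R S T : comAlgType C) (f : {lrmorphism R -> S})
      (g : {lrmorphism S -> T}) (h : {lrmorphism R -> T})
      (a : ob R) (b : ob S) (c : ob T),
    hom g c b -> hom f b a -> hom h c a -> Prop }.

Record prestack_map (Y X : prestack) := PrestackMap {
  mob : forall R, ob Y R -> ob X R;
  mhom : forall (R S : comAlgType C) (f : {lrmorphism R -> S}) (b : ob Y S) (a : ob Y R),
    hom f b a -> hom f (mob b) (mob a);
  mcomp : forall (R S T : comAlgType C) (f : {lrmorphism R -> S}) (g : {lrmorphism S -> T})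
      (h : {lrmorphism R -> T}) a b c
      (v : hom g c b) (u : hom f b a) (w : hom h c a),
    comp v u w -> comp (mhom v) (mhom u) (mhom w) }.

(* A representable finite etale cover of X: a finite etale R-algebra cring a
   (the pullback of the cover along a : Spec R -> X is Spec (cring a)) for each
   object a over R, and compatible isomorphisms
   cring a (x)_R S ~ cring b for the arrows b -> a over Spec S -> Spec R. *)
Record cover (X : prestack) := Cover {
  cring : forall R, ob X R -> comPzRingType;
  cstr : forall R (a : ob X R), {rmorphism R -> cring a};
  cfet : forall R (a : ob X R), finite_etale (cstr a);
  cmap : forall (R S : comAlgType C) (f : {lrmorphism R -> S}) (b : ob X S) (a : ob X R),
    hom f b a -> {rmorphism cring a -> cring b};
  cmapE : forall (R S : comAlgType C) (f : {lrmorphism R -> S}) (b : ob X S) (a : ob X R)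
      (u : hom f b a) r, cmap u (cstr a r) = cstr b (f r);
  cpushout : forall (R S : comAlgType C) (f : {lrmorphism R -> S}) (b : ob X S) (a : ob X R)
      (u : hom f b a) (T : comPzRingType)
      (p : {rmorphism cring a -> T}) (q : {rmorphism S -> T}),
    (forall r, p (cstr a r) = q (f r)) ->
    exists w : {rmorphism cring b -> T},
      [/\ forall x, w (cmap u x) = p x, forall s, w (cstr b s) = q s
        & forall w' : {rmorphism cring b -> T},
            (forall x, w' (cmap u x) = p x) -> (forall s, w' (cstr b s) = q s) ->
            w' =1 w];
  cmap_comp : forall (R S T : comAlgType C) (f : {lrmorphism R -> S}) (g : {lrmorphism S -> T})
      (h : {lrmorphism R -> T}) a b c
      (v : hom g c b) (u : hom f b a) (w : hom h c a),
    comp v u w -> forall x, cmap w x = cmap v (cmap u x) }.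

(* A morphism of covers E -> E' over X, given by its comorphisms. *)
Record cover_map (X : prestack) (E E' : cover X) := CoverMap {
  cm : forall R (a : ob X R), {rmorphism cring E' a -> cring E a};
  cm_str : forall R (a : ob X R) r, cm a (cstr E' a r) = cstr E a r;
  cm_nat : forall (R S : comAlgType C) (f : {lrmorphism R -> S}) (b : ob X S) (a : ob X R)
      (u : hom f b a) x, cm b (cmap E' u x) = cmap E u (cm a x) }.

(* The fiber of E at a point x of X with values in C: the sections of
   Spec (cring x) -> Spec C. *)
Record fiber (X : prestack) (x : ob X C^o) (E : cover X) := Fiber {
  fpt :> {rmorphism cring E x -> C^o};
  fptE : forall c, fpt (cstr E x c) = c }.

Lemma fiber_map_subproof (X : prestack) (x : ob X C^o) (E E' : cover X)
  (m : cover_map E E') (p : fiber x E) c :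
  (fpt p \o cm m x) (cstr E' x c) = c.
Proof. by rewrite /= cm_str fptE. Qed.

Definition fiber_map (X : prestack) (x : ob X C^o) (E E' : cover X)
    (m : cover_map E E') (p : fiber x E) : fiber x E' :=
  Fiber (fiber_map_subproof m p).

Record pi1_sort (X : prestack) (x : ob X C^o) := Pi1 {
  pact : forall E : cover X, fiber x E -> fiber x E;
  pact_bij : forall E, bijective (@pact E);
  pact_nat : forall (E E' : cover X) (m : cover_map E E') (p : fiber x E),
    pact (fiber_map m p) = fiber_map m (pact p) }.

Section Pi1Group.
Variables (X : prestack) (x : ob X C^o).
Implicit Types s t : pi1_sort x.

Lemma pi1P s t : (forall E p, pact s p = pact t p :> fiber x E) -> s = t.
Proof.
case: s t => [s sb sn] [t tb tn] /= E.
have st : s = t by apply: functional_extensionality_dep => F; apply/funext/E.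
by subst t; congr Pi1; exact: Prop_irrelevance.
Qed.

Definition pi1_one : pi1_sort x :=
  @Pi1 X x (fun E p => p) (fun E => Bijective (frefl _) (frefl _))
    (fun _ _ _ _ => erefl).

Lemma pi1_mul_nat s t (E E' : cover X) (m : cover_map E E') (p : fiber x E) :
  (@pact _ _ s E' \o @pact _ _ t E') (fiber_map m p) =
  fiber_map m ((@pact _ _ s E \o @pact _ _ t E) p).
Proof. by rewrite /= !pact_nat. Qed.

Definition pi1_mul s t : pi1_sort x :=
  @Pi1 X x (fun E => @pact _ _ s E \o @pact _ _ t E)
    (fun E => bij_comp (pact_bij s E) (pact_bij t E)) (pi1_mul_nat s t).

Lemma pi1_inv_ex s : exists t, pi1_mul t s = pi1_one.
Proof.
have ex E : exists g : fiber x E -> fiber x E,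
    cancel (@pact _ _ s E) g /\ cancel g (@pact _ _ s E).
  by have [g gK Kg] := pact_bij s E; exists g.
pose t E := sval (cid (ex E)).
have tK E : cancel (@pact _ _ s E) (t E) by exact: (svalP (cid (ex E))).1.
have Kt E : cancel (t E) (@pact _ _ s E) by exact: (svalP (cid (ex E))).2.
have tn E E' (m : cover_map E E') (p : fiber x E) :
    t E' (fiber_map m p) = fiber_map m (t E p).
  by rewrite -[in LHS](Kt E p) -pact_nat tK.
exists (Pi1 (fun E => Bijective (Kt E) (tK E)) tn).
by apply: pi1P => E p; exact: tK.
Qed.

Definition pi1_inv s : pi1_sort x := sval (cid (pi1_inv_ex s)).

Lemma pi1_mulA : associative pi1_mul.
Proof. by move=> s t u; apply: pi1P. Qed.
Lemma pi1_mul1 : left_id pi1_one pi1_mul.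
Proof. by move=> s; apply: pi1P. Qed.
Lemma pi1_mulV : left_inverse pi1_one pi1_inv pi1_mul.
Proof. by move=> s; exact: (svalP (cid (pi1_inv_ex s))). Qed.

Definition pi1 : largeGroup := LargeGroup pi1_mulA pi1_mul1 pi1_mulV.

End Pi1Group.

Section Monodromy.
Variables (Y X : prestack) (f : prestack_map Y X).

Definition pullback (E : cover X) : cover Y :=
  @Cover Y (fun R a => cring E (mob f a)) (fun R a => cstr E (mob f a))
    (fun R a => cfet E (mob f a)) (fun R S g b a u => cmap E (mhom f u))
    (fun R S g b a u => cmapE E (mhom f u))
    (fun R S g b a u => @cpushout X E R S g _ _ (mhom f u))
    (fun R S T g h k a b c v u w vuw => @cmap_comp X E _ _ _ _ _ _ _ _ _ _ _ _ (mcomp f vuw)).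

Definition pullback_map (E E' : cover X) (m : cover_map E E') :
    cover_map (pullback E) (pullback E') :=
  @CoverMap Y (pullback E) (pullback E') (fun R a => cm m (mob f a))
    (fun R a => cm_str m (mob f a))
    (fun R S g b a u => cm_nat m (mhom f u)).

Variable y : ob Y C^o.

(* fiber y (pullback E) and fiber (mob f y) E are both the sections of
   cstr E (mob f y). *)
Definition fiber_up (E : cover X) (p : fiber (mob f y) E) :
  fiber y (pullback E) := @Fiber Y y (pullback E) (fpt p) (fptE p).
Definition fiber_down (E : cover X) (p : fiber y (pullback E)) :
  fiber (mob f y) E := @Fiber X (mob f y) E (fpt p) (fptE p).

Lemma fiber_upK E : cancel (@fiber_up E) (@fiber_down E).
Proof. by case. Qed.
Lemma fiber_downK E : cancel (@fiber_down E) (@fiber_up E).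
Proof. by case. Qed.

Lemma push_bij (s : pi1 y) E :
  bijective (@fiber_down E \o @pact _ _ s (pullback E) \o @fiber_up E).
Proof.
apply: bij_comp; last exact: Bijective (@fiber_upK E) (@fiber_downK E).
apply: bij_comp; last exact: pact_bij.
exact: Bijective (@fiber_downK E) (@fiber_upK E).
Qed.

Lemma push_nat (s : pi1 y) E E' (m : cover_map E E') p :
  (@fiber_down E' \o @pact _ _ s (pullback E') \o @fiber_up E') (fiber_map m p) =
  fiber_map m ((@fiber_down E \o @pact _ _ s (pullback E) \o @fiber_up E) p).
Proof.
rewrite /=.
have -> : fiber_up (fiber_map m p) = fiber_map (pullback_map m) (fiber_up p).
  by congr Fiber; exact: Prop_irrelevance.
rewrite pact_nat.
by congr Fiber; exact: Prop_irrelevance.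
Qed.

Definition pi1_push (s : pi1 y) : pi1 (mob f y) :=
  Pi1 (push_bij s) (@push_nat s).

Definition push_image (t : pi1 (mob f y)) : Prop :=
  exists s, pi1_push s = t.

Lemma pi1_push1 : pi1_push 1%lg = 1%lg.
Proof. by apply: pi1P => E p /=; rewrite fiber_upK. Qed.

Lemma pi1_pushM s t : pi1_push (s * t)%lg = (pi1_push s * pi1_push t)%lg.
Proof. by apply: pi1P => E p /=; rewrite fiber_downK. Qed.

Lemma push_image1 : push_image 1%lg.
Proof. by exists 1%lg; exact: pi1_push1. Qed.
Lemma push_imageM a b : push_image a -> push_image b -> push_image (a * b)%lg.
Proof.
by move=> [s <-] [t <-]; exists (s * t)%lg; exact: pi1_pushM.
Qed.
Lemma push_imageV a : push_image a -> push_image a^-1%lg.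
Proof.
move=> [s <-]; exists s^-1%lg.
by apply: (@lg_mulI (pi1 (mob f y)) (pi1_push s)); rewrite -pi1_pushM !lg_mulgV pi1_push1.
Qed.

Definition pi1_image : subgroup (pi1 (mob f y)) :=
  Subgroup push_image1 push_imageM push_imageV.

Definition Mon : largeGroup := quotient (normal_core pi1_image).

End Monodromy.

Definition span (R : comNzRingType) (V : lmodType R) (A : set V) : set V :=
  [set x | exists n (c : 'I_n -> R) (v : 'I_n -> V),
     (forall i, A (v i)) /\ x = \sum_(i < n) c i *: v i].

(* The R-points of the projective space of lines in V, for V free of finite
   rank: L is a submodule which is, Zariski-locally on Spec R, generated by one
   vector with an invertible coordinate. *)
Record projective_point (R : comNzRingType) (V : lmodType R) (L : set V) : Prop :=
  ProjectivePoint {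
  pp_submod : span L `<=` L;
  pp_rank_le1 : forall (v w : V) (l m : {linear V -> R^o}),
    L v -> L w -> l v * m w = l w * m v;
  pp_rank_ge1 : span (V := R^o)
    [set r | exists (l : {linear V -> R^o}) v, L v /\ r = l v] 1 }.

Section Cubics.
Variable R : comAlgType C.

Definition subst_form (F : {mpoly R[3]}) (h : 'M[R]_3) : {mpoly R[3]} :=
  F \mPo [tuple \sum_(j < 3) h i j *: 'X_j | i < 3].

(* K is an R-point of P^9 \ Delta: no fiber of the cubic has a singular point
   over any extension of a residue field. *)
Record smooth_cubic (K : set {mpoly R[3]}) : Prop := SmoothCubic {
  sc_point : projective_point K;
  sc_homog : forall F, K F -> F \is 3.-homog;
  sc_smooth : forall (k : fieldType) (g : {rmorphism R -> k}) (v : 'I_3 -> k),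
    (exists i, v i != 0) ->
    ~ (forall F, K F -> (map_mpoly g F).@[v] = 0 /\
         forall i, (map_mpoly g F)^`M(i).@[v] = 0) }.

(* H is an R-point of PGL_3, the open subscheme det <> 0 of the projective
   space of 3 x 3 matrices. *)
Record pgl3 (H : set 'M[R]_3) : Prop := PGL3 {
  pgl_point : projective_point H;
  pgl_det : span (V := R^o) [set r | exists h, H h /\ r = \det h] 1 }.

(* F (v + t w) = 0 mod t^n: the line through p in the direction w meets K at p
   with multiplicity >= n. *)
Definition contact (K : set {mpoly R[3]}) (p : set 'cV[R]_3) (w : 'cV[R]_3)
    (n : nat) : Prop :=
  forall F v, K F -> p v -> forall i, (i < n)%N ->
    (mmap polyC (fun j => (v j 0)%:P + w j 0 *: 'X) F)`_i = 0.

(* p is an R-point of the cubic K such that every line tangent to K at p meets K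
   at p with multiplicity >= 3. For K smooth the directions w with contact K p w 2
   form a locally free module of rank 2 commuting with base change, so this
   condition defines a closed subscheme of the universal cubic. *)
Definition is_flex (K : set {mpoly R[3]}) (p : set 'cV[R]_3) : Prop :=
  [/\ projective_point p, contact K p 0 1
    & forall w, contact K p w 2 -> contact K p w 3].

Record cubic := Cubic {
  ceq : set {mpoly R[3]};
  ceqP : smooth_cubic ceq }.

Record flexed_cubic := FlexedCubic {
  fcubic :> cubic;
  fflex : set 'cV[R]_3;
  fflexP : is_flex (ceq fcubic) fflex }.

End Cubics.

Section CubicHom.
Variables (R S : comAlgType C) (f : {lrmorphism R -> S}).

(* The transformations P^2_S -> P^2_S in PGL_3(S) carrying b onto the base change
   of a along f: an inclusion between rank one direct summands is an equality. *)
Record cubic_hom (b : cubic S) (a : cubic R) := CubicHom {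
  chmx : set 'M[S]_3;
  chmxP : pgl3 chmx;
  chmx_cubic : forall F h, ceq a F -> chmx h ->
    ceq b (subst_form (map_mpoly f F) h) }.

Record flexed_hom (b : flexed_cubic S) (a : flexed_cubic R) := FlexedHom {
  fhom :> cubic_hom b a;
  fhom_flex : forall h v, chmx fhom h -> fflex b v ->
    span [set map_mx f u | u in fflex a] (h *m v) }.

End CubicHom.

(* w is the composite of v and u: an arrow is determined by its ring map and its
   line of matrices, and chmx w is the line spanned by the products. *)
Definition cubic_comp (R S T : comAlgType C) (f : {lrmorphism R -> S})
    (g : {lrmorphism S -> T}) (h : {lrmorphism R -> T})
    (a : cubic R) (b : cubic S) (c : cubic T)
    (v : cubic_hom g c b) (u : cubic_hom f b a) (w : cubic_hom h c a) : Prop :=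
  (forall r, h r = g (f r)) /\
  (forall m n, chmx u m -> chmx v n -> chmx w (map_mx g m *m n)).

(* The quotient prestack of P^9 \ Delta by PGL_3, whose stackification is
   [(P^9 \ Delta) / PGL_3]. *)
Definition plane_cubics : prestack := Prestack cubic_comp.

Definition flexed_plane_cubics : prestack :=
  @Prestack flexed_cubic flexed_hom
    (fun R S T f g h a b c v u w => @cubic_comp R S T f g h a b c v u w).

Definition forget_flex : prestack_map flexed_plane_cubics plane_cubics :=
  @PrestackMap flexed_plane_cubics plane_cubics (fun R a => fcubic a)
    (fun R S f b a u => fhom u) (fun R S T f g h a b c v u w vuw => vuw).

End Stacks.

Definition SL2F3 : Type := {A : 'M['F_3]_2 | \det A == 1}.
HB.instance Definition _ := SubChoice.on SL2F3.

(* (b, A) stands for the affine transformation v |-> A v + b. *)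
Definition ASL2F3 : Type := ('cV['F_3]_2 * SL2F3)%type.
HB.instance Definition _ := Choice.on ASL2F3.

Section ASL2F3Group.

Lemma SL2F3_one_subproof : \det (1%:M : 'M['F_3]_2) == 1.
Proof. by rewrite det1. Qed.

Lemma SL2F3_mul_subproof (A B : SL2F3) : \det (val A *m val B) == 1.
Proof. by rewrite det_mulmx (eqP (valP A)) (eqP (valP B)) mulr1. Qed.

Lemma SL2F3_inv_subproof (A : SL2F3) : \det (invmx (val A)) == 1.
Proof. by rewrite det_inv (eqP (valP A)) invr1. Qed.

Definition asl_one : ASL2F3 := (0, (Sub 1%:M SL2F3_one_subproof : SL2F3)).
Definition asl_mul (x y : ASL2F3) : ASL2F3 :=
  (val x.2 *m y.1 + x.1, Sub (val x.2 *m val y.2) (SL2F3_mul_subproof x.2 y.2) : SL2F3).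
Definition asl_inv (x : ASL2F3) : ASL2F3 :=
  (- (invmx (val x.2) *m x.1), Sub (invmx (val x.2)) (SL2F3_inv_subproof x.2) : SL2F3).

Lemma SL2F3_unit (A : SL2F3) : val A \in unitmx.
Proof. by rewrite unitmxE (eqP (valP A)) unitr1. Qed.

Lemma asl_mulA : associative asl_mul.
Proof.
move=> [a A] [b B] [c D]; congr pair => /=; last by apply: val_inj; exact: mulmxA.
by rewrite mulmxDr mulmxA addrA.
Qed.

Lemma asl_mul1 : left_id asl_one asl_mul.
Proof.
move=> [a A]; congr pair => /=; first by rewrite mul1mx addr0.
by apply: val_inj; exact: mul1mx.
Qed.

Lemma asl_mulr1 : right_id asl_one asl_mul.
Proof.
move=> [a A]; congr pair => /=; first by rewrite mulmx0 add0r.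
by apply: val_inj; exact: mulmx1.
Qed.

Lemma asl_mulV : left_inverse asl_one asl_inv asl_mul.
Proof.
move=> [a A]; congr pair => /=; first by rewrite subrr.
by apply: val_inj; apply: mulVmx; exact: SL2F3_unit.
Qed.

Lemma asl_mulrV : right_inverse asl_one asl_inv asl_mul.
Proof.
move=> [a A]; congr pair => /=.
  by rewrite mulmxN mulmxA mulmxV ?SL2F3_unit// mul1mx addNr.
by apply: val_inj; apply: mulmxV; exact: SL2F3_unit.
Qed.

HB.instance Definition _ :=
  isGroup.Build ASL2F3 asl_mulA asl_mul1 asl_mulr1 asl_mulV asl_mulrV.

End ASL2F3Group.

(* Main.v *)
(* Write C for the base field and w for a primitive cube root of unity. A frame
   of a smooth cubic is a family of matrices W(u), u in F_3^2, with
   W(u) W(v) = w^det(u, v) W(u + v), all leaving the cubic invariant. In suitable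
   coordinates (flat-locally on the base) the cubic is in Hesse form and W is the
   Schroedinger representation, whence ASL_2(F_3) acts simply transitively on
   frames and the frames form a Galois cover of X with this group: pi_1(X) maps
   to ASL_2(F_3). The map is onto because any two frames are the values of the
   Schroedinger frame at two points of the Hesse pencil, and sections of finite
   etale covers of an integrally closed ring extending C[t] inside an
   algebraically closed field transport fibers from one point to the other.
   The operator (1/3) sum_u W(u) is an involution whose (-1)-eigenline is a flex
   p_0. The condition "p_0 is the marked flex" is given by an idempotent on the
   pullback of the frame cover to Y, so pi_1(Y) lands in the stabilizer
   SL_2(F_3) of p_0; and a cover E of Y induces the cover of X whose value at a
   cubic is E at the universal frame marked with p_0, so the kernel of
   pi_1(X) -> ASL_2(F_3) comes from pi_1(Y). Finally SL_2(F_3) contains no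
   nontrivial normal subgroup of ASL_2(F_3). *)

Require Import Defs.
From HB Require Import structures.
From mathcomp Require Import all_boot all_order all_algebra all_fingroup.
From mathcomp Require Import mpoly.
From mathcomp Require Import boolp classical_sets functions reals.
From mathcomp Require Import complex.
From mathcomp Require Import ring.

Set Implicit Arguments.
Unset Strict Implicit.
Unset Printing Implicit Defensive.

Import GRing.Theory.
Local Open Scope ring_scope.

(** * Rings of fractions and residue fields *)

(** The hard point is that Hesse coordinates exist near every point of the base after adjoining
    roots. The normal forms require an exact flex, not one modulo the maximal ideal of a local ring,
    and no Hensel property is at hand. A flex is sought on the lines through an auxiliary centre:
    the product of the Hessian over the three intersection points is a polynomial of degree 9 in the
    line, and at a root of it this product vanishes. One factor then vanishes only if the two others
    are units, that is, if the line contains a single flex at the closed point. Such a centre can be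
    written down once the flexes of the residue cubic are known; hence a Hesse form is found first
    modulo the maximal ideal, then exactly. Flat descent enters only through [pure_along]: the local
    extensions kill no scalar, and an element that becomes a scalar there was one locally. Paths in
    the Hesse pencil are replaced by the integral closure of a localization of C[t] in an
    algebraically closed field; fibers over its two C-points are compared through sections. *)

Record fracData (T : comPzRingType) := FracData {
  fden : T -> Prop;
  fid : T -> Prop;
  fden1 : fden 1;
  fdenM : forall s t, fden s -> fden t -> fden (s * t);
  fid0 : fid 0;
  fidD : forall x y, fid x -> fid y -> fid (x + y);
  fidM : forall a x, fid x -> fid (a * x) }.

(* The ring (T / fid)[fden^-1]; it covers quotients (fden = {1}),
   localizations (fid = 0) and residue fields at once. *)
Section FracRing.
Variables (T : comPzRingType) (d : fracData T).
Notation M := (fden d).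
Notation I := (fid d).
Implicit Types a b c s t u : T.

Definition frel (p q : T * T) := exists2 u, M u & I (u * (p.1 * q.2 - q.1 * p.2)).

Record fracRing := FracRing {
  fclass : T * T -> Prop;
  fclassP : exists p, M p.2 /\ fclass = frel p }.

HB.instance Definition _ := gen_eqMixin fracRing.
HB.instance Definition _ := gen_choiceMixin fracRing.

Lemma frel_refl p : frel p p.
Proof. by exists 1; [exact: fden1|rewrite subrr mulr0; exact: fid0]. Qed.

Lemma fidN x : I x -> I (- x).
Proof. by move=> Ix; rewrite -mulN1r; exact: fidM. Qed.

Lemma frel_sym p q : frel p q -> frel q p.
Proof. by case=> u Mu Iu; exists u => //; rewrite -opprB mulrN; exact: fidN. Qed.

Lemma frel_trans q p r : M q.2 -> frel p q -> frel q r -> frel p r.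
Proof.
move=> Mq [u Mu Iu] [v Mv Iv]; exists (u * v * q.2).
  by do !apply: fdenM.
have -> : u * v * q.2 * (p.1 * r.2 - r.1 * p.2) =
   (v * r.2) * (u * (p.1 * q.2 - q.1 * p.2)) +
   (u * p.2) * (v * (q.1 * r.2 - r.1 * q.2)) by ring.
by apply: fidD; exact: fidM.
Qed.

Lemma frel_pair (p q : {x : T * T | M x.2}) :
  frel (sval p) = frel (sval q) <-> frel (sval p) (sval q).
Proof.
case: p q => [p Mp] [q Mq] /=; split=> [->|pq]; first exact: frel_refl.
apply/funext => r; apply/propext; split=> H.
  by apply: frel_trans H => //; exact: frel_sym.
exact: frel_trans H.
Qed.

Definition fpi (p : {x : T * T | M x.2}) : fracRing :=
  FracRing (ex_intro _ (sval p) (conj (svalP p) erefl)).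

Lemma fpi_eq p q : fpi p = fpi q <-> frel (sval p) (sval q).
Proof.
rewrite -frel_pair; split=> [E|E]; first by move: (congr1 fclass E).
rewrite /fpi; move: (ex_intro _ _ _) (ex_intro _ _ _); rewrite E => h1 h2.
by congr FracRing; exact: Prop_irrelevance.
Qed.

Lemma fpi_surj (x : fracRing) : exists p, fpi p = x.
Proof.
case: x => c h; have [p [Mp E]] := h; exists (exist _ p Mp).
subst c; congr FracRing; exact: Prop_irrelevance.
Qed.

Definition frepr x := sval (cid (fpi_surj x)).
Lemma freprK x : fpi (frepr x) = x. Proof. exact: svalP (cid (fpi_surj x)). Qed.

Definition fadd0 (p q : {x : T * T | M x.2}) : {x : T * T | M x.2} :=
  exist _ ((sval p).1 * (sval q).2 + (sval q).1 * (sval p).2,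
           (sval p).2 * (sval q).2) (fdenM (svalP p) (svalP q)).
Definition fmul0 (p q : {x : T * T | M x.2}) : {x : T * T | M x.2} :=
  exist _ ((sval p).1 * (sval q).1, (sval p).2 * (sval q).2)
    (fdenM (svalP p) (svalP q)).
Definition fopp0 (p : {x : T * T | M x.2}) : {x : T * T | M x.2} :=
  exist _ (- (sval p).1, (sval p).2) (svalP p).
Definition fadd x y := fpi (fadd0 (frepr x) (frepr y)).
Definition fmul x y := fpi (fmul0 (frepr x) (frepr y)).
Definition fopp x := fpi (fopp0 (frepr x)).
Definition fconst (a : T) : fracRing := fpi (exist _ (a, 1) (fden1 d)).

Lemma fpiD p q : fadd (fpi p) (fpi q) = fpi (fadd0 p q).
Proof.
have /fpi_eq[u Mu Iu] := freprK (fpi p); have /fpi_eq[v Mv Iv] := freprK (fpi q).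
apply/fpi_eq; exists (u * v); first exact: fdenM.
move: (frepr (fpi p)) (frepr (fpi q)) Iu Iv => p' q' Iu Iv /=.
have -> : u * v * (((sval p').1 * (sval q').2 + (sval q').1 * (sval p').2) *
    ((sval p).2 * (sval q).2) - ((sval p).1 * (sval q).2 + (sval q).1 * (sval p).2) *
    ((sval p').2 * (sval q').2)) =
  (v * (sval q).2 * (sval q').2) * (u * ((sval p').1 * (sval p).2 - (sval p).1 * (sval p').2))
  + (u * (sval p).2 * (sval p').2) * (v * ((sval q').1 * (sval q).2 - (sval q).1 * (sval q').2)).
  by ring.
by apply: fidD; exact: fidM.
Qed.

Lemma fpiM p q : fmul (fpi p) (fpi q) = fpi (fmul0 p q).
Proof.
have /fpi_eq[u Mu Iu] := freprK (fpi p); have /fpi_eq[v Mv Iv] := freprK (fpi q).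
apply/fpi_eq; exists (u * v); first exact: fdenM.
move: (frepr (fpi p)) (frepr (fpi q)) Iu Iv => p' q' Iu Iv /=.
have -> : u * v * ((sval p').1 * (sval q').1 * ((sval p).2 * (sval q).2) -
    (sval p).1 * (sval q).1 * ((sval p').2 * (sval q').2)) =
  (v * (sval q').1 * (sval q).2) * (u * ((sval p').1 * (sval p).2 - (sval p).1 * (sval p').2))
  + (u * (sval p).1 * (sval p').2) * (v * ((sval q').1 * (sval q).2 - (sval q).1 * (sval q').2)).
  by ring.
by apply: fidD; exact: fidM.
Qed.

Lemma fpiN p : fopp (fpi p) = fpi (fopp0 p).
Proof.
have /fpi_eq[u Mu Iu] := freprK (fpi p).
apply/fpi_eq; exists u => //; move: (frepr _) Iu => p' Iu /=.
by rewrite !mulNr -opprD mulrN; exact: fidN.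
Qed.

Let fpiE p q : (sval p).1 * (sval q).2 = (sval q).1 * (sval p).2 -> fpi p = fpi q.
Proof.
move=> E; apply/fpi_eq; exists 1; first exact: fden1.
by rewrite E subrr mulr0; exact: fid0.
Qed.

Lemma faddA : associative fadd.
Proof.
move=> x y z; rewrite -[x]freprK -[y]freprK -[z]freprK !fpiD.
by apply: fpiE => /=; ring.
Qed.
Lemma faddC : commutative fadd.
Proof.
by move=> x y; rewrite -[x]freprK -[y]freprK !fpiD; apply: fpiE => /=; ring.
Qed.
Lemma fadd0r : left_id (fconst 0) fadd.
Proof. by move=> x; rewrite -[x]freprK !fpiD; apply: fpiE => /=; ring. Qed.
Lemma faddNr : left_inverse (fconst 0) fopp fadd.
Proof. by move=> x; rewrite -[x]freprK fpiN !fpiD; apply: fpiE => /=; ring. Qed.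
Lemma fmulA : associative fmul.
Proof.
move=> x y z; rewrite -[x]freprK -[y]freprK -[z]freprK !fpiM.
by apply: fpiE => /=; ring.
Qed.
Lemma fmulC : commutative fmul.
Proof.
by move=> x y; rewrite -[x]freprK -[y]freprK !fpiM; apply: fpiE => /=; ring.
Qed.
Lemma fmul1r : left_id (fconst 1) fmul.
Proof. by move=> x; rewrite -[x]freprK !fpiM; apply: fpiE => /=; ring. Qed.
Lemma fmulDl : left_distributive fmul fadd.
Proof.
move=> x y z; rewrite -[x]freprK -[y]freprK -[z]freprK !(fpiM, fpiD).
by apply: fpiE => /=; ring.
Qed.

HB.instance Definition _ := GRing.isZmodule.Build fracRing faddA faddC fadd0r faddNr.
HB.instance Definition _ :=
  GRing.Zmodule_isComPzRing.Build fracRing fmulA fmulC fmul1r fmulDl.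

Fact fconst_zmod_morphism : zmod_morphism fconst.
Proof.
move=> a b; change (fconst (a - b) = fadd (fconst a) (fopp (fconst b))).
by rewrite fpiN fpiD; apply: fpiE => /=; ring.
Qed.
Fact fconst_monoid_morphism : monoid_morphism fconst.
Proof.
split=> // a b; change (fconst (a * b) = fmul (fconst a) (fconst b)).
by rewrite fpiM; apply: fpiE => /=; ring.
Qed.
HB.instance Definition _ :=
  GRing.isZmodMorphism.Build T fracRing fconst fconst_zmod_morphism.
HB.instance Definition _ :=
  GRing.isMonoidMorphism.Build T fracRing fconst fconst_monoid_morphism.

Lemma fconst_eq0 a : fconst a = 0 <-> exists2 u, M u & I (u * a).
Proof.
rewrite (_ : 0 = fconst 0) ?rmorph0// fpi_eq /frel /=.
by rewrite mul0r subr0 mulr1.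
Qed.

Lemma fconst_unit s : M s -> exists t : fracRing, t * fconst s = 1.
Proof.
move=> Ms; exists (fpi (exist _ (1, s) Ms)).
change (fmul (fpi (exist _ (1, s) Ms)) (fconst s) = fconst 1).
by rewrite fpiM; apply: fpiE => /=; ring.
Qed.

Lemma fracP (x : fracRing) : exists a s, M s /\ x * fconst s = fconst a.
Proof.
have [[[a s] /= Ms] <-] := fpi_surj x; exists a, s; split=> //.
change (fmul (fpi (exist _ (a, s) Ms)) (fconst s) = fconst a).
by rewrite fpiM; apply: fpiE => /=; ring.
Qed.

Section Lift.
Variables (U : comPzRingType) (f : {rmorphism T -> U}).
Hypotheses (fI : forall x, I x -> f x = 0) (fM : forall s, M s -> exists t : U, t * f s = 1).

Lemma flift_ex (x : fracRing) :
  exists y, forall a s, M s -> x * fconst s = fconst a -> y * f s = f a.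
Proof.
have [a [s [Ms E]]] := fracP x; have [t ts] := fM Ms; exists (t * f a) => b u Mu Eu.
have : fconst (a * u - b * s) = 0.
  by rewrite rmorphB !rmorphM /= -E -Eu; ring.
case/fconst_eq0=> v Mv /fI; rewrite rmorphM => E2.
have [v' vv] := fM Mv.
have E3 : f (a * u - b * s) = 0 by rewrite -[LHS]mul1r -vv -mulrA E2 mulr0.
move: E3; rewrite rmorphB !rmorphM => /subr0_eq E3.
by rewrite -mulrA E3 mulrCA ts mulr1.
Qed.
Definition flift x : U := sval (cid (flift_ex x)).
Lemma fliftE x a s : M s -> x * fconst s = fconst a -> flift x * f s = f a.
Proof. exact: (svalP (cid (flift_ex x))). Qed.
Lemma flift_const a : flift (fconst a) = f a.
Proof.
have := @fliftE (fconst a) a 1 (fden1 d); rewrite !rmorph1 !mulr1; exact.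
Qed.
Let unit_inj s (x y : U) : M s -> x * f s = y * f s -> x = y.
Proof.
by case/fM=> t ts E; rewrite -[x]mulr1 -[y]mulr1 -ts [t * _]mulrC !mulrA E.
Qed.
Fact flift_zmod_morphism : zmod_morphism flift.
Proof.
move=> x y; have [a [s [Ms Ex]]] := fracP x; have [b [t [Mt Ey]]] := fracP y.
have Mst := fdenM Ms Mt; apply: (unit_inj Mst).
have -> : flift (x - y) * f (s * t) = f (a * t - b * s).
  by apply: fliftE => //; rewrite !rmorphM rmorphB !rmorphM /= -Ex -Ey; ring.
by rewrite rmorphM rmorphB !rmorphM -(fliftE Ms Ex) -(fliftE Mt Ey); ring.
Qed.
Fact flift_monoid_morphism : monoid_morphism flift.
Proof.
split=> [|x y]; first by rewrite -(rmorph1 fconst) flift_const rmorph1.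
have [a [s [Ms Ex]]] := fracP x; have [b [t [Mt Ey]]] := fracP y.
have Mst := fdenM Ms Mt; apply: (unit_inj Mst).
have -> : flift (x * y) * f (s * t) = f (a * b).
  by apply: fliftE => //; rewrite !rmorphM /= -Ex -Ey; ring.
by rewrite !rmorphM -(fliftE Ms Ex) -(fliftE Mt Ey); ring.
Qed.
HB.instance Definition _ := GRing.isZmodMorphism.Build fracRing U flift flift_zmod_morphism.
HB.instance Definition _ := GRing.isMonoidMorphism.Build fracRing U flift flift_monoid_morphism.
Definition frac_lift : {rmorphism fracRing -> U} := flift.
Lemma frac_liftE a : frac_lift (fconst a) = f a. Proof. exact: flift_const. Qed.
End Lift.

Lemma frac_hom_eq (U : comPzRingType) (f g : {rmorphism fracRing -> U}) :
  (forall a, f (fconst a) = g (fconst a)) -> f =1 g.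
Proof.
move=> fg x; have [a [s [Ms E]]] := fracP x; have [t ts] := fconst_unit Ms.
have := congr1 f E; rewrite rmorphM fg => E1.
have := congr1 g E; rewrite rmorphM => E2.
have gs : g t * g (fconst s) = 1 by rewrite -rmorphM ts rmorph1.
have E3 : f x * g (fconst s) = g x * g (fconst s) by rewrite E1 E2 fg.
by rewrite -[f x]mulr1 -[g x]mulr1 -gs [g t * _]mulrC !mulrA E3.
Qed.

End FracRing.

(** A proposition, because the rings built below by universal properties carry no decidable
    predicate for units. *)
Definition invertible (S : pzRingType) (x : S) := exists y, y * x = 1.

Definition nzOf (K : comPzRingType) (nz : (1 : K) != 0) : Type := K.
HB.instance Definition _ K nz := GRing.ComPzRing.on (@nzOf K nz).
HB.instance Definition _ K nz :=
  GRing.PzSemiRing_isNonZero.Build (@nzOf K nz) nz.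

Section FieldOf.
Variables (K : comPzRingType) (nz : (1 : K) != 0).
Hypothesis Kinv : forall x : K, x != 0 -> invertible x.

Definition fieldOf_inv (x : K) : K :=
  match pselect (invertible x) with left h => sval (cid h) | right _ => 0 end.
Definition fieldOf (_ : forall x : K, x != 0 -> invertible x) : Type := nzOf nz.
HB.instance Definition _ := GRing.ComNzRing.on (fieldOf Kinv).
Fact fieldOf_mulVf (x : fieldOf Kinv) : x != 0 -> (fieldOf_inv x : fieldOf Kinv) * x = 1.
Proof.
move=> /Kinv h; rewrite /fieldOf_inv; case: pselect => // h'.
exact: svalP (cid h').
Qed.
Fact fieldOf_inv0 : fieldOf_inv (0 : fieldOf Kinv) = 0.
Proof.
rewrite /fieldOf_inv; case: pselect => // h; exfalso; case: h => y /eqP.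
by rewrite mulr0 eq_sym (negPf nz).
Qed.
HB.instance Definition _ :=
  GRing.ComNzRing_isField.Build (fieldOf Kinv) fieldOf_mulVf fieldOf_inv0.
End FieldOf.

Section MaxIdeal.
Variables (T : comPzRingType) (I : T -> Prop).
Hypotheses (I0 : I 0) (ID : forall x y, I x -> I y -> I (x + y))
  (IM : forall a x, I x -> I (a * x)) (I1 : ~ I 1).

Let ideal (J : T -> Prop) :=
  [/\ J 0, forall x y, J x -> J y -> J (x + y) & forall a x, J x -> J (a * x)].

Lemma max_ideal_ex : exists J : T -> Prop,
  [/\ ideal J, forall x, I x -> J x, ~ J 1 & forall a, ~ J a -> exists b, J (1 - b * a)].
Proof.
(* Zorn's lemma asks for the union of every chain, the empty one included; with [J \/ I] in place of
   [J] the empty set is admissible. *)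
pose P := [set J : set T | ideal (fun x => J x \/ I x) /\ ~ J 1]%classic.
have [|J [[Jid J1] Jmax]] := @Zorn_bigcup T P.
  move=> F FP tot; split; last by case=> X /FP[_].
  split; first by right.
    move=> x y [[X FX Xx]|Ix] [[Y FY Yy]|Iy]; last by right; exact: ID.
    - have [XY|YX] := tot _ _ FX FY.
      + have [[_ D _] _] := FP _ FY.
        by have [Yxy|Ixy] := D x y (or_introl (XY _ Xx)) (or_introl Yy); [left; exists Y|right].
      + have [[_ D _] _] := FP _ FX.
        by have [Yxy|Ixy] := D x y (or_introl Xx) (or_introl (YX _ Yy)); [left; exists X|right].
    - have [[_ D _] _] := FP _ FX.
      by have [h|h] := D x y (or_introl Xx) (or_intror Iy); [left; exists X|right].
    - have [[_ D _] _] := FP _ FY.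
      by have [h|h] := D x y (or_intror Ix) (or_introl Yy); [left; exists Y|right].
  move=> a x [[X FX Xx]|Ix]; last by right; exact: IM.
  have [[_ _ D] _] := FP _ FX.
  by have [h|h] := D a x (or_introl Xx); [left; exists X|right].
exists (fun x => J x \/ I x); split => //; [by right|by case| move=> a Ja].
(* [B] is the ideal spanned by [J], [I] and [a]; were it proper, it would contradict the maximality
   of [J]. *)
pose B := [set x : T | exists2 b, exists z, (J z \/ I z) /\ z = x - b * a & True]%classic.
have [//|NB] := pselect (exists b, J (1 - b * a) \/ I (1 - b * a)).
have [J0 JD JM] := Jid.
exfalso; apply: (Jmax B); last first.
  split.
    have BI x : I x -> B x.
      by move=> Ix; exists 0 => //; exists x; rewrite mul0r subr0; split=> //; right.
    suff BB : ideal B.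
      have [B0 BD BM] := BB; split; first by left.
        move=> x y hx hy; left; apply: BD.
          by case: hx => [//|/BI].
        by case: hy => [//|/BI].
      by move=> b x hx; left; apply: BM; case: hx => [//|/BI].
    split; first exact: BI.
      move=> x y [b [z [Jz Ez]] _] [c [t [Jt Et]] _]; subst z t; exists (b + c) => //.
      by exists (x - b * a + (y - c * a)); split; [exact: JD|ring].
    move=> c x [b [z [Jz E]] _]; exists (c * b) => //; exists (c * z).
    by split; [exact: JM|rewrite E; ring].
  by case=> b [z [Jz E]] _; apply: NB; exists b; rewrite -E.
split; last first.
  move=> BJ; apply: Ja; left; apply: BJ; exists 1 => //; exists 0; split=> //.
  by rewrite mul1r subrr.
by move=> x Jx; exists 0 => //; exists x; rewrite mul0r subr0; split=> //; left.
Qed.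

Lemma max_residue : exists (k : fieldType) (chi : {rmorphism T -> k}),
  (forall x, I x -> chi x = 0) /\ (forall y, exists x, chi x = y).
Proof.
have [J [[J0 JD JM] IJ J1 Jmax]] := max_ideal_ex.
have d1 (s t : T) : s = 1 -> t = 1 -> s * t = 1 by move=> -> ->; rewrite mulr1.
pose d : fracData T := @FracData T (fun s => s = 1) J erefl d1 J0 JD JM.
pose K := fracRing d.
have K0 a : fconst d a = 0 <-> J a.
  rewrite fconst_eq0; split=> [[u -> ]|Ja]; first by rewrite mul1r.
  by exists 1 => //; rewrite mul1r.
have nz : (1 : K) != 0 by apply/eqP; rewrite -(rmorph1 (fconst d)) => /K0.
have Ksurj (x : K) : exists a, fconst d a = x.
  by have [a [s [-> E]]] := fracP x; exists a; rewrite -E rmorph1 mulr1.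
have Kinv (x : K) : x != 0 -> invertible x.
  have [a <-] := Ksurj x => /eqP a0; have [|b Jb] := Jmax a; first by move/K0.
  exists (fconst d b); apply/eqP; rewrite -subr_eq0 -opprB oppr_eq0; apply/eqP.
  by rewrite -(rmorph1 (fconst d)) -rmorphM -rmorphB; apply/K0.
exists (fieldOf nz Kinv : fieldType), (fconst d : {rmorphism T -> K}).
by split=> [x /IJ/K0|].
Qed.

End MaxIdeal.

(** The passage from local to global used throughout: the scalars after multiplication by which a
    statement holds form an ideal, and [chi] runs over the points near which the statement is
    checked. *)
Lemma ideal_unit (T : comPzRingType) (I : T -> Prop) :
  I 0 -> (forall x y, I x -> I y -> I (x + y)) -> (forall a x, I x -> I (a * x)) ->
  (forall (k : fieldType) (chi : {rmorphism T -> k}), exists2 s, I s & chi s != 0) ->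
  I 1.
Proof.
move=> I0 ID IM H; apply: contrapT => I1.
have [k [chi [chiI _]]] := max_residue I0 ID IM I1.
by have [s /chiI -> /eqP] := H k chi.
Qed.

Lemma local_eq0 (T : comPzRingType) (x : T) :
  (forall (k : fieldType) (chi : {rmorphism T -> k}), exists2 s, s * x = 0 & chi s != 0) ->
  x = 0.
Proof.
move=> H; rewrite -[x]mul1r; apply: (ideal_unit (I := fun s => s * x = 0)) => //.
- exact: mul0r.
- by move=> s t E F; rewrite mulrDl E F addr0.
- by move=> a s E; rewrite -mulrA E mulr0.
Qed.

(** Kronecker's construction, with a maximal ideal containing [p] in place of an irreducible
    factor. *)
Lemma field_root (k : fieldType) (p : {poly k}) : (1 < size p)%N ->
  exists (k' : fieldType) (j : {rmorphism k -> k'}) (r : k'), root (map_poly j p) r.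
Proof.
move=> p1; pose I (q : {poly k}) := p %| q.
have [||||K [chi [chiI _]]] := @max_residue {poly k} I.
- exact: dvdp0.
- by move=> x y; exact: dvdp_add.
- by move=> a x px; rewrite /I dvdp_mull.
- by rewrite /I dvdp1 => /eqP E; move: p1; rewrite E.
pose j : {rmorphism k -> K} := chi \o polyC.
exists K, j, (chi 'X); apply/rootP.
have -> : (map_poly j p).[chi 'X] = chi p; last exact: chiI (dvdpp p).
rewrite -[X in _ = chi X](comp_polyXr p) comp_polyE rmorph_sum.
rewrite horner_coef size_map_poly; apply: eq_bigr => i _.
by rewrite coef_map -mul_polyC rmorphM rmorphXn.
Qed.

(** * Pure extensions *)

(* For every [R]-algebra [T] there is an algebra [T'] over both [T] and [S] in
   which an element of [T] coming from [S], up to a factor in [Q], already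
   comes from [R], up to a factor in [P]. *)
Definition pure_along (R S : comPzRingType) (i : {rmorphism R -> S})
    (P : R -> Prop) (Q : S -> Prop) : Prop :=
  (forall r s', Q s' -> s' * i r = 0 -> exists2 s, P s & s * r = 0) /\
  forall (T : comPzRingType) (f : {rmorphism R -> T}),
    exists (T' : comPzRingType) (f' : {rmorphism S -> T'}) (a : {rmorphism T -> T'}),
      (forall r, f' (i r) = a (f r)) /\
      forall x s' r', Q s' -> f' s' * a x = f' r' ->
        exists s r, P s /\ f s * x = f r.

Lemma pure_along_comp (R S U : comPzRingType) (i : {rmorphism R -> S})
    (j : {rmorphism S -> U}) P Q V :
  pure_along i P Q -> pure_along j Q V -> pure_along (j \o i) P V.
Proof.
move=> [i1 i2] [j1 j2]; split.
  by move=> r s' Vs' /(j1 _ _ Vs')[s Qs /(i1 _ _ Qs)].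
move=> T f; have [T1 [f1 [a1 [E1 H1]]]] := i2 T f.
have [T2 [f2 [a2 [E2 H2]]]] := j2 T1 f1.
exists T2, f2, (a2 \o a1); split=> [r|x s' r' Vs']; first by rewrite /= E2 E1.
by move/(H2 _ _ _ Vs') => [s [r [Qs /(H1 _ _ _ Qs)]]].
Qed.

Section Localize.
Variables (R : comPzRingType) (P : R -> Prop).
Hypotheses (P1 : P 1) (PM : forall s t, P s -> P t -> P (s * t)).

Definition locData : fracData R :=
  @FracData R P (fun x => x = 0) P1 PM erefl
    (fun x y hx hy => etrans (congr2 +%R hx hy) (addr0 0))
    (fun a x hx => etrans (congr1 ( *%R a) hx) (mulr0 a)).

End Localize.

(** [T'] is [T] localized at the image of [P], and both parts amount to clearing denominators. *)
Lemma pure_along_loc (R : comPzRingType) (P : R -> Prop) (P1 : P 1)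
    (PM : forall s t, P s -> P t -> P (s * t)) (Q : fracRing (locData P1 PM) -> Prop) :
  (forall y a s, Q y -> P s -> y * fconst _ s = fconst _ a -> P a) ->
  pure_along (fconst (locData P1 PM)) P Q.
Proof.
move=> QP; split.
  move=> r s' Qs' E; have [a [s [Ps Es]]] := fracP s'.
  have : fconst (locData P1 PM) (a * r) = 0 by rewrite rmorphM /= -Es mulrAC E mul0r.
  case/fconst_eq0 => u Pu /= uar; exists (u * a); last by rewrite -mulrA.
  exact: (PM _ _ Pu (QP _ _ _ Qs' Ps Es)).
move=> T f; pose M (t : T) := exists2 s, P s & t = f s.
have M1 : M 1 by exists 1 => //; rewrite rmorph1.
have MM s t : M s -> M t -> M (s * t).
  by move=> [s' Ps' ->] [t' Pt' ->]; exists (s' * t'); rewrite ?rmorphM//; exact: (PM _ _ Ps' Pt').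
pose a : {rmorphism T -> fracRing (locData M1 MM)} := fconst (locData M1 MM).
have h0 (x : R) : x = 0 -> (a \o f) x = 0 by move=> ->; rewrite rmorph0.
have hM (s : R) : P s -> exists t, t * (a \o f) s = 1.
  by move=> Ps; apply: fconst_unit; exists s.
pose f' := frac_lift (d := locData P1 PM) h0 hM.
exists (fracRing (locData M1 MM)), f', a.
split=> [r|x s' r' Qs' E]; first exact: frac_liftE.
have [b [s [Ps Es]]] := fracP s'; have [c [t [Pt Et]]] := fracP r'.
have E1 : f' s' * a (f s) = a (f b).
  by have := congr1 f' Es; rewrite rmorphM /f' !frac_liftE.
have E2 : f' r' * a (f t) = a (f c).
  by have := congr1 f' Et; rewrite rmorphM /f' !frac_liftE.
have : a (f (b * t) * x - f (c * s)) = 0.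
  rewrite rmorphB !rmorphM /= -E1 -E2 -E; ring.
case/(fconst_eq0 (locData M1 MM)) => u [v Pv ->] /=; rewrite mulrBr => /subr0_eq E3.
exists (v * (b * t)), (v * (c * s)); split; last by rewrite !(rmorphM f) -mulrA -rmorphM E3 !rmorphM.
exact: (PM _ _ Pv (PM _ _ (QP _ _ _ Qs' Ps Es) Pt)).
Qed.

Lemma qpoly_lift (R U : comNzRingType) (p : {poly R}) (f : {rmorphism R -> U}) (r : U) :
  p \is monic -> (1 < size p)%N -> root (map_poly f p) r ->
  exists g : {rmorphism {poly %/ p} -> U}, forall q : {poly %/ p}, g q = (map_poly f q).[r].
Proof.
move=> pm p1 pr; pose g (q : {poly %/ p}) := (map_poly f q).[r].
have pE : mk_monic p = p by rewrite /mk_monic p1 pm.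
have ga : zmod_morphism g by move=> x y; rewrite /g /= rmorphB hornerD hornerN.
have gm : monoid_morphism g.
  split=> [|x y]; first by rewrite /g /= rmorph1 hornerC.
  rewrite /g poly_of_qpolyM; move: (x : {poly R}) (y : {poly R}) => {x y} x y.
  rewrite pE -hornerM -rmorphM /= {2}(Pdiv.RingMonic.rdivp_eq pm (_ * _)).
  by rewrite rmorphD rmorphM hornerD hornerM (rootP pr) mulr0 add0r.
pose gg : {rmorphism {poly %/ p} -> U} :=
  HB.pack g (GRing.isZmodMorphism.Build _ _ g ga) (GRing.isMonoidMorphism.Build _ _ g gm).
by exists gg.
Qed.

Lemma in_qpoly_self (A : comNzRingType) (h : {poly A}) :
  h \is monic -> (1 < size h)%N -> in_qpoly h h = 0.
Proof.
move=> hm h1; apply/val_inj => /=.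
have E : mk_monic h = h by rewrite /mk_monic h1 hm.
by rewrite -{1}E Pdiv.RingMonic.rmodpp// monic_mk_monic.
Qed.

Lemma zero_ring_eq (T : comPzRingType) : (1 : T) = 0 -> forall x y : T, x = y.
Proof. by move=> E x y; rewrite -[x]mul1r -[y]mul1r E !mul0r. Qed.

(** [R[X]/p] is free on powers of X, so a relation in [T[X]/p] can be read one coefficient at a
    time; the coefficient used is one where the multiplier [s'] lies in [P]. *)
Lemma pure_along_root (R : comNzRingType) (p : {poly R}) (P : R -> Prop)
    (Q : {poly %/ p} -> Prop) : p \is monic -> (1 < size p)%N -> P 1 ->
  (forall q : {poly %/ p}, Q q -> exists i, P (q : {poly R})`_i) ->
  pure_along (qpolyC p) P Q.
Proof.
move=> pm p1 P1 QP.
have CM (A : comNzRingType) (h : {poly A}) (q : {poly %/ h}) a i :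
    ((q * qpolyC h a : {poly %/ h}) : {poly A})`_i = (q : {poly A})`_i * a.
  have -> : q * qpolyC h a = in_qpoly h ((q : {poly A}) * a%:P).
    rewrite in_qpolyM; congr (_ * _); apply/val_inj/esym/in_qpoly_small; rewrite ?size_mk_monic//.
    by rewrite (leq_ltn_trans (size_polyC_leq1 _))// size_mk_monic_gt1.
  rewrite in_qpoly_small ?coefMC// mulrC mul_polyC.
  by rewrite (leq_ltn_trans (size_scale_leq _ _))// size_mk_monic.
split=> [r s' Qs' E|T f].
  have [i Pi] := QP _ Qs'; exists (s' : {poly R})`_i => //.
  by rewrite -CM E coef0.
(* Polynomials are formed over nonzero rings, so the zero algebra is treated apart. *)
have [T0|/eqP nz] := eqVneq (1 : T) 0.
  pose z (x : {poly %/ p}) : T := 0.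
  have za : zmod_morphism z by move=> x y; rewrite /z subrr.
  have zm : monoid_morphism z by split=> [|x y]; rewrite /z ?mulr0// T0.
  pose f' : {rmorphism {poly %/ p} -> T} :=
    HB.pack z (GRing.isZmodMorphism.Build _ _ z za) (GRing.isMonoidMorphism.Build _ _ z zm).
  exists T, f', idfun; split=> [r|x s' r' _ _]; first exact: zero_ring_eq.
  by exists 1, 1; split => //; exact: zero_ring_eq.
have nz' : (1 : T) != 0 by apply/eqP.
pose T1 : comNzRingType := nzOf nz'; pose f1 : {rmorphism R -> T1} := f.
pose p' := map_poly f1 p.
have p'm : p' \is monic by exact: monic_map.
have sp' : size p' = size p by rewrite size_map_poly_id0// (monicP pm) rmorph1 oner_eq0.
have p'1 : (1 < size p')%N by rewrite sp'.
have pE : mk_monic p = p by rewrite /mk_monic p1 pm.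
have pE' : mk_monic p' = p' by rewrite /mk_monic p'1 p'm.
have inC c : in_qpoly p' c%:P = qpolyC p' c.
  apply/val_inj/in_qpoly_small.
  by rewrite (leq_ltn_trans (size_polyC_leq1 _))// size_mk_monic_gt1.
have inE (q : {poly T1}) : in_qpoly p' q = (map_poly (qpolyC p') q).[qpolyX p'].
  elim/poly_ind: q => [|q c IH]; first by rewrite !rmorph0 horner0.
  rewrite in_qpolyD in_qpolyM IH inC rmorphD rmorphM /= map_polyX map_polyC.
  by rewrite hornerMXaddC.
have rt : root (map_poly (qpolyC p' \o f1) p) (qpolyX p').
  apply/rootP; rewrite map_poly_comp -inE.
  exact: in_qpoly_self.
have [f' f'E] := @qpoly_lift R {poly %/ p'} p (qpolyC p' \o f1) (qpolyX p') pm p1 rt.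
have f'E2 q : f' q = map_poly f1 q :> {poly T1}.
  rewrite f'E map_poly_comp -inE in_qpoly_small// pE' sp'.
  by rewrite (leq_ltn_trans (size_poly _ _))// -[in X in (_ < X)%N]pE size_mk_monic.
pose aT : {rmorphism T1 -> {poly %/ p'}} := qpolyC p'.
exists {poly %/ p'}, f', aT; split=> [r|x s' r' Qs' E].
  by rewrite f'E /= map_polyC hornerC.
have [i Pi] := QP _ Qs'; exists (s' : {poly R})`_i, (r' : {poly R})`_i.
split=> //; have := congr1 (fun q : {poly %/ p'} => (q : {poly T1})`_i) E.
by rewrite CM !f'E2 !coef_map.
Qed.

(* A ring with a geometric point. *)
Record pring := Pring {
  pr :> comNzRingType;
  pk : fieldType;
  pchi : {rmorphism pr -> pk} }.

(** [A] is then a local ring with maximal ideal the kernel of [pchi A]; the field [pk A] may be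
    larger than its residue field. *)
Definition plocal (A : pring) := forall s : A, pchi A s != 0 -> invertible s.

(** Purity is asked up to factors that do not vanish at the geometric points, so that localizing
    counts as an extension. *)
Definition pext (A B : pring) (i : {rmorphism A -> B}) :=
  (exists j : {rmorphism pk A -> pk B}, forall r, pchi B (i r) = j (pchi A r)) /\
  pure_along i (fun s => pchi A s != 0) (fun s => pchi B s != 0).

Lemma pext_comp (A B D : pring) (i : {rmorphism A -> B}) (j : {rmorphism B -> D}) :
  pext i -> pext j -> pext (j \o i).
Proof.
move=> [[k kE] h] [[l lE] g]; split; last exact: pure_along_comp h g.
by exists (l \o k) => r; rewrite /= lE kE.
Qed.

Lemma pext_local (A : pring) :
  exists (B : pring) (i : {rmorphism A -> B}), plocal B /\ pext i.
Proof.
case: A => R k chi; pose P (s : R) := chi s != 0.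
have P1 : P 1 by rewrite /P rmorph1 oner_eq0.
have PM s t : P s -> P t -> P (s * t) by rewrite /P rmorphM; exact: mulf_neq0.
pose B := fracRing (locData P1 PM).
have h0 (x : R) : x = 0 -> chi x = 0 by move=> ->; rewrite rmorph0.
have hM (s : R) : P s -> exists t, t * chi s = 1 by exists (chi s)^-1; rewrite mulVf.
pose chi' : {rmorphism B -> k} := frac_lift (d := locData P1 PM) h0 hM.
have chi'E r : chi' (fconst _ r) = chi r by exact: frac_liftE.
have nz : (1 : B) != 0.
  by apply/eqP => /(congr1 chi')/eqP; rewrite rmorph1 rmorph0 oner_eq0.
have QP (y : B) (a s : R) : chi' y != 0 -> P s -> y * fconst (locData P1 PM) s = fconst (locData P1 PM) a -> P a.
  move=> y0 s0 /(congr1 chi'); rewrite rmorphM !chi'E /P => <-.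
  by rewrite mulf_neq0.
exists (@Pring (nzOf nz) k chi'), (fconst (locData P1 PM)); split; last first.
  split; last exact: (pure_along_loc QP).
  by exists idfun => r; rewrite /= chi'E.
move=> /= y y0; have [a [s [Ps E]]] := fracP y.
have [t ts] := fconst_unit (d := locData P1 PM) (QP _ _ _ y0 Ps E).
by exists (t * fconst (locData P1 PM) s); rewrite -mulrA [_ * y]mulrC; exact: etrans (congr1 ( *%R t) E) ts.
Qed.

(** The field of the geometric point is enlarged first; a root of [p] there selects a point of
    [A[X]/p]. *)
Lemma pext_root (A : pring) (p : {poly A}) : p \is monic -> (1 < size p)%N ->
  exists (B : pring) (i : {rmorphism A -> B}), pext i /\ exists r, root (map_poly i p) r.
Proof.
case: A p => R k chi /= p pm p1.
have [|k' [j [r rt]]] := @field_root k (map_poly chi p).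
  by rewrite size_map_poly_id0// (monicP pm) rmorph1 oner_eq0.
have rt' : root (map_poly (j \o chi) p) r by rewrite map_poly_comp.
have [chi' E] := qpoly_lift pm p1 rt'.
exists (@Pring {poly %/ p} k' chi'), (qpolyC p); split; last first.
  exists (qpolyX p); apply/rootP.
  have inE (q : {poly R}) : in_qpoly p q = (map_poly (qpolyC p) q).[qpolyX p].
    elim/poly_ind: q => [|q c IH]; first by rewrite !rmorph0 horner0.
    rewrite in_qpolyD in_qpolyM IH rmorphD rmorphM /= map_polyX map_polyC.
    rewrite hornerMXaddC; congr (_ + _); apply/val_inj/in_qpoly_small.
    by rewrite (leq_ltn_trans (size_polyC_leq1 _))// size_mk_monic_gt1.
  by rewrite -inE in_qpoly_self.
split.
  by exists j => c; rewrite /= E map_polyC hornerC.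
apply: pure_along_root => //=; first by rewrite rmorph1 oner_eq0.
move=> q q0; apply: contrapT => N.
move: q0; rewrite E (_ : map_poly _ _ = 0) ?horner0 ?eqxx//.
apply/polyP => i; rewrite coef_map coef0 /=; apply/eqP.
have [->|ci] := eqVneq (chi (q : {poly R})`_i) 0; first by rewrite rmorph0.
by case: N; exists i.
Qed.

Lemma pext_split_aux (A : pring) n (p : {poly A}) : p \is monic -> size p = n.+1 ->
  exists (B : pring) (i : {rmorphism A -> B}), pext i /\
  exists rs, map_poly i p = \prod_(r <- rs) ('X - r%:P).
Proof.
elim: n A p => [|n IH] A p pm sp.
  have [B [i [_ Bi]]] := pext_local A; exists B, i; split=> //.
  exists [::]; rewrite big_nil (size1_polyC (eq_leq sp)) -[p`_0]/(p`_(1.-1)) -sp.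
  by rewrite -/(lead_coef p) (monicP pm) rmorph1.
have [||B [i [iB [r rt]]]] := @pext_root A p => //; first by rewrite sp.
have /factor_theorem[q Eq] := rt.
have pm' : map_poly i p \is monic by exact: monic_map.
have qm : q \is monic by move: pm'; rewrite Eq monicMr// monicXsubC.
have sq : size q = n.+1.
  have : size (map_poly i p) = n.+2 by rewrite size_map_poly_id0 ?sp// (monicP pm) rmorph1 oner_eq0.
  by rewrite Eq size_Mmonic ?monicXsubC ?monic_neq0// size_XsubC addn2 /= => -[].
have [D [j [jD [rs E]]]] := IH B q qm sq.
exists D, (j \o i); split; first exact: pext_comp jD.
exists (rcons rs (j r)); rewrite map_poly_comp Eq rmorphM /= E.
by rewrite -cats1 big_cat /= big_seq1 rmorphB /= map_polyX map_polyC.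
Qed.

Lemma pext_split (A : pring) (p : {poly A}) : p \is monic ->
  exists (B : pring) (i : {rmorphism A -> B}), [/\ plocal B, pext i &
  exists rs, map_poly i p = \prod_(r <- rs) ('X - r%:P)].
Proof.
move=> pm; have sp : size p = (size p).-1.+1.
  by rewrite prednK// size_poly_gt0 monic_neq0.
have [B [i [iB [rs E]]]] := pext_split_aux pm sp.
have [D [j [Dl jD]]] := pext_local B.
exists D, (j \o i); split=> //; first exact: pext_comp jD.
exists (map j rs); rewrite map_poly_comp E rmorph_prod big_map.
by apply: eq_bigr => r _; rewrite rmorphB /= map_polyX map_polyC.
Qed.

(** * The Weyl relations *)

Lemma det22 (S : comPzRingType) (A : 'M[S]_2) : \det A = A 0 0 * A 1 1 - A 0 1 * A 1 0.
Proof.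
have o1 : lift 0 0 = 1 :> 'I_2 by apply/val_inj.
have o2 : lift 1 0 = 0 :> 'I_2 by apply/val_inj.
rewrite (expand_det_row _ ord0) !big_ord_recl big_ord0 addr0 o1 /cofactor !det_mx11.
by rewrite !mxE !o1 !o2 /= expr0 expr1; ring.
Qed.

Lemma det33 (S : comPzRingType) (A : 'M[S]_3) : \det A =
  A 0 0 * (A 1 1 * A 2%:R 2%:R - A 1 2%:R * A 2%:R 1)
  - A 0 1 * (A 1 0 * A 2%:R 2%:R - A 1 2%:R * A 2%:R 0)
  + A 0 2%:R * (A 1 0 * A 2%:R 1 - A 1 1 * A 2%:R 0).
Proof.
have o1 : lift 0 0 = 1 :> 'I_3 by apply/val_inj.
have o2 : lift 0 1 = 2%:R :> 'I_3 by apply/val_inj.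
have o3 : lift 1 0 = 0 :> 'I_3 by apply/val_inj.
have o4 : lift 1 1 = 2%:R :> 'I_3 by apply/val_inj.
have o5 : lift 2%:R 0 = 0 :> 'I_3 by apply/val_inj.
have o6 : lift 2%:R 1 = 1 :> 'I_3 by apply/val_inj.
have o7 : lift 0 (lift 0 0) = 2%:R :> 'I_3 by apply/val_inj.
rewrite (expand_det_row _ ord0) !big_ord_recl big_ord0 addr0 o7 o1 /cofactor !det22.
rewrite !mxE !o1 !o2 !o3 !o4 !o5 !o6 /= expr0 expr1; ring.
Qed.

Section F3.

Lemma I3_ind (P : 'I_3 -> Prop) : P 0 -> P 1 -> P 2%:R -> forall i, P i.
Proof.
move=> P0 P1 P2 [[|[|[|//]]] h].
- by rewrite (_ : Ordinal h = 0)//; apply/val_inj.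
- by rewrite (_ : Ordinal h = 1)//; apply/val_inj.
- by rewrite (_ : Ordinal h = 2%:R)//; apply/val_inj.
Qed.

Lemma F3_ind (P : 'F_3 -> Prop) : P 0 -> P 1 -> P 2%:R -> forall i, P i.
Proof. exact: I3_ind. Qed.

Lemma sum3 (V : nmodType) (F : 'I_3 -> V) : \sum_i F i = F 0 + F 1 + F 2%:R.
Proof.
by rewrite !big_ord_recl big_ord0 addr0 addrA; congr (F _ + F _ + F _); apply/val_inj.
Qed.

Lemma F3_3 : 3%:R = 0 :> 'F_3. Proof. exact/val_inj. Qed.

(** Lets [ring], which does not know that 3 = 0, prove identities in F_3: [3%:R * z] is the multiple
    of 3 to be discarded. *)
Lemma F3_eq (z x y : 'F_3) : x = y + 3%:R * z -> x = y.
Proof. by move=> ->; rewrite F3_3 mul0r addr0. Qed.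

Definition vec2 (a b : 'F_3) : 'cV['F_3]_2 := \col_i (if i == 0 then a else b).
Lemma vec2_0 a b : vec2 a b 0 0 = a. Proof. by rewrite mxE. Qed.
Lemma vec2_1 a b : vec2 a b 1 0 = b. Proof. by rewrite mxE. Qed.
Lemma vec2E (u : 'cV['F_3]_2) : u = vec2 (u 0 0) (u 1 0).
Proof.
apply/matrixP => i j; rewrite mxE ord1.
by case: i => [[|[|//]] h] /=; congr (u _ _); apply/val_inj.
Qed.
Lemma vec2D a b c d : vec2 a b + vec2 c d = vec2 (a + c) (b + d).
Proof. by apply/matrixP => i j; rewrite !mxE; case: ifP. Qed.

Definition det2 (u v : 'cV['F_3]_2) : 'F_3 := u 0 0 * v 1 0 - u 1 0 * v 0 0.

Lemma det2Dl u v x : det2 (u + v) x = det2 u x + det2 v x.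
Proof. by rewrite /det2 !mxE; ring. Qed.
Lemma det2Dr u v x : det2 x (u + v) = det2 x u + det2 x v.
Proof. by rewrite /det2 !mxE; ring. Qed.
Lemma det2Zl a u v : det2 (a *: u) v = a * det2 u v.
Proof. by rewrite /det2 !mxE; ring. Qed.
Lemma det2C u v : det2 u v = - det2 v u.
Proof. by rewrite /det2; ring. Qed.
Lemma det2uu u : det2 u u = 0.
Proof. by rewrite /det2; ring. Qed.
Lemma mul2E (A : 'M['F_3]_2) (u : 'cV_2) i : (A *m u) i 0 = A i 0 * u 0 0 + A i 1 * u 1 0.
Proof.
rewrite mxE !big_ord_recl big_ord0 addr0.
by congr (A _ _ * u _ _ + A _ _ * u _ _); apply/val_inj.
Qed.
Lemma det2M (A : 'M['F_3]_2) u v : det2 (A *m u) (A *m v) = \det A * det2 u v.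
Proof. by rewrite /det2 !mul2E det22; ring. Qed.

End F3.

Section Roots.
Variables (S : comPzRingType) (w : S).

(* [w] is a primitive cube root of unity in the strong sense. *)
Definition cube_root := 1 + w + w * w = 0.
Definition wp (x : 'F_3) : S := w ^+ (x : nat).

Hypothesis w1 : cube_root.

Lemma cube_root_sq : w * w = -1 - w.
Proof. by apply/eqP; rewrite -subr_eq0; apply/eqP; rewrite -[RHS]w1; ring. Qed.
Lemma cube_root3 : w ^+ 3 = 1.
Proof. by rewrite !exprS expr0 mulr1 cube_root_sq; ring: cube_root_sq. Qed.
Lemma wp0 : wp 0 = 1. Proof. by []. Qed.
Lemma wp1 : wp 1 = w. Proof. by rewrite /wp expr1. Qed.
Lemma wp2 : wp 2%:R = -1 - w. Proof. by rewrite -cube_root_sq -expr2. Qed.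
Lemma wpD x y : wp (x + y) = wp x * wp y.
Proof.
rewrite /wp -exprD; have -> : (x + y : 'F_3) = ((x + y)%N %% 3)%N :> nat by [].
by rewrite [in RHS](divn_eq (x + y) 3) exprD mulnC exprM cube_root3 expr1n mul1r.
Qed.
Lemma wpN x : wp (- x) * wp x = 1. Proof. by rewrite -wpD addNr wp0. Qed.

(** Because (1 - w)(1 - w^2) = 3. *)
Lemma wp_sub1 (i3 : S) x : 3%:R * i3 = 1 -> x != 0 -> invertible (1 - wp x).
Proof.
move=> h3; elim/F3_ind: x => // _.
  by exists (i3 * (1 - w * w)); rewrite wp1 -[RHS]h3; ring: cube_root_sq.
by exists (i3 * (1 - w)); rewrite wp2 -[RHS]h3; ring: cube_root_sq.
Qed.

Lemma wp_fix (i3 : S) x y : 3%:R * i3 = 1 -> x != 0 -> wp x * y = y -> y = 0.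
Proof.
move=> h3 x0 E; have [t ts] := wp_sub1 h3 x0.
by rewrite -[y]mul1r -ts -mulrA mulrBl mul1r E subrr mulr0.
Qed.

End Roots.

Lemma cube_root_map (S T : comPzRingType) (f : {rmorphism S -> T}) w :
  cube_root w -> cube_root (f w).
Proof. by rewrite /cube_root => E; rewrite -(rmorph1 f) -rmorphM -!rmorphD E rmorph0. Qed.
Lemma wp_map (S T : comPzRingType) (f : {rmorphism S -> T}) w x : f (wp w x) = wp (f w) x.
Proof. exact: rmorphXn. Qed.

(** * Symmetric trilinear forms and polarization *)

Section Trilinear.
Variable S : comPzRingType.
Implicit Types (B : 'I_3 -> 'I_3 -> 'I_3 -> S) (a b c v : 'cV[S]_3) (M : 'M[S]_3).

Definition tri B a b c : S :=
  \sum_i \sum_j \sum_k B i j k * (a i 0 * b j 0 * c k 0).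
Definition bas i : 'cV[S]_3 := \col_j (j == i)%:R.
Definition tsym B := (forall i j k, B i j k = B j i k) /\ (forall i j k, B i j k = B i k j).

Lemma triDl B a a' b c : tri B (a + a') b c = tri B a b c + tri B a' b c.
Proof.
rewrite /tri -big_split; apply: eq_bigr => i _; rewrite -big_split; apply: eq_bigr => j _.
by rewrite -big_split; apply: eq_bigr => k _; rewrite mxE /=; ring.
Qed.
Lemma triZl B x a b c : tri B (x *: a) b c = x * tri B a b c.
Proof.
rewrite /tri mulr_sumr; apply: eq_bigr => i _; rewrite mulr_sumr; apply: eq_bigr => j _.
by rewrite mulr_sumr; apply: eq_bigr => k _; rewrite mxE /=; ring.
Qed.
Lemma triC B a b c : tsym B -> tri B a b c = tri B b a c.
Proof.
move=> [B1 _]; rewrite /tri exchange_big; apply: eq_bigr => i _; apply: eq_bigr => j _.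
by apply: eq_bigr => k _; rewrite B1; ring.
Qed.
Lemma triA B a b c : tsym B -> tri B a b c = tri B a c b.
Proof.
move=> [_ B2]; apply: eq_bigr => i _; rewrite exchange_big; apply: eq_bigr => j _.
by apply: eq_bigr => k _; rewrite B2; ring.
Qed.

Lemma triZ3 B (x y z : S) a b c : tsym B ->
  tri B (x *: a) (y *: b) (z *: c) = x * y * z * tri B a b c.
Proof.
move=> sB; rewrite triZl (triC _ (y *: b))// triZl (triC b)// (triA a)// (triC a)// triZl.
by rewrite (triC c)// (triA a)// -!mulrA.
Qed.
Lemma triDm B a b b' c : tsym B -> tri B a (b + b') c = tri B a b c + tri B a b' c.
Proof. by move=> sB; rewrite (triC a)// triDl !(triC _ a). Qed.
Lemma triDr B a b c c' : tsym B -> tri B a b (c + c') = tri B a b c + tri B a b c'.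
Proof. by move=> sB; rewrite (triA a)// triDm// !(triA a _ b). Qed.

Lemma col_bas a : a = \sum_i a i 0 *: bas i.
Proof.
apply/matrixP => i j; rewrite ord1 summxE (bigD1 i)//= big1 ?addr0 => [|k ki].
  by rewrite !mxE eqxx mulr1.
by rewrite !mxE eq_sym (negPf ki) mulr0.
Qed.

Lemma tri_bas B i j k : tri B (bas i) (bas j) (bas k) = B i j k.
Proof.
rewrite /tri (bigD1 i)//= [X in _ + X]big1 ?addr0 => [|i' hi]; last first.
  by apply: big1 => j' _; apply: big1 => k' _; rewrite !mxE (negPf hi) !mul0r mulr0.
rewrite (bigD1 j)//= [X in _ + X]big1 ?addr0 => [|j' hj]; last first.
  by apply: big1 => k' _; rewrite !mxE (negPf hj) mulr0 mul0r mulr0.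
rewrite (bigD1 k)//= [X in _ + X]big1 ?addr0 => [|k' hk]; last first.
  by rewrite !mxE (negPf hk) !mulr0.
by rewrite !mxE !eqxx !mulr1.
Qed.

Definition tcomp B M i j k := tri B (col i M) (col j M) (col k M).

Lemma mulmx_bas M i : M *m bas i = col i M.
Proof.
apply/matrixP => j l; rewrite !mxE (bigD1 i)//= big1 ?addr0 => [|k ki].
  by rewrite !mxE eqxx mulr1.
by rewrite !mxE (negPf ki) mulr0.
Qed.

Lemma tri_comp B M a b c : tri (tcomp B M) a b c = tri B (M *m a) (M *m b) (M *m c).
Proof.
rewrite {1}/tri /tcomp /tri.
transitivity (\sum_i \sum_j \sum_k \sum_i' \sum_j' \sum_k'
  B i' j' k' * ((M i' i * a i 0) * (M j' j * b j 0) * (M k' k * c k 0))).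
  apply: eq_bigr => i _; apply: eq_bigr => j _; apply: eq_bigr => k _.
  rewrite mulr_suml; apply: eq_bigr => i' _; rewrite mulr_suml; apply: eq_bigr => j' _.
  by rewrite mulr_suml; apply: eq_bigr => k' _; rewrite !mxE; ring.
under eq_bigr do under eq_bigr do rewrite exchange_big.
under eq_bigr do rewrite exchange_big.
rewrite exchange_big; apply: eq_bigr => i' _.
under eq_bigr do under eq_bigr do rewrite exchange_big.
under eq_bigr do rewrite exchange_big.
rewrite exchange_big; apply: eq_bigr => j' _.
under eq_bigr do under eq_bigr do rewrite exchange_big.
under eq_bigr do rewrite exchange_big.
rewrite exchange_big; apply: eq_bigr => k' _.
rewrite !mxE !mulr_suml mulr_sumr; apply: eq_bigr => i _.
rewrite -[in RHS]mulrA big_distrlr /= !mulr_sumr; apply: eq_bigr => j _.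
by rewrite !mulr_sumr; apply: eq_bigr => k _; ring.
Qed.

Lemma tsym_comp B M : tsym B -> tsym (tcomp B M).
Proof. by move=> sB; split=> i j k; rewrite /tcomp; [exact: triC|exact: triA]. Qed.

Lemma tri_ext B B' : (forall a b c, tri B a b c = tri B' a b c) ->
  forall i j k, B i j k = B' i j k.
Proof. by move=> E i j k; rewrite -[LHS]tri_bas E tri_bas. Qed.

Lemma eq_tri B B' a b c : (forall i j k, B i j k = B' i j k) -> tri B a b c = tri B' a b c.
Proof.
by move=> E; apply: eq_bigr => i _; apply: eq_bigr => j _; apply: eq_bigr => k _; rewrite E.
Qed.

Definition tinv B M := forall a b c, tri B (M *m a) (M *m b) (M *m c) = tri B a b c.

Lemma tinvP B M : tinv B M <-> forall i j k, tcomp B M i j k = B i j k.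
Proof.
split=> [h i j k|h a b c]; first by rewrite /tcomp -!mulmx_bas h tri_bas.
by rewrite -tri_comp; exact: eq_tri.
Qed.

Lemma tri_cube_add B a b : tsym B -> tri B (a + b) (a + b) (a + b) =
  tri B a a a + 3%:R * tri B a a b + 3%:R * tri B a b b + tri B b b b.
Proof.
move=> sB.
have Dm x y z t : tri B x (y + z) t = tri B x y t + tri B x z t.
  by rewrite triC// triDl !(triC _ x).
have Dr x y z t : tri B x t (y + z) = tri B x t y + tri B x t z.
  by rewrite triA// Dm !(triA x _ t).
rewrite !(triDl, Dm, Dr) (triA a b a) // (triC b a a)// (triA a b a)//.
rewrite (triC b a b)// (triA b b a)// (triC b a b)//; ring.
Qed.

(** Inclusion-exclusion over the sums of a, b and c recovers 6 B(a, b, c) from values of the cubic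
    form. *)
Lemma polarize B B' (i6 : S) : 6%:R * i6 = 1 -> tsym B -> tsym B' ->
  (forall v, tri B v v v = tri B' v v v) -> forall a b c, tri B a b c = tri B' a b c.
Proof.
move=> h6 sB sB' E a b c.
have K D : tsym D -> 6%:R * tri D a b c =
  (tri D (a + (b + c)) (a + (b + c)) (a + (b + c)) - tri D (a + b) (a + b) (a + b)
  - tri D (a + c) (a + c) (a + c) - tri D (b + c) (b + c) (b + c)
  + tri D a a a + tri D b b b + tri D c c c).
  move=> sD; rewrite !tri_cube_add//.
  have Dm x y z t : tri D x (y + z) t = tri D x y t + tri D x z t.
    by rewrite triC// triDl !(triC _ x).
  have Dr x y z t : tri D x t (y + z) = tri D x t y + tri D x t z.
    by rewrite triA// Dm !(triA x _ t).
  by rewrite !(Dm, Dr) (triA a c b)//; ring.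
by rewrite -[LHS]mul1r -[RHS]mul1r -h6 ![6%:R * _]mulrC -!mulrA !K// !E.
Qed.

End Trilinear.

Arguments bas {S}.

Lemma tri_map (S T : comPzRingType) (f : {rmorphism S -> T}) B a b c :
  f (tri B a b c) = tri (fun i j k => f (B i j k)) (map_mx f a) (map_mx f b) (map_mx f c).
Proof.
rewrite rmorph_sum; apply: eq_bigr => i _; rewrite rmorph_sum; apply: eq_bigr => j _.
by rewrite rmorph_sum; apply: eq_bigr => k _; rewrite !rmorphM !mxE.
Qed.

(** * Weyl systems and the Schroedinger representation *)

Section Weyl.
Variables (S : comPzRingType) (w i3 : S).
Hypotheses (w1 : cube_root w) (h3 : 3%:R * i3 = 1).
Implicit Types (W : 'cV['F_3]_2 -> 'M[S]_3) (u v : 'cV['F_3]_2).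
Notation wp := (wp w).

Definition weyl W :=
  W 0 = 1%:M /\ forall u v, W u *m W v = wp (det2 u v) *: W (u + v).

(** The Schroedinger representation: a character given by [u 1 0], then the translation by [u 0 0].
    The phase 2 u_0 u_1 adds u_0 v_1 + u_1 v_0 to the cocycle u_1 v_0 of the bare products, which
    makes it the alternating form [det2] modulo 3. *)
Definition weyl0 u : 'M[S]_3 := \matrix_(i, j)
  if (i : 'F_3) == (j : 'F_3) + u 0 0
  then wp (2%:R * u 0 0 * u 1 0 + u 1 0 * j) else 0.

Lemma weyl0_col u (j : 'F_3) :
  weyl0 u *m bas j = wp (2%:R * u 0 0 * u 1 0 + u 1 0 * j) *: bas (j + u 0 0).
Proof.
apply/matrixP => i k; rewrite mulmx_bas !mxE; case: eqP => _; first by rewrite mulr1.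
by rewrite mulr0.
Qed.

Lemma mx_bas_eq (M N : 'M[S]_3) : (forall j : 'F_3, M *m bas j = N *m bas j) -> M = N.
Proof.
move=> E; apply/matrixP => i j.
by have /matrixP/(_ i 0) := E j; rewrite !mulmx_bas !mxE.
Qed.

Lemma weyl0P : weyl weyl0.
Proof.
split=> [|u v]; apply: mx_bas_eq => j.
  by rewrite mul1mx weyl0_col !mxE !(mulr0, mul0r) !addr0 scale1r.
rewrite -mulmxA weyl0_col -scalemxAr weyl0_col -scalemxAl weyl0_col !scalerA -!wpD//.
have -> : (j : 'F_3) + v 0 0 + u 0 0 = (j : 'F_3) + (u + v) 0 0.
  by rewrite mxE -addrA [v 0 0 + _]addrC.
rewrite !mxE; congr (wp _ *: _).
by apply: (@F3_eq (- (u 0 0 * v 1 0))); rewrite /det2; ring.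
Qed.

Lemma weylV W u : weyl W -> W u *m W (- u) = 1%:M.
Proof.
by move=> [W1 WM]; rewrite WM subrr W1 -scaleN1r det2C det2Zl det2uu mulr0 oppr0 scale1r.
Qed.

Lemma weylK W u : weyl W -> W (- u) *m W u = 1%:M.
Proof. by move=> hW; rewrite -{2}[u]opprK weylV. Qed.

Lemma weyl_cube W u : weyl W -> W u *m W u *m W u = 1%:M.
Proof.
move=> hW; have [W1 WM] := hW.
rewrite WM det2uu scale1r WM det2Dl det2uu addr0 scale1r -[RHS]W1; congr W.
have -> : u + u + u = (3%:R : 'F_3) *: u by rewrite !mulrSr mulr0n add0r !scalerDl !scale1r.
by rewrite F3_3 scale0r.
Qed.

Lemma weyl_conj W u v : weyl W ->
  W v *m W u *m W (- v) = wp (2%:R * det2 v u) *: W u.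
Proof.
move=> [_ WM]; rewrite WM -scalemxAl WM scalerA -wpD// [v + u - v]addrAC subrr add0r.
congr (wp _ *: _); rewrite -scaleN1r [det2 (_ + _) _]det2C det2Zl det2Dr det2uu.
by rewrite add0r; ring.
Qed.

(** Conjugation by a suitable W(v) multiplies W(u) by a nontrivial cube root of unity, while the
    trace is unchanged. *)
Lemma weyl_tr W u : weyl W -> u != 0 -> \tr (W u) = 0.
Proof.
move=> hW u0; have [W1 WM] := hW.
have [v dv] : exists v, det2 v u != 0.
  case: (eqVneq (u 0 0) 0) => [E0|E0].
    exists (vec2 1 0); rewrite /det2 !vec2_0 !vec2_1 mul0r subr0 mul1r.
    by apply: contraNneq u0 => E1; rewrite [u]vec2E E0 E1; apply/eqP/matrixP => i j; rewrite !mxE; case: ifP.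
  by exists (vec2 0 1); rewrite /det2 !vec2_0 !vec2_1 mul0r sub0r mul1r oppr_eq0.
have E := weyl_conj u v hW.
have := congr1 mxtrace E; rewrite mxtrace_mulC mulmxA weylK// mul1mx mxtraceZ => /esym.
apply: (wp_fix w1 h3).
by move: dv; elim/F3_ind: (det2 v u).
Qed.

Lemma weyl_split W a b : weyl W -> W (vec2 a 0) *m W (vec2 0 b) = wp (a * b) *: W (vec2 a b).
Proof.
by move=> [_ WM]; rewrite WM vec2D addr0 add0r /det2 !vec2_0 !vec2_1 mul0r subr0.
Qed.

Lemma weyl_ext W W' : weyl W -> weyl W' -> W (vec2 1 0) = W' (vec2 1 0) ->
  W (vec2 0 1) = W' (vec2 0 1) -> forall u, W u = W' u.
Proof.
move=> hW hW' E1 E2 u.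
have pw V x : weyl V -> V (x + x) = V x *m V x by move=> [_ ->]; rewrite det2uu scale1r.
have A a : W (vec2 a 0) = W' (vec2 a 0).
  elim/F3_ind: a => //.
    by rewrite (_ : vec2 0 0 = 0) ?(proj1 hW) ?(proj1 hW')//; apply/matrixP => i j; rewrite !mxE; case: ifP.
  by rewrite (_ : vec2 _ 0 = vec2 1 0 + vec2 1 0) ?pw ?E1// vec2D addr0.
have B b : W (vec2 0 b) = W' (vec2 0 b).
  elim/F3_ind: b => //.
  by rewrite (_ : vec2 0 _ = vec2 0 1 + vec2 0 1) ?pw ?E2// vec2D addr0.
have C V a b : weyl V -> V (vec2 a b) = wp (- (a * b)) *: (V (vec2 a 0) *m V (vec2 0 b)).
  by move=> hV; rewrite weyl_split// scalerA wpN// scale1r.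
by rewrite [u]vec2E (C W)// (C W')// A B.
Qed.

(* The columns of [h] are the W(j, 0) v for an eigenvector v of W(0, 1) of
   eigenvalue 1, a column of 1 + W(0, 1) + W(0, 2). *)
Lemma weyl_coord W (k : fieldType) (chi : {rmorphism S -> k}) : weyl W ->
  exists2 h : 'M[S]_3, (forall u, W u *m h = h *m weyl0 u) & chi (\det h) != 0.
Proof.
move=> hW; have [W1 WM] := hW.
pose Z := \sum_b W (vec2 0 b).
have ZW b : W (vec2 0 b) *m Z = Z.
  rewrite mulmx_sumr [RHS](reindex_inj (addrI b)); apply: eq_bigr => c _.
  by rewrite WM vec2D add0r /det2 !vec2_0 !vec2_1 mul0r mulr0 subrr scale1r.
have WZ b : Z *m W (vec2 0 b) = Z.
  rewrite mulmx_suml [RHS](reindex_inj (addIr b)); apply: eq_bigr => c _.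
  by rewrite WM vec2D add0r /det2 !vec2_0 !vec2_1 mul0r mulr0 subrr scale1r.
have Z2 : Z *m Z = 3%:R *: Z.
  rewrite {1}/Z mulmx_suml (eq_bigr (fun=> Z)) => [|b _]; last by rewrite ZW.
  by rewrite sumr_const card_ord scaler_nat.
have v0 : vec2 0 0 = 0 by apply/matrixP => i j; rewrite !mxE; case: ifP.
have trZ : \tr Z = 3%:R.
  rewrite raddf_sum (bigD1 0)//= big1 ?addr0 => [|b b0].
    by rewrite v0 W1 mxtrace1.
  apply: weyl_tr => //; apply: contra b0 => /eqP/matrixP/(_ 1 0).
  by rewrite vec2_1 mxE => ->.
have k3 : chi 3%:R != 0.
  by apply/eqP => E; have := congr1 chi h3; rewrite rmorphM E mul0r rmorph1 => /esym/eqP; rewrite oner_eq0.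
(* The trace 3 of [Z] is nonzero at [chi], hence so is one of its diagonal entries. *)
have [i Zi] : exists i, chi (Z i i) != 0.
  apply: contrapT => N; move/eqP: k3; apply; rewrite -trZ rmorph_sum big1// => i _.
  by apply: contrapT => /eqP h; apply: N; exists i.
pose c := Z *m bas i.
have Wc b : W (vec2 0 b) *m c = c by rewrite mulmxA ZW.
pose h : 'M[S]_3 := \matrix_(a, j) (W (vec2 j 0) *m c) a 0.
(* [g] inverts [h] up to the scalar 3 [Z i i]: an off-diagonal entry of the product comes from Z
   W(m, 0) Z with m nonzero, which conjugation by W(0, 1) multiplies by a nontrivial cube root of
   unity. *)
pose g : 'M[S]_3 := \matrix_(j, a) (Z *m W (- vec2 j 0)) i a.
have hb (j : 'F_3) : h *m bas j = W (vec2 j 0) *m c.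
  by rewrite mulmx_bas; apply/matrixP => x y; rewrite ord1 !mxE.
exists h => [u|].
  apply: mx_bas_eq => j.
  rewrite -!mulmxA weyl0_col -scalemxAr !hb mulmxA WM {2}[u]vec2E vec2D addr0.
  have -> : W (vec2 (u 0 0 + j) (u 1 0)) =
     wp (- ((u 0 0 + j) * u 1 0)) *: (W (vec2 (u 0 0 + j) 0) *m W (vec2 0 (u 1 0))).
    by rewrite weyl_split// scalerA wpN// scale1r.
  rewrite -!scalemxAl -mulmxA Wc scalerA -wpD// addrC; congr (wp _ *: (W (vec2 _ 0) *m c)).
    by apply: (@F3_eq (- (u 0 0 * u 1 0 + u 1 0 * j))); rewrite /det2 !vec2_0 !vec2_1; ring.
  exact: addrC.
have gh : g *m h = (3%:R * Z i i)%:M.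
  apply/matrixP => j l.
  transitivity ((Z *m (W (- vec2 j 0) *m W (vec2 l 0)) *m Z) i i).
    transitivity ((Z *m W (- vec2 j 0) *m (W (vec2 l 0) *m c)) i 0).
      by rewrite [LHS]mxE [RHS]mxE; apply: eq_bigr => x _; rewrite !mxE.
    rewrite /c !mulmxA mulmx_bas mxE //.
  rewrite WM -scaleN1r [_ *: vec2 j 0](_ : _ = vec2 (- j) 0); last first.
    by rewrite scaleN1r; apply/matrixP => x y; rewrite !mxE; case: ifP => //; rewrite oppr0.
  rewrite vec2D addr0 {1}/det2 !vec2_0 !vec2_1 mulr0 mul0r subr0 wp0 scale1r [RHS]mxE.
  case: eqVneq => [->|jl]; first by rewrite addNr v0 W1 mulmx1 Z2 mxE.
  have m0 : - j + l != 0 by rewrite addrC subr_eq0 eq_sym.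
  have E : Z *m W (vec2 (- j + l) 0) *m Z = wp (- j + l) *: (Z *m W (vec2 (- j + l) 0) *m Z).
    have EN : - vec2 0 1 = vec2 0 (- 1).
      by apply/matrixP => x y; rewrite !mxE; case: ifP => //; rewrite oppr0.
    transitivity (Z *m (W (vec2 0 1) *m W (vec2 (- j + l) 0) *m W (- vec2 0 1)) *m Z).
      by rewrite !mulmxA WZ -!mulmxA EN ZW.
    rewrite weyl_conj// -scalemxAr -scalemxAl.
    congr (wp _ *: _); rewrite /det2 !vec2_0 !vec2_1 mul0r sub0r mul1r.
    by apply: (@F3_eq (j - l)); ring.
  apply: (wp_fix w1 h3 m0).
  by move: E => /matrixP/(_ i i); rewrite [in X in _ = X -> _]mxE => /esym.
have : chi (\det g * \det h) != 0.
  by rewrite -det_mulmx gh det_scalar rmorphXn expf_neq0// rmorphM mulf_neq0.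
by rewrite rmorphM mulf_eq0 negb_or => /andP[].
Qed.

End Weyl.

(** * Hesse forms and frames *)

Lemma invertible_eq0 (S : comPzRingType) (x y : S) : invertible x -> x * y = 0 -> y = 0.
Proof. by move=> [t ts] E; rewrite -[y]mul1r -ts -mulrA E mulr0. Qed.
Lemma invertibleM (S : comPzRingType) (x y : S) :
  invertible x -> invertible y -> invertible (x * y).
Proof. by move=> [s sx] [t ty]; exists (s * t); rewrite mulrACA sx ty mulr1. Qed.
Lemma invertible_map (S : comPzRingType) (k : fieldType) (f : {rmorphism S -> k}) x :
  invertible x -> f x != 0.
Proof.
move=> [t E]; apply/eqP => E0; have := congr1 f E.
by rewrite rmorphM E0 mulr0 rmorph1 => /esym/eqP; rewrite oner_eq0.
Qed.

Section Hesse.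
Variable S : comPzRingType.
Implicit Types (B : 'I_3 -> 'I_3 -> 'I_3 -> S) (al be : S) (v : 'cV[S]_3).

(* The polar form of al (x^3 + y^3 + z^3) + 6 be x y z. *)
Definition hesse al be (i j k : 'I_3) : S :=
  if (i == j) && (j == k) then al
  else if [&& i != j, j != k & i != k] then be else 0.

Lemma tri_hesse al be (a b c : 'cV[S]_3) : tri (hesse al be) a b c =
  al * (a 0 0 * b 0 0 * c 0 0 + a 1 0 * b 1 0 * c 1 0 + a 2%:R 0 * b 2%:R 0 * c 2%:R 0)
  + be * (a 0 0 * b 1 0 * c 2%:R 0 + a 0 0 * b 2%:R 0 * c 1 0
        + a 1 0 * b 0 0 * c 2%:R 0 + a 1 0 * b 2%:R 0 * c 0 0
        + a 2%:R 0 * b 0 0 * c 1 0 + a 2%:R 0 * b 1 0 * c 0 0).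
Proof. by rewrite /tri !sum3 /hesse /=; ring. Qed.

Lemma hesse_sym al be : tsym (hesse al be).
Proof.
split=> i j k; rewrite /hesse; move: i j k.
  by elim/I3_ind; elim/I3_ind; elim/I3_ind.
by elim/I3_ind; elim/I3_ind; elim/I3_ind.
Qed.

Definition smooth3 B := forall (k : fieldType) (g : {rmorphism S -> k}) (v : 'cV[k]_3),
  v != 0 -> exists c, tri (fun i j l => g (B i j l)) v v c != 0.

Definition polar_mx B v : 'M[S]_3 := \matrix_(i, j) tri B v (bas i) (bas j).
(** The Hessian determinant of v |-> B(v, v, v), divided by 216. *)
Definition hess B v := \det (polar_mx B v).

Lemma polar_mxP B v (x y : 'cV[S]_3) : tri B v x y = (x^T *m polar_mx B v *m y) 0 0.
Proof.
have E i j : tri B v (bas i) (bas j) = \sum_k B k i j * v k 0.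
  apply: eq_bigr => k _; rewrite (bigD1 i)//= [X in _ + X]big1 ?addr0 => [|i' hi]; last first.
    by apply: big1 => j' _; rewrite !mxE (negPf hi) !(mulr0, mul0r).
  rewrite (bigD1 j)//= [X in _ + X]big1 ?addr0 => [|j' hj]; last first.
    by rewrite !mxE (negPf hj) !(mulr0, mul0r).
  by rewrite !mxE !eqxx !mulr1.
rewrite mxE; under eq_bigr => j _ do rewrite mxE mulr_suml.
rewrite /tri exchange_big /= [RHS]exchange_big /=; apply: eq_bigr => i _.
rewrite exchange_big; apply: eq_bigr => j _; rewrite !mxE E !mulr_sumr mulr_suml.
by apply: eq_bigr => k _; ring.
Qed.

Lemma polar_mx_comp B (M : 'M[S]_3) v :
  polar_mx (tcomp B M) v = M^T *m polar_mx B (M *m v) *m M.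
Proof.
apply/matrixP => i j; rewrite mxE tri_comp polar_mxP !mulmx_bas.
rewrite [LHS]mxE [RHS]mxE; apply: eq_bigr => l _; rewrite !mxE; congr (_ * _).
by apply: eq_bigr => l' _; rewrite !mxE.
Qed.

Lemma hess_comp B (M : 'M[S]_3) v :
  hess (tcomp B M) v = \det M ^+ 2 * hess B (M *m v).
Proof. by rewrite /hess polar_mx_comp !det_mulmx det_tr; ring. Qed.

Lemma polar_mx_ext B B' v : (forall i j k, B i j k = B' i j k) -> polar_mx B v = polar_mx B' v.
Proof. by move=> E; apply/matrixP => i j; rewrite !mxE; exact: eq_tri. Qed.

Lemma hess_inv B (M : 'M[S]_3) v : tinv B M -> \det M = 1 -> hess B (M *m v) = hess B v.
Proof.
move=> /tinvP BM M1; rewrite /hess -(polar_mx_ext v BM) -/(hess (tcomp B M) v) hess_comp M1.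
by rewrite expr1n mul1r.
Qed.

(** The Hessian of a Hesse form lies again in the pencil of Hesse forms; together with the form it
    will isolate xyz and x^3 + y^3 + z^3. *)
Lemma hess_hesse al be v : hess (hesse al be) v =
  (al ^+ 3 + 2%:R * be ^+ 3) * (v 0 0 * v 1 0 * v 2%:R 0)
  - al * be ^+ 2 * (v 0 0 ^+ 3 + v 1 0 ^+ 3 + v 2%:R 0 ^+ 3).
Proof. by rewrite /hess det33 !mxE !tri_hesse !mxE /=; ring. Qed.

End Hesse.

Section Smooth.
Variable S : comPzRingType.
Implicit Types (B : 'I_3 -> 'I_3 -> 'I_3 -> S) (al be : S).

Lemma hesse_units al be (k : fieldType) (g : {rmorphism S -> k}) :
  smooth3 (hesse al be) -> g al != 0 /\ g (al ^+ 3 + 8%:R * be ^+ 3) != 0.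
Proof.
move=> sm.
have gh i j l : g (hesse al be i j l) = hesse (g al) (g be) i j l.
  by rewrite /hesse; do 2?case: ifP => // _; rewrite rmorph0.
pose vec (x y z : k) : 'cV[k]_3 := \col_i (if i == 0 then x else if i == 1 then y else z).
have g0 : g al != 0.
  apply/eqP => E; have [|c /eqP] := sm k g (vec 1 0 0).
    by apply/eqP => /matrixP/(_ 0 0)/eqP; rewrite !mxE /= oner_eq0.
  by apply; rewrite (eq_tri _ _ _ gh) tri_hesse E !mxE /=; ring.
split=> //; apply/eqP => E.
(* [m] is a cube root of unity, and (1 : 1 : m^2) is then a singular point. *)
pose m := - (2%:R * g be) / g al.
have gm : g al * m = - (2%:R * g be) by rewrite /m mulrC divfK.
have m3 : m ^+ 3 = 1.
  apply: (mulfI (expf_neq0 3 g0)); rewrite -exprMn gm mulr1; apply/eqP.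
  rewrite -subr_eq0 -oppr_eq0; apply/eqP; rewrite -[RHS]E rmorphD rmorphM !rmorphXn rmorph_nat; ring.
have [|c /eqP] := sm k g (vec 1 1 (m ^+ 2)).
  by apply/eqP => /matrixP/(_ 0 0)/eqP; rewrite !mxE /= oner_eq0.
apply; rewrite (eq_tri _ _ _ gh) tri_hesse !mxE /=.
have gm' : 2%:R * g be = - (g al * m) by rewrite gm opprK.
transitivity (g al * (c 0 0 + c 1 0 + m ^+ 3 * m * c 2%:R 0) + (2%:R * g be) *
  (m ^+ 2 * c 0 0 + m ^+ 2 * c 1 0 + c 2%:R 0)); first by ring.
rewrite m3 gm'; transitivity (g al * ((1 - m ^+ 3) * (c 0 0 + c 1 0))); first by ring.
by rewrite m3 subrr mul0r mulr0.
Qed.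

Lemma smooth3_comp B (h h' : 'M[S]_3) : h *m h' = 1%:M -> h' *m h = 1%:M ->
  smooth3 B -> smooth3 (tcomp B h).
Proof.
move=> hh' h'h sm k g v v0.
have G c : tri (fun i j l => g (tcomp B h i j l)) v v c = tri (fun i j l => g (B i j l))
    (map_mx g h *m v) (map_mx g h *m v) (map_mx g h *m c).
  rewrite -tri_comp; apply: eq_tri => i j l; rewrite /tcomp tri_map.
  by rewrite !map_col.
have [|c hc] := sm k g (map_mx g h *m v).
  apply: contraNneq v0 => E; apply/eqP.
  by rewrite -[v]mul1mx -(map_mx1 g) -h'h map_mxM -mulmxA E mulmx0.
exists (map_mx g h' *m c); rewrite G mulmxA -map_mxM hh' map_mx1 mul1mx //.
Qed.

End Smooth.

Lemma smooth3_map (S T : comPzRingType) (f : {rmorphism S -> T}) B :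
  smooth3 B -> smooth3 (fun i j k => f (B i j k)).
Proof. by move=> sm k g v v0; exact: (sm k (g \o f) v v0). Qed.

(** * Hesse forms as the invariants of the Schroedinger frame *)

Section WeylHesse.
Variables (S : comPzRingType) (w i3 : S).
Hypotheses (w1 : cube_root w) (h3 : 3%:R * i3 = 1).

Lemma hesse_weyl0 al be u : tinv (hesse al be) (weyl0 w u).
Proof.
apply/tinvP => i j k; rewrite /tcomp -!mulmx_bas !weyl0_col.
set x := 2%:R * u 0 0 * u 1 0.
rewrite (triZ3 _ _ _ _ _ _ (hesse_sym al be)) tri_bas -!wpD//.
have [z|n] := boolP ((i : 'F_3) + j + k == 0).
  have -> : x + u 1 0 * i + (x + u 1 0 * j) + (x + u 1 0 * k) = 0.
    by rewrite -[RHS](mulr0 (u 1 0)) -(eqP z); apply: (@F3_eq x); ring.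
  rewrite wp0 mul1r; move: (u 0 0) i j k z {x}.
  by elim/F3_ind; elim/I3_ind; elim/I3_ind; elim/I3_ind.
have [-> ->] : hesse al be i j k = 0 /\
   hesse al be ((i : 'F_3) + u 0 0) ((j : 'F_3) + u 0 0) ((k : 'F_3) + u 0 0) = 0.
  move: (u 0 0) i j k n {x}.
  by elim/F3_ind; elim/I3_ind; elim/I3_ind; elim/I3_ind.
by rewrite mulr0.
Qed.

(** W(0, 1) forces [B i j k] = 0 unless i + j + k = 0 in F_3, that is, unless the indices are all
    equal or all distinct; W(1, 0) makes [B] constant under shifts. *)
Lemma weyl0_hesse B : tsym B -> (forall u, tinv B (weyl0 w u)) ->
  exists al be, forall i j k, B i j k = hesse al be i j k.
Proof.
move=> sB inv; exists (B 0 0 0), (B 0 1 2%:R).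
have Z (i j k : 'F_3) : i + j + k != 0 -> B i j k = 0.
  move=> n; apply: (wp_fix w1 h3 n); have := inv (vec2 0 1) (bas i) (bas j) (bas k).
  rewrite !weyl0_col triZ3// !vec2_0 !vec2_1 !addr0 !tri_bas -!wpD// => E.
  by rewrite -[RHS]E; congr (wp w _ * _); ring.
have X (i j k : 'F_3) : B (i + 1) (j + 1) (k + 1) = B i j k.
  have := inv (vec2 1 0) (bas i) (bas j) (bas k).
  rewrite !weyl0_col triZ3// !vec2_0 !vec2_1 !mulr0 !mul0r !addr0 wp0 !tri_bas !mul1r; exact.
have [s1 s2] := sB.
have E1 : B 1 1 1 = B 0 0 0 by rewrite -[RHS]X; congr B; apply/val_inj.
have E2 : B 2%:R 2%:R 2%:R = B 0 0 0 by rewrite -E1 -[RHS]X; congr B; apply/val_inj.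
have Ea : B 0 2%:R 1 = B 0 1 2%:R by rewrite s2.
have Eb : B 1 0 2%:R = B 0 1 2%:R by rewrite s1.
have Ec : B 1 2%:R 0 = B 0 1 2%:R by rewrite s2 Eb.
have Ed : B 2%:R 0 1 = B 0 1 2%:R by rewrite s1 Ea.
have Ee : B 2%:R 1 0 = B 0 1 2%:R by rewrite s2 Ed.
by elim/I3_ind; elim/I3_ind; elim/I3_ind; rewrite /hesse /=; try by apply: Z.
Qed.

Lemma det_weyl0 u : \det (weyl0 w u) = 1.
Proof.
rewrite det33 !mxE.
set x := 2%:R * u 0 0 * u 1 0.
have P : wp w (x + u 1 0 * (0 : 'F_3)) * wp w (x + u 1 0 * (1 : 'F_3)) * wp w (x + u 1 0 * (2%:R : 'F_3)) = 1.
  rewrite -!wpD// -[RHS](wp0 w); congr wp.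
  by apply: (@F3_eq (x + u 1 0)); ring.
move: (u 0 0) P => a; move: x => x.
by elim/F3_ind: a => /= <-; ring.
Qed.

End WeylHesse.

Section Frames.
Variables (S : comPzRingType) (w : S).
Implicit Types (B : 'I_3 -> 'I_3 -> 'I_3 -> S) (W : 'cV['F_3]_2 -> 'M[S]_3).

Definition frame B W := weyl w W /\ forall u, tinv B (W u).

(* The right action of the affine group on frames; [W] is turned into [W u]
   for u replaced by A u, twisted by the character attached to b. *)
Definition fact (g : ASL2F3) W u : 'M[S]_3 :=
  wp w (det2 g.1 (val g.2 *m u)) *: W (val g.2 *m u).

Hypothesis w1 : cube_root w.

Lemma tinv_wp B (M : 'M[S]_3) x : tsym B -> tinv B M -> tinv B (wp w x *: M).
Proof.
move=> sB hM a b c; rewrite -!scalemxAl triZ3// -!wpD// hM.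
by rewrite (_ : x + x + x = 0) ?wp0 ?mul1r//; apply: (@F3_eq x); ring.
Qed.

Lemma fact_weyl g W : weyl w W -> weyl w (fact g W).
Proof.
move=> [W1 WM]; split=> [|u v].
  by rewrite /fact mulmx0 W1 /det2 !mxE !mulr0 subrr scale1r.
rewrite /fact -scalemxAl -scalemxAr WM !scalerA -!wpD// mulmxDr det2Dr det2M.
by rewrite (eqP (valP g.2)) mul1r; congr (wp w _ *: _); ring.
Qed.

Lemma factM g h W u : fact (g * h)%g W u = fact h (fact g W) u.
Proof.
case: g h => [b A] [c D]; rewrite /fact /= scalerA -wpD// -!mulmxA; congr (wp w _ *: _).
by rewrite det2Dl det2M (eqP (valP A)) mul1r.
Qed.

Lemma fact1 W u : fact 1%g W u = W u.
Proof. by rewrite /fact /= mul1mx /det2 !mxE !mul0r subrr scale1r. Qed.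

Lemma frame_hesse_basis B (h h' : 'M[S]_3) al be : tsym B -> h' *m h = 1%:M -> h *m h' = 1%:M ->
  (forall i j k, tcomp B h i j k = hesse al be i j k) ->
  frame B (fun u => h *m weyl0 w u *m h').
Proof.
move=> sB h'h hh' E; split.
  have [W1 WM] := weyl0P w1; split=> [|u v]; first by rewrite W1 mulmx1.
  by rewrite !mulmxA -[_ *m h' *m h]mulmxA h'h mulmx1 -[h *m _ *m _]mulmxA WM -scalemxAr -scalemxAl.
move=> u a b c; rewrite -!mulmxA -tri_comp (eq_tri _ _ _ E) hesse_weyl0//.
by rewrite -(eq_tri _ _ _ E) tri_comp !mulmxA hh' !mul1mx.
Qed.

End Frames.

(** * Automorphisms of Hesse forms over a local ring *)

Section LocalClassification.
Variables (A : pring) (w i3 i6 : A).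
Hypotheses (w1 : cube_root w) (h3 : 3%:R * i3 = 1) (h6 : 6%:R * i6 = 1) (Al : plocal A).

Lemma plocal_unit0 (x y : A) : pchi A x != 0 -> x * y = 0 -> y = 0.
Proof. by move=> /Al; exact: invertible_eq0. Qed.

Lemma plocal_idem (e : A) : e * e = e -> e = 0 \/ e = 1.
Proof.
move=> ee; have [E|n] := eqVneq (pchi A e) 0; [left|right].
  apply: (@plocal_unit0 (1 - e)); first by rewrite rmorphB rmorph1 E subr0 oner_neq0.
  by rewrite mulrBl mul1r ee subrr.
by apply/eqP; rewrite -subr_eq0; apply/eqP/(plocal_unit0 n); rewrite mulrBr ee mulr1 subrr.
Qed.

Lemma plocal_cube_root (c : A) : c ^+ 3 = 1 -> exists x, c = wp w x.
Proof.
move=> c3.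
have E : (c - 1) * ((c - w) * (c - (-1 - w))) = 0.
  by rewrite -[RHS](subrr (c ^+ 3)) {2}c3; ring: (cube_root_sq w1).
have [z|n] := eqVneq (pchi A (c - 1)) 0; last first.
  have E2 := plocal_unit0 n E.
  have [z2|n2] := eqVneq (pchi A (c - w)) 0; last first.
    by exists 2%:R; rewrite wp2//; apply/eqP; rewrite -subr_eq0; apply/eqP/(plocal_unit0 n2).
  exists 1; rewrite wp1; apply/eqP; rewrite -subr_eq0; apply/eqP.
  apply: (@plocal_unit0 (c - (-1 - w))); last by rewrite mulrC.
  rewrite (_ : c - (-1 - w) = (c - w) + (1 + w + w)); last by ring.
  rewrite rmorphD z2 add0r; apply: (@invertible_map _ _ (pchi A)).
  by exists (- (i3 * (1 + w + w))); rewrite -[RHS]h3; ring: (cube_root_sq w1).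
exists 0; rewrite wp0; apply/eqP; rewrite -subr_eq0; apply/eqP.
have u1 : pchi A (c - w) != 0.
  rewrite (_ : c - w = (c - 1) + (1 - wp w 1)); last by rewrite wp1; ring.
  by rewrite rmorphD z add0r; apply: (@invertible_map _ _ (pchi A)); exact: wp_sub1 h3 _.
have u2 : pchi A (c - (-1 - w)) != 0.
  rewrite -wp2// (_ : c - wp w 2%:R = (c - 1) + (1 - wp w 2%:R)); last by ring.
  by rewrite rmorphD z add0r; apply: (@invertible_map _ _ (pchi A)); exact: wp_sub1 h3 _.
by apply: (plocal_unit0 u2); apply: (plocal_unit0 u1); rewrite -[RHS]E; ring.
Qed.

(** An endomorphism self-adjoint for all the forms B(., ., c) of the Fermat cubic is diagonal. The
    coordinate projectors are self-adjoint, hence so are their conjugates by [N], which are thus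
    diagonal idempotents with sum 1; as the ring is local, one of them is 1 at [j]. *)
Lemma monomial_of_cubes (N : 'M[A]_3) : tinv (hesse 1 0) N -> N *m N *m N = 1%:M ->
  forall j, exists i, forall l, l != i -> N l j = 0.
Proof.
move=> sN N3 j; pose E (i : 'I_3) : 'M[A]_3 := delta_mx i i.
pose P i := N *m N *m E i *m N.
have NP i : N *m P i = E i *m N by rewrite /P !mulmxA N3 mul1mx.
have fer (a b c : 'cV[A]_3) : tri (hesse 1 0) a b c = \sum_l a l 0 * b l 0 * c l 0.
  by rewrite tri_hesse sum3; ring.
have Ei i (x : 'cV[A]_3) l : (E i *m x) l 0 = (l == i)%:R * x l 0.
  rewrite mxE (bigD1 l)//= big1 ?addr0 => [|l' hl].
    by rewrite mxE; case: eqVneq => [->|_]; rewrite ?eqxx// !mul0r.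
  by rewrite mxE; case: (l' =P i) => [<-|_]; rewrite ?andbF ?mul0r// eq_sym (negPf hl) mul0r.
have Psym i a b c : tri (hesse 1 0) (P i *m a) b c = tri (hesse 1 0) a (P i *m b) c.
  have NPv v : N *m (P i *m v) = E i *m (N *m v) by rewrite mulmxA NP mulmxA.
  rewrite -[LHS]sN -[RHS]sN !NPv !fer.
  by apply: eq_bigr => l _; rewrite !Ei; ring.
have Poff i l m : l != m -> P i l m = 0.
  move=> lm; have := Psym i (bas m) (bas l) (bas l); rewrite !fer.
  rewrite (bigD1 l)//= big1 ?addr0 => [|x hx]; last by rewrite [bas l x 0]mxE (negPf hx) !mulr0.
  rewrite [in RHS](bigD1 l)//= [in RHS]big1 ?addr0 => [|x hx]; last by rewrite [bas l x 0]mxE (negPf hx) !mulr0.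
  by rewrite !mulmx_bas !mxE !eqxx (negPf lm) !mulr1 !mul0r.
have Pdiag i (M : 'M[A]_3) : (M *m P i) ^~ j =1 fun l => M l j * P i j j.
  by move=> l; rewrite mxE (bigD1 j)//= big1 ?addr0// => x xj; rewrite Poff ?mulr0.
have E2 i : E i *m E i = E i by rewrite mul_delta_mx.
have PP i : P i j j * P i j j = P i j j.
  rewrite -[LHS](Pdiag i (P i)); congr (fun M : 'M[A]_3 => M j j).
  rewrite {2}/P !mulmxA -[P i *m N *m N](mulmxA) -[P i]/(N *m N *m E i *m N).
  rewrite -[N *m N *m E i *m N *m (N *m N)]mulmxA [N *m (N *m N)]mulmxA N3 mulmx1.
  by rewrite -[N *m N *m E i *m E i]mulmxA E2.
have P1 : \sum_i P i j j = 1.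
  transitivity ((\sum_i P i) j j); first by rewrite summxE.
  rewrite /P -mulmx_suml -mulmx_sumr (_ : \sum_i E i = 1%:M) ?mulmx1 ?N3 ?mxE ?eqxx//.
  apply/matrixP => x y; rewrite summxE (bigD1 x)//= big1 ?addr0 => [|z hz].
    by rewrite !mxE eqxx [y == x]eq_sym.
  by rewrite !mxE eq_sym (negPf hz).
have [i Pi] : exists i, P i j j = 1.
  apply: contrapT => no; have: (1 : A) = 0.
    by rewrite -P1 big1// => i _; have [//|h] := plocal_idem (PP i); case: no; exists i.
  by move/eqP; rewrite oner_eq0.
exists i => l li; rewrite -[LHS]mulr1 -Pi -(Pdiag i N) NP mxE big1// => x _.
by rewrite mxE (negPf li) mul0r.
Qed.

(** [N] is monomial and its entries are cube roots of unity. N^3 = 1 excludes transpositions, so the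
    permutation is a translation of F_3; invariance of xyz makes the three exponents sum to 0, which
    means that they are affine in the index. *)
Lemma weyl0_of_hesse (N : 'M[A]_3) : tinv (hesse 1 0) N -> tinv (hesse 0 1) N ->
  N *m N *m N = 1%:M -> exists x u, N = wp w x *: weyl0 w u.
Proof.
move=> sN pN N3.
have [s0 h0] := cid (monomial_of_cubes sN N3 0).
have [s1' h1] := cid (monomial_of_cubes sN N3 1).
have [s2 h2] := cid (monomial_of_cubes sN N3 2%:R).
pose d0 := N s0 0; pose d1 := N s1' 1; pose d2 := N s2 2%:R.
have Nb j s : (forall l, l != s -> N l j = 0) -> N *m bas j = N s j *: bas s.
  move=> h; rewrite mulmx_bas; apply/matrixP => l m; rewrite !mxE.
  by case: eqVneq => [->|/h->]; rewrite ?mulr1 ?mulr0.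
have N0 := Nb _ _ h0; have N1 := Nb _ _ h1; have N2 := Nb _ _ h2.
have cub (d : A) s j : N *m bas j = d *: bas s -> exists x, d = wp w x.
  move=> E; apply: plocal_cube_root; have := sN (bas j) (bas j) (bas j).
  rewrite E triZ3 ?tri_bas /hesse ?eqxx /= ?mulr1; last exact: hesse_sym.
  by move=> <-; ring.
have [x0 e0] := cub _ _ _ N0; have [x1 e1] := cub _ _ _ N1; have [x2 e2] := cub _ _ _ N2.
rewrite e0 in N0; rewrite e1 in N1; rewrite e2 in N2.
have nz (x : 'F_3) : wp w x != 0.
  by apply/eqP => E; have /eqP := wpN w1 x; rewrite E mulr0 eq_sym oner_eq0.
have dist : [&& s0 != s1', s1' != s2 & s0 != s2] /\ x0 + x1 + x2 = 0.
  have := pN (bas 0) (bas 1) (bas 2%:R); rewrite N0 N1 N2 triZ3 ?tri_bas; last exact: hesse_sym.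
  rewrite /hesse /= -!wpD//; case: ifP => [_|_]; first by rewrite mulr0 => /eqP; rewrite eq_sym oner_eq0.
  case: ifP => [hd|_]; last by rewrite mulr0 => /eqP; rewrite eq_sym oner_eq0.
  rewrite mulr1 => E; split=> //; apply/eqP; apply: contraT => n.
  by have /eqP := wp_fix w1 h3 n (etrans (congr1 ( *%R^~ 1) E) (mulr1 1)); rewrite oner_eq0.
have Nc (j : 'I_3) a b c x y z : N *m bas j = wp w x *: bas a -> N *m bas a = wp w y *: bas b ->
    N *m bas b = wp w z *: bas c -> c = j.
  move=> E1 E2 E3; apply: contraTeq isT => cj.
  have : N *m N *m N *m bas j = bas j by rewrite N3 mul1mx.
  rewrite -!mulmxA E1 -!scalemxAr E2 -!scalemxAr E3 !scalerA => /matrixP/(_ j 0)/eqP.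
  by rewrite !mxE eqxx [j == c]eq_sym (negPf cj) mulr0 eq_sym oner_eq0.
have NN (j : 'I_3) : exists a x, N *m bas j = wp w x *: bas a /\
    a = (if j == 0 then s0 else if j == 1 then s1' else s2).
  by elim/I3_ind: j; [exists s0, x0|exists s1', x1|exists s2, x2].
have cyc (j : 'I_3) : let f i := (if i == 0 then s0 else if i == 1 then s1' else s2) in f (f (f j)) = j.
  move=> f; have [a [x [E1 ea]]] := NN j; have [b [y [E2 eb]]] := NN a; have [c [z [E3 ec]]] := NN b.
  by rewrite /f -ea -eb -ec; exact: Nc E1 E2 E3.
have [S1 S2] : s1' = (s0 : 'F_3) + 1 /\ s2 = (s0 : 'F_3) + 2%:R.
  case: dist => + _; have := cyc 0; have := cyc 1; rewrite /=.
  move: (s0) (s1') (s2); clear.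
  by do 3!elim/I3_ind; move=> //= _ _ _; split; apply/val_inj.
(* The exponent at j must be x + 2 s_0 u_1 + u_1 j; the columns 0 and 1 determine x and u_1. *)
exists (x0 - 2%:R * (s0 : 'F_3) * (x1 - x0)), (vec2 s0 (x1 - x0)).
apply: mx_bas_eq => j; rewrite -scalemxAl weyl0_col !vec2_0 !vec2_1 scalerA -wpD//.
elim/F3_ind: j.
- by rewrite N0 add0r; congr (wp w _ *: _); ring.
- by rewrite N1 [1 + (s0 : 'F_3)]addrC -S1; congr (wp w _ *: _); ring.
- rewrite N2 [2%:R + (s0 : 'F_3)]addrC -S2; congr (wp w _ *: _).
  have [_ E] := dist; have -> : x2 = - x0 - x1 by rewrite -[RHS]addr0 -E; ring.
  by apply: (@F3_eq (- x1)); ring.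
Qed.

End LocalClassification.

Section FrameTransitivity.
Variables (A : pring) (w i3 i6 : A).
Hypotheses (w1 : cube_root w) (h3 : 3%:R * i3 = 1) (h6 : 6%:R * i6 = 1) (Al : plocal A).
Implicit Types (B : 'I_3 -> 'I_3 -> 'I_3 -> A) (W : 'cV['F_3]_2 -> 'M[A]_3).

Lemma mx_inverse (h : 'M[A]_3) : pchi A (\det h) != 0 ->
  exists h', h *m h' = 1%:M /\ h' *m h = 1%:M.
Proof.
move=> /Al[t td]; exists (t *: \adj h).
by rewrite -scalemxAr -scalemxAl mul_mx_adj mul_adj_mx scale_scalar_mx td.
Qed.

Lemma det_weyl W u : weyl w W -> \det (W u) = 1.
Proof.
move=> hW; have [h hE /Al hd] := weyl_coord w1 h3 (pchi A) hW.
have := congr1 determinant (hE u); rewrite !det_mulmx det_weyl0// mulr1 => E.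
apply/eqP; rewrite -subr_eq0; apply/eqP/(invertible_eq0 hd).
by rewrite mulrBr mulr1 mulrC E subrr.
Qed.

Lemma frame_local_basis B W : tsym B -> smooth3 B -> frame w B W ->
  exists h h' al be, [/\ h *m h' = 1%:M, h' *m h = 1%:M,
    forall u, W u *m h = h *m weyl0 w u,
    forall i j k, tcomp B h i j k = hesse al be i j k
    & pchi A al != 0 /\ pchi A (al ^+ 3 + 8%:R * be ^+ 3) != 0].
Proof.
move=> sB sm [hW BW]; have [h hE hd] := weyl_coord w1 h3 (pchi A) hW.
have [h' [hh' h'h]] := mx_inverse hd.
have [|u a b c|al [be E]] := @weyl0_hesse _ w i3 w1 h3 (tcomp B h); first exact: tsym_comp.
  by rewrite !tri_comp !mulmxA -!hE -!mulmxA BW.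
exists h, h', al, be; split=> //; apply: hesse_units.
move=> k g v v0; have [c hc] := smooth3_comp hh' h'h sm g v0.
by exists c; rewrite -(eq_tri _ _ _ (fun i j l => congr1 g (E i j l))).
Qed.

(** A transformation of determinant 1 that preserves the form preserves its Hessian, and xyz and x^3
    + y^3 + z^3 are combinations of the two because [al] and [al ^+ 3 + 8%:R * be ^+ 3] are
    units. *)
Lemma hesse_inv_pencil al be (N : 'M[A]_3) : pchi A al != 0 ->
  pchi A (al ^+ 3 + 8%:R * be ^+ 3) != 0 -> \det N = 1 -> tinv (hesse al be) N ->
  tinv (hesse 1 0) N /\ tinv (hesse 0 1) N.
Proof.
move=> /Al al0 /Al d0 N1 NF.
have H (v : 'cV[A]_3) := hess_inv v NF N1; have F (v : 'cV[A]_3) := NF v v v.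
have p (v : 'cV[A]_3) : (N *m v) 0 0 * (N *m v) 1 0 * (N *m v) 2%:R 0 = v 0 0 * v 1 0 * v 2%:R 0.
  apply/eqP; rewrite -subr_eq0; apply/eqP; apply: (invertible_eq0 (invertibleM al0 d0)).
  have := H v; have := F v; rewrite !tri_hesse !hess_hesse.
  move: (N *m v) => v' E1 E2.
  have X (a b c d : A) : a = b -> c = d -> al * be ^+ 2 * (a - b) + al * (c - d) = 0.
    by move=> -> ->; rewrite !subrr !mulr0 addr0.
  by rewrite -[RHS](X _ _ _ _ E1 E2); ring.
have s (v : 'cV[A]_3) : (N *m v) 0 0 ^+ 3 + (N *m v) 1 0 ^+ 3 + (N *m v) 2%:R 0 ^+ 3 =
    v 0 0 ^+ 3 + v 1 0 ^+ 3 + v 2%:R 0 ^+ 3.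
  apply/eqP; rewrite -subr_eq0; apply/eqP/(invertible_eq0 al0).
  have := F v; have := p v; rewrite !tri_hesse; move: (N *m v) => v' E1 E2.
  have X (a b c d : A) : a = b -> c = d -> (c - d) - 6%:R * be * (a - b) = 0.
    by move=> -> ->; rewrite !subrr mulr0 subr0.
  by rewrite -[RHS](X _ _ _ _ E1 E2); ring.
split=> a b c; rewrite -tri_comp; apply: (polarize h6) => //; try exact: hesse_sym.
- by apply: tsym_comp; exact: hesse_sym.
- move=> v; rewrite tri_comp !tri_hesse.
  have := s v; move: (N *m v) => v' E.
  have X (x y : A) : x = y -> x - y = 0 by move=> ->; rewrite subrr.
  by apply/eqP; rewrite -subr_eq0; apply/eqP; rewrite -[RHS](X _ _ E); ring.
- by apply: tsym_comp; exact: hesse_sym.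
- move=> v; rewrite tri_comp !tri_hesse.
  have := p v; move: (N *m v) => v' E.
  have X (x y : A) : x = y -> 6%:R * (x - y) = 0 by move=> ->; rewrite subrr mulr0.
  by apply/eqP; rewrite -subr_eq0; apply/eqP; rewrite -[RHS](X _ _ E); ring.
Qed.

Lemma weyl_nz W u : weyl w W -> exists i j, pchi A (W u i j) != 0.
Proof.
move=> hW; apply: contrapT => no; have := weylV u hW => /matrixP/(_ 0 0).
rewrite !mxE eqxx => /(congr1 (pchi A)); rewrite rmorph_sum big1 => [|l _].
  by rewrite rmorph1 => /esym/eqP; rewrite oner_eq0.
rewrite rmorphM; have [->|n] := eqVneq (pchi A (W u 0 l)) 0; first by rewrite mul0r.
by case: no; exists 0, l.
Qed.

Lemma wp_inj_weyl W u x y : weyl w W -> wp w x *: W u = wp w y *: W u -> x = y.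
Proof.
move=> hW /matrixP E; have [i [j /Al n]] := weyl_nz u hW.
apply/eqP; rewrite -subr_eq0; apply: contraT => xy.
have : W u i j = 0.
  apply: (wp_fix w1 h3 xy); have := E i j; rewrite !mxE addrC wpD// -mulrA => ->.
  by rewrite mulrA wpN// mul1r.
by move: n => [t ts] W0; move: ts; rewrite W0 mulr0 => /eqP; rewrite eq_sym oner_eq0.
Qed.

(** Each W'(u) preserves the cubic and has cube 1, so it is a multiple of some W(v). The vectors v1,
    v2 attached to the standard basis have determinant 1 because commutators agree, and give the
    linear part; the two scalars give the translation. *)
Lemma frame_trans B W W' : tsym B -> smooth3 B -> frame w B W -> frame w B W' ->
  exists g : ASL2F3, forall u, W' u = fact w g W u.
Proof.
move=> sB sm fW fW'; have [h [h' [al [be [hh' h'h hE BE [al0 d0]]]]]] := frame_local_basis sB sm fW.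
have [hW BW] := fW; have [hW' BW'] := fW'.
have WE u : W u = h *m weyl0 w u *m h' by rewrite -hE -mulmxA hh' mulmx1.
have cl u : exists x v, W' u = wp w x *: W v.
  pose N := h' *m W' u *m h.
  have N3 : N *m N *m N = 1%:M.
    rewrite /N !mulmxA -[h' *m W' u *m h *m h']mulmxA hh' mulmx1.
    rewrite -[h' *m W' u *m W' u *m h *m h']mulmxA hh' mulmx1.
    by rewrite -[h' *m _ *m _]mulmxA -[h' *m _ *m _]mulmxA (weyl_cube u hW') mulmx1 h'h.
  have Nd : \det N = 1.
    by rewrite /N !det_mulmx (det_weyl u hW') mulr1 mulrC -det_mulmx hh' det1.
  have NF : tinv (hesse al be) N.
    move=> a b c; rewrite -!(eq_tri _ _ _ BE) !tri_comp /N !mulmxA hh' !mul1mx -!mulmxA.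
    exact: BW'.
  have [sN pN] := hesse_inv_pencil al0 d0 Nd NF.
  have [x [v E]] := weyl0_of_hesse w1 h3 Al sN pN N3.
  exists x, v; rewrite WE scalemxAl scalemxAr -E /N !mulmxA hh' mul1mx -mulmxA hh' mulmx1.
  by [].
have [k1 [v1 E1]] := cl (vec2 1 0); have [k2 [v2 E2]] := cl (vec2 0 1).
have d12 : det2 v1 v2 = 1.
  have [_ WM] := hW; have [_ WM'] := hW'.
  have de : det2 (vec2 1 0) (vec2 0 1) = 1.
    by rewrite /det2 !vec2_0 !vec2_1 mul0r subr0 mulr1.
  have Ea : wp w (k1 + k2 + det2 v1 v2) *: W (v1 + v2) = wp w 1 *: W' (vec2 1 0 + vec2 0 1).
    have := WM' (vec2 1 0) (vec2 0 1); rewrite de => <-.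
    by rewrite E1 E2 -scalemxAl -scalemxAr WM !scalerA -!wpD.
  have Eb : wp w (k1 + k2 + det2 v2 v1) *: W (v1 + v2) = wp w (- 1) *: W' (vec2 1 0 + vec2 0 1).
    have := WM' (vec2 0 1) (vec2 1 0); rewrite det2C de [vec2 0 1 + _]addrC => <-.
    rewrite E1 E2 -scalemxAl -scalemxAr WM !scalerA -!wpD//.
    by rewrite [k1 + k2]addrC [v1 + v2]addrC.
  have : wp w (k1 + k2 + det2 v1 v2) *: W (v1 + v2) =
      wp w (2%:R + (k1 + k2 + det2 v2 v1)) *: W (v1 + v2).
    by rewrite [in RHS]wpD// -scalerA Eb scalerA -wpD// Ea; congr (wp w _ *: _); apply/val_inj.
  move/(wp_inj_weyl hW); rewrite (det2C v2) => E.
  apply: (@F3_eq (det2 v1 v2 - 1)); apply/eqP; rewrite -subr_eq0; apply/eqP.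
  transitivity (- (k1 + k2 + det2 v1 v2 - (2%:R + (k1 + k2 - det2 v1 v2)))); first by ring.
  by rewrite E subrr oppr0.
pose M : 'M['F_3]_2 := \matrix_(i, j) if j == 0 then v1 i 0 else v2 i 0.
have dM : \det M == 1 by rewrite det22 !mxE /= -d12 /det2 [v2 0 0 * _]mulrC.
(* The translation part b solves det(b, v1) = k1 and det(b, v2) = k2. *)
pose g : ASL2F3 := (k2 *: v1 - k1 *: v2, Sub M dM).
have M1 : M *m vec2 1 0 = v1.
  by rewrite [RHS]vec2E [LHS]vec2E !mul2E !vec2_0 !vec2_1 !mxE /= !mulr1 !mulr0 !addr0.
have M2 : M *m vec2 0 1 = v2.
  by rewrite [RHS]vec2E [LHS]vec2E !mul2E !vec2_0 !vec2_1 !mxE /= !mulr1 !mulr0 !add0r.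
exists g; apply: (weyl_ext w1 hW' (fact_weyl w1 g hW)).
  rewrite E1 /fact /= M1; congr (wp w _ *: _).
  by rewrite det2Dl -scaleN1r !det2Zl det2uu [det2 v2 _]det2C d12; ring.
rewrite E2 /fact /= M2; congr (wp w _ *: _).
by rewrite det2Dl -scaleN1r !det2Zl det2uu d12; ring.
Qed.

End FrameTransitivity.

(** * Local existence of Hesse coordinates *)

(* [c i j] is the polar coefficient of x^(3-i-j) y^i z^j. *)
Section CoefficientForm.
Variable S : comPzRingType.
Implicit Types (c : nat -> nat -> S) (B : 'I_3 -> 'I_3 -> 'I_3 -> S).

Definition cubic_tensor c (i j k : 'I_3) : S :=
  c (addn (addn (i == 1) (j == 1)) (k == 1)) (addn (addn (i == 2%:R) (j == 2%:R)) (k == 2%:R)).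

Lemma cubic_tensor_sym c : tsym (cubic_tensor c).
Proof.
split=> i j k; rewrite /cubic_tensor; congr c; first by rewrite [addn (j == _) _]addnC.
- by rewrite [addn (j == _) _]addnC.
- by rewrite -!addnA; congr addn; exact: addnC.
- by rewrite -!addnA; congr addn; exact: addnC.
Qed.

Definition cubic_coef B (i j : nat) : S :=
  match i, j with
  | 0%N, 0%N => B 0 0 0 | 1%N, 0%N => B 0 0 1 | 0%N, 1%N => B 0 0 2%:R
  | 2, 0%N => B 0 1 1 | 1%N, 1%N => B 0 1 2%:R | 0%N, 2 => B 0 2%:R 2%:R
  | 3, 0%N => B 1 1 1 | 2, 1%N => B 1 1 2%:R | 1%N, 2 => B 1 2%:R 2%:R
  | _, _ => B 2%:R 2%:R 2%:R end.

Lemma cubic_coefK B : tsym B -> forall i j k, cubic_tensor (cubic_coef B) i j k = B i j k.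
Proof.
move=> [s1 s2].
have p1 (i j k : 'I_3) : B j i k = B i j k := s1 j i k.
have p2 (i j k : 'I_3) : B i k j = B i j k := s2 i k j.
elim/I3_ind; elim/I3_ind; elim/I3_ind; rewrite /cubic_tensor /= //;
 first [exact: s1 | exact: s2 | by rewrite s1 s2 | by rewrite s2 s1 | by rewrite s1 s2 s1].
Qed.

Definition cubic_ev c (x y z : S) : S :=
  c 0%N 0%N * x ^+ 3 + c 3%N 0%N * y ^+ 3 + c 0%N 3%N * z ^+ 3
  + 3%:R * (c 1%N 0%N * x ^+ 2 * y + c 0%N 1%N * x ^+ 2 * z + c 2%N 0%N * x * y ^+ 2
    + c 2%N 1%N * y ^+ 2 * z + c 0%N 2%N * x * z ^+ 2 + c 1%N 2%N * y * z ^+ 2)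
  + 6%:R * (c 1%N 1%N * x * y * z).

Lemma tri_cubic c (v : 'cV[S]_3) :
  tri (cubic_tensor c) v v v = cubic_ev c (v 0 0) (v 1 0) (v 2%:R 0).
Proof. by rewrite /tri !sum3 /cubic_tensor /cubic_ev /=; ring. Qed.

Definition vec3 (x y z : S) : 'cV[S]_3 := \col_i if i == 0 then x else if i == 1 then y else z.

Definition mx3 (a b c d e f g h i : S) : 'M[S]_3 := \matrix_(r, s)
  if r == 0 then (if s == 0 then a else if s == 1 then b else c)
  else if r == 1 then (if s == 0 then d else if s == 1 then e else f)
  else (if s == 0 then g else if s == 1 then h else i).

Lemma mx3_mul (a b c d e f g h i : S) (v : 'cV[S]_3) : mx3 a b c d e f g h i *m v =
  vec3 (a * v 0 0 + b * v 1 0 + c * v 2%:R 0) (d * v 0 0 + e * v 1 0 + f * v 2%:R 0)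
       (g * v 0 0 + h * v 1 0 + i * v 2%:R 0).
Proof.
apply/matrixP => r s; rewrite ord1 [LHS]mxE sum3 !mxE.
by elim/I3_ind: r.
Qed.

Lemma det_mx3 (a b c d e f g h i : S) :
  \det (mx3 a b c d e f g h i) = a * (e * i - f * h) - b * (d * i - f * g) + c * (d * h - e * g).
Proof. by rewrite det33 !mxE. Qed.

Lemma vec3E (v : 'cV[S]_3) : v = vec3 (v 0 0) (v 1 0) (v 2%:R 0).
Proof. by apply/matrixP => i j; rewrite ord1 mxE; elim/I3_ind: i. Qed.

End CoefficientForm.

Lemma cubic_tensor_map (S T : comPzRingType) (f : {rmorphism S -> T}) c i j k :
  f (cubic_tensor c i j k) = cubic_tensor (fun a b => f (c a b)) i j k.
Proof. by []. Qed.

Lemma smooth3_eq (S : comPzRingType) (B B' : 'I_3 -> 'I_3 -> 'I_3 -> S) :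
  (forall i j k, B i j k = B' i j k) -> smooth3 B -> smooth3 B'.
Proof.
move=> E sm k g v v0; have [x hx] := sm k g v v0; exists x.
by rewrite -(eq_tri _ _ _ (fun i j l => congr1 g (E i j l))).
Qed.

Definition psmooth (A : pring) (B : 'I_3 -> 'I_3 -> 'I_3 -> A) :=
  smooth3 (fun i j k => pchi A (B i j k)).

Lemma psmooth_ext (A D : pring) (i : {rmorphism A -> D}) B : pext i ->
  psmooth B -> psmooth (fun a b c => i (B a b c)).
Proof.
move=> [[j jE] _] /(smooth3_map j) sm.
by apply: smooth3_eq sm => a b c; rewrite /= jE.
Qed.

Definition hesse_basis (A : pring) (B : 'I_3 -> 'I_3 -> 'I_3 -> A) :=
  exists (D : pring) (i : {rmorphism A -> D}), [/\ plocal D, pext i &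
    exists (h h' : 'M[D]_3) al be, [/\ h *m h' = 1%:M, h' *m h = 1%:M &
      forall x y z, tcomp (fun a b c => i (B a b c)) h x y z = hesse al be x y z]].

Section HesseBasis.
Variable A : pring.
Implicit Types (B : 'I_3 -> 'I_3 -> 'I_3 -> A).

Lemma tcomp_ext (S : comPzRingType) (B B' : 'I_3 -> 'I_3 -> 'I_3 -> S) h i j k :
  (forall i j k, B i j k = B' i j k) -> tcomp B h i j k = tcomp B' h i j k.
Proof. by move=> E; exact: eq_tri. Qed.

Lemma tcomp_tcomp (S : comPzRingType) (B : 'I_3 -> 'I_3 -> 'I_3 -> S) (h g : 'M[S]_3) i j k :
  tcomp (tcomp B h) g i j k = tcomp B (h *m g) i j k.
Proof. by rewrite {1}/tcomp tri_comp /tcomp -!mulmx_bas !mulmxA. Qed.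

Lemma tcomp_map (S T : comPzRingType) (f : {rmorphism S -> T})
    (B : 'I_3 -> 'I_3 -> 'I_3 -> S) h i j k :
  f (tcomp B h i j k) = tcomp (fun a b c => f (B a b c)) (map_mx f h) i j k.
Proof. by rewrite /tcomp tri_map !map_col. Qed.

Lemma hesse_basis_ext (D : pring) (i : {rmorphism A -> D}) B : pext i ->
  hesse_basis (fun a b c => i (B a b c)) -> hesse_basis B.
Proof.
move=> iD [D' [j [D'l jD' H]]]; exists D', (j \o i); split=> //.
exact: pext_comp jD'.
Qed.

Lemma hesse_basis_eq B B' : (forall i j k, B i j k = B' i j k) -> hesse_basis B' -> hesse_basis B.
Proof.
move=> E [D [i [Dl iD [h [h' [al [be [E1 E2 H]]]]]]]].
exists D, i; split=> //; exists h, h', al, be; split=> // x y z.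
by rewrite -H; apply: tcomp_ext => a b c; rewrite E.
Qed.

Lemma hesse_basis_comp B (h h' : 'M[A]_3) : h *m h' = 1%:M -> h' *m h = 1%:M ->
  hesse_basis (tcomp B h) -> hesse_basis B.
Proof.
move=> hh' h'h [D [i [Dl iD [g [g' [al [be [E1 E2 H]]]]]]]].
exists D, i; split=> //; exists (map_mx i h *m g), (g' *m map_mx i h'), al, be; split.
- by rewrite mulmxA -[_ *m g *m g']mulmxA E1 mulmx1 -map_mxM hh' map_mx1.
- by rewrite mulmxA -[_ *m _ *m map_mx i h]mulmxA -map_mxM h'h map_mx1 mulmx1.
- move=> x y z; rewrite -H -tcomp_tcomp; apply: tcomp_ext => a b c.
  by rewrite tcomp_map.
Qed.

Lemma psmooth_comp B (h h' : 'M[A]_3) : h *m h' = 1%:M -> h' *m h = 1%:M ->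
  psmooth B -> psmooth (tcomp B h).
Proof.
move=> hh' h'h sm; have := @smooth3_comp _ _ (map_mx (pchi A) h) (map_mx (pchi A) h') _ _ sm.
rewrite -!map_mxM hh' h'h !map_mx1 => /(_ erefl erefl).
by apply: smooth3_eq => i j k; rewrite -tcomp_map.
Qed.

Hypothesis Al : plocal A.
Variable i6 : A.
Hypothesis h6 : 6%:R * i6 = 1.

(** By polarization a change of coordinates is justified by one polynomial identity in x, y, z,
    within reach of [ring]. *)
Lemma hesse_basis_subst (c c' : nat -> nat -> A) a b d e f g l m n :
  pchi A (a * (f * n - g * m) - b * (e * n - g * l) + d * (e * m - f * l)) != 0 ->
  (forall x y z, cubic_ev c (a * x + b * y + d * z) (e * x + f * y + g * z) (l * x + m * y + n * z)
     = cubic_ev c' x y z) ->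
  (psmooth (cubic_tensor c) -> psmooth (cubic_tensor c')) /\
  (hesse_basis (cubic_tensor c') -> hesse_basis (cubic_tensor c)).
Proof.
rewrite -det_mx3 => /(mx_inverse Al)[h' [hh' h'h]] E.
have E' i j k : cubic_tensor c' i j k = tcomp (cubic_tensor c) (mx3 a b d e f g l m n) i j k.
  apply: tri_ext => u v t; apply: (polarize h6); try exact: cubic_tensor_sym.
    by apply: tsym_comp; exact: cubic_tensor_sym.
  by move=> {}v; rewrite tri_comp !tri_cubic mx3_mul !mxE E.
split=> [sm|H].
  by apply: smooth3_eq (psmooth_comp hh' h'h sm) => i j k; rewrite E'.
by apply: (hesse_basis_comp hh' h'h); apply: hesse_basis_eq H => i j k; rewrite E'.
Qed.

End HesseBasis.

Lemma pext_id (A : pring) : pext (idfun : {rmorphism A -> A}).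
Proof.
split; first by exists idfun.
split=> [r s s0 E|T f]; first by exists s.
exists T, f, idfun; split=> // x s r s0 E; exists s, r; split => //.
Qed.

Lemma pext_root_local (A : pring) (p : {poly A}) : p \is monic -> (1 < size p)%N ->
  exists (D : pring) (i : {rmorphism A -> D}), [/\ plocal D, pext i & exists r, root (map_poly i p) r].
Proof.
move=> pm p1; have [B [i [iB [r rt]]]] := pext_root pm p1.
have [D [j [Dl jD]]] := pext_local B; exists D, (j \o i); split=> //.
  exact: pext_comp jD.
by exists (j r); rewrite map_poly_comp rmorph_root.
Qed.

Lemma pext_chi (A D : pring) (i : {rmorphism A -> D}) x : pext i ->
  pchi A x != 0 -> pchi D (i x) != 0.
Proof. by move=> [[j E] _] x0; rewrite E fmorph_eq0. Qed.

(** The arguments belong in order to x^3, y^3, z^3, x^2 y, x^2 z, x y^2, y^2 z, x z^2, y z^2 and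
    xyz. *)
Definition coefs (S : comPzRingType) (c00 c30 c03 c10 c01 c20 c21 c02 c12 c11 : S)
    (i j : nat) : S :=
  match i, j with
  | 0%N, 0%N => c00 | 1%N, 0%N => c10 | 0%N, 1%N => c01
  | 2, 0%N => c20 | 1%N, 1%N => c11 | 0%N, 2 => c02
  | 3, 0%N => c30 | 2, 1%N => c21 | 1%N, 2 => c12
  | 0%N, 3 => c03 | _, _ => 0 end.

Lemma coefs_map (S T : comPzRingType) (f : {rmorphism S -> T}) a1 a2 a3 a4 a5 a6 a7 a8 a9 a0 i j :
  f (coefs a1 a2 a3 a4 a5 a6 a7 a8 a9 a0 i j) =
  coefs (f a1) (f a2) (f a3) (f a4) (f a5) (f a6) (f a7) (f a8) (f a9) (f a0) i j.
Proof. by move: i j => [|[|[|[|i]]]] [|[|[|[|j]]]] //=; rewrite rmorph0. Qed.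

Lemma coefs_cof (S : comPzRingType) (B : 'I_3 -> 'I_3 -> 'I_3 -> S) : tsym B ->
  forall i j k, B i j k = cubic_tensor (coefs (B 0 0 0) (B 1 1 1) (B 2%:R 2%:R 2%:R)
   (B 0 0 1) (B 0 0 2%:R) (B 0 1 1) (B 1 1 2%:R) (B 0 2%:R 2%:R) (B 1 2%:R 2%:R) (B 0 1 2%:R)) i j k.
Proof.
move=> sB i j k; rewrite -(cubic_coefK sB).
by move: i j k; elim/I3_ind; elim/I3_ind; elim/I3_ind.
Qed.

Lemma cubic_grad (S : comPzRingType) c (v x : 'cV[S]_3) :
  tri (cubic_tensor c) v v x =
  (c 0%N 0%N * v 0 0 ^+ 2 + c 2%N 0%N * v 1 0 ^+ 2 + c 0%N 2%N * v 2%:R 0 ^+ 2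
   + 2%:R * (c 1%N 0%N * v 0 0 * v 1 0 + c 0%N 1%N * v 0 0 * v 2%:R 0 + c 1%N 1%N * v 1 0 * v 2%:R 0)) * x 0 0
  + (c 1%N 0%N * v 0 0 ^+ 2 + c 3%N 0%N * v 1 0 ^+ 2 + c 1%N 2%N * v 2%:R 0 ^+ 2
   + 2%:R * (c 2%N 0%N * v 0 0 * v 1 0 + c 1%N 1%N * v 0 0 * v 2%:R 0 + c 2%N 1%N * v 1 0 * v 2%:R 0)) * x 1 0
  + (c 0%N 1%N * v 0 0 ^+ 2 + c 2%N 1%N * v 1 0 ^+ 2 + c 0%N 3%N * v 2%:R 0 ^+ 2
   + 2%:R * (c 1%N 1%N * v 0 0 * v 1 0 + c 0%N 2%N * v 0 0 * v 2%:R 0 + c 1%N 2%N * v 1 0 * v 2%:R 0)) * x 2%:R 0.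
Proof. by rewrite /tri !sum3 /cubic_tensor /=; ring. Qed.

(* A point over the residue field where the three partial derivatives vanish. *)
Lemma psmooth_contra (A : pring) c (k : fieldType) (chi : {rmorphism A -> k})
    (l : {rmorphism pk A -> k}) (x y z : k) : (forall a, chi a = l (pchi A a)) ->
  psmooth (cubic_tensor c) -> [|| x != 0, y != 0 | z != 0] ->
  let d i j := chi (c i j) in
  d 0%N 0%N * x ^+ 2 + d 2%N 0%N * y ^+ 2 + d 0%N 2%N * z ^+ 2
   + 2%:R * (d 1%N 0%N * x * y + d 0%N 1%N * x * z + d 1%N 1%N * y * z) = 0 ->
  d 1%N 0%N * x ^+ 2 + d 3%N 0%N * y ^+ 2 + d 1%N 2%N * z ^+ 2
   + 2%:R * (d 2%N 0%N * x * y + d 1%N 1%N * x * z + d 2%N 1%N * y * z) = 0 ->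
  d 0%N 1%N * x ^+ 2 + d 2%N 1%N * y ^+ 2 + d 0%N 3%N * z ^+ 2
   + 2%:R * (d 1%N 1%N * x * y + d 0%N 2%N * x * z + d 1%N 2%N * y * z) = 0 -> False.
Proof.
move=> chiE sm nz d E1 E2 E3; have [|t /eqP] := sm k l (vec3 x y z).
  apply: contraTneq nz => E; rewrite !negb_or !negbK.
  have := congr1 (fun v : 'cV[k]_3 => v 0 0) E; have := congr1 (fun v : 'cV[k]_3 => v 1 0) E.
  by have := congr1 (fun v : 'cV[k]_3 => v 2%:R 0) E; rewrite !mxE /= => -> -> ->; rewrite eqxx.
apply.
have E i j m : l (pchi A (cubic_tensor c i j m)) = cubic_tensor (fun a b => chi (c a b)) i j m.
  by rewrite -chiE cubic_tensor_map.
rewrite (eq_tri _ _ _ E) cubic_grad !mxE /=.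
by rewrite E1 E2 E3 !mul0r !addr0.
Qed.

Lemma hesse_basis_hesse (A : pring) (d e : A) : plocal A ->
  hesse_basis (cubic_tensor (coefs d d d 0 0 0 0 0 0 e)).
Proof.
move=> Al; exists A, idfun; split=> //; first exact: pext_id.
exists 1%:M, 1%:M, d, e; split; rewrite ?mul1mx//; move=> x y z.
rewrite /tcomp.
have Eb i : col i (1%:M : 'M[A]_3) = bas i by rewrite -mulmx_bas mul1mx.
rewrite !Eb tri_bas; move: x y z; by elim/I3_ind; elim/I3_ind; elim/I3_ind.
Qed.

(** x is rescaled by a cube root of a/d; smoothness at (1 : 0 : 0) makes [a] a unit. *)
Lemma hesse_basis_diag (A : pring) (i6 a d e : A) : plocal A -> 6%:R * i6 = 1 ->
  psmooth (cubic_tensor (coefs a d d 0 0 0 0 0 0 e)) -> pchi A d != 0 ->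
  hesse_basis (cubic_tensor (coefs a d d 0 0 0 0 0 0 e)).
Proof.
move=> Al h6 sm d0; have [d' dd] := Al _ d0.
have a0 : pchi A a != 0.
  apply/eqP => E; apply: (@psmooth_contra _ _ _ (pchi A) idfun 1 0 0 (fun=> erefl) sm); rewrite ?oner_neq0//= ?E ?rmorph0; by ring.
pose p : {poly A} := 'X^3 - (a * d')%:P.
have [||D [i [Dl iD [r /rootP rt]]]] := @pext_root_local A p; rewrite ?monicXnsubC ?size_XnsubC//.
have r3 : r ^+ 3 = i a * i d'.
  by apply/eqP; rewrite -subr_eq0 -rmorphM; apply/eqP; rewrite -[RHS]rt rmorphB /= map_polyXn map_polyC !hornerE.
apply: (hesse_basis_ext iD).
apply: (hesse_basis_eq (B' := cubic_tensor (coefs (i a) (i d) (i d) 0 0 0 0 0 0 (i e)))) => [x y z|].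
  by rewrite cubic_tensor_map /cubic_tensor coefs_map rmorph0.
have r0 : pchi D r != 0.
  apply/eqP => E; have : pchi D (i a * i d') = 0 by rewrite -r3 rmorphXn E expr0n.
  rewrite -rmorphM; apply/eqP/pext_chi => //; rewrite rmorphM mulf_neq0//.
  by apply: (@invertible_map _ _ (pchi A)); exists d; rewrite mulrC.
have [r' rr] := Dl _ r0.
have iad : i a = i d * r ^+ 3 by rewrite r3 mulrCA -rmorphM mulrC -[d * _]mulrC dd rmorph1 mul1r.
have h6' : 6%:R * i i6 = 1 by rewrite -[RHS](rmorph1 i) -h6 rmorphM rmorph_nat.
have [||_ H] := @hesse_basis_subst D Dl (i i6) h6' (coefs (i a) (i d) (i d) 0 0 0 0 0 0 (i e))
   (coefs (i d) (i d) (i d) 0 0 0 0 0 0 (i e * r')) r' 0 0 0 1 0 0 0 1.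
- rewrite !(mul0r, mulr0, subr0, addr0) !mulr1; apply: (@invertible_map _ _ (pchi D)).
  by exists r; rewrite mulrC.
- move=> x y z; rewrite /cubic_ev /= iad.
  have E : r ^+ 3 * r' ^+ 3 = 1 by rewrite -exprMn mulrC rr expr1n.
  transitivity (i d * (r ^+ 3 * r' ^+ 3) * x ^+ 3 + i d * y ^+ 3 + i d * z ^+ 3 + 6%:R * (i e * r' * x * y * z)).
    by ring.
  by rewrite E; ring.
- by apply: H; exact: hesse_basis_hesse.
Qed.

Lemma monic_XnD (R : comNzRingType) n (q : {poly R}) : (size q <= n)%N ->
  'X^n + q \is monic /\ size ('X^n + q) = n.+1.
Proof.
move=> sq; have E : (size q < size ('X^n : {poly R}))%N by rewrite size_polyXn ltnS.
by rewrite monicE lead_coefDl// lead_coefXn eqxx size_polyDl// size_polyXn.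
Qed.

(** * From a flex to a Weierstrass equation and to the Hesse form *)

Section WeierstrassChain.
Variables (A : pring) (w i6 : A).
Hypotheses (Al : plocal A) (w1 : cube_root w) (h6 : 6%:R * i6 = 1).

Lemma pchi_nat n : n \in [:: 2; 3; 4; 6; 24] -> pchi A n%:R != 0.
Proof.
have k6 : pchi A 6%:R != 0.
  by apply: (@invertible_map _ _ (pchi A)); exists i6; rewrite mulrC.
have k2 : pchi A 2%:R != 0 by apply: contraNneq k6 => E; rewrite (natrM _ 2 3) rmorphM E mul0r.
have k3 : pchi A 3%:R != 0 by apply: contraNneq k6 => E; rewrite (natrM _ 2 3) rmorphM E mulr0.
rewrite !inE; do 4?case/orP; move/eqP=> -> //.
  by rewrite (natrM _ 2 2) rmorphM mulf_neq0.
by rewrite (natrM _ 4 6) (natrM _ 2 2) !rmorphM !mulf_neq0.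
Qed.

(* Nine inflection points of y^2 z = x^3 + ..., written with a point of order
   three: F = 3 nu ((y-tz)^3 + 3t (y-tz)^2 z + g (y-tz) z^2 + s^2 z^3 - x^2 z),
   whose line through the point (t, s) of slope g / 2s is an inflection tangent
   when g^2 = 12 t s^2. *)
Lemma hesse_basis_torsion (nu t s g : A) : pchi A nu != 0 -> pchi A s != 0 ->
  g ^+ 2 = 12%:R * t * s ^+ 2 ->
  let c := coefs 0 (3%:R * nu) (3%:R * nu * (s ^+ 2 + 2%:R * t ^+ 3 - g * t)) 0 (- nu) 0 0 0
     (nu * (g - 3%:R * t ^+ 2)) 0 in
  psmooth (cubic_tensor c) -> hesse_basis (cubic_tensor c).
Proof.
move=> nu0 s0 Eg c sm.
(* With Y = y - tz and l = sz + (g/2s)Y the form is 3 nu (Y^3 - z(x - l)(x + l)), the three linear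
   factors being inflection tangents. The substitution below turns Y into 12 s^2 x and these
   tangents, up to constants, into the linear factors of a^3 + b^3 + c^3 - 3abc at a = -2gx, b = y,
   c = z. *)
pose d := 12%:R * nu * s ^+ 2.
pose c' := coefs (3%:R * nu * (1728%:R * s ^+ 6 - 32%:R * s ^+ 2 * g ^+ 3)) d d 0 0 0 0 0 0 (d * g).
have [||smc' H] := @hesse_basis_subst A Al i6 h6 c c'
   0 (s * (1 + 2%:R * (-1 - w))) (s * (1 + 2%:R * w))
   (12%:R * s ^+ 2 - 2%:R * g * t) t t (- (2%:R * g)) 1 1.
- rewrite [X in pchi A X](_ : _ = 24%:R * s ^+ 3 * (1 + 2%:R * w)); last by ring.
  rewrite rmorphM rmorphM rmorphXn !mulf_neq0 ?expf_neq0//; first exact: pchi_nat.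
  apply: (@invertible_map _ _ (pchi A)); exists (- (2%:R * i6 * (1 + 2%:R * w))).
  rewrite -[RHS]h6.
  transitivity (- (2%:R * i6) * (1 + 4%:R * w + 4%:R * (w * w))); first by ring.
  by rewrite cube_root_sq//; ring.
- move=> x y z; rewrite /cubic_ev /= /d.
  ring: (cube_root_sq w1) Eg.
apply: H; apply: (@hesse_basis_diag A i6) => //; first exact: smc'.
by rewrite /d rmorphM rmorphM rmorphXn !mulf_neq0 ?expf_neq0// (natrM _ 4 3) rmorphM mulf_neq0// pchi_nat.
Qed.

End WeierstrassChain.

(** [t] is a root of the 3-division polynomial 3t^4 + 6at^2 + 12bt - a^2, made monic, and [s] a
    square root of t^3 + at + b. The point (t, s) has order three, and g = a + 3t^2 satisfies g^2 =
    12 t s^2. *)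
Lemma hesse_basis_weierstrass (A : pring) (w i6 nu a b : A) : plocal A -> cube_root w ->
  6%:R * i6 = 1 -> pchi A nu != 0 ->
  let c := coefs 0 (3%:R * nu) (3%:R * nu * b) 0 (- nu) 0 0 0 (nu * a) 0 in
  psmooth (cubic_tensor c) -> hesse_basis (cubic_tensor c).
Proof.
move=> Al w1 h6 nu0 c sm.
pose q : {poly A} := Poly [:: - (2%:R * i6 * a ^+ 2); 4%:R * b; 2%:R * a].
have [|pm sp] := @monic_XnD A 4 q; first exact: leq_trans (size_Poly _) _.
have [|D [i [Dl iD [t /rootP tr]]]] := pext_root_local pm; first by rewrite sp.
have Et : i a ^+ 2 = 3%:R * t ^+ 4 + 6%:R * i a * t ^+ 2 + 12%:R * i b * t.
  move: tr; rewrite /q /= !cons_poly_def !(rmorphD, rmorphM, rmorph0) /= !map_polyX !map_polyC ?map_polyXn /=.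
  rewrite !hornerE /= => E.
  have h6' : 6%:R * i i6 = 1 by rewrite -[RHS](rmorph1 i) -h6 rmorphM rmorph_nat.
  have E3 : 3%:R * t ^+ 4 + 6%:R * i a * t ^+ 2 + 12%:R * i b * t - (6%:R * i i6) * i a ^+ 2 = 0.
    have := congr1 ( *%R 3%:R) E; rewrite mulr0 => <-; rewrite ?rmorphN ?rmorphM ?rmorphXn ?rmorph_nat; ring.
  by move: E3; rewrite h6' mul1r => /eqP; rewrite subr_eq0 => /eqP <-; ring.
pose q2 : {poly D} := (- (t ^+ 3 + i a * t + i b))%:P.
have [|pm2 sp2] := @monic_XnD D 2 q2; first exact: leq_trans (size_polyC_leq1 _) _.
have [|D2 [j [D2l jD [s /rootP sr]]]] := pext_root_local pm2; first by rewrite sp2.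
pose l : {rmorphism A -> D2} := j \o i; have lD : pext l := pext_comp iD jD.
have Es : s ^+ 2 = j t ^+ 3 + l a * j t + l b.
  move: sr; rewrite rmorphD /= map_polyXn map_polyC hornerD hornerXn hornerC => E.
  have : s ^+ 2 + j (- (t ^+ 3 + i a * t + i b)) = 0 := E.
  rewrite rmorphN !rmorphD rmorphXn rmorphM.
  by move/eqP; rewrite subr_eq0 => /eqP.
have El : l a ^+ 2 = 3%:R * j t ^+ 4 + 6%:R * l a * j t ^+ 2 + 12%:R * l b * j t.
  rewrite /l -[RHS]/(_ + _ * j (i a) * _ + _ * j (i b) * _) /= -rmorphXn Et.
  by rewrite !rmorphD; congr (_ + _ + _); rewrite rmorphM ?[j (_ * _)]rmorphM rmorph_nat ?rmorphXn.
apply: (hesse_basis_ext lD).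
pose T := j t; pose g := l a + 3%:R * T ^+ 2.
pose c' := coefs 0 (3%:R * l nu) (3%:R * l nu * (s ^+ 2 + 2%:R * T ^+ 3 - g * T)) 0 (- l nu) 0 0 0
     (l nu * (g - 3%:R * T ^+ 2)) 0.
have Ec x y z : l (cubic_tensor c x y z) = cubic_tensor c' x y z.
  rewrite /cubic_tensor coefs_map rmorph0 rmorphN !rmorphM rmorph_nat /c'.
  congr (coefs _ _ _ _ _ _ _ _ _ _ _ _); rewrite /g.
    by rewrite Es -/T; ring.
  by ring.
have sm' : psmooth (cubic_tensor c') by apply: smooth3_eq (psmooth_ext lD sm) => x y z; rewrite Ec.
have Eg : g ^+ 2 = 12%:R * T * s ^+ 2.
  rewrite /g Es -/T; transitivity (l a ^+ 2 + 6%:R * l a * T ^+ 2 + 9%:R * T ^+ 4); first by ring.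
  by rewrite El -/T; ring.
apply: (hesse_basis_eq Ec).
apply: (@hesse_basis_torsion D2 (l w) (l i6)) => //.
- exact: cube_root_map.
- by rewrite -[RHS](rmorph1 l) -h6 rmorphM rmorph_nat.
- exact: pext_chi lD nu0.
(* If [s] vanished at the closed point, so would [g], and (0 : t : 1) would be singular there. *)
apply/eqP => s0.
have g0 : pchi D2 g = 0.
  have : pchi D2 g ^+ 2 == 0 by rewrite -rmorphXn Eg rmorphM rmorphXn s0 expr0n mulr0.
  by rewrite expf_eq0 => /eqP.
clearbody g; apply: (@psmooth_contra _ _ _ (pchi D2) idfun 0 (pchi D2 T) 1 (fun=> erefl) sm'); rewrite ?oner_neq0 ?orbT//=.
- by rewrite rmorph0; ring.
- by rewrite !(rmorphXn, rmorphD, rmorphN, rmorph0, rmorph_nat, rmorphM) g0; ring.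
- by rewrite !(rmorphXn, rmorphD, rmorphN, rmorph0, rmorph_nat, rmorphM) g0 s0; ring.
Qed.

(** The flex is (1 : 0 : 0) with tangent z = 0. The square is completed in x, the cube in y, and z
    is rescaled. The coefficient [n] of y^3 is a unit: otherwise the line z = 0 would be a component
    of the residue cubic, singular where it meets the residual conic. *)
Lemma hesse_basis_flex0 (A : pring) (w i6 m n c03 c21 c02 c12 c11 : A) : plocal A ->
  cube_root w -> 6%:R * i6 = 1 -> pchi A m != 0 ->
  let c := coefs 0 n c03 0 m 0 c21 c02 c12 c11 in
  psmooth (cubic_tensor c) -> hesse_basis (cubic_tensor c).
Proof.
move=> Al w1 h6 m0 c sm; have [m' mm] := Al _ m0.
have k2 : pchi A 2%:R != 0 by exact: pchi_nat h6 _ _.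
(* Substituting 2z for z avoids halves when the square is completed. *)
pose d := - (c11 * m'); pose e := - (c02 * m').
pose m2 := 2%:R * m.
have m20 : pchi A m2 != 0 by rewrite rmorphM mulf_neq0.
pose a21 := 2%:R * c11 * d + 2%:R * c21.
pose a12 := 4%:R * c02 * d + 4%:R * c12.
pose a03 := 6%:R * c02 * e + 8%:R * c03.
pose c1 := coefs 0 n a03 0 m2 0 a21 0 a12 0.
have [||sm1 H1] := @hesse_basis_subst A Al i6 h6 c c1 1 d e 0 1 0 0 0 2%:R.
- by rewrite [X in pchi A X](_ : _ = 2%:R)//; ring.
- by move=> x y z; rewrite /cubic_ev /= /c1 /a21 /a12 /a03 /m2 /d /e; ring: mm.
apply: H1; move/sm1: sm => {sm1} sm.
have n0 : pchi A n != 0.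
  apply/eqP => E.
  pose q : {poly pk A} := (pchi A a21 / pchi A m2)%:P.
  have [|pm sp] := @monic_XnD (pk A) 2 q; first exact: leq_trans (size_polyC_leq1 _) _.
  have [|k' [j [r /rootP rt]]] := @field_root (pk A) ('X^2 + q); first by rewrite sp.
  apply: (@psmooth_contra _ _ _ (j \o pchi A) j r 1 0 (fun=> erefl) sm); rewrite ?oner_neq0 ?orbT//= ?rmorph0.
  - by ring.
  - by rewrite E rmorph0; ring.
  - move: rt; rewrite rmorphD /= map_polyXn map_polyC hornerD hornerXn hornerC => E0.
    have : r ^+ 2 + j (pchi A a21 / pchi A m2) = 0 := E0.
    rewrite rmorphM fmorphV => {E0} rt.
    have jm : j (pchi A m2) != 0 by rewrite fmorph_eq0.
    transitivity (j (pchi A m2) * (r ^+ 2 + j (pchi A a21) / j (pchi A m2))).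
      by rewrite [RHS]mulrDr [_ * (_ / _)]mulrCA divff//; ring.
    by rewrite rt mulr0.
have [n' nn] := Al _ n0.
pose dl := - (a21 * n').
pose b12 := n * dl ^+ 2 + 2%:R * a21 * dl + a12.
pose b03 := n * dl ^+ 3 + 3%:R * a21 * dl ^+ 2 + 3%:R * a12 * dl + a03.
pose c2 := coefs 0 n b03 0 m2 0 0 0 b12 0.
have [||sm2 H2] := @hesse_basis_subst A Al i6 h6 c1 c2 1 0 0 0 1 dl 0 0 1.
- by rewrite [X in pchi A X](_ : _ = 1) ?rmorph1 ?oner_neq0//; ring.
- by move=> x y z; rewrite /cubic_ev /= /b12 /b03 /dl; ring: nn.
apply: H2; move/sm2: sm => {sm2} sm.
pose nu := 2%:R * i6 * n.
have En : 3%:R * nu = n.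
  by transitivity ((6%:R * i6) * n); [rewrite /nu; ring | rewrite h6 mul1r].
have nu0 : pchi A nu != 0.
  by apply: contraNneq n0 => E; rewrite -En rmorphM E mulr0.
have [nu' nunu] := Al _ nu0; have [m2' mm2] := Al _ m20.
pose rh := - (nu * m2').
have rh0 : pchi A rh != 0.
  rewrite rmorphN oppr_eq0 rmorphM mulf_neq0//.
  by apply: (@invertible_map _ _ (pchi A)); exists m2; rewrite mulrC.
have [||sm3 H3] := @hesse_basis_subst A Al i6 h6 c2 (coefs 0 (3%:R * nu)
    (3%:R * nu * (2%:R * i6 * nu' * b03 * rh ^+ 3)) 0 (- nu) 0 0 0 (nu * (nu' * b12 * rh ^+ 2)) 0) 1 0 0 0 1 0 0 0 rh.
- by rewrite [X in pchi A X](_ : _ = rh)//; ring.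
- move=> x y z; rewrite /cubic_ev /= En.
  have E1 : m2 * rh = - nu by rewrite /rh mulrN mulrCA [m2 * _]mulrC mm2 mulr1.
  have E2 : n * (2%:R * i6 * nu' * b03 * rh ^+ 3) = b03 * rh ^+ 3.
    rewrite -En; transitivity ((6%:R * i6) * (nu' * nu) * (b03 * rh ^+ 3)); first by ring.
    by rewrite h6 nunu !mul1r.
  have E3 : nu * (nu' * b12 * rh ^+ 2) = b12 * rh ^+ 2 by rewrite !mulrA [nu * _]mulrC nunu mul1r.
  by rewrite E2 E3 -E1; ring.
apply: H3; apply: (@hesse_basis_weierstrass A w i6) => //; exact: sm3.
Qed.

Lemma basis_complete (A : pring) (p : 'cV[A]_3) : plocal A -> (exists i, pchi A (p i 0) != 0) ->
  exists h h' : 'M[A]_3, [/\ h *m h' = 1%:M, h' *m h = 1%:M & h *m bas 0 = p].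
Proof.
move=> Al [j]; rewrite (vec3E p); move: (p 0 0) (p 1 0) (p 2%:R 0) => a b c.
have key x y z l m n q r : pchi A (\det (mx3 a x y b z l c m n)) != 0 ->
    q = a -> r = b -> exists h h' : 'M[A]_3, [/\ h *m h' = 1%:M, h' *m h = 1%:M & h *m bas 0 = vec3 q r c].
  move=> /(mx_inverse Al)[h' [hh' h'h]] -> ->; exists (mx3 a x y b z l c m n), h'; split=> //.
  by rewrite mulmx_bas; apply/matrixP => s t; rewrite !mxE.
rewrite mxE; elim/I3_ind: j => /= p0.
- by apply: (@key 0 0 1 0 0 1 a b) => //; rewrite det_mx3 [X in pchi A X](_ : _ = a)//; ring.
- by apply: (@key 1 0 0 0 0 1 a b) => //; rewrite det_mx3 [X in pchi A X](_ : _ = - b) ?rmorphN ?oppr_eq0//; ring.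
- by apply: (@key 1 0 0 1 0 0 a b) => //; rewrite det_mx3 [X in pchi A X](_ : _ = c)//; ring.
Qed.

Lemma tsym_map (S T : comPzRingType) (f : {rmorphism S -> T}) B :
  tsym B -> tsym (fun i j k => f (B i j k)).
Proof. by case=> s1 s2; split=> i j k; congr (f _). Qed.

Lemma tri_bas2 (S : comPzRingType) (B : 'I_3 -> 'I_3 -> 'I_3 -> S) i j c :
  tri B (bas i) (bas j) c = \sum_k B i j k * c k 0.
Proof.
rewrite /tri (bigD1 i)//= [X in _ + X]big1 ?addr0 => [|i' ne]; last first.
  by rewrite big1// => j' _; rewrite big1// => k _; rewrite !mxE (negPf ne) !mul0r mulr0.
rewrite (bigD1 j)//= [X in _ + X]big1 ?addr0 => [|j' ne]; last first.
  by rewrite big1// => k _; rewrite !mxE (negPf ne) mulr0 mul0r mulr0.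
by apply: eq_bigr => k _; rewrite !mxE !eqxx !mul1r.
Qed.

(* The tangent line at the point [bas 0] becomes z = 0. *)
Lemma tangent_basis (A : pring) (B : 'I_3 -> 'I_3 -> 'I_3 -> A) : plocal A -> tsym B ->
  psmooth B -> pchi A (B 0 0 0) = 0 -> exists h h' : 'M[A]_3,
  [/\ h *m h' = 1%:M, h' *m h = 1%:M, tcomp B h 0 0 0 = B 0 0 0, tcomp B h 0 0 1 = 0
    & pchi A (tcomp B h 0 0 2%:R) != 0 /\ h *m bas 0 = bas 0].
Proof.
move=> Al sB sm B0.
have [|c] := sm (pk A) idfun (bas 0).
  by apply/eqP => /matrixP/(_ 0 0); rewrite !mxE eqxx => /eqP; rewrite oner_eq0.
rewrite (eq_tri (B' := fun i j k => pchi A (B i j k)))// tri_bas2 sum3 B0 mul0r add0r => nz.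
have key (x y : A) (M : 'M[A]_3) : pchi A (\det M) != 0 -> col 0 M = bas 0 ->
    tri B (bas 0) (bas 0) (col 1 M) = 0 -> pchi A (tri B (bas 0) (bas 0) (col 2%:R M)) != 0 ->
    exists h h' : 'M[A]_3,
  [/\ h *m h' = 1%:M, h' *m h = 1%:M, tcomp B h 0 0 0 = B 0 0 0, tcomp B h 0 0 1 = 0
    & pchi A (tcomp B h 0 0 2%:R) != 0 /\ h *m bas 0 = bas 0].
  move=> /(mx_inverse Al)[h' [hh' h'h]] E0 E1 E2; exists M, h'.
  by split; rewrite // /tcomp !E0 ?tri_bas ?mulmx_bas.
have [B1|B1] := eqVneq (pchi A (B 0 0 1)) 0.
  have B2 : pchi A (B 0 0 2%:R) != 0.
    by apply: contraNneq nz => E; rewrite B1 E !mul0r addr0.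
  have [b bb] := Al _ B2.
  apply: (key 0 0 (mx3 1 0 0 0 1 0 0 (- (B 0 0 1 * b)) 1)).
  - by rewrite det_mx3 [X in pchi A X](_ : _ = 1) ?rmorph1 ?oner_neq0//; ring.
  - by apply/matrixP => i j; rewrite !mxE; elim/I3_ind: i.
  - by rewrite tri_bas2 sum3 !mxE /=; ring: bb.
  - by rewrite tri_bas2 sum3 !mxE /= !mulr0 !add0r mulr1.
have [b bb] := Al _ B1.
apply: (key 0 0 (mx3 1 0 0 0 (- (B 0 0 2%:R * b)) 1 0 1 0)).
- by rewrite det_mx3 [X in pchi A X](_ : _ = -1) ?rmorphN ?oppr_eq0 ?rmorph1 ?oner_neq0//; ring.
- by apply/matrixP => i j; rewrite !mxE; elim/I3_ind: i.
- by rewrite tri_bas2 sum3 !mxE /=; ring: bb.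
- by rewrite tri_bas2 sum3 !mxE /= !mulr0 add0r mulr1 addr0.
Qed.

Lemma hess_bas0 (S : comPzRingType) (B : 'I_3 -> 'I_3 -> 'I_3 -> S) : tsym B ->
  B 0 0 1 = 0 -> hess B (bas 0) = B 0 0 0 * (B 0 1 1 * B 0 2%:R 2%:R - B 0 1 2%:R ^+ 2)
     - B 0 0 2%:R ^+ 2 * B 0 1 1.
Proof.
move=> [s1 s2] E1; rewrite /hess det33 !mxE !tri_bas.
by rewrite (s2 0 1 0) (s2 0 2%:R 0) (s2 0 2%:R 1) !E1; ring.
Qed.

Section Flex.
Variables (A : pring) (w i6 : A).
Hypotheses (Al : plocal A) (w1 : cube_root w) (h6 : 6%:R * i6 = 1).
Implicit Types (B : 'I_3 -> 'I_3 -> 'I_3 -> A).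

(** Once the flex is (1 : 0 : 0) and its tangent is z = 0, the Hessian there is minus the product of
    a unit square and [B 0 1 1], so its vanishing removes the term in x y^2. *)
Lemma hesse_basis_flex B (p : 'cV[A]_3) : tsym B -> psmooth B -> (exists i, pchi A (p i 0) != 0) ->
  tri B p p p = 0 -> hess B p = 0 -> hesse_basis B.
Proof.
move=> sB sm p0 Bp Hp; have [h [h' [hh' h'h hp]]] := basis_complete Al p0.
apply: (hesse_basis_comp hh' h'h).
have {sm} sm : psmooth (tcomp B h) := psmooth_comp hh' h'h sm.
have {Bp} Bp : tcomp B h 0 0 0 = 0 by rewrite /tcomp -!mulmx_bas hp.
have {Hp} Hp : hess (tcomp B h) (bas 0) = 0 by rewrite hess_comp hp Hp mulr0.
have {sB} sB : tsym (tcomp B h) := tsym_comp _ sB.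
move: (tcomp B h) sm Bp Hp sB => {p p0 h h' hh' h'h hp} {}B sm Bp Hp sB.
have [|h [h' [hh' h'h E0 E1 [E2 hp]]]] := tangent_basis Al sB sm; first by rewrite Bp rmorph0.
apply: (hesse_basis_comp hh' h'h).
have {sm} sm : psmooth (tcomp B h) := psmooth_comp hh' h'h sm.
have {Hp} Hp : hess (tcomp B h) (bas 0) = 0 by rewrite hess_comp hp Hp mulr0.
have {sB} sB : tsym (tcomp B h) := tsym_comp _ sB.
move: E0; rewrite Bp => {}Bp.
move: (tcomp B h) sm Bp Hp sB E1 E2 => {h h' hh' h'h hp} {}B sm Bp Hp sB E1 E2.
have B011 : B 0 1 1 = 0.
  move: Hp; rewrite hess_bas0// Bp mul0r sub0r => /eqP; rewrite oppr_eq0 => /eqP E.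
  by apply: (plocal_unit0 Al _ E); rewrite rmorphXn expf_neq0.
have Ec := coefs_cof sB; rewrite Bp E1 B011 in Ec.
apply: (hesse_basis_eq Ec); apply: (@hesse_basis_flex0 A w i6) => //.
by apply: smooth3_eq sm => i j k; rewrite Ec.
Qed.

End Flex.

(** * The polynomial of the nine flexes seen from a point *)

Section HessianTensor.
Variable S : comPzRingType.
Implicit Types (B : 'I_3 -> 'I_3 -> 'I_3 -> S) (x y z : 'cV[S]_3).

Definition hess_mixed B i j k : S :=
  \det (\matrix_(r, s) B (if r == 0 then i else if r == 1 then j else k) r s).

(* The polar form of 6 times the Hessian. *)
Definition hess_tensor B i j k : S :=
  hess_mixed B i j k + hess_mixed B i k j + hess_mixed B j i k
  + hess_mixed B j k i + hess_mixed B k i j + hess_mixed B k j i.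

Lemma hess_tensor_sym B : tsym (hess_tensor B).
Proof. by split=> i j k; rewrite /hess_tensor; ring. Qed.

Lemma tri_hess_tensor B x : tri (hess_tensor B) x x x = 6%:R * hess B x.
Proof.
have E (i j : 'I_3) : tri B x (bas i) (bas j) = B 0 i j * x 0 0 + B 1 i j * x 1 0 + B 2%:R i j * x 2%:R 0.
  rewrite /tri; have -> : B 0 i j * x 0 0 + B 1 i j * x 1 0 + B 2%:R i j * x 2%:R 0 = \sum_k B k i j * x k 0.
    by rewrite sum3.
  apply: eq_bigr => k _; rewrite (bigD1 i)//= [X in _ + X]big1 ?addr0 => [|i' ne]; last first.
    by rewrite big1// => j' _; rewrite !mxE (negPf ne) mulr0 mul0r mulr0.
  rewrite (bigD1 j)//= [X in _ + X]big1 ?addr0 => [|j' ne]; first by rewrite !mxE !eqxx !mulr1.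
  by rewrite !mxE (negPf ne) !mulr0.
have Em i j k : hess_mixed B i j k = B i 0 0 * (B j 1 1 * B k 2%:R 2%:R - B j 1 2%:R * B k 2%:R 1)
    - B i 0 1 * (B j 1 0 * B k 2%:R 2%:R - B j 1 2%:R * B k 2%:R 0)
    + B i 0 2%:R * (B j 1 0 * B k 2%:R 1 - B j 1 1 * B k 2%:R 0).
  by rewrite /hess_mixed det33 !mxE.
transitivity (6%:R * tri (hess_mixed B) x x x).
  by rewrite /tri !sum3 /hess_tensor; ring.
congr (_ * _); transitivity (\sum_i \sum_j \sum_k (x i 0 * x j 0 * x k 0) * hess_mixed B i j k).
  by apply: eq_bigr => i _; apply: eq_bigr => j _; apply: eq_bigr => k _; rewrite mulrC.
rewrite !sum3 !Em /hess det33.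
have F r s : polar_mx B x r s = B 0 r s * x 0 0 + B 1 r s * x 1 0 + B 2%:R r s * x 2%:R 0 by rewrite mxE E.
by rewrite !F; ring.
Qed.

End HessianTensor.

Section LeadingTerm.
Variable S : comNzRingType.
Implicit Types (p q : {poly S}) (s t : S).

(** Only a bound for the degree is recorded, so that top coefficients add and multiply even when
    they vanish. *)
Definition dtop d p t := (size p <= d.+1)%N /\ p`_d = t.

Lemma dtopD d p q s t : dtop d p s -> dtop d q t -> dtop d (p + q) (s + t).
Proof.
move=> [hp <-] [hq <-]; split; last by rewrite coefD.
by rewrite (leq_trans (size_polyD _ _))// geq_max hp.
Qed.

Lemma dtopN d p t : dtop d p t -> dtop d (- p) (- t).
Proof. by move=> [hp <-]; split; rewrite ?coefN// size_polyN. Qed.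

Lemma dtopM d e p q s t : dtop d p s -> dtop e q t -> dtop (d + e) (p * q) (s * t).
Proof.
move=> [hp <-] [hq <-]; split.
  rewrite (leq_trans (size_polyMleq _ _))// -subn1 leq_subLR add1n.
  by rewrite (leq_trans (leq_add hp hq))// addSn addnS.
have hd : (d < (d + e).+1)%N by rewrite ltnS leq_addr.
rewrite coefM (bigD1 (Ordinal hd))//= addKn big1 ?addr0// => j /negPf ne.
have [jd|jd] := ltnP j d; last first.
  have dj : (d < j)%N by rewrite ltn_neqAle jd eq_sym -[d]/(val (Ordinal hd)) (inj_eq val_inj) ne.
  by rewrite [p`_j]nth_default ?mul0r// (leq_trans hp).
by rewrite [q`_(_)]nth_default ?mulr0// (leq_trans hq)// -(addnBAC _ (ltnW jd)) -[X in (X < _)%N]add0n ltn_add2r subn_gt0.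
Qed.

Lemma dtopC t : dtop 0 t%:P t.
Proof. by split; rewrite ?coefC// size_polyC leq_b1. Qed.

Lemma dtop_nat d n p t : dtop d p t -> dtop d (n%:R * p) (n%:R * t).
Proof. by move=> h; have := dtopM (dtopC n%:R) h; rewrite polyC_natr. Qed.

Lemma dtop_sum (I : finType) d (p : I -> {poly S}) (t : I -> S) :
  (forall i, dtop d (p i) (t i)) -> dtop d (\sum_i p i) (\sum_i t i).
Proof.
move=> h; apply: (big_ind2 (dtop d)) => [||i _]; last exact: h.
  by split; rewrite ?coef0// size_poly0.
by move=> p1 t1 p2 t2; exact: dtopD.
Qed.

Lemma dtop_line s t : dtop 1 (s%:P + 'X * t%:P) t.
Proof.
split; last by rewrite coefD coefC coefXM coefC add0r.
rewrite (leq_trans (size_polyD _ _))// geq_max (leq_trans (size_polyC_leq1 _))//=.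
by rewrite (leq_trans (size_polyMleq _ _))// size_polyX addSn add1n /= ltnS size_polyC leq_b1.
Qed.

Lemma dtop_tri d1 d2 d3 (B : 'I_3 -> 'I_3 -> 'I_3 -> S) (x y z : 'cV[{poly S}]_3) (a b c : 'cV[S]_3) :
  (forall i, dtop d1 (x i 0) (a i 0)) -> (forall i, dtop d2 (y i 0) (b i 0)) ->
  (forall i, dtop d3 (z i 0) (c i 0)) ->
  dtop (d1 + d2 + d3) (tri (fun i j k => (B i j k)%:P) x y z) (tri B a b c).
Proof.
move=> h1 h2 h3; do 3!(apply: dtop_sum => ?).
by have := dtopM (dtopC (B _ _ _)) (dtopM (dtopM (h1 _) (h2 _)) (h3 _)); apply.
Qed.

Lemma dtop_monic d p n m : dtop d p n -> m * n = 1 ->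
  m *: p \is monic /\ size (m *: p) = d.+1.
Proof.
move=> [hp E] mn; have Ed : (m *: p)`_d = 1 by rewrite coefZ E.
have sz : size (m *: p) = d.+1.
  apply/eqP; rewrite eqn_leq (leq_trans (size_scale_leq _ _))//= ltnNge.
  by apply/negP => h; move: Ed; rewrite nth_default// => /eqP; rewrite eq_sym oner_eq0.
by split=> //; rewrite monicE lead_coefE sz /= Ed.
Qed.

End LeadingTerm.

Section NormForm.
Variable S : comPzRingType.

(* The norm of h3 t^3 + h2 t^2 + h1 t + h0 from S[t]/(t^3 - e1 t^2 + e2 t - e3). *)
Definition nform (e1 e2 e3 h0 h1 h2 h3 : S) : S :=
  let q2 := h2 + h3 * e1 in let q1 := h1 - h3 * e2 in let q0 := h0 + h3 * e3 in
  q0 * q0 * q0 + q0 * q0 * q1 * e1 + q0 * q0 * q2 * (e1 * e1 - 2%:R * e2)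
  + q0 * q1 * q1 * e2 + q0 * q1 * q2 * (e1 * e2 - 3%:R * e3)
  + q0 * q2 * q2 * (e2 * e2 - 2%:R * (e1 * e3)) + q1 * q1 * q1 * e3
  + q1 * q1 * q2 * (e1 * e3) + q1 * q2 * q2 * (e2 * e3) + q2 * q2 * q2 * (e3 * e3).

Lemma nformE t1 t2 t3 h0 h1 h2 h3 : let q t := h3 * t ^+ 3 + h2 * t ^+ 2 + h1 * t + h0 in
  nform (t1 + t2 + t3) (t1 * t2 + t1 * t3 + t2 * t3) (t1 * t2 * t3) h0 h1 h2 h3 = q t1 * q t2 * q t3.
Proof. by rewrite /nform /=; ring. Qed.

Variables (g : S) (B : 'I_3 -> 'I_3 -> 'I_3 -> S).
Implicit Types x v : 'cV[S]_3.

(** If [g] inverts B(v, v, v), the first three arguments are the elementary symmetric functions of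
    the roots of t |-> B on x + tv, and the value is the product of 6 [hess B] over the three points
    of the cubic on this line. Over a field it vanishes when the line contains a flex. *)
Definition pencil_norm x v : S :=
  let H := tri (hess_tensor B) in
  nform (- (3%:R * (g * tri B x v v))) (3%:R * (g * tri B x x v)) (- (g * tri B x x x))
    (H x x x) (3%:R * H x x v) (3%:R * H x v v) (H v v v).

End NormForm.

Lemma tri_line (S : comPzRingType) (B : 'I_3 -> 'I_3 -> 'I_3 -> S) (x v : 'cV[S]_3) t : tsym B ->
  tri B (x + t *: v) (x + t *: v) (x + t *: v) =
  tri B v v v * t ^+ 3 + 3%:R * tri B x v v * t ^+ 2 + 3%:R * tri B x x v * t + tri B x x x.
Proof.
move=> sB; have E1 := triZ3 1 1 t x x v sB; have E2 := triZ3 1 t t x v v sB.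
by rewrite !scale1r in E1 E2; rewrite tri_cube_add// triZ3// E1 E2; ring.
Qed.

Lemma hess_tensor_map (S T : comPzRingType) (f : {rmorphism S -> T}) B i j k :
  f (hess_tensor B i j k) = hess_tensor (fun a b c => f (B a b c)) i j k.
Proof.
have E a b c : f (hess_mixed B a b c) = hess_mixed (fun a b c => f (B a b c)) a b c.
  by rewrite /hess_mixed -det_map_mx; congr (\det _); apply/matrixP => r s; rewrite !mxE.
by rewrite /hess_tensor !rmorphD !E.
Qed.

Lemma pencil_norm_map (S T : comPzRingType) (f : {rmorphism S -> T}) g B x v :
  f (pencil_norm g B x v) =
  pencil_norm (f g) (fun i j k => f (B i j k)) (map_mx f x) (map_mx f v).
Proof.
have nm e1 e2 e3 h0 h1 h2 h3 : f (nform e1 e2 e3 h0 h1 h2 h3) =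
    nform (f e1) (f e2) (f e3) (f h0) (f h1) (f h2) (f h3).
  by rewrite /nform !(rmorph_nat, rmorphN, rmorphD, rmorphM).
have Eh a b c : f (tri (hess_tensor B) a b c) =
    tri (hess_tensor (fun i j k => f (B i j k))) (map_mx f a) (map_mx f b) (map_mx f c).
  by rewrite tri_map; apply: eq_tri => i j k; rewrite hess_tensor_map.
by rewrite /pencil_norm nm !(rmorph_nat, rmorphN, rmorphM) !tri_map -!Eh !tri_map.
Qed.

Section NormPolynomial.
Variables (S : comNzRingType) (g : S) (B : 'I_3 -> 'I_3 -> 'I_3 -> S) (a b v : 'cV[S]_3).

Definition norm_poly : {poly S} :=
  pencil_norm g%:P (fun i j k => (B i j k)%:P) (map_mx polyC a + 'X *: map_mx polyC b) (map_mx polyC v).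

Lemma norm_polyE (T : comNzRingType) (f : {rmorphism S -> T}) u :
  (map_poly f norm_poly).[u] =
  pencil_norm (f g) (fun i j k => f (B i j k)) (map_mx f a + u *: map_mx f b) (map_mx f v).
Proof.
have [phi [pC pX pE]] : exists phi : {rmorphism {poly S} -> T},
    [/\ forall c, phi c%:P = f c, phi 'X = u & forall p, phi p = (map_poly f p).[u]].
  exists (horner_eval u \o map_poly f); split=> // [c|]; rewrite /= /horner_eval.
    by rewrite map_polyC hornerC.
  by rewrite map_polyX hornerX.
rewrite -pE pencil_norm_map pC.
have -> : map_mx phi (map_mx polyC a + 'X *: map_mx polyC b) = map_mx f a + u *: map_mx f b.
  by apply/matrixP => i j; rewrite !mxE rmorphD rmorphM pX !pC.
have -> : map_mx phi (map_mx polyC v) = map_mx f v.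
  by apply/matrixP => i j; rewrite !mxE pC.
have -> // : (fun i j k => phi (B i j k)%:P) = (fun i j k => f (B i j k)).
by apply/funext => i; apply/funext => j; apply/funext => k; rewrite pC.
Qed.

(** Every term of the norm is homogeneous of degree 9 in x, so along a + ub the top coefficient is
    the same expression at b. *)
Lemma norm_poly_top : dtop 9 norm_poly (pencil_norm g B b v).
Proof.
have hx i : dtop 1 ((map_mx polyC a + 'X *: map_mx polyC b) i 0) (b i 0).
  by rewrite !mxE; exact: dtop_line.
have hv i : dtop 0 (map_mx polyC v i 0) (v i 0) by rewrite mxE; exact: dtopC.
have EH : tri (fun i j k => (hess_tensor B i j k)%:P) =
    tri (hess_tensor (fun i j k => (B i j k)%:P : {poly S})).
  apply/funext => x; apply/funext => y; apply/funext => z; apply: eq_tri => i j k.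
  exact: (hess_tensor_map polyC).
have E1 := dtopN (dtop_nat 3 (dtopM (dtopC g) (dtop_tri B hx hv hv))).
have E2 := dtop_nat 3 (dtopM (dtopC g) (dtop_tri B hx hx hv)).
have E3 := dtopN (dtopM (dtopC g) (dtop_tri B hx hx hx)).
have H0 := dtop_tri (hess_tensor B) hx hx hx.
have H1 := dtop_nat 3 (dtop_tri (hess_tensor B) hx hx hv).
have H2 := dtop_nat 3 (dtop_tri (hess_tensor B) hx hv hv).
have H3 := dtop_tri (hess_tensor B) hv hv hv.
rewrite EH in H0 H1 H2 H3.
have Q2 := dtopD H2 (dtopM H3 E1).
have Q1 := dtopD H1 (dtopN (dtopM H3 E2)).
have Q0 := dtopD H0 (dtopM H3 E3).
rewrite /= in Q0 Q1 Q2 E1 E2 E3.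
have M := fun d e p q s t => @dtopM S d e p q s t.
have T1 := dtopM (dtopM Q0 Q0) Q0.
have T2 := dtopM (dtopM (dtopM Q0 Q0) Q1) E1.
have T3 := dtopM (dtopM (dtopM Q0 Q0) Q2) (dtopD (dtopM E1 E1) (dtopN (dtop_nat 2 E2))).
have T4 := dtopM (dtopM (dtopM Q0 Q1) Q1) E2.
have T5 := dtopM (dtopM (dtopM Q0 Q1) Q2) (dtopD (dtopM E1 E2) (dtopN (dtop_nat 3 E3))).
have T6 := dtopM (dtopM (dtopM Q0 Q2) Q2) (dtopD (dtopM E2 E2) (dtopN (dtop_nat 2 (dtopM E1 E3)))).
have T7 := dtopM (dtopM (dtopM Q1 Q1) Q1) E3.
have T8 := dtopM (dtopM (dtopM Q1 Q1) Q2) (dtopM E1 E3).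
have T9 := dtopM (dtopM (dtopM Q1 Q2) Q2) (dtopM E2 E3).
have T10 := dtopM (dtopM (dtopM Q2 Q2) Q2) (dtopM E3 E3).
exact: (dtopD (dtopD (dtopD (dtopD (dtopD (dtopD (dtopD (dtopD (dtopD T1 T2) T3) T4) T5) T6) T7) T8) T9) T10).
Qed.

End NormPolynomial.

Notation tmap f B := (fun i j k => f (B i j k)).

Lemma pencil_roots (A : pring) (B : 'I_3 -> 'I_3 -> 'I_3 -> A) (g : A) (x v : 'cV[A]_3) :
  plocal A -> tsym B -> g * tri B v v v = 1 ->
  exists (D : pring) (i : {rmorphism A -> D}) (t1 t2 t3 : D), [/\ plocal D, pext i,
    forall t, t \in [:: t1; t2; t3] ->
     tri (tmap i B) (map_mx i x + t *: map_mx i v) (map_mx i x + t *: map_mx i v) (map_mx i x + t *: map_mx i v) = 0,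
    [/\ i (- (3%:R * (g * tri B x v v))) = t1 + t2 + t3,
        i (3%:R * (g * tri B x x v)) = t1 * t2 + t1 * t3 + t2 * t3
      & i (- (g * tri B x x x)) = t1 * t2 * t3]
    & let h t := hess (tmap i B) (map_mx i x + t *: map_mx i v) in
      i (pencil_norm g B x v) = 216%:R * (h t1 * h t2 * h t3)].
Proof.
move=> Al sB gF.
set e1 := - (3%:R * (g * tri B x v v)); set e2 := 3%:R * (g * tri B x x v); set e3 := - (g * tri B x x x).
pose q : {poly A} := Poly [:: - e3; e2; - e1].
have [|pm sp] := @monic_XnD A 3 q; first exact: leq_trans (size_Poly _) _.
have [D [i [Dl iD [rs Er]]]] := pext_split pm.
have srs : size rs = 3.
  apply: succn_inj; rewrite -[RHS]sp -(size_prod_XsubC _ id) -Er size_map_poly_id0//.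
  by rewrite (monicP pm) rmorph1 oner_neq0.
case: rs Er srs => [|t1 [|t2 [|t3 [|]]]]//; rewrite !big_cons big_nil mulr1 => Er _.
have Ex : ('X - t1%:P) * (('X - t2%:P) * ('X - t3%:P)) = 'X^3 + Poly [:: - (t1 * t2 * t3);
    t1 * t2 + t1 * t3 + t2 * t3; - (t1 + t2 + t3)].
  rewrite /= !cons_poly_def !mul0r !add0r !(rmorphN, rmorphD) /= !(rmorphM) /=; ring.
have co k : (i ('X^3 + q)`_k) = ('X^3 + Poly [:: - (t1 * t2 * t3);
    t1 * t2 + t1 * t3 + t2 * t3; - (t1 + t2 + t3)])`_k by rewrite -Ex -Er coef_map.
have {co} [] := (co 0%N, co 1%N, co 2); case; rewrite !coefD !coefXn !coef_Poly /= !add0r !rmorphN.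
move=> /oppr_inj E3' E2' /oppr_inj E1'.
have E1 : i e1 = t1 + t2 + t3 := etrans (rmorphN _ _) E1'; have E2 : i e2 = t1 * t2 + t1 * t3 + t2 * t3 := E2'.
have {E1' E2' E3'} E3 : i e3 = t1 * t2 * t3 := etrans (rmorphN _ _) E3'.
have sBi : tsym (tmap i B) := tsym_map i sB.
have gFi : i g * tri (tmap i B) (map_mx i v) (map_mx i v) (map_mx i v) = 1.
  by rewrite -tri_map -rmorphM gF rmorph1.
exists D, i, t1, t2, t3; split=> //.
- move=> t ht.
  have Et : (t - t1) * (t - t2) * (t - t3) = 0.
    by move: ht; rewrite !inE => /or3P[]/eqP->; rewrite subrr ?mul0r ?mulr0 ?mul0r.
  have gF' : i g * i (tri B v v v) = 1 by rewrite -rmorphM gF rmorph1.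
  rewrite tri_line// -!tri_map.
  transitivity (i (tri B v v v) * ((t - t1) * (t - t2) * (t - t3))); last by rewrite Et mulr0.
  transitivity (i (tri B v v v) * (t ^+ 3 - (t1 + t2 + t3) * t ^+ 2 + (t1 * t2 + t1 * t3 + t2 * t3) * t - t1 * t2 * t3)); last by ring.
  rewrite -E1 -E2 -E3 /e1 /e2 /e3 !rmorphN !rmorphM !rmorph_nat.
  by ring: gF'.
- pose h t := hess (tmap i B) (map_mx i x + t *: map_mx i v).
  rewrite -[RHS]/(216%:R * (h t1 * h t2 * h t3)) pencil_norm_map /pencil_norm.
  have Hs := hess_tensor_sym (tmap i B).
  have := nformE t1 t2 t3 (tri (hess_tensor (tmap i B)) (map_mx i x) (map_mx i x) (map_mx i x))
   (3%:R * tri (hess_tensor (tmap i B)) (map_mx i x) (map_mx i x) (map_mx i v))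
   (3%:R * tri (hess_tensor (tmap i B)) (map_mx i x) (map_mx i v) (map_mx i v))
   (tri (hess_tensor (tmap i B)) (map_mx i v) (map_mx i v) (map_mx i v)).
  cbv zeta beta; rewrite -!(tri_line _ _ _ Hs) !tri_hess_tensor -/(h t1) -/(h t2) -/(h t3) -E1 -E2 -E3.
  rewrite /e1 /e2 /e3 !rmorphN !rmorphM !rmorph_nat !tri_map => ->; ring.
Qed.

Section ApproximateFlex.
Variables (A : pring) (i6 : A).
Hypotheses (Al : plocal A) (h6 : 6%:R * i6 = 1).
Implicit Type B : 'I_3 -> 'I_3 -> 'I_3 -> A.

Lemma pchi_ext (D : pring) (i : {rmorphism A -> D}) : pext i -> exists j : {rmorphism pk A -> pk D},
  forall a, pchi D (i a) = j (pchi A a).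
Proof. by case. Qed.

Lemma pchi_ext216 (D : pring) (i : {rmorphism A -> D}) : pchi D 216%:R != 0.
Proof.
have k6 : pchi D 6%:R != 0.
  rewrite -(rmorph_nat i); apply: (@invertible_map _ _ (pchi D)); exists (i i6).
  by rewrite -rmorphM mulrC h6 rmorph1.
by rewrite (natrM _ 6 36) (natrM _ 6 6) !rmorphM !mulf_neq0.
Qed.

(** The point obtained is on the cubic exactly, but its Hessian vanishes only at the closed point,
    as one factor of a product that vanishes there. *)
Lemma approx_flex_pencil B (sB : tsym B) g (x : 'cV[A]_3) : g * B 0 0 0 = 1 -> pchi A (pencil_norm g B x (bas 0)) = 0 ->
  (exists2 j, j != 0 & pchi A (x j 0) != 0) ->
  exists (D : pring) (i : {rmorphism A -> D}) (p : 'cV[D]_3), [/\ plocal D, pext i,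
   tri (tmap i B) p p p = 0, pchi D (hess (tmap i B) p) = 0
   & exists j, pchi D (p j 0) != 0].
Proof.
move=> gB N0 [j j0 xj].
have [|D [i [t1 [t2 [t3 [Dl iD F0 _ Ni]]]]]] := @pencil_roots A B g x (bas 0) Al sB; first by rewrite tri_bas.
have [l lE] := pchi_ext iD.
have : pchi D (i (pencil_norm g B x (bas 0))) = 0 by rewrite lE N0 rmorph0.
rewrite Ni rmorphM => /eqP; rewrite mulf_eq0 (negPf (pchi_ext216 i)) /= !rmorphM !mulf_eq0.
have p0 t : exists j, pchi D ((map_mx i x + t *: map_mx i (bas 0)) j 0) != 0.
  by exists j; rewrite !mxE (negPf j0) rmorph0 mulr0 addr0; exact: pext_chi.
case/orP => [/orP[]|] /eqP E; [exists D, i, (map_mx i x + t1 *: map_mx i (bas 0))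
 |exists D, i, (map_mx i x + t2 *: map_mx i (bas 0))|exists D, i, (map_mx i x + t3 *: map_mx i (bas 0))];
by split=> //; apply: F0; rewrite !inE eqxx ?orbT.
Qed.

End ApproximateFlex.

Lemma norm_poly_root (S T : comNzRingType) (f : {rmorphism S -> T}) g B (a b v : 'cV[S]_3) m n u :
  m * n = 1 -> (map_poly f (m *: norm_poly g B a b v)).[u] = 0 ->
  pencil_norm (f g) (tmap f B) (map_mx f a + u *: map_mx f b) (map_mx f v) = 0.
Proof.
move=> mn; rewrite map_polyZ hornerZ norm_polyE => E.
by rewrite -[LHS]mul1r -(rmorph1 f) -mn mulrC rmorphM mulrA [_ * f m]mulrC E mul0r.
Qed.

Lemma map_mx_bas (S T : comPzRingType) (f : {rmorphism S -> T}) j : map_mx f (bas j) = bas j.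
Proof. by apply/matrixP => r s; rewrite !mxE rmorph_nat. Qed.

Lemma h6_map (S T : comPzRingType) (f : {rmorphism S -> T}) (i6 : S) :
  6%:R * i6 = 1 -> 6%:R * f i6 = 1.
Proof. by move=> h6; rewrite -(rmorph_nat f) -rmorphM h6 rmorph1. Qed.

(** * Hesse coordinates modulo the maximal ideal *)

Section HesseModulo.
Variables (A : pring) (w i6 : A).
Hypotheses (Al : plocal A) (w1 : cube_root w) (h6 : 6%:R * i6 = 1).
Implicit Type B : 'I_3 -> 'I_3 -> 'I_3 -> A.

(** Seen from (1 : 0 : 0), either the line to (0 : 0 : 1) already meets a flex at the closed point,
    or the norm polynomial of the lines to (0 : 1 : u) has a unit as top coefficient, hence a root
    in an extension. *)
Lemma approx_flex B : tsym B -> pchi A (B 0 0 0) != 0 ->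
  exists (D : pring) (i : {rmorphism A -> D}) (p : 'cV[D]_3), [/\ plocal D, pext i,
   tri (tmap i B) p p p = 0, pchi D (hess (tmap i B) p) = 0
   & exists j, pchi D (p j 0) != 0].
Proof.
move=> sB /Al[g gB].
have [n0|/Al[m mn]] := eqVneq (pchi A (pencil_norm g B (bas 2%:R) (bas 0))) 0.
  by apply: (approx_flex_pencil Al h6 sB gB n0); exists 2%:R; rewrite // !mxE eqxx rmorph1 oner_neq0.
have [pm sp] := dtop_monic (norm_poly_top g B (bas 1) (bas 2%:R) (bas 0)) mn.
have [|D [i [Dl iD [u /rootP ru]]]] := pext_root_local pm; first by rewrite sp.
have n0 := norm_poly_root mn ru; rewrite !map_mx_bas in n0.
have gBi : i g * i (B 0 0 0) = 1 by rewrite -rmorphM gB rmorph1.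
have x0 : exists2 j, j != 0 & pchi D ((bas 1 + u *: bas 2%:R) j 0) != 0.
  by exists 1; rewrite // !mxE /= mulr0 addr0 rmorph1 oner_neq0.
have n0' := etrans (congr1 (pchi D) n0) (rmorph0 _).
have [D2 [j [p [D2l jD F0 H0 p0]]]] := approx_flex_pencil Dl (h6_map i h6) (tsym_map i sB) gBi n0' x0.
by exists D2, (j \o i), p; split=> //; exact: pext_comp.
Qed.

Definition hesse_mod B := exists (D : pring) (i : {rmorphism A -> D}), [/\ plocal D, pext i &
  exists (h h' : 'M[D]_3) al be, [/\ h *m h' = 1%:M, h' *m h = 1%:M &
  forall x y z, pchi D (tcomp (tmap i B) h x y z) = pchi D (hesse al be x y z)]].

Lemma hesse_mod_of_basis B B' : (forall i j k, pchi A (B i j k) = pchi A (B' i j k)) ->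
  hesse_basis B' -> hesse_mod B.
Proof.
move=> E [D [i [Dl iD [h [h' [al [be [E1 E2 H]]]]]]]].
exists D, i; split=> //; exists h, h', al, be; split=> // x y z.
rewrite -H !tcomp_map; apply: tcomp_ext => a b c.
by have [l lE] := pchi_ext iD; rewrite !lE E.
Qed.

Lemma hesse_mod_comp B (h h' : 'M[A]_3) : h *m h' = 1%:M -> h' *m h = 1%:M ->
  hesse_mod (tcomp B h) -> hesse_mod B.
Proof.
move=> hh' h'h [D [i [Dl iD [g [g' [al [be [E1 E2 H]]]]]]]].
exists D, i; split=> //; exists (map_mx i h *m g), (g' *m map_mx i h'), al, be; split.
- by rewrite mulmxA -[X in X *m _]mulmxA E1 mulmx1 -map_mxM hh' map_mx1.
- by rewrite mulmxA -[X in X *m _]mulmxA -map_mxM h'h map_mx1 mulmx1.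
- move=> x y z; rewrite -H -tcomp_tcomp; congr (pchi D _); apply: tcomp_ext => a b c.
  by rewrite tcomp_map.
Qed.

Lemma hesse_mod_ext (D : pring) (i : {rmorphism A -> D}) B : pext i ->
  (exists (D' : pring) (j : {rmorphism D -> D'}), [/\ plocal D', pext j &
  exists (h h' : 'M[D']_3) al be, [/\ h *m h' = 1%:M, h' *m h = 1%:M &
  forall x y z, pchi D' (tcomp (tmap j (tmap i B)) h x y z) = pchi D' (hesse al be x y z)]]) ->
  hesse_mod B.
Proof.
move=> iD [D' [j [D'l jD' H]]]; exists D', (j \o i); split=> //.
exact: pext_comp jD'.
Qed.

(** Here a flex modulo the maximal ideal is enough: the coefficient of x y^2 lies in that ideal and
    is replaced by 0. *)
Lemma hesse_mod_flex B (p : 'cV[A]_3) : tsym B -> psmooth B -> (exists i, pchi A (p i 0) != 0) ->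
  tri B p p p = 0 -> pchi A (hess B p) = 0 -> hesse_mod B.
Proof.
move=> sB sm p0 Bp Hp; have [h [h' [hh' h'h hp]]] := basis_complete Al p0.
apply: (hesse_mod_comp hh' h'h).
have {sm} sm : psmooth (tcomp B h) := psmooth_comp hh' h'h sm.
have {Bp} Bp : tcomp B h 0 0 0 = 0 by rewrite /tcomp -!mulmx_bas hp.
have {Hp} Hp : pchi A (hess (tcomp B h) (bas 0)) = 0 by rewrite hess_comp hp rmorphM Hp mulr0.
have {sB} sB : tsym (tcomp B h) := tsym_comp _ sB.
move: (tcomp B h) sm Bp Hp sB => {p p0 h h' hh' h'h hp} {}B sm Bp Hp sB.
have [|h [h' [hh' h'h E0 E1 [E2 hp]]]] := tangent_basis Al sB sm; first by rewrite Bp rmorph0.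
apply: (hesse_mod_comp hh' h'h).
have {sm} sm : psmooth (tcomp B h) := psmooth_comp hh' h'h sm.
have {Hp} Hp : pchi A (hess (tcomp B h) (bas 0)) = 0 by rewrite hess_comp hp rmorphM Hp mulr0.
have {sB} sB : tsym (tcomp B h) := tsym_comp _ sB.
move: E0; rewrite Bp => {}Bp.
move: (tcomp B h) sm Bp Hp sB E1 E2 => {h h' hh' h'h hp} {}B sm Bp Hp sB E1 E2.
have B011 : pchi A (B 0 1 1) = 0.
  move: Hp; rewrite hess_bas0// Bp mul0r sub0r rmorphN rmorphM rmorphXn => /eqP.
  by rewrite oppr_eq0 mulf_eq0 expf_eq0 /= (negPf E2) => /eqP.
have Ec := coefs_cof sB; rewrite Bp E1 in Ec.
pose B' := cubic_tensor (coefs 0 (B 1 1 1) (B 2%:R 2%:R 2%:R) 0 (B 0 0 2%:R) 0 (B 1 1 2%:R)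
  (B 0 2%:R 2%:R) (B 1 2%:R 2%:R) (B 0 1 2%:R)).
have E' i j k : pchi A (B i j k) = pchi A (B' i j k).
  by rewrite Ec !cubic_tensor_map /cubic_tensor !coefs_map B011 rmorph0.
apply: (hesse_mod_of_basis E'); apply: (@hesse_basis_flex0 A w i6) => //.
by apply: smooth3_eq sm => i j k; rewrite E'.
Qed.

End HesseModulo.

Lemma hesse_mod_exists (A : pring) (w i6 : A) (B : 'I_3 -> 'I_3 -> 'I_3 -> A) :
  plocal A -> cube_root w -> 6%:R * i6 = 1 -> tsym B -> psmooth B -> hesse_mod B.
Proof.
move=> Al w1 h6 sB sm.
(* If the form vanished at all vectors modulo the maximal ideal, polarization would kill the tensor
   there, against smoothness. *)
have [v v0] : exists v : 'cV[A]_3, pchi A (tri B v v v) != 0.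
  apply: contrapT => N.
  have {}N v : pchi A (tri B v v v) = 0.
    by apply/eqP; apply: contrapT => /negP v0; apply: N; exists v.
  have E a b c : pchi A (tri B a b c) = 0.
    have k6 := pchi_nat h6 (isT : 6%N \in [:: 2; 3; 4; 6; 24]).
    apply/eqP; rewrite -(mulrI_eq0 _ (mulfI k6)) -rmorphM.
    rewrite (_ : 6%:R * _ = tri B (a + b + c) (a + b + c) (a + b + c) - tri B (a + b) (a + b) (a + b)
      - tri B (a + c) (a + c) (a + c) - tri B (b + c) (b + c) (b + c) + tri B a a a + tri B b b b + tri B c c c).
      by rewrite !(rmorphB, rmorphD) !N !subr0 !addr0.
    rewrite !tri_cube_add// !triDl !triDm//.
    by rewrite (triC b a c sB); ring.
  have [|c] := sm (pk A) idfun (bas 0).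
    by apply/eqP => /matrixP/(_ 0 0); rewrite !mxE eqxx => /eqP; rewrite oner_eq0.
  rewrite (eq_tri (B' := tmap (pchi A) B))// tri_bas2 big1 ?eqxx// => k _.
  by rewrite -tri_bas E mul0r.
have p0 : exists i, pchi A (v i 0) != 0.
  apply: contrapT => N; case/eqP: v0; rewrite tri_map (_ : map_mx _ v = 0).
    by rewrite -[X in tri _ X](scale0r (0 : 'cV_3)) triZl mul0r.
  apply/matrixP => i j; rewrite !ord1 !mxE; apply/eqP; apply: contrapT => /negP vi.
  by apply: N; exists i.
have [h [h' [hh' h'h hp]]] := basis_complete Al p0.
apply: (hesse_mod_comp hh' h'h).
have sm' := psmooth_comp hh' h'h sm; have sB' := tsym_comp h sB.
have [|D [i [p [Dl iD F0 H0 {}p0]]]] := approx_flex Al h6 sB'.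
  by rewrite /tcomp -!mulmx_bas hp.
apply: (hesse_mod_ext iD).
apply: (hesse_mod_flex Dl (cube_root_map i w1) (h6_map i h6) (tsym_map i sB') _ p0 F0 H0).
exact: psmooth_ext.
Qed.

(** * Exact Hesse coordinates, by lifting a flex *)

Definition char0 (k : fieldType) := forall n, (0 < n)%N -> n%:R != 0 :> k.

Lemma nat_nonroot (k : fieldType) (p : {poly k}) : char0 k -> p != 0 -> exists n, p.[n%:R] != 0.
Proof.
move=> k0 p0; apply: contrapT => N.
have r n : root p n%:R by apply/eqP/eqP/negPn/negP => h; apply: N; exists n.
pose s : seq k := [seq n%:R | n <- iota 0 (size p)].
have : (size s < size p)%N.
  apply: max_poly_roots => //; first by apply/allP => x /mapP[n _ ->].
  have ne a b : (a < b)%N -> a%:R != b%:R :> k.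
    by move=> ab; rewrite eq_sym -subr_eq0 -natrB 1?ltnW// k0// subn_gt0.
  rewrite map_inj_uniq ?iota_uniq// => a b E.
  by case: (ltngtP a b) => // /ne; rewrite E eqxx.
by rewrite size_map size_iota ltnn.
Qed.

Lemma poly_nz (k : fieldType) (s : seq k) : last 1 s != 0 -> Poly s != 0 \/ s = [::].
Proof.
case: s => [|a s]; [by right|left]; rewrite -size_poly_eq0 (@PolyK _ 0)//.
Qed.

Section HesseField.
Variable k : fieldType.
Hypothesis k0 : char0 k.
Variables al be : k.
Hypotheses (al0 : al != 0) (d0 : al ^+ 3 + 8%:R * be ^+ 3 != 0).

Let F x y z : k := al * (x ^+ 3 + y ^+ 3 + z ^+ 3) + 6%:R * be * x * y * z.

Lemma tri_hesse3 (p : 'cV[k]_3) : tri (hesse al be) p p p = F (p 0 0) (p 1 0) (p 2%:R 0).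
Proof. by rewrite tri_hesse /F; ring. Qed.

Lemma hesse_flex (p : 'cV[k]_3) : tri (hesse al be) p p p = 0 ->
  hess (hesse al be) p = (al ^+ 3 + 8%:R * be ^+ 3) * (p 0 0 * p 1 0 * p 2%:R 0).
Proof.
rewrite tri_hesse3 hess_hesse => E; apply/eqP; rewrite -subr_eq0; apply/eqP.
by transitivity (- (be ^+ 2 * F (p 0 0) (p 1 0) (p 2%:R 0))); [rewrite /F; ring|rewrite E mulr0 oppr0].
Qed.

Lemma hesse_flex_eq0 (p : 'cV[k]_3) : tri (hesse al be) p p p = 0 -> hess (hesse al be) p = 0 ->
  [|| p 0 0 == 0, p 1 0 == 0 | p 2%:R 0 == 0].
Proof.
by move/hesse_flex => -> /eqP; rewrite !mulf_eq0 (negPf d0) /= -orbA.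
Qed.

(** The centre (3 : 1 - 5c : 2c - 1) lies on x + 2y + 5z = 0. The conditions put it off the cubic
    and off z = 0, make the line from it to the flex (0 : 1 : -1) free of other flexes, and make
    that line not tangent to the cubic at this flex. Each is a nonzero polynomial in c, so some
    natural number meets all of them. *)
Lemma good_center : exists n, let c : k := n%:R in
  [/\ F 3%:R (1 - 5%:R * c) (2%:R * c - 1) != 0, 2%:R * c - 1 != 0, c ^+ 3 - 1 != 0
    & c * al + 2%:R * be != 0].
Proof.
pose p1 := Poly [:: 27%:R * al - 18%:R * be; - (9%:R * al) + 126%:R * be;
  63%:R * al - 180%:R * be; - (117%:R * al)].
pose p2 : {poly k} := Poly [:: -1; 2%:R]; pose p3 : {poly k} := Poly [:: -1; 0; 0; 1].
pose p4 := Poly [:: 2%:R * be; al].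
have [||n hn] := @nat_nonroot k (p1 * p2 * p3 * p4) => //.
  rewrite !mulf_neq0//.
  - by have [|//|//] := @poly_nz k [:: 27%:R * al - 18%:R * be; - (9%:R * al) + 126%:R * be;
  63%:R * al - 180%:R * be; - (117%:R * al)]; rewrite /= oppr_eq0 mulf_neq0// k0.
  - by have [|//|//] := @poly_nz k [:: -1; 2%:R]; rewrite /= k0.
  - by have [|//|//] := @poly_nz k [:: -1; 0; 0; 1]; rewrite /= oner_neq0.
  - by have [|//|//] := @poly_nz k [:: 2%:R * be; al].
exists n => c; move: hn; rewrite -/c !hornerM !mulf_eq0 !negb_or /p1 /p2 /p3 /p4.
rewrite !horner_Poly /= => /andP[/andP[/andP[h1 h2] h3] h4]; split.
- by apply: contraNneq h1 => E; rewrite -[X in _ == X]E; apply/eqP; rewrite /F; ring.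
- by apply: contraNneq h2 => E; rewrite -[X in _ == X]E; apply/eqP; ring.
- by apply: contraNneq h3 => E; rewrite -[X in _ == X]E; apply/eqP; ring.
- by apply: contraNneq h4 => E; rewrite -[X in _ == X]E; apply/eqP; ring.
Qed.

(* The line x + 2 y + 5 z = 0 passes through no flex. *)
Lemma hesse_noflex (c t : k) : 2%:R * c - 1 != 0 ->
  let x := 2%:R + 3%:R * t in let y := -1 + (1 - 5%:R * c) * t in let z := (2%:R * c - 1) * t in
  F x y z = 0 -> [&& x != 0, y != 0 & z != 0].
Proof.
move=> c0 x y z E; apply/and3P; split; apply/eqP => Z.
(* A flex on the line would make two of the cubes 1, 8, 125 of its coefficients equal; 117, 124 and
   7 are their differences. *)
- have : 117%:R * al * (2%:R * c - 1) ^+ 3 = 27%:R * F x y z.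
    have Et : 3%:R * t = - 2%:R by apply/eqP; rewrite -addr_eq0 addrC; apply/eqP.
    have Ey : 3%:R * y = 5%:R * (2%:R * c - 1) by rewrite /y mulrDr mulrCA Et; ring.
    have Ez : 3%:R * z = - 2%:R * (2%:R * c - 1) by rewrite /z mulrCA Et; ring.
    transitivity (al * ((3%:R * x) ^+ 3 + (3%:R * y) ^+ 3 + (3%:R * z) ^+ 3) + 6%:R * be * (3%:R * x) * (3%:R * y) * (3%:R * z)).
      by rewrite Ey Ez Z; ring.
    by rewrite /F; ring.
  by rewrite E mulr0 ; apply/eqP; rewrite !mulf_neq0 ?expf_neq0// k0.
- have : - (124%:R * al * (2%:R * c - 1) ^+ 3) = (1 - 5%:R * c) ^+ 3 * F x y z.
    have Et : (1 - 5%:R * c) * t = 1 by apply/eqP; rewrite -subr_eq0 addrC; apply/eqP.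
    have Ex : (1 - 5%:R * c) * x = - 5%:R * (2%:R * c - 1) by rewrite /x mulrDr mulrCA Et; ring.
    have Ez : (1 - 5%:R * c) * z = 2%:R * c - 1 by rewrite /z mulrCA Et; ring.
    set d := 1 - 5%:R * c in Et Ex Ez *.
    transitivity (al * ((d * x) ^+ 3 + (d * y) ^+ 3 + (d * z) ^+ 3) + 6%:R * be * (d * x) * (d * y) * (d * z)).
      by rewrite Ex Ez Z; ring.
    by rewrite /F; ring.
  by rewrite E mulr0 ; apply/eqP; rewrite oppr_eq0 !mulf_neq0 ?expf_neq0// k0.
- have t0 : t = 0 by apply/eqP; move/eqP: Z; rewrite mulf_eq0 (negPf c0).
  have : 7%:R * al = F x y z by rewrite /F /x /y /z t0; ring.
  by rewrite E ; apply/eqP; rewrite mulf_neq0// k0.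
Qed.

(** On the line from (0 : 1 : -1) to the centre x = 3t and y + z = -3ct, so y = 0 or z = 0 would
    give c^3 = 1 on the cubic. *)
Lemma hesse_oneflex (c t : k) : c ^+ 3 - 1 != 0 -> t != 0 ->
  let x := 3%:R * t in let y := 1 + (1 - 5%:R * c) * t in let z := -1 + (2%:R * c - 1) * t in
  F x y z = 0 -> [&& x != 0, y != 0 & z != 0].
Proof.
move=> c3 t0 x y z E.
have x0 : x != 0 by rewrite mulf_neq0// k0.
have yz : y + z = - (3%:R * c * t) by rewrite /y /z; ring.
have key : 27%:R * al * t ^+ 3 * (c ^+ 3 - 1) != 0.
  by rewrite !mulf_neq0 ?expf_neq0// k0.
apply/and3P; split=> //; apply: contraNneq key => Z.
- have Ez : z = - (3%:R * c * t) by rewrite -yz Z add0r.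
  by rewrite -[X in _ == X]oppr0 -[in X in _ == X]E /F Z Ez /x; apply/eqP; ring.
- have Ey : y = - (3%:R * c * t) by rewrite -yz Z addr0.
  by rewrite -[X in _ == X]oppr0 -[in X in _ == X]E /F Z Ey /x; apply/eqP; ring.
Qed.

End HesseField.

Lemma hess_map (S T : comPzRingType) (f : {rmorphism S -> T}) B v :
  f (hess B v) = hess (tmap f B) (map_mx f v).
Proof.
rewrite /hess -det_map_mx; congr (\det _); apply/matrixP => r s.
by rewrite !mxE tri_map !map_mx_bas.
Qed.

Lemma hesse_map (S T : comPzRingType) (f : {rmorphism S -> T}) al be i j k :
  f (hesse al be i j k) = hesse (f al) (f be) i j k.
Proof. by rewrite /hesse; do 2?case: ifP => // _; rewrite rmorph0. Qed.

Lemma char0_pext (A D : pring) (i : {rmorphism A -> D}) : pext i -> char0 (pk A) -> char0 (pk D).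
Proof. by move=> [[l lE] _] k0 n n0; rewrite -(rmorph_nat l) fmorph_eq0 k0. Qed.

Section NearlyHesse.
Variables (A : pring) (B : 'I_3 -> 'I_3 -> 'I_3 -> A) (al be : A).
Hypothesis nB : forall i j k, pchi A (B i j k) = pchi A (hesse al be i j k).

Lemma near_tri p q r : pchi A (tri B p q r) = tri (hesse (pchi A al) (pchi A be)) (map_mx (pchi A) p)
  (map_mx (pchi A) q) (map_mx (pchi A) r).
Proof. by rewrite tri_map; apply: eq_tri => i j k; rewrite nB hesse_map. Qed.

Lemma near_hess p : pchi A (hess B p) = hess (hesse (pchi A al) (pchi A be)) (map_mx (pchi A) p).
Proof.
rewrite hess_map /hess; congr (\det _); apply: polar_mx_ext => i j k.
by rewrite nB hesse_map.
Qed.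

Lemma near_pext (D : pring) (i : {rmorphism A -> D}) : pext i ->
  forall a b c, pchi D (i (B a b c)) = pchi D (hesse (i al) (i be) a b c).
Proof. by move=> [[l lE] _] a b c; rewrite -hesse_map !lE nB. Qed.

End NearlyHesse.

Lemma pencil_norm_flex (S : comPzRingType) g B (x v : 'cV[S]_3) :
  tri B x x x = 0 -> tri (hess_tensor B) x x x = 0 -> pencil_norm g B x v = 0.
Proof. by move=> E1 E2; rewrite /pencil_norm /nform E1 E2; ring. Qed.

Lemma disc_map (S T : comPzRingType) (f : {rmorphism S -> T}) (x y : S) :
  f (x ^+ 3 + 8%:R * y ^+ 3) = f x ^+ 3 + 8%:R * f y ^+ 3.
Proof. by rewrite rmorphD rmorphXn rmorphM rmorph_nat rmorphXn. Qed.

Section PencilCoordinates.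
Variables (S T : comPzRingType) (f : {rmorphism S -> T}) (n : nat).

Definition pencil_center : 'cV[S]_3 := vec3 3%:R (1 - 5%:R * n%:R) (2%:R * n%:R - 1).
Definition pencil_flex : 'cV[S]_3 := vec3 0 1 (-1).
Definition pencil_dir : 'cV[S]_3 := vec3 2%:R (-1) 0.

Lemma vec3_map (x y z : S) : map_mx f (vec3 x y z) = vec3 (f x) (f y) (f z).
Proof. by apply/matrixP => i j; rewrite !mxE; elim/I3_ind: i. Qed.

End PencilCoordinates.

Lemma pencil_center_map (S T : comPzRingType) (f : {rmorphism S -> T}) n :
  map_mx f (pencil_center S n) = pencil_center T n.
Proof. by rewrite vec3_map !rmorphB !rmorphM rmorph1 !rmorph_nat. Qed.

Lemma pencil_flex_map (S T : comPzRingType) (f : {rmorphism S -> T}) :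
  map_mx f (pencil_flex S) = pencil_flex T.
Proof. by rewrite vec3_map rmorphN rmorph1 rmorph0. Qed.

Lemma pencil_dir_map (S T : comPzRingType) (f : {rmorphism S -> T}) :
  map_mx f (pencil_dir S) = pencil_dir T.
Proof. by rewrite vec3_map rmorphN rmorph1 rmorph0 rmorph_nat. Qed.

Lemma map_mx_line (S T : comPzRingType) (f : {rmorphism S -> T}) (x v : 'cV[S]_3) t :
  map_mx f (x + t *: v) = map_mx f x + f t *: map_mx f v.
Proof. by rewrite map_mxD map_mxZ. Qed.

(** The flexes of the residue cubic being known, the centre [v] is chosen so that its line through
    (0 : 1 : -1) contains no other. A root of the norm polynomial reducing to this line gives a line
    on which two Hessian factors are units, and the third vanishes exactly. *)
Lemma hesse_basis_near (A : pring) (w i6 : A) B al be : plocal A -> cube_root w ->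
  6%:R * i6 = 1 -> char0 (pk A) -> tsym B -> psmooth B ->
  (forall i j k, pchi A (B i j k) = pchi A (hesse al be i j k)) -> hesse_basis B.
Proof.
move=> Al w1 h6 k0 sB sm nB.
have [al0 d0] : pchi A al != 0 /\ pchi A al ^+ 3 + 8%:R * pchi A be ^+ 3 != 0.
  apply: (hesse_units idfun); apply: smooth3_eq sm => i j k.
  by rewrite nB hesse_map.
have d0' (D : pring) (i : {rmorphism A -> D}) : pext i -> pchi D (i al) != 0 /\
    pchi D (i al) ^+ 3 + 8%:R * pchi D (i be) ^+ 3 != 0.
  move=> iD; split; first exact: pext_chi.
  by rewrite -!disc_map; apply: pext_chi iD _; rewrite disc_map.
have [n [c1 c2 c3 c4]] := @good_center _ k0 (pchi A al) (pchi A be) al0.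
pose v := pencil_center A n; pose p0 := pencil_flex A; pose b := pencil_dir A.
have cond (D : pring) (i : {rmorphism A -> D}) : pext i -> let c : pk D := n%:R in
   [/\ 2%:R * c - 1 != 0, c ^+ 3 - 1 != 0 & c * pchi D (i al) + 2%:R * pchi D (i be) != 0].
  move=> [[l lE] _] c; split; rewrite ?lE.
  - by rewrite (_ : _ - 1 = l (2%:R * n%:R - 1)) ?fmorph_eq0// rmorphB rmorphM rmorph1 !rmorph_nat.
  - by rewrite (_ : _ - 1 = l (n%:R ^+ 3 - 1)) ?fmorph_eq0// rmorphB rmorphXn rmorph1 rmorph_nat.
  - rewrite (_ : _ + _ = l (n%:R * pchi A al + 2%:R * pchi A be)) ?fmorph_eq0//.
    by rewrite rmorphD !rmorphM !rmorph_nat.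
have [|g gF] := Al (tri B v v v).
  by rewrite (near_tri nB) tri_hesse3 pencil_center_map !mxE /=; exact: c1.
(* The top coefficient is a unit because the line through [b] and [v] contains no flex at the closed
   point. *)
have [m mn] : exists m, m * pencil_norm g B b v = 1.
  apply: (Al); have [D [i [t1 [t2 [t3 [Dl iD F0 _ Ni]]]]]] := pencil_roots b Al sB gF.
  have [al0' d0''] := d0' _ _ iD; have k0' := char0_pext iD k0; have [c2' _ _] := cond _ _ iD.
  have [l lE] := pchi_ext iD.
  have hnz t : t \in [:: t1; t2; t3] -> pchi D (hess (tmap i B) (map_mx i b + t *: map_mx i v)) != 0.
    move/F0 => E; have := congr1 (pchi D) E; rewrite rmorph0 (near_tri (near_pext nB iD)) => {}E.
    apply/eqP => Eh; move: Eh; rewrite (near_hess (near_pext nB iD)) => Eh.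
    have := hesse_flex_eq0 d0'' E Eh; move: E.
    rewrite tri_hesse3 map_mx_line !pencil_center_map !pencil_dir_map !mxE /=.
    rewrite [_ * 3%:R]mulrC [_ * (1 - _)]mulrC [_ * (_ - 1)]mulrC add0r.
    case/(hesse_noflex k0' al0' c2')/and3P => /negPf h1 /negPf h2 /negPf h3.
    by rewrite h1 h2 h3.
  have : pchi D (i (pencil_norm g B b v)) != 0.
    rewrite Ni rmorphM mulf_neq0 ?(pchi_ext216 h6 i)// !rmorphM !mulf_neq0// hnz// !inE eqxx ?orbT//.
  by rewrite lE fmorph_eq0.
have [pm sp] := dtop_monic (norm_poly_top g B p0 b v) mn.
have [D [i [Dl iD [rs Er]]]] := pext_split pm.
(* The polynomial splits, and it vanishes at 0 modulo the maximal ideal since [p0] is a flex there;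
   so one of its roots reduces to 0. *)
have [r r0 rr] : exists2 r, pchi D r = 0 & pencil_norm (i g) (tmap i B) (map_mx i p0 + r *: map_mx i b) (map_mx i v) = 0.
  have : (map_poly i (m *: norm_poly g B p0 b v)).[0] = i m * i (pencil_norm g B p0 v).
    by rewrite map_polyZ hornerZ norm_polyE scale0r addr0 -pencil_norm_map.
  have [l lE] := pchi_ext iD.
  have E0 : pchi A (pencil_norm g B p0 v) = 0.
    rewrite pencil_norm_map pencil_flex_map.
    have Et : tri (tmap (pchi A) B) (pencil_flex _) (pencil_flex _) (pencil_flex _) = 0.
      by rewrite -(pencil_flex_map (pchi A)) -tri_map (near_tri nB) tri_hesse3 pencil_flex_map !mxE /=; ring.
    apply: pencil_norm_flex => //; rewrite tri_hess_tensor -(pencil_flex_map (pchi A)) -hess_map.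
    by rewrite (near_hess nB) hess_hesse pencil_flex_map !mxE /=; ring.
  rewrite Er horner_prod => /(congr1 (pchi D)); rewrite rmorphM [X in _ = _ * X]lE E0 rmorph0 mulr0 rmorph_prod => /eqP.
  rewrite prodf_seq_eq0 => /hasP[r rrs /=]; rewrite hornerXsubC sub0r rmorphN oppr_eq0 => /eqP r0.
  exists r => //; apply: (norm_poly_root mn).
  by rewrite Er (big_rem r rrs) /= hornerM hornerXsubC subrr mul0r.
have gFi : i g * tri (tmap i B) (map_mx i v) (map_mx i v) (map_mx i v) = 1.
  by rewrite -tri_map -rmorphM gF rmorph1.
have [D2 [j [t1 [t2 [t3 [D2l jD F0 [_ E2 E3] Nj]]]]]] :=
  pencil_roots (map_mx i p0 + r *: map_mx i b) Dl (tsym_map i sB) gFi.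
have [l lE] := pchi_ext jD; have iD2 : pext (j \o i) := pext_comp iD jD.
have [al0' d0''] := d0' _ _ iD2; have k0' := char0_pext iD2 k0; have [_ c3' c4'] := cond _ _ iD2.
pose q t := map_mx j (map_mx i p0 + r *: map_mx i b) + t *: map_mx j (map_mx i v).
have qE t : map_mx (pchi D2) (q t) = pencil_flex _ + pchi D2 t *: pencil_center _ n.
  rewrite !map_mx_line lE r0 rmorph0 scale0r addr0 !pencil_flex_map; congr (_ + _ *: _).
  by rewrite !pencil_center_map.
pose B2 := tmap (j \o i) B; have nB2 := near_pext nB iD2.
have hnz t : t \in [:: t1; t2; t3] -> pchi D2 t != 0 -> pchi D2 (hess B2 (q t)) != 0.
  move=> ht t0; have := congr1 (pchi D2) (F0 _ ht); rewrite rmorph0 -/(q t) (near_tri nB2) => E.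
  apply/eqP => Eh; move: Eh; rewrite (near_hess nB2) => Eh.
  have := hesse_flex_eq0 d0'' E Eh; move: E.
  rewrite tri_hesse3 qE !mxE /=.
  rewrite [_ * 3%:R]mulrC [_ * (1 - _)]mulrC [_ * (_ - 1)]mulrC add0r.
  case/(hesse_oneflex k0' al0' c3' t0)/and3P => /negPf h1 /negPf h2 /negPf h3.
  by rewrite h1 h2 h3.
have fin t : t \in [:: t1; t2; t3] -> pchi D2 t = 0 -> hess B2 (q t) = 0 -> hesse_basis B.
  move=> ht t0 Eh; apply: (hesse_basis_ext iD2).
  apply: (@hesse_basis_flex D2 ((j \o i) w) ((j \o i) i6) D2l _ _ _ (q t)) => //.
  - exact: cube_root_map.
  - exact: h6_map.
  - exact: tsym_map.
  - exact: psmooth_ext.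
  - exists 1; have := congr1 (fun M : 'cV_3 => M 1 0) (qE t).
    by rewrite mxE => ->; rewrite t0 !mxE /= mul0r addr0 oner_neq0.
  - exact: F0.
have xE : map_mx (pchi D) (map_mx i p0 + r *: map_mx i b) = pencil_flex _.
  by rewrite map_mx_line r0 scale0r addr0 !pencil_flex_map.
have vE : map_mx (pchi D) (map_mx i v) = pencil_center _ n by rewrite !pencil_center_map.
(* At the closed point the three parameters have product 0 but nonzero second symmetric function
   (the line is not tangent at the flex): exactly one reduces to 0. *)
have e3 : pchi D2 t1 * (pchi D2 t2 * pchi D2 t3) = 0.
  rewrite -!rmorphM mulrA -E3 lE rmorphN rmorphM (near_tri (near_pext nB iD)) xE tri_hesse3 !mxE /=.
  by rewrite -[RHS](rmorph0 l); congr (l _); ring.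
have e2 : pchi D2 t1 * pchi D2 t2 + pchi D2 t1 * pchi D2 t3 + pchi D2 t2 * pchi D2 t3 != 0.
  rewrite -!rmorphM -!rmorphD -E2 lE fmorph_eq0 !rmorphM rmorph_nat mulf_neq0//.
    by apply: char0_pext iD k0 _ _.
  rewrite mulf_neq0//.
    by apply: (@invertible_map _ _ (pchi D)); eexists; rewrite mulrC; exact: gFi.
  rewrite (near_tri (near_pext nB iD)) xE vE tri_hesse !mxE /=.
  have [_ _ c4''] := cond _ _ iD.
  rewrite [X in X != 0](_ : _ = - 3%:R * (n%:R * pchi D (i al) + 2%:R * pchi D (i be))); last by ring.
  by rewrite mulf_neq0// oppr_eq0 (char0_pext iD k0).
have h0 : hess B2 (q t1) * hess B2 (q t2) * hess B2 (q t3) = 0.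
  have := Nj; rewrite rr rmorph0 => /esym E.
  exact: (plocal_unit0 D2l (pchi_ext216 h6 (j \o i)) E).
have unit0 x y : pchi D2 x != 0 -> x * y = 0 -> y = 0 := plocal_unit0 D2l (x := x) (y := y).
move/eqP: e3; rewrite !mulf_eq0 => /or3P[] /eqP z.
- move: e2; rewrite z !mul0r !add0r mulf_eq0 negb_or => /andP[n2 n3].
  apply: (fin t1); rewrite ?inE ?eqxx//.
  apply: (unit0 (hess B2 (q t2) * hess B2 (q t3))); last by rewrite mulrC mulrA.
  by rewrite rmorphM mulf_neq0// hnz// !inE eqxx ?orbT.
- move: e2; rewrite z !(mul0r, mulr0) add0r addr0 mulf_eq0 negb_or => /andP[n2 n3].
  apply: (fin t2); rewrite ?inE ?eqxx ?orbT//.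
  apply: (unit0 (hess B2 (q t1) * hess B2 (q t3))); last by rewrite mulrAC.
  by rewrite rmorphM mulf_neq0// hnz// !inE eqxx ?orbT.
- move: e2; rewrite z !mulr0 !addr0 mulf_eq0 negb_or => /andP[n2 n3].
  apply: (fin t3); rewrite ?inE ?eqxx ?orbT//.
  apply: (unit0 (hess B2 (q t1) * hess B2 (q t2))) => //.
  by rewrite rmorphM mulf_neq0// hnz// !inE eqxx ?orbT.
Qed.

Theorem hesse_basis_exists (A : pring) (w i6 : A) (B : 'I_3 -> 'I_3 -> 'I_3 -> A) : plocal A -> cube_root w ->
  6%:R * i6 = 1 -> char0 (pk A) -> tsym B -> smooth3 B -> hesse_basis B.
Proof.
move=> Al w1 h6 k0 sB /(smooth3_map (pchi A)) sm.
have [D [i [Dl iD [h [h' [al [be [hh' h'h H]]]]]]]] := hesse_mod_exists Al w1 h6 sB sm.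
apply: (hesse_basis_ext iD); apply: (hesse_basis_comp hh' h'h).
apply: (hesse_basis_near Dl (cube_root_map i w1) (h6_map i h6) _ _ _ H).
- exact: (char0_pext iD k0).
- exact: tsym_comp (tsym_map i sB).
- exact: psmooth_comp hh' h'h (psmooth_ext iD sm).
Qed.

(** * Galois covers *)

HB.instance Definition _ := [Finite of SL2F3 by <:].
HB.instance Definition _ := Finite.on ASL2F3.

Section GaloisCriterion.
Variables (R : comNzRingType) (T : comPzRingType) (s : {rmorphism R -> T}).
Variable act : ASL2F3 -> {rmorphism T -> T}.
Hypotheses (act1 : forall x, act 1%g x = x)
  (actM : forall g h x, act (g * h)%g x = act g (act h x))
  (acts : forall g r, act g (s r) = s r)
  (sI : injective s)
  (fixT : forall x, (forall g, act g x = x) -> exists r, s r = x).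
Variables (n : nat) (a b : 'I_n -> T).
Hypothesis dual : forall g, \sum_j a j * act g (b j) = if g == 1%g then 1 else 0.

Let tr x := \sum_(g : ASL2F3) act g x.

Let tr_fix x g : act g (tr x) = tr x.
Proof.
rewrite /tr rmorph_sum [RHS](reindex_inj (@mulgI ASL2F3 g)) /=.
by apply: eq_bigr => h _; rewrite actM.
Qed.

Let tr_ex x : exists r, s r = tr x := fixT (tr_fix x).
Let trR x := sval (cid (tr_ex x)).
Let trRE x : s (trR x) = tr x. Proof. exact: (svalP (cid (tr_ex x))). Qed.

Let trD x y : tr (x + y) = tr x + tr y.
Proof. by rewrite /tr -big_split; apply: eq_bigr => g _; rewrite rmorphD. Qed.

Let trZ r x : tr (s r * x) = s r * tr x.
Proof. by rewrite /tr mulr_sumr; apply: eq_bigr => g _; rewrite rmorphM acts. Qed.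

(** The a_j and b_j are Galois coordinates: x = sum_j a_j tr(b_j x) provides the dual basis. *)
Lemma galois_finite_etale : finite_etale s.
Proof.
split.
- exists n, a, (fun j x => trR (b j * x)); split.
  + by move=> j x y; apply: sI; rewrite rmorphD !trRE mulrDr trD.
  + by move=> j r x; apply: sI; rewrite rmorphM !trRE mulrCA trZ.
  + move=> x; transitivity (\sum_j \sum_(g : ASL2F3) (a j * act g (b j)) * act g x); last first.
      apply: eq_bigr => j _; rewrite trRE mulr_suml; apply: eq_bigr => g _.
      by rewrite rmorphM -mulrA [RHS]mulrC.
    rewrite exchange_big (bigD1 1%g)//= [X in _ + X]big1 ?addr0 => [|g ne].
      by rewrite -mulr_suml dual eqxx mul1r act1.
    by rewrite -mulr_suml dual (negPf ne) mul0r.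
- move=> M D DD DM Ds x.
  have D0 : D 0 = 0 by have := Ds 0; rewrite rmorph0.
  have Dsum (I : finType) (F : I -> T) : D (\sum_i F i) = \sum_i D (F i).
    by apply: (big_morph D DD D0).
  pose d g := \sum_j a j *: D (act g (b j)).
  (* D is applied to the traces tr(b_j y), which come from R, and the results are summed against the
     a_j. *)
  have key y : D y + \sum_(g : ASL2F3) act g y *: d g = 0.
    have E j : a j *: D (tr (b j * y)) = 0 by rewrite -trRE Ds scaler0.
    have : \sum_j a j *: D (tr (b j * y)) = 0 by rewrite big1.
    rewrite (eq_bigr (fun j => \sum_(g : ASL2F3) ((a j * act g (b j)) *: D (act g y) +
                act g y *: (a j *: D (act g (b j)))))); last first.
      move=> j _; rewrite /tr Dsum scaler_sumr; apply: eq_bigr => g _.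
      by rewrite rmorphM DM scalerDr !scalerA [_ * a j]mulrC.
    rewrite exchange_big /=.
    rewrite (eq_bigr (fun g => (\sum_j a j * act g (b j)) *: D (act g y) + act g y *: d g)); last first.
      by move=> g _; rewrite big_split /= -scaler_suml -scaler_sumr.
    rewrite big_split /= => E2; apply: etrans E2; congr (_ + _); apply: esym.
    rewrite (bigD1 1%g)//= [X in _ + X]big1 ?addr0 => [|g ne]; first by rewrite dual eqxx scale1r act1.
    by rewrite dual (negPf ne) scale0r.
  pose Sg z := \sum_(g : ASL2F3) act g z *: d g.
  have DS z : D z = - Sg z by apply/eqP; rewrite -addr_eq0 key.
  (* Thus -D is the explicit combination [Sg]. Computing sum_j a_j Sg(b_j x) from its formula and
     from the Leibniz rule gives Sg x = 0. *)
  have SM y z : Sg (y * z) = y *: Sg z + z *: Sg y.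
    by apply: oppr_inj; rewrite -DS DM !DS !scalerN opprD.
  have aS : \sum_j a j *: Sg (b j) = d 1%g.
    rewrite /Sg; under eq_bigr => j _ do rewrite scaler_sumr.
    rewrite exchange_big (bigD1 1%g)//= [X in _ + X]big1 ?addr0 => [|g ne].
      under eq_bigr => j _ do rewrite scalerA.
      by rewrite -scaler_suml dual eqxx scale1r.
    under eq_bigr => j _ do rewrite scalerA.
    by rewrite -scaler_suml dual (negPf ne) scale0r.
  have aSx : \sum_j a j *: Sg (b j * x) = x *: d 1%g.
    rewrite /Sg; under eq_bigr => j _ do rewrite scaler_sumr.
    rewrite exchange_big (bigD1 1%g)//= [X in _ + X]big1 ?addr0 => [|g ne].
      under eq_bigr => j _ do rewrite scalerA rmorphM mulrA.
      by rewrite -scaler_suml -mulr_suml dual eqxx mul1r act1.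
    under eq_bigr => j _ do rewrite scalerA rmorphM mulrA.
    by rewrite -scaler_suml -mulr_suml dual (negPf ne) mul0r scale0r.
  have ab : \sum_j a j * b j = 1.
    by have := dual 1%g; rewrite eqxx => <-; apply: eq_bigr => j _; rewrite act1.
  have : Sg x + x *: d 1%g = x *: d 1%g.
    rewrite -{1}aS scaler_sumr -aSx -[Sg x]scale1r -ab scaler_suml -big_split.
    by apply: eq_bigr => j _; rewrite SM scalerDr !scalerA [x * a j]mulrC.
  move/eqP; rewrite addrC -subr_eq0 addrAC subrr add0r DS => /eqP ->.
  by rewrite oppr0.
Qed.

End GaloisCriterion.

Section TensorFunctions.
Variables (T : comPzRingType) (act : ASL2F3 -> {rmorphism T -> T}).

(* The functions on the group coming from elements of T (x) T. *)
Definition tensfun (f : ASL2F3 -> T) :=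
  exists l : seq (T * T), forall g, f g = \sum_(p <- l) p.1 * act g p.2.

Lemma tensfun_pure x y : tensfun (fun g => x * act g y).
Proof. by exists [:: (x, y)] => g; rewrite big_seq1. Qed.

Lemma tensfunD f f' : tensfun f -> tensfun f' -> tensfun (fun g => f g + f' g).
Proof. by move=> [l h] [l' h']; exists (l ++ l') => g; rewrite big_cat h h'. Qed.

Lemma tensfunM f f' : tensfun f -> tensfun f' -> tensfun (fun g => f g * f' g).
Proof.
move=> [l h] [l' h']; exists [seq (p.1 * q.1, p.2 * q.2) | p <- l, q <- l'] => g.
rewrite big_allpairs_dep h h' mulr_suml; apply: eq_bigr => p _.
by rewrite mulr_sumr; apply: eq_bigr => q _; rewrite /= rmorphM mulrACA.
Qed.

Lemma tensfunZ x f : tensfun f -> tensfun (fun g => x * f g).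
Proof.
move=> [l h]; exists [seq (x * p.1, p.2) | p <- l] => g.
by rewrite big_map h mulr_sumr; apply: eq_bigr => p _; rewrite mulrA.
Qed.

Lemma tensfun_sum (I : finType) (F : I -> ASL2F3 -> T) :
  (forall i, tensfun (F i)) -> tensfun (fun g => \sum_i F i g).
Proof.
move=> h; have [l hl] : exists l : I -> seq (T * T), forall i g, F i g = \sum_(p <- l i) p.1 * act g p.2.
  by exists (fun i => sval (cid (h i))) => i; exact: (svalP (cid (h i))).
exists (flatten [seq l i | i <- index_enum I]) => g.
by rewrite big_flatten /= big_map; apply: eq_bigr => i _; exact: hl.
Qed.

Lemma tensfun_ext f f' : (forall g, f g = f' g) -> tensfun f -> tensfun f'.
Proof. by move=> E [l h]; exists l => g; rewrite -E. Qed.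

Lemma tensfun_dual f : tensfun f -> exists n (a b : 'I_n -> T), forall g, \sum_j a j * act g (b j) = f g.
Proof.
move=> [l h]; exists (size l), (fun j => (tnth (in_tuple l) j).1), (fun j => (tnth (in_tuple l) j).2) => g.
by rewrite h [RHS](big_tnth _ _ l).
Qed.

End TensorFunctions.

(** * The ring of frames *)

Lemma weyl_map (S T : comPzRingType) (f : {rmorphism S -> T}) w W :
  weyl w W -> weyl (f w) (fun u => map_mx f (W u)).
Proof.
move=> [W0 WM]; split=> [|u v]; first by rewrite W0 map_mx1.
by rewrite -map_mxM WM map_mxZ wp_map.
Qed.

Lemma tinv_map (S T : comPzRingType) (f : {rmorphism S -> T}) B M :
  tinv B M -> tinv (tmap f B) (map_mx f M).
Proof.
by move/tinvP => h; apply/tinvP => i j k; rewrite -tcomp_map h.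
Qed.

Lemma tinv_ext (S : comPzRingType) (B B' : 'I_3 -> 'I_3 -> 'I_3 -> S) M :
  (forall i j k, B i j k = B' i j k) -> tinv B M -> tinv B' M.
Proof. by move=> E h a b c; rewrite -!(eq_tri _ _ _ E) h. Qed.

Lemma fact_map (S T : comPzRingType) (f : {rmorphism S -> T}) w g W u :
  map_mx f (fact w g W u) = fact (f w) g (fun u => map_mx f (W u)) u.
Proof. by rewrite /fact map_mxZ wp_map. Qed.

Lemma fact_ext (S : comPzRingType) (w : S) g W W' u : (forall u, W u = W' u) ->
  fact w g W u = fact w g W' u.
Proof. by move=> E; rewrite /fact E. Qed.

Lemma weyl_eq (S : comPzRingType) (w : S) W W' : (forall u, W u = W' u) -> weyl w W -> weyl w W'.
Proof. by move=> E [W0 WM]; split=> [|u v]; rewrite -!E. Qed.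

Lemma mpoly_hom_eq n (R : nzRingType) (S : pzRingType) (g g' : {rmorphism {mpoly R[n]} -> S}) :
  (forall r, g r%:MP = g' r%:MP) -> (forall k, g 'X_k = g' 'X_k) -> g =1 g'.
Proof.
move=> E1 E2; elim/mpolyind => [|r m p _ _ IH]; first by rewrite !rmorph0.
rewrite -mul_mpolyC mpolyXE_id !rmorphD IH !rmorphM !rmorph_prod E1.
by congr (_ * _ + _); apply: eq_bigr => k _; rewrite !rmorphXn E2.
Qed.

Section FrameRing.
Variables (R : comNzRingType) (w i6 : R) (K : ('I_3 -> 'I_3 -> 'I_3 -> R) -> Prop).

Definition isframe (S : comPzRingType) (f : {rmorphism R -> S}) (W : 'cV['F_3]_2 -> 'M[S]_3) :=
  weyl (f w) W /\ forall B, K B -> forall u, tinv (tmap f B) (W u).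

Lemma isframe_map (S T : comPzRingType) (f : {rmorphism R -> S}) (g : {rmorphism S -> T})
    (f' : {rmorphism R -> T}) W : (forall r, f' r = g (f r)) ->
  isframe f W -> isframe f' (fun u => map_mx g (W u)).
Proof.
move=> E [h1 h2]; split; first by rewrite E; exact: weyl_map.
by move=> B KB u; apply: tinv_ext (tinv_map g (h2 B KB u)) => i j k; rewrite E.
Qed.

Lemma isframe_eq (S : comPzRingType) (f f' : {rmorphism R -> S}) W W' :
  (forall r, f r = f' r) -> (forall u, W u = W' u) -> isframe f W -> isframe f' W'.
Proof.
move=> E EW [h1 h2]; split; first by rewrite -E; exact: weyl_eq h1.
by move=> B KB u; rewrite -EW; apply: tinv_ext (h2 B KB u) => i j k; rewrite E.
Qed.

Record frameRing (T : comPzRingType) (s : {rmorphism R -> T}) (W : 'cV['F_3]_2 -> 'M[T]_3) : Prop := {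
  fr_frame : isframe s W;
  fr_univ : forall (S : comPzRingType) (f : {rmorphism R -> S}) W', isframe f W' ->
    exists g : {rmorphism T -> S}, (forall r, g (s r) = f r) /\ forall u, map_mx g (W u) = W' u;
  fr_uniq : forall (S : comPzRingType) (g g' : {rmorphism T -> S}),
    (forall r, g (s r) = g' (s r)) -> (forall u, map_mx g (W u) = map_mx g' (W u)) -> g =1 g' }.

Section Construction.
Let I := ('cV['F_3]_2 * 'I_3 * 'I_3)%type.
Let M := {mpoly R[#|{: I}|]}.
Let c : {rmorphism R -> M} := @mpolyC #|{: I}| R.
Let X u : 'M[M]_3 := \matrix_(i, j) 'X_(enum_rank ((u, i, j) : I)).

Let good (S : comPzRingType) (f : {rmorphism M -> S}) := isframe (f \o c) (fun u => map_mx f (X u)).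

(** The relations are not listed: the ideal consists of the polynomials killed by every map that
    makes the variables a frame. Such maps factor through the quotient at once, and the quotient
    carries a frame because the conditions are equations. *)
Let id0 x := forall (S : comPzRingType) (f : {rmorphism M -> S}), good f -> f x = 0.

Let d : fracData M.
Proof.
apply: (@FracData M (fun s => s = 1) id0) => //.
- by move=> s t -> ->; rewrite mulr1.
- by move=> S f _; rewrite rmorph0.
- by move=> x y hx hy S f gf; rewrite rmorphD (hx _ _ gf) (hy _ _ gf) addr0.
- by move=> a x hx S f gf; rewrite rmorphM (hx _ _ gf) mulr0.
Defined.

Let pi : {rmorphism M -> fracRing d} := fconst d.

Let pi_eq x y : (forall (S : comPzRingType) (f : {rmorphism M -> S}), good f -> f x = f y) -> pi x = pi y.
Proof.
move=> E; apply/eqP; rewrite -subr_eq0 -rmorphB; apply/eqP/fconst_eq0; exists 1 => //.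
by move=> S f gf; rewrite mul1r rmorphB (E _ _ gf) subrr.
Qed.

Let pi_mx (A B : 'M[M]_3) : (forall (S : comPzRingType) (f : {rmorphism M -> S}), good f ->
  map_mx f A = map_mx f B) -> map_mx pi A = map_mx pi B.
Proof.
move=> E; apply/matrixP => i j; rewrite [LHS]mxE [RHS]mxE; apply: pi_eq => S f /E/matrixP/(_ i j).
by rewrite [LHS]mxE [RHS]mxE.
Qed.

Let good_lift (S : comPzRingType) (f : {rmorphism R -> S}) W' : isframe f W' ->
  exists g : {rmorphism M -> S}, (forall r, g (c r) = f r) /\ forall u, map_mx g (X u) = W' u.
Proof.
move=> h; have [z|nz] := eqVneq (1 : S) 0.
  have za : zmod_morphism (fun _ : M => 0 : S) by move=> x y; rewrite subr0.
  have zm : monoid_morphism (fun _ : M => 0 : S) by split=> [|x y]; rewrite ?mulr0 ?z.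
  pose A1 := GRing.isZmodMorphism.Build M S _ za.
  pose A2 := GRing.isMonoidMorphism.Build M S _ zm.
  pose g : {rmorphism M -> S} := HB.pack (fun _ : M => 0 : S) A1 A2.
  exists g; split=> [r|u]; first exact: (zero_ring_eq z).
  by apply/matrixP => i j; exact: (zero_ring_eq z).
pose S' : comNzRingType := nzOf nz.
pose f' : {rmorphism R -> S'} := f.
pose h' (k : 'I_#|{: I}|) : S' := let: (u, i, j) := enum_val k in W' u i j.
exists (mmap f' h' : {rmorphism M -> S'}); split=> [r|u].
  exact: (mmapC h' (f' : {additive R -> S'}) r).
apply/matrixP => i j; rewrite [LHS]mxE [X u i j]mxE.
apply: etrans (mmapX h' f' _) _; rewrite mmap1U /h' enum_rankK //.
Qed.

Lemma frameRing_ex : exists (T : comPzRingType) (s : {rmorphism R -> T}) W, frameRing s W.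
Proof.
exists (fracRing d), (pi \o c), (fun u => map_mx pi (X u)); split.
- split.
    split.
      have <- : map_mx pi 1%:M = 1%:M by exact: map_mx1.
      by apply: pi_mx => S f [[h _] _]; rewrite h map_mx1.
    move=> u v; rewrite /= -wp_map -wp_map -map_mxM -map_mxZ.
    apply: pi_mx => S f [[_ h] _]; apply: etrans (map_mxM f _ _) _; apply: etrans (h u v) _.
    by rewrite map_mxZ !wp_map.
  move=> B KB u; apply/tinvP => i j k; rewrite -[RHS]/(pi (c (B i j k))).
  rewrite -(tcomp_map pi (tmap c B)); apply: pi_eq => S f [_ h].
  by rewrite tcomp_map; have /tinvP := h B KB u; apply.
- move=> S f W' /[dup] h /good_lift[g [gc gX]].
  have gg : good g by apply: isframe_eq h => [r|u]; rewrite ?gX// -gc.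
  have gI x : fid d x -> g x = 0 by move=> /(_ _ _ gg).
  have gM s : fden d s -> exists t, t * g s = 1 by move=> ->; exists 1; rewrite rmorph1 mulr1.
  exists (frac_lift gI gM); split=> [r|u]; first exact: etrans (frac_liftE _ _ _) (gc r).
  rewrite -gX; apply/matrixP => i j; rewrite [LHS]mxE [map_mx pi _ _ _]mxE [RHS]mxE; exact: frac_liftE.
- move=> S g g' E1 E2; apply: frac_hom_eq.
  apply: (@mpoly_hom_eq _ _ _ (g \o pi) (g' \o pi)) => [r|k]; first exact: E1.
  have := E2 (enum_val k).1.1 => /matrixP/(_ (enum_val k).1.2 (enum_val k).2).
  rewrite [LHS]mxE [RHS]mxE [map_mx pi _ _ _]mxE [X _ _ _]mxE.
  by rewrite -!surjective_pairing enum_valK.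
Qed.

End Construction.

End FrameRing.

Lemma isframe_fact (R : comNzRingType) (w : R) K (S : comPzRingType) (f : {rmorphism R -> S}) W g :
  cube_root w -> (forall B, K B -> tsym B) ->
  isframe w K f W -> isframe w K f (fact (f w) g W).
Proof.
move=> w1 Ks [h1 h2]; split; first exact: (fact_weyl (cube_root_map f w1) g h1).
by move=> B KB u; apply: tinv_wp; [exact: cube_root_map|exact: (tsym_map f (Ks _ KB))|exact: h2].
Qed.

Section FrameRingTheory.
Variables (R : comNzRingType) (w i6 : R) (K : ('I_3 -> 'I_3 -> 'I_3 -> R) -> Prop).
Hypotheses (w1 : cube_root w) (h6 : 6%:R * i6 = 1)
  (R0 : forall (k : fieldType) (chi : {rmorphism R -> k}), char0 k)
  (Ksym : forall B, K B -> tsym B)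
  (Kgen : forall (k : fieldType) (chi : {rmorphism R -> k}), exists B0 s, [/\ K B0, chi s != 0,
     forall B, K B -> exists r, forall i j l, s * B i j l = r * B0 i j l
     & forall (k' : fieldType) (g : {rmorphism R -> k'}), g s != 0 -> smooth3 (tmap g B0)]).
Variables (T : comPzRingType) (s : {rmorphism R -> T}) (W : 'cV['F_3]_2 -> 'M[T]_3).
Hypothesis fr : frameRing w K s W.

Let ww := cube_root_map s w1.
Let i3 := s (2%:R * i6).
Let h3 : 3%:R * i3 = 1.
Proof. by rewrite -(rmorph_nat s) -rmorphM mulrA -natrM h6 rmorph1. Qed.

Lemma frameRing_act_ex g : exists a : {rmorphism T -> T},
  (forall r, a (s r) = s r) /\ forall u, map_mx a (W u) = fact (s w) g W u.
Proof. by apply: (fr_univ fr); apply: isframe_fact w1 Ksym _; exact: fr_frame fr. Qed.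

Definition fr_act g := sval (cid (frameRing_act_ex g)).
Lemma fr_act_str g r : fr_act g (s r) = s r.
Proof. exact: (svalP (cid (frameRing_act_ex g))).1. Qed.
Lemma fr_act_frame g u : map_mx (fr_act g) (W u) = fact (s w) g W u.
Proof. exact: (svalP (cid (frameRing_act_ex g))).2. Qed.

Lemma fr_act1 x : fr_act 1%g x = x.
Proof.
apply: (fr_uniq fr (g := fr_act 1%g) (g' := idfun)) => [r|u]; first exact: fr_act_str.
by rewrite fr_act_frame fact1 map_mx_id.
Qed.

Lemma fr_actM g h x : fr_act (g * h)%g x = fr_act g (fr_act h x).
Proof.
apply: (fr_uniq fr (g := fr_act (g * h)%g) (g' := fr_act g \o fr_act h)) => [r|u]; first by rewrite /= !fr_act_str.
transitivity (map_mx (fr_act g) (map_mx (fr_act h) (W u))); last first.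
  by apply/matrixP => i j; rewrite !mxE.
rewrite !fr_act_frame (factM ww) fact_map fr_act_str.
by apply: fact_ext => v; rewrite fr_act_frame.
Qed.

(** As a function of g this comes from T (x) T. Since W(v) has trace 0 for v nonzero, it is 0 unless
    the linear part of g fixes u, and then it is a character of the translation part. *)
Let tw u g := i3 * \tr (W (- u) *m map_mx (fr_act g) (W u)).

Let twE u (g : ASL2F3) : tw u g = if val g.2 *m u == u then wp (s w) (det2 g.1 u) else 0.
Proof.
have [Wy _] := fr_frame fr.
rewrite /tw fr_act_frame /fact -scalemxAr (proj2 Wy) scalerA.
case: eqP => [->|ne].
  rewrite addNr (proj1 Wy) mxtraceZ mxtrace1 -wpD// -scaleN1r det2Zl det2uu mulr0 addr0.
  by transitivity ((3%:R * i3) * wp (s w) (det2 g.1 u)); [ring|rewrite h3 mul1r].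
rewrite mxtraceZ (weyl_tr ww h3 Wy) ?mulr0//.
by rewrite addrC subr_eq0; apply/eqP.
Qed.

Let tw_tens u : tensfun fr_act (tw u).
Proof.
apply: tensfunZ; apply: tensfun_sum => i.
apply: tensfun_ext (tensfun_sum (F := fun j g => W (- u) i j * fr_act g (W u j i)) _) => [g|j].
  by rewrite mxE; apply: eq_bigr => j _; rewrite !mxE.
exact: tensfun_pure.
Qed.

Let wp_sum x : wp (s w) x + wp (s w) x * wp (s w) x + wp (s w) x * wp (s w) x * wp (s w) x =
  if x == 0 then 3%:R else 0.
Proof.
elim/F3_ind: x; rewrite ?wp0 ?wp1 ?(wp2 ww) /=.
- by ring.
- by ring: (cube_root_sq ww).
- by ring: (cube_root_sq ww).
Qed.

(** For a cube root of unity x, (x + x^2 + x^3)/3 is the indicator of x = 1; at x = 0 it is 0. *)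
Let d u g := i3 * (tw u g + tw u g * tw u g + tw u g * tw u g * tw u g).

Let dE u (g : ASL2F3) : d u g = if (val g.2 *m u == u) && (det2 g.1 u == 0) then 1 else 0.
Proof.
rewrite /d twE; case: eqP => _ /=; last by rewrite !mul0r !addr0 mulr0.
by rewrite wp_sum; case: eqP => _; rewrite ?mulr0// mulrC.
Qed.

(** The indicators attached to the two basis vectors multiply to that of g = 1: the linear part
    fixes both vectors and the translation pairs to 0 with both. *)
Lemma frameRing_dual : exists n (a b : 'I_n -> T),
  forall g, \sum_j a j * fr_act g (b j) = if g == 1%g then 1 else 0.
Proof.
have d_tens u : tensfun fr_act (d u).
  apply: tensfunZ; have F := tw_tens u.
  exact: (tensfunD (tensfunD F (tensfunM F F)) (tensfunM (tensfunM F F) F)).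
have [n [a [b E]]] := tensfun_dual (tensfunM (d_tens (vec2 1 0)) (d_tens (vec2 0 1))).
exists n, a, b => g; rewrite E !dE.
have -> : (g == 1%g) = [&& val g.2 *m vec2 1 0 == vec2 1 0, det2 g.1 (vec2 1 0) == 0,
    val g.2 *m vec2 0 1 == vec2 0 1 & det2 g.1 (vec2 0 1) == 0].
  apply/eqP/idP => [->|/and4P[/eqP A1 /eqP b1 /eqP A2 /eqP b2]].
    by rewrite /= !mul1mx /det2 !mxE !mul0r subr0 !eqxx.
  case: g A1 b1 A2 b2 {E} => b' A /= A1 b1 A2 b2; congr pair.
    move: b1 b2; rewrite /det2 !mxE /= !mulr0 !mulr1 sub0r subr0 => /eqP; rewrite oppr_eq0 => /eqP b1 b0.
    by rewrite (vec2E b') b0 b1; apply/matrixP => i j; rewrite !mxE; case: ifP.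
  apply: val_inj => /=; apply/matrixP => i j.
  have := congr1 (fun v : 'cV_2 => v i 0) A1; have := congr1 (fun v : 'cV_2 => v i 0) A2.
  rewrite !mul2E !mxE /= !mulr0 !mulr1 addr0 add0r => e2 e1.
  case: j => -[|[|//]] lj.
    by rewrite (_ : Ordinal lj = 0) ?e1; [case: eqP|exact/val_inj].
  rewrite (_ : Ordinal lj = 1) ?e2; last exact/val_inj.
  by case: i {e1 e2} => -[|[|//]] li.
by case: (_ == _) (_ == _) (_ == _) (_ == _) => -[] [] []; rewrite /= ?mulr0 ?mul0r ?mulr1.
Qed.

Lemma tri_scale (S : comPzRingType) (x y : S) B B' a b c :
  (forall i j k, x * B i j k = y * B' i j k) -> x * tri B a b c = y * tri B' a b c.
Proof.
move=> E; rewrite /tri !mulr_sumr; apply: eq_bigr => i _.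
rewrite !mulr_sumr; apply: eq_bigr => j _; rewrite !mulr_sumr; apply: eq_bigr => k _.
by rewrite !mulrA E.
Qed.

Lemma tinv_scale (S : comPzRingType) (x y : S) B B' M : invertible x ->
  (forall i j k, x * B i j k = y * B' i j k) -> tinv B' M -> tinv B M.
Proof.
move=> [x' xx] E h a b c; rewrite -[LHS]mul1r -[RHS]mul1r -xx -!mulrA.
by rewrite !(tri_scale _ _ _ E) h.
Qed.

Lemma local_generator (D : pring) (f : {rmorphism R -> D}) : plocal D ->
  exists B0, [/\ K B0, tsym (tmap f B0), smooth3 (tmap f B0)
    & forall (S : comPzRingType) (j : {rmorphism D -> S}) M, tinv (tmap (j \o f) B0) M ->
      forall B, K B -> tinv (tmap (j \o f) B) M].
Proof.
move=> Dl; have [B0 [x [KB x0 gen sm]]] := Kgen (pchi D \o f).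
have xu : invertible (f x) := Dl _ x0.
exists B0; split=> //; first exact: (tsym_map f (Ksym KB)).
  by move=> k' g v v0; apply: (sm k' (g \o f) (invertible_map g xu) k' idfun v v0).
move=> S j M hM B /gen[y hy].
have jx : invertible (j (f x)) by have [x' E] := xu; exists (j x'); rewrite -rmorphM E rmorph1.
by apply: (tinv_scale (x := j (f x)) (y := j (f y)) jx _ hM) => a b c /=; rewrite -!rmorphM hy.
Qed.

Lemma isframe_trans (D : pring) (f : {rmorphism R -> D}) W1 W2 : plocal D ->
  isframe w K f W1 -> isframe w K f W2 -> exists g, forall u, W2 u = fact (f w) g W1 u.
Proof.
move=> Dl [h1 h1'] [h2 h2']; have [B0 [KB sB smB _]] := local_generator f Dl.
have h3' : 3%:R * f (2%:R * i6) = 1 by rewrite -(rmorph_nat f) -rmorphM mulrA -natrM h6 rmorph1.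
apply: (frame_trans (cube_root_map f w1) h3' (h6_map f h6) Dl sB smB).
  by split=> // u; exact: h1'.
by split=> // u; exact: h2'.
Qed.

(** The existence of Hesse coordinates enters here: they carry the Schroedinger frame to the
    cubic. *)
Lemma isframe_local (k : fieldType) (chi : {rmorphism R -> k}) :
  exists (D : pring) (f : {rmorphism R -> D}) W', [/\ plocal D,
    pure_along f (fun r => chi r != 0) (fun x => pchi D x != 0) & isframe w K f W'].
Proof.
pose A0 := @Pring R k chi; have [D1 [i1 [D1l [_ D1p]]]] := pext_local A0.
have [B0 [KB sB smB gen]] := local_generator (i1 : {rmorphism R -> D1}) D1l.
have [D [i [Dl [_ Dp] [h [h' [al [be [hh' h'h H]]]]]]]] :=
  @hesse_basis_exists D1 (i1 w) (i1 i6) (tmap i1 B0) D1l (cube_root_map i1 w1) (h6_map i1 h6)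
  (R0 (pchi D1 \o i1)) sB smB.
pose f : {rmorphism R -> D} := i \o i1.
have h3' : 3%:R * f (2%:R * i6) = 1 by rewrite -(rmorph_nat f) -rmorphM mulrA -natrM h6 rmorph1.
have [f1 f2] := frame_hesse_basis (cube_root_map f w1) (tsym_map i sB) h'h hh' H.
exists D, f, (fun u => h *m weyl0 (f w) u *m h'); split=> //.
  exact: pure_along_comp D1p Dp.
by split=> // B KB' u; apply: gen => //; exact: f2.
Qed.

(** A scalar killed in the frame ring is killed in every ring with a frame, in particular in the
    local extensions, which are pure. *)
Lemma frameRing_inj : injective s.
Proof.
move=> x y E; apply/eqP; rewrite -subr_eq0; apply/eqP; apply: local_eq0 => k chi.
have [D [f [W' [Dl [D1 _] fW']]]] := isframe_local chi.
have [phi [phis _]] := fr_univ fr fW'.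
have [||t t0 tz] := D1 (x - y) 1; last by exists t.
  by rewrite rmorph1 oner_neq0.
by rewrite mul1r rmorphB -!phis E subrr.
Qed.

(* Over a local extension acquiring a frame an invariant element becomes the
   pullback of a scalar, because two frames are there conjugate; purity then
   brings the scalar back. *)
Lemma frameRing_fix x : (forall g, fr_act g x = x) -> exists r, s r = x.
Proof.
move=> xfix; suff [r Er] : exists r, s 1 * x = s r by exists r; rewrite -Er rmorph1 mul1r.
apply: (@ideal_unit R (fun a => exists r, s a * x = s r)).
- by exists 0; rewrite !rmorph0 mul0r.
- by move=> a b [r Er] [q Eq]; exists (r + q); rewrite !rmorphD mulrDl Er Eq.
- by move=> a b [r Er]; exists (a * r); rewrite !rmorphM -mulrA Er.
move=> k chi; have [D [f [W' [Dl [_ D2] fW']]]] := isframe_local chi.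
have [phi [phis phiW]] := fr_univ fr fW'.
have [T' [f' [al [E1 E2]]]] := D2 T s.
(* The universal frame and the local one give two maps from [T] to [T']; near each point of [T']
   they differ by some g, which fixes [x]. *)
suff Ex : al x = f' (phi x).
  have [||a [r [ra Ea]]] := E2 x 1 (phi x); last by exists a => //; exists r.
    by rewrite rmorph1 oner_neq0.
  by rewrite rmorph1 mul1r.
apply/eqP; rewrite -subr_eq0; apply/eqP; apply: local_eq0 => k' chi'.
have nz : (1 : T') != 0.
  by apply: contra_neq (oner_neq0 k') => E; rewrite -(rmorph1 chi') E rmorph0.
pose A0 := @Pring (nzOf nz) k' chi'.
have [E0 [e [El [_ [e1 _]]]]] := pext_local A0.
pose e' : {rmorphism T' -> E0} := e.
pose v : {rmorphism R -> E0} := e' \o (al \o s).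
have fr1 : isframe w K v (fun u => map_mx (e' \o al) (W u)).
  by apply: isframe_map (fr_frame fr).
have fr2 : isframe w K v (fun u => map_mx (e' \o f') (W' u)).
  by apply: isframe_map fW' => r; rewrite /= -E1.
have [g gE] := isframe_trans El fr1 fr2.
have Eg : e' (f' (phi x)) = e' (al (fr_act g x)).
  apply: (fr_uniq fr (g := e' \o (f' \o phi)) (g' := e' \o (al \o fr_act g))) => [r|u] /=.
    by rewrite fr_act_str phis E1.
  have -> : map_mx (e' \o (f' \o phi)) (W u) = map_mx (e' \o f') (W' u).
    by rewrite -phiW; apply/matrixP => i j; rewrite !mxE.
  have -> : map_mx (e' \o (al \o fr_act g)) (W u) = map_mx (e' \o al) (map_mx (fr_act g) (W u)).
    by apply/matrixP => i j; rewrite !mxE.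
  by rewrite gE fr_act_frame fact_map.
have [||t t0 tz] := e1 (al x - f' (phi x)) 1.
- by rewrite rmorph1 oner_neq0.
- by rewrite mul1r -[LHS]/(e' _) rmorphB Eg xfix subrr.
- by exists t.
Qed.

Theorem frameRing_fet : finite_etale s.
Proof.
have [n [a [b E]]] := frameRing_dual.
exact: (galois_finite_etale fr_act1 fr_actM fr_act_str frameRing_inj frameRing_fix E).
Qed.

End FrameRingTheory.

(** * Cubic forms and their polar tensors *)

Section CubicForms.
Variable R : comNzRingType.
Implicit Types (F G : {mpoly R[3]}) (B : 'I_3 -> 'I_3 -> 'I_3 -> R).

(* Six times the polar form of a cubic form. *)
Definition d3 F i j k : R := (((F^`M(i))^`M(j))^`M(k))@_0%MM.

Lemma d3_sym F : tsym (d3 F).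
Proof. by split=> i j k; rewrite /d3; [rewrite (mderiv_comm i)|rewrite (mderiv_comm j)]. Qed.

Lemma d3D F G i j k : d3 (F + G) i j k = d3 F i j k + d3 G i j k.
Proof. by rewrite /d3 !mderivD mcoeffD. Qed.

Lemma d3Z a F i j k : d3 (a *: F) i j k = a * d3 F i j k.
Proof. by rewrite /d3 !mderivZ mcoeffZ. Qed.

Lemma d3_0 i j k : d3 0 i j k = 0.
Proof. by rewrite /d3 !mderiv0 mcoeff0. Qed.

Lemma d3_sum (I : Type) (r : seq I) (P : pred I) (F : I -> {mpoly R[3]}) i j k :
  d3 (\sum_(a <- r | P a) F a) i j k = \sum_(a <- r | P a) d3 (F a) i j k.
Proof.
by apply: (big_morph (fun F => d3 F i j k)) => [F1 F2|]; rewrite ?d3D ?d3_0.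
Qed.

Lemma mderivXi (i a : 'I_3) : ('X_i : {mpoly R[3]})^`M(a) = ((i == a)%:R)%:MP.
Proof.
rewrite mderivX mnm1E eq_sym; case: eqP => [->|_]; last by rewrite scale0r.
rewrite (_ : (U_(i) - U_(i))%MM = 0%MM) ?mpolyX0 ?scale1r//.
by apply/mnmP => l; rewrite mnmBE subnn mnm0E.
Qed.

Lemma mdeg3P (m : 'X_{1..3}) : mdeg m = 3 -> exists i j k : 'I_3, m = (U_(i) + U_(j) + U_(k))%MM.
Proof.
have step (p : 'X_{1..3}) d : mdeg p = d.+1 -> exists i q, mdeg q = d /\ p = (q + U_(i))%MM.
  move=> pd; have [i pi] : exists i, p i != 0%N.
    apply/existsP; apply: contra_eqT pd; rewrite negb_exists => /forallP h.
    suff -> : p = 0%MM by rewrite mdeg0.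
    by apply/mnmP => i; rewrite mnm0E; apply/eqP; move: (h i); rewrite negbK.
  have le : (U_(i) <= p)%MM by rewrite lep1mP.
  exists i, (p - U_(i))%MM; rewrite submK//; split=> //.
  by have := congr1 mdeg (submK le); rewrite mdegD mdeg1 addn1 pd => /succn_inj.
move=> /step[i [m1 [/step[j [m2 [/step[k [m3 [/eqP]]]]]]]]].
by rewrite mdeg_eq0 => /eqP -> -> -> ->; exists k, j, i; rewrite add0m.
Qed.

Lemma d3_prod (p q r : {mpoly R[3]}) (x y z : 'I_3 -> R) a b c :
  (forall a, p^`M(a) = (x a)%:MP) -> (forall a, q^`M(a) = (y a)%:MP) ->
  (forall a, r^`M(a) = (z a)%:MP) ->
  d3 (p * q * r) a b c = x a * y b * z c + x a * z b * y c + y a * x b * z c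
    + y a * z b * x c + z a * x b * y c + z a * y b * x c.
Proof.
move=> hp hq hr; rewrite /d3 !(mderivM, mderivD, mderivC, hp, hq, hr).
rewrite [X in X@_0%MM](_ : _ = (x a * y b * z c + x a * z b * y c + y a * x b * z c
    + y a * z b * x c + z a * x b * y c + z a * y b * x c)%:MP); first by rewrite mcoeffC eqxx mulr1.
by rewrite !rmorphD !rmorphM; ring.
Qed.

Lemma tri_prod (S : comPzRingType) (x y z : 'I_3 -> S) (v : 'cV[S]_3) :
  tri (fun i j k => x i * y j * z k) v v v =
  (\sum_i x i * v i 0) * (\sum_i y i * v i 0) * (\sum_i z i * v i 0).
Proof. by rewrite /tri !sum3; ring. Qed.

(** Euler's formula. An arbitrary homomorphism [phi] covers evaluation, substitution and restriction
    to a line at once; products of three variables suffice. *)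
Lemma homog_eval F (S : comPzRingType) (phi : {rmorphism {mpoly R[3]} -> S}) : F \is 3.-homog ->
  let x := \col_i phi 'X_i in
  6%:R * phi F = tri (fun i j k => phi (d3 F i j k)%:MP) x x x.
Proof.
move=> hF x.
have key m : m \in msupp F -> 6%:R * phi 'X_[m] = tri (fun i j k => phi (d3 'X_[m] i j k)%:MP) x x x.
  move=> /(dhomog_mf hF) /= /mdeg3P[i [j [k ->]]]; rewrite !mpolyXD.
  pose d (i a : 'I_3) : S := (i == a)%:R.
  have dx l : \sum_a d l a * x a 0 = phi 'X_l.
    rewrite (bigD1 l)//= big1 ?addr0 => [|a ne]; rewrite mxE /d ?eqxx ?mul1r//.
    by rewrite eq_sym (negPf ne) mul0r.
  have E a b c : phi (d3 ('X_i * 'X_j * 'X_k) a b c)%:MP =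
     d i a * d j b * d k c + d i a * d k b * d j c + d j a * d i b * d k c
    + d j a * d k b * d i c + d k a * d i b * d j c + d k a * d j b * d i c.
    rewrite (d3_prod _ _ _ (mderivXi i) (mderivXi j) (mderivXi k)).
    pose psi : {rmorphism R -> S} := phi \o @mpolyC 3 R.
    by rewrite -[LHS]/(psi _) !rmorphD !rmorphM !rmorph_nat.
  rewrite (eq_tri _ _ _ E) !rmorphM -!dx.
  have triD (B B' : 'I_3 -> 'I_3 -> 'I_3 -> S) : tri (fun i j k => B i j k + B' i j k) x x x =
      tri B x x x + tri B' x x x.
    rewrite /tri -big_split; apply: eq_bigr => a _; rewrite -big_split.
    by apply: eq_bigr => b _; rewrite -big_split; apply: eq_bigr => c _; rewrite mulrDl.
  rewrite !triD.
  have P i' j' k' : tri (fun a b c => d i' a * d j' b * d k' c) x x x =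
      phi 'X_i' * phi 'X_j' * phi 'X_k' by rewrite tri_prod !dx.
  rewrite (P i j k) (P j i k) (P k i j) (P k j i).
  have -> : tri (fun a b c => d i a * d k b * d j c) x x x = phi 'X_i * phi 'X_k * phi 'X_j by exact: P.
  have -> : tri (fun a b c => d j a * d k b * d i c) x x x = phi 'X_j * phi 'X_k * phi 'X_i by exact: P.
  by rewrite !dx; ring.
transitivity (\sum_(m <- msupp F) phi (F@_m)%:MP * (6%:R * phi 'X_[m])).
  rewrite {1}(mpolyE F) rmorph_sum mulr_sumr; apply: eq_bigr => m _.
  by rewrite -mul_mpolyC rmorphM mulrCA.
transitivity (\sum_(m <- msupp F) phi (F@_m)%:MP * tri (fun i j k => phi (d3 'X_[m] i j k)%:MP) x x x).
  by rewrite [LHS]big_seq [RHS]big_seq; apply: eq_bigr => m /key ->.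
transitivity (\sum_(m <- msupp F) tri (fun i j k => phi (d3 (F@_m *: 'X_[m]) i j k)%:MP) x x x).
  apply: eq_bigr => m _; rewrite -[RHS]mul1r; apply: tri_scale => i j k.
  by rewrite mul1r d3Z !rmorphM.
have E i j k : phi (d3 F i j k)%:MP = \sum_(m <- msupp F) phi (d3 (F@_m *: 'X_[m]) i j k)%:MP.
  by rewrite {1}(mpolyE F) d3_sum !rmorph_sum.
rewrite (eq_tri _ _ _ E) /tri exchange_big; apply: eq_bigr => i _.
rewrite exchange_big; apply: eq_bigr => j _; rewrite exchange_big; apply: eq_bigr => k _.
by rewrite mulr_suml.
Qed.

Lemma homog_meval F (v : 'cV[R]_3) : F \is 3.-homog ->
  6%:R * F.@[fun i => v i 0] = tri (d3 F) v v v.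
Proof.
move=> hF; have := homog_eval (meval (fun i => v i 0) : {rmorphism {mpoly R[3]} -> R}) hF.
move=> /= ->; have -> : \col_i (('X_i : {mpoly R[3]}).@[fun i => v i 0]) = v.
  by apply/matrixP => i j; rewrite ord1 mxE mevalXU.
by apply: eq_tri => i j k; rewrite mevalC.
Qed.

Lemma homog_mderiv F (v : 'cV[R]_3) i : F \is 3.-homog ->
  6%:R * F^`M(i).@[fun i => v i 0] = 3%:R * tri (d3 F) v v (bas i).
Proof.
move=> hF; pose B := d3 F; have sB : tsym B := d3_sym F.
have E : 6%:R * F = \sum_a \sum_b \sum_c (B a b c)%:MP * ('X_a * 'X_b * 'X_c).
  rewrite (homog_eval idfun hF) /tri.
  by apply: eq_bigr => a _; apply: eq_bigr => b _; apply: eq_bigr => c _; rewrite !mxE.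
have -> : 6%:R * F^`M(i).@[fun i => v i 0] = ((6%:R * F)^`M(i)).@[fun i => v i 0].
  by rewrite -mpolyC_nat mderiv_mulC mevalM mevalC.
pose D p := (p^`M(i)).@[fun i => v i 0].
have D_sum (G : 'I_3 -> {mpoly R[3]}) : D (\sum_j G j) = \sum_j D (G j).
  by apply: (big_morph D) => [p q|]; rewrite /D ?mderivD ?mevalD// mderiv0 meval0.
rewrite E -/(D _) D_sum.
transitivity (tri B (bas i) v v + tri B v (bas i) v + tri B v v (bas i)); last first.
  by rewrite (triC v (bas i) v sB) (triC (bas i) v v sB) (triA v (bas i) v sB); ring.
rewrite /tri -!big_split; apply: eq_bigr => a _; rewrite D_sum -!big_split.
apply: eq_bigr => b _; rewrite D_sum -!big_split; apply: eq_bigr => c _.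
rewrite /D mderiv_mulC !mderivM !mderivXi !mevalM !mevalD !mevalM !mevalD !mevalM !mevalC !mevalXU !mxE /=; ring.
Qed.

Lemma d3_subst F (h : 'M[R]_3) (i6 : R) i j k : 6%:R * i6 = 1 -> F \is 3.-homog ->
  let G := F \mPo [tuple \sum_(b < 3) h a b *: 'X_b | a < 3] in
  G \is 3.-homog -> d3 G i j k = tcomp (d3 F) h i j k.
Proof.
move=> h6 hF G hG; apply: tri_ext => a b c.
apply: (polarize h6); [exact: d3_sym|exact/tsym_comp/d3_sym|move=> v].
rewrite tri_comp -!homog_meval//; congr (_ * _); rewrite /G comp_mpoly_meval.
apply: meval_eq => l; rewrite tnth_mktuple raddf_sum mxE.
by apply: eq_bigr => m _; rewrite /= mevalZ mevalXU.
Qed.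

Lemma homog_contact F (v w : 'cV[R]_3) i : F \is 3.-homog ->
  6%:R * (mmap polyC (fun j => (v j 0)%:P + w j 0 *: 'X) F)`_i =
  nth 0 [:: tri (d3 F) v v v; 3%:R * tri (d3 F) v v w; 3%:R * tri (d3 F) v w w; tri (d3 F) w w w] i.
Proof.
move=> hF; set phi := mmap _ _.
have E := homog_eval (phi : {rmorphism {mpoly R[3]} -> {poly R}}) hF.
have -> : 6%:R * (phi F)`_i = (6%:R * phi F)`_i by rewrite -polyC_natr coefCM.
rewrite E; have -> : \col_i phi 'X_i = map_mx polyC v + 'X *: map_mx polyC w.
  by apply/matrixP => a b; rewrite ord1 !mxE /phi mmapX mmap1U mulrC mul_polyC.
rewrite (eq_tri (B' := tmap polyC (d3 F))) => [|a b c]; last exact: (mmapC _ (polyC : {additive R -> {poly R}}) _).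
rewrite tri_line; last exact: tsym_map (d3_sym F).
rewrite -!tri_map -polyC_natr -!rmorphM !coefD !coefCM coefXn coefXn coefX coefC.
by case: i => [|[|[|[|i]]]] /=; rewrite ?(mulr0, mulr1, add0r, addr0)// nth_nil.
Qed.

End CubicForms.

Lemma d3_map (R S : comNzRingType) (f : {rmorphism R -> S}) F i j k :
  d3 (map_mpoly f F) i j k = f (d3 F i j k).
Proof. by rewrite /d3 !mcoeff_mderiv mcoeff_map_mpoly !rmorphMn. Qed.

Lemma map_homog (R S : comNzRingType) (f : {rmorphism R -> S}) (F : {mpoly R[3]}) :
  F \is 3.-homog -> map_mpoly f F \is 3.-homog.
Proof.
move=> hF; apply/dhomogP => m; rewrite mcoeff_msupp mcoeff_map_mpoly => h.
apply: (dhomog_mf hF); rewrite mcoeff_msupp.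
by apply: contraNneq h => ->; apply/eqP; exact: (rmorph0 f).
Qed.

Definition mklin (R : comNzRingType) (V : lmodType R) (f : V -> R^o) (h : linear f) : {linear V -> R^o} :=
  HB.pack f (GRing.isLinear.Build R V R^o *:%R f h).

Local Notation span := Defs.span.

Lemma span_ideal (R : comNzRingType) (P : R -> Prop) (k : fieldType) (chi : {rmorphism R -> k}) :
  span (V := R^o) P 1 -> exists2 r, P r & chi r != 0.
Proof.
move=> [n [c [v [hv E]]]]; apply: contrapT => N; have := oner_neq0 k.
rewrite -(rmorph1 chi) -[X in chi X]/(1 : R^o) E rmorph_sum big1 ?eqxx// => i _.
rewrite -[c i *: v i]/(c i * v i) rmorphM; apply/eqP; rewrite mulf_eq0; apply/orP; right.
by apply: contrapT => /negP h; apply: N; exists (v i).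
Qed.

(** * Lines of forms, lines of matrices and the transport of frames *)

Section CubicLine.
Variables (C : fieldType) (R : comAlgType C) (a : cubic R).

Definition tensors (B : 'I_3 -> 'I_3 -> 'I_3 -> R) := exists2 F, ceq a F & B = d3 F.

Lemma mcoeff_linear (m : 'X_{1..3}) : linear (mcoeff m : {mpoly R[3]} -> R^o).
Proof. by move=> x p q; rewrite mcoeffD mcoeffZ. Qed.

Lemma cubic_prop F G m m' : ceq a F -> ceq a G -> F@_m * G@_m' = G@_m * F@_m'.
Proof.
move=> hF hG.
exact: (pp_rank_le1 (sc_point (ceqP a)) (mklin (mcoeff_linear m)) (mklin (mcoeff_linear m')) hF hG).
Qed.

(** The line of forms need not be free; near each point one form generates it up to the denominator
    [s]. *)
Lemma cubic_gen (k : fieldType) (chi : {rmorphism R -> k}) : exists F0 s, [/\ ceq a F0, chi s != 0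
  & forall F, ceq a F -> exists r, s *: F = r *: F0].
Proof.
have [s [l [F0 [hF0 Es]]] s0] := span_ideal chi (pp_rank_ge1 (sc_point (ceqP a))).
exists F0, s; split=> // F hF; exists (l F); apply/mpolyP => m.
by rewrite !mcoeffZ Es (pp_rank_le1 (sc_point (ceqP a)) l (mklin (mcoeff_linear m)) hF0 hF).
Qed.

Lemma tensors_sym B : tensors B -> tsym B.
Proof. by move=> [F _ ->]; exact: d3_sym. Qed.

Lemma ceq_homog F : ceq a F -> F \is 3.-homog.
Proof. exact: sc_homog (ceqP a) F. Qed.

Hypothesis C0 : char0 C.

Lemma alg_char0 (k : fieldType) (chi : {rmorphism R -> k}) : char0 k.
Proof.
move=> n n0; have := C0 n0; rewrite -(fmorph_eq0 (chi \o (in_alg R : {rmorphism C -> R}))).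
by rewrite rmorph_nat.
Qed.

Lemma h6A : 6%:R * (6%:R^-1 : C)%:A = 1 :> R.
Proof. by apply: (h6_map (in_alg R)); rewrite divff// C0. Qed.

Lemma tensors_gen (k : fieldType) (chi : {rmorphism R -> k}) : exists B0 s, [/\ tensors B0, chi s != 0,
     forall B, tensors B -> exists r, forall i j l, s * B i j l = r * B0 i j l
     & forall (k' : fieldType) (g : {rmorphism R -> k'}), g s != 0 -> smooth3 (tmap g B0)].
Proof.
have [F0 [s [hF0 s0 gen]]] := cubic_gen chi.
exists (d3 F0), s; split=> //; first by exists F0.
  move=> B [F hF ->]; have [r E] := gen F hF; exists r => i j l.
  by rewrite -!d3Z E.
move=> k' g gs k1 g1 v v0; apply: contrapT => N.
have {}N c : tri (tmap g1 (tmap g (d3 F0))) v v c = 0.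
  by apply/eqP; apply: contrapT => /negP h; apply: N; exists c.
pose gg : {rmorphism R -> k1} := g1 \o g.
have gg0 : gg s != 0 by rewrite /= fmorph_eq0.
have k10 := alg_char0 gg.
apply: (sc_smooth (ceqP a) (g := gg) (v := fun i => v i 0)).
  apply: contrapT => h; case/eqP: v0; apply/matrixP => i j; rewrite ord1 mxE.
  by apply/eqP; apply: contrapT => /negP vi; apply: h; exists i.
move=> F hF; have hg : map_mpoly gg F \is 3.-homog := map_homog gg (ceq_homog hF).
have [r Er] := gen F hF.
have N' c : tri (d3 (map_mpoly gg F)) v v c = 0.
  apply/eqP; rewrite -(mulrI_eq0 _ (mulfI gg0)); apply/eqP.
  have E i j l : gg s * d3 (map_mpoly gg F) i j l = gg r * tmap gg (d3 F0) i j l.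
    by rewrite d3_map -!rmorphM -!d3Z Er.
  by rewrite (tri_scale _ _ _ E) -[tri _ v v c]/(tri (tmap g1 (tmap g (d3 F0))) v v c) N mulr0.
split.
  apply/eqP; rewrite -(mulrI_eq0 _ (mulfI (k10 6%N isT))); apply/eqP.
  by rewrite homog_meval.
move=> i; apply/eqP; rewrite -(mulrI_eq0 _ (mulfI (k10 6%N isT))); apply/eqP.
by rewrite homog_mderiv// N' mulr0.
Qed.

End CubicLine.

Section MatrixLine.
Variables (C : fieldType) (S : comAlgType C) (H : classical_sets.set 'M[S]_3).
Hypothesis hH : pgl3 H.

Lemma mx_entry_linear i j : linear (fun h : 'M[S]_3 => h i j : S^o).
Proof. by move=> x p q; rewrite !mxE. Qed.

Lemma pgl_prop h h' i j k l : H h -> H h' -> h i j * h' k l = h' i j * h k l.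
Proof.
move=> h1 h2.
exact: (pp_rank_le1 (pgl_point hH) (mklin (mx_entry_linear i j)) (mklin (mx_entry_linear k l)) h1 h2).
Qed.

Lemma pgl_unit (k : fieldType) (chi : {rmorphism S -> k}) : exists2 h, H h & chi (\det h) != 0.
Proof. by have [r [h [hh ->]] r0] := span_ideal chi (pgl_det hH); exists h. Qed.

Variables (T : comPzRingType) (s : {rmorphism S -> T}).
Local Notation "h ^s" := (map_mx s h) (at level 2, format "h ^s").

Lemma pgl_inj_r n (N : 'M[T]_(n, 3)) : (forall h, H h -> N *m h^s = 0) -> N = 0.
Proof.
move=> N0; apply/matrixP => i j; rewrite [RHS]mxE; apply: local_eq0 => k chi.
have [h hh d0] := pgl_unit (chi \o s); exists (s (\det h)) => //.
have := congr1 (fun M => M *m \adj h^s) (N0 h hh); rewrite mul0mx -mulmxA mul_mx_adj det_map_mx mul_mx_scalar.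
by move/matrixP/(_ i j); rewrite !mxE.
Qed.

Lemma pgl_inj_l n (N : 'M[T]_(3, n)) : (forall h, H h -> h^s *m N = 0) -> N = 0.
Proof.
move=> N0; apply/matrixP => i j; rewrite [RHS]mxE; apply: local_eq0 => k chi.
have [h hh d0] := pgl_unit (chi \o s); exists (s (\det h)) => //.
have := congr1 (mulmx (\adj h^s)) (N0 h hh); rewrite mulmx0 mulmxA mul_adj_mx det_map_mx mul_scalar_mx.
by move/matrixP/(_ i j); rewrite !mxE.
Qed.

Lemma pgl_eq_r n (N N' : 'M[T]_(n, 3)) : (forall h, H h -> N *m h^s = N' *m h^s) -> N = N'.
Proof.
by move=> E; apply/eqP; rewrite -subr_eq0; apply/eqP/pgl_inj_r => h hh; rewrite mulmxBl E// subrr.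
Qed.

Lemma pgl_eq_l n (N N' : 'M[T]_(3, n)) : (forall h, H h -> h^s *m N = h^s *m N') -> N = N'.
Proof.
by move=> E; apply/eqP; rewrite -subr_eq0; apply/eqP/pgl_inj_l => h hh; rewrite mulmxBr E// subrr.
Qed.

(** Two matrices of the line are locally multiples of one matrix, which their quadratic relations
    express without a generator. *)
Lemma pgl_swap h h' (X : 'M[T]_3) : H h -> H h' -> h^s *m X *m h'^s = h'^s *m X *m h^s.
Proof.
move=> h1 h2; apply/matrixP => i j; rewrite !mxE; apply: eq_bigr => l _.
rewrite !mxE !mulr_suml; apply: eq_bigr => m _; rewrite !mxE.
by rewrite mulrAC -rmorphM (pgl_prop i m l j h1 h2) rmorphM mulrAC.
Qed.

Lemma pgl_sum : exists n (c : 'I_n -> T) (h : 'I_n -> 'M[S]_3),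
  (forall i, H (h i)) /\ \sum_i c i * s (\det (h i)) = 1.
Proof.
have [n [c [v [hv E]]]] := pgl_det hH; have [h hP] := choice hv.
exists n, (fun i => s (c i)), h; split=> [i|]; first by have [] := hP i.
rewrite -(rmorph1 s) -[X in s X]/(1 : S^o) E rmorph_sum; apply: eq_bigr => i _.
by have [_ <-] := hP i; rewrite -rmorphM.
Qed.

(** Conjugation by a line of matrices is defined without a generator: the products h M adj(h) are
    combined by means of a relation sum_i c_i det(h_i) = 1. *)
Lemma pgl_conj (M : 'M[T]_3) : exists N, forall h, H h -> N *m h^s = h^s *m M.
Proof.
have [n [c [g [hg E]]]] := pgl_sum.
exists (\sum_i c i *: ((g i)^s *m (M *m \adj (g i)^s))) => h hh.
rewrite mulmx_suml -[RHS]scale1r -E scaler_suml; apply: eq_bigr => i _.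
rewrite -scalemxAl pgl_swap// -!mulmxA mul_adj_mx mulmxA mul_mx_scalar det_map_mx.
by rewrite scalerA.
Qed.

Lemma pgl_conjV (P : 'M[T]_3) : exists Q, forall h, H h -> h^s *m Q = P *m h^s.
Proof.
have [n [c [g [hg E]]]] := pgl_sum.
exists (\sum_i c i *: (\adj (g i)^s *m P *m (g i)^s)) => h hh.
rewrite mulmx_sumr -[RHS]scale1r -E scaler_suml; apply: eq_bigr => i _.
rewrite -scalemxAr -[LHS]/(c i *: (h^s *m (_ *m _))) mulmxA pgl_swap// !mulmxA mul_mx_adj mul_scalar_mx det_map_mx.
by rewrite -scalemxAl scalerA.
Qed.

End MatrixLine.

Section FrameTransport.
Variables (C : fieldType) (C0 : char0 C) (w0 : C) (hw : cube_root w0).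

Definition isf (R : comAlgType C) (a : cubic R) (S : comPzRingType) (f : {rmorphism R -> S}) W :=
  isframe (w0%:A : R) (tensors a) f W.

Variables (R S : comAlgType C) (f : {lrmorphism R -> S}) (b : cubic S) (a : cubic R) (u : cubic_hom f b a).
Variables (T : comPzRingType) (s : {rmorphism S -> T}) (p : {rmorphism R -> T}).
Hypothesis sf : forall r, p r = s (f r).
Local Notation "h ^s" := (map_mx s h) (at level 2, format "h ^s").

Let sw : s (w0%:A : S) = p (w0%:A : R). Proof. by rewrite sf rmorph_alg. Qed.

Lemma subst_tensor F h i j k : ceq a F -> chmx u h ->
  d3 (subst_form (map_mpoly f F) h) i j k = tcomp (tmap f (d3 F)) h i j k.
Proof.
move=> hF hh; have hG := ceq_homog (chmx_cubic hF hh).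
apply: etrans (d3_subst i j k (h6A S C0) (map_homog f (ceq_homog hF)) hG) _.
by apply: tcomp_ext => x y z; rewrite d3_map.
Qed.

Lemma subst_tensor_tri F h x y z : ceq a F -> chmx u h ->
  tri (tmap s (d3 (subst_form (map_mpoly f F) h))) x y z =
  tri (tmap p (d3 F)) (h^s *m x) (h^s *m y) (h^s *m z).
Proof.
move=> hF hh; rewrite -tri_comp; apply: eq_tri => i j k.
rewrite subst_tensor// tcomp_map; apply: tcomp_ext => i' j' k'; by rewrite sf.
Qed.

Lemma frame_pull V : isf b s V ->
  exists W, isf a p W /\ forall h v, chmx u h -> W v *m h^s = h^s *m V v.
Proof.
move=> [[V0 VM] VI].
have [W hW] := choice (fun v => pgl_conj (chmxP u) s (V v)).
exists W; split=> [|h v hh]; last exact: hW.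
split; first split.
- by apply: (pgl_eq_r (chmxP u) (s := s)) => h hh; rewrite hW// V0 mulmx1 mul1mx.
- move=> x y; apply: (pgl_eq_r (chmxP u) (s := s)) => h hh.
  by rewrite -mulmxA !hW// mulmxA hW// -mulmxA VM sw -scalemxAr -scalemxAl hW.
move=> B [F hF ->] v x y z; apply/eqP; rewrite -subr_eq0; apply/eqP; apply: local_eq0 => k chi.
have [h hh d0] := pgl_unit (chmxP u) (chi \o s); pose d := s (\det h).
exists (d * d * d); last by rewrite !rmorphM !mulf_neq0.
have := VI _ (ex_intro2 _ _ _ (chmx_cubic hF hh) erefl) v (\adj h^s *m x) (\adj h^s *m y) (\adj h^s *m z).
rewrite !subst_tensor_tri// !mulmxA -!hW//.
have E : h^s *m \adj h^s = d%:M by rewrite mul_mx_adj det_map_mx.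
rewrite -!(mulmxA (W v)) -!mulmxA !(mulmxA h^s) !E !mul_scalar_mx -!scalemxAr !triZ3; try exact/tsym_map/d3_sym.
by move=> E'; rewrite mulrBr E' subrr.
Qed.

(** Invariance is known only for the forms of [b] obtained by substitution. By smoothness one of
    them has a coefficient that is a unit near the given point, and all other forms are multiples of
    it there. *)
Lemma frame_push P : isf a p P ->
  exists Q, isf b s Q /\ forall h v, chmx u h -> h^s *m Q v = P v *m h^s.
Proof.
move=> [[P0 PM] PI].
have [Q hQ] := choice (fun v => pgl_conjV (chmxP u) s (P v)).
exists Q; split=> [|h v hh]; last exact: hQ.
split; first split.
- by apply: (pgl_eq_l (chmxP u) (s := s)) => h hh; rewrite hQ// P0 mulmx1 mul1mx.
- move=> x y; apply: (pgl_eq_l (chmxP u) (s := s)) => h hh.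
  by rewrite mulmxA hQ// -mulmxA hQ// mulmxA PM sw -scalemxAr -scalemxAl hQ.
move=> B [G hG ->] v x y z; apply/eqP; rewrite -subr_eq0; apply/eqP; apply: local_eq0 => k chi.
have [h hh d0] := pgl_unit (chmxP u) (chi \o s).
have [B0 [s0 [[F0 hF0 ->] s0n _ sm]]] := tensors_gen a C0 (chi \o p).
pose G' := subst_form (map_mpoly f F0) h; have hG' : ceq b G' := chmx_cubic hF0 hh.
have [m m0] : exists m, chi (s G'@_m) != 0.
  apply: contrapT => N.
  have Nm m : chi (s G'@_m) = 0.
    by apply/eqP; apply: contrapT => /negP N'; apply: N; exists m.
  have {}N i j l : chi (s (d3 G' i j l)) = 0.
    by rewrite /d3 !mcoeff_mderiv !rmorphMn Nm !mul0rn.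
  have [|c] := sm k (chi \o p) s0n k idfun (bas 0).
    by apply/eqP => /matrixP/(_ 0 0); rewrite !mxE eqxx => /eqP; rewrite oner_eq0.
  case/eqP; pose hk := map_mx chi h^s; have hu : hk \in unitmx.
    by rewrite unitmxE /hk !det_map_mx unitfE.
  have E a1 a2 a3 : tri (tmap chi (tmap s (d3 G'))) a1 a2 a3 = 0.
    by rewrite /tri; do 3!(rewrite big1// => ? _); rewrite N mul0r.
  have E2 x1 x2 x3 : tri (tmap chi (tmap s (d3 G'))) x1 x2 x3 =
      tri (tmap chi (tmap p (d3 F0))) (hk *m x1) (hk *m x2) (hk *m x3).
    rewrite -tri_comp; apply: eq_tri => i j l; rewrite -(tcomp_map chi (tmap p (d3 F0))); congr (chi _).
    have := subst_tensor_tri (bas i) (bas j) (bas l) hF0 hh; rewrite tri_bas => ->.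
    by rewrite /tcomp !mulmx_bas.
  have := E (invmx hk *m bas 0) (invmx hk *m bas 0) (invmx hk *m c).
  by rewrite E2 !mulmxA mulmxV// !mul1mx.
have hQ' : tinv (tmap s (d3 G')) (Q v).
  by move=> x' y' z'; rewrite !subst_tensor_tri// !mulmxA !hQ// -!mulmxA PI//; exists F0.
exists (s G'@_m); last exact: m0.
have E i j l : s G'@_m * s (d3 G i j l) = s G@_m * s (d3 G' i j l).
  rewrite -!rmorphM -!d3Z; congr (s (d3 _ i j l)); apply/mpolyP => m'.
  by rewrite !mcoeffZ (cubic_prop m m' hG' hG).
by rewrite mulrBr !(tri_scale _ _ _ E) hQ' subrr.
Qed.

End FrameTransport.

Local Notation cover := Defs.cover.
Local Notation fiber := Defs.fiber.

(** * The frame cover *)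

Lemma rmorph_ext (A B : pzSemiRingType) (f g : {rmorphism A -> B}) : f =1 g -> f = g.
Proof.
move=> E; have {E} E : (f : A -> B) = g by apply/funext.
case: f g E => f [[f1] [f2]] [g [[g1] [g2]]] /= E; subst g.
by rewrite (Prop_irrelevance f1 g1) (Prop_irrelevance f2 g2).
Qed.

Lemma fiber_ext (C : fieldType) (X : prestack C) x (E : cover X) (p q : fiber x E) :
  fpt p =1 fpt q -> p = q.
Proof.
case: p q => p hp [q hq] /= /rmorph_ext E'; subst q.
by rewrite (Prop_irrelevance hp hq).
Qed.

Lemma map_mx2 (A B D : Type) (f : B -> D) (g : A -> B) m n (M : 'M[A]_(m, n)) :
  map_mx (f \o g) M = map_mx f (map_mx g M).
Proof. by apply/matrixP => i j; rewrite !mxE. Qed.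

Section FrameCover.
Variables (C : fieldType) (C0 : char0 C) (w0 : C) (hw : cube_root w0).

Section OneCubic.
Variables (R : comAlgType C) (a : cubic R).
Local Notation wR := (w0%:A : R).

Record fpack := FPack {
  fT : comPzRingType;
  fs : {rmorphism R -> fT};
  fW : 'cV['F_3]_2 -> 'M[fT]_3;
  fP : frameRing wR (tensors a) fs fW }.

Lemma fpack_ex : exists x : fpack, True.
Proof. by have [T [s [W P]]] := frameRing_ex wR (tensors a); exists (FPack P). Qed.

Definition fpk := sval (cid fpack_ex).

Let ww : cube_root wR := cube_root_map (in_alg R) hw.

Lemma fpk_fet : finite_etale (fs fpk).
Proof.
exact: (frameRing_fet ww (h6A R C0) (fun k chi => alg_char0 C0 chi) (@tensors_sym _ _ a)
  (fun k chi => tensors_gen a C0 chi) (fP fpk)).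
Qed.

Lemma fpk_inj : injective (fs fpk).
Proof.
exact: (frameRing_inj ww (h6A R C0) (fun k chi => alg_char0 C0 chi) (@tensors_sym _ _ a)
  (fun k chi => tensors_gen a C0 chi) (fP fpk)).
Qed.

Definition fact_hom g : {rmorphism fT fpk -> fT fpk} := fr_act ww (@tensors_sym _ _ a) (fP fpk) g.

Lemma fact_hom_str g r : fact_hom g (fs fpk r) = fs fpk r.
Proof. exact: fr_act_str. Qed.

Lemma fact_hom_frame g u : map_mx (fact_hom g) (fW fpk u) = fact (fs fpk wR) g (fW fpk) u.
Proof. exact: fr_act_frame. Qed.

Lemma fact_hom1 x : fact_hom 1%g x = x. Proof. exact: fr_act1. Qed.

Lemma fact_homM g h x : fact_hom (g * h)%g x = fact_hom g (fact_hom h x).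
Proof. exact: fr_actM. Qed.

(** A map that does not distinguish g from 1 would send the Galois coordinates to both 1 and 0. *)
Lemma fact_hom_free (S : comNzRingType) (p : {rmorphism fT fpk -> S}) g :
  (forall x, p (fact_hom g x) = p x) -> g = 1%g.
Proof.
move=> E; have [n [c [d D]]] := frameRing_dual ww (h6A R C0) (@tensors_sym _ _ a) (fP fpk).
apply/eqP; apply: contrapT => /negP ne.
have /eqP : (1 : S) = 0; last by rewrite oner_eq0.
transitivity (p (\sum_j c j * fact_hom 1%g (d j))); first by rewrite D eqxx rmorph1.
transitivity (p (\sum_j c j * fact_hom g (d j))); last by rewrite D (negPf ne) rmorph0.
rewrite !rmorph_sum; apply: eq_bigr => j _; rewrite !rmorphM; congr (_ * _).
by rewrite E fact_hom1.
Qed.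

End OneCubic.

Section Arrow.
Variables (R S : comAlgType C) (f : {lrmorphism R -> S}) (b : cubic S) (a : cubic R) (u : cubic_hom f b a).
Local Notation sb := (fs (fpk b)).

Lemma fcmap_ex : exists psi : {rmorphism fT (fpk a) -> fT (fpk b)},
  (forall r, psi (fs (fpk a) r) = sb (f r)) /\
  forall h v, chmx u h -> map_mx psi (fW (fpk a) v) *m map_mx sb h = map_mx sb h *m fW (fpk b) v.
Proof.
have [W [hW1 hW2]] := @frame_pull C C0 w0 R S f b a u _ sb (sb \o f) (fun=> erefl) _ (fr_frame (fP (fpk b))).
have [psi [p1 p2]] := fr_univ (fP (fpk a)) hW1.
by exists psi; split=> // h v hh; rewrite p2 hW2.
Qed.

Definition fcmap := sval (cid fcmap_ex).
Lemma fcmapE r : fcmap (fs (fpk a) r) = sb (f r). Proof. exact: (svalP (cid fcmap_ex)).1. Qed.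
Lemma fcmapW h v : chmx u h ->
  map_mx fcmap (fW (fpk a) v) *m map_mx sb h = map_mx sb h *m fW (fpk b) v.
Proof. exact: (svalP (cid fcmap_ex)).2. Qed.

Lemma fcmap_uniq (T : comPzRingType) (g : {rmorphism fT (fpk a) -> T}) (q : {rmorphism fT (fpk b) -> T}) :
  (forall r, g (fs (fpk a) r) = q (sb (f r))) ->
  (forall h v, chmx u h -> map_mx g (fW (fpk a) v) *m map_mx (q \o sb) h = map_mx (q \o sb) h *m map_mx q (fW (fpk b) v)) ->
  forall x, g x = q (fcmap x).
Proof.
move=> E1 E2; apply: (fr_uniq (fP (fpk a)) (g' := q \o fcmap)) => [r|v]; first by rewrite E1 /= fcmapE.
apply: (pgl_eq_r (chmxP u) (s := q \o sb)) => h hh; rewrite E2//.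
have := congr1 (map_mx q) (fcmapW v hh); rewrite !map_mxM.
have E3 : map_mx (q \o fcmap) (fW (fpk a) v) = map_mx q (map_mx fcmap (fW (fpk a) v)) := map_mx2 _ _ _.
have E4 : map_mx (q \o sb) h = map_mx q (map_mx sb h) := map_mx2 _ _ _.
by rewrite E3 E4 => ->.
Qed.

(** A map out of the frame ring of [a] is a frame, and [frame_push] carries it to [b]. *)
Lemma fcpushout (T : comPzRingType) (p : {rmorphism fT (fpk a) -> T}) (q : {rmorphism S -> T}) :
  (forall r, p (fs (fpk a) r) = q (f r)) ->
  exists w : {rmorphism fT (fpk b) -> T},
      [/\ forall x, w (fcmap x) = p x, forall s, w (sb s) = q s
        & forall w' : {rmorphism fT (fpk b) -> T},
            (forall x, w' (fcmap x) = p x) -> (forall s, w' (sb s) = q s) ->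
            w' =1 w].
Proof.
move=> E; have hP : isf w0 a (p \o fs (fpk a)) (fun v => map_mx p (fW (fpk a) v)).
  exact: (isframe_map (f' := p \o fs (fpk a)) (fun=> erefl) (fr_frame (fP (fpk a)))).
have [Q [hQ1 hQ2]] := @frame_push C C0 w0 R S f b a u _ q (p \o fs (fpk a)) E _ hP.
have [w [w1 w2]] := fr_univ (fP (fpk b)) hQ1.
have mE (w' : {rmorphism fT (fpk b) -> T}) (h : 'M[S]_3) : (forall s, w' (sb s) = q s) ->
    map_mx (w' \o sb) h = map_mx q h by move=> E'; apply/matrixP => i j; rewrite !mxE /= E'.
exists w; split=> // [x|w' h1 h2].
  apply/esym/fcmap_uniq => [r|h v hh]; first by rewrite w1 E.
  by rewrite w2 (mE w h w1) hQ2.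
apply: (fr_uniq (fP (fpk b))) => [r|v]; first by rewrite w1 h2.
rewrite w2; apply: (pgl_eq_l (chmxP u) (s := q)) => h hh; rewrite hQ2//.
have -> : map_mx p (fW (fpk a) v) = map_mx w' (map_mx fcmap (fW (fpk a) v)).
  by apply/matrixP => i j; rewrite !mxE h1.
have := congr1 (map_mx w') (fcmapW v hh); rewrite !map_mxM.
have -> : map_mx w' (map_mx sb h) = map_mx q h by rewrite -(mE w' h h2); apply/matrixP => i j; rewrite !mxE.
by [].
Qed.

Lemma fcmap_act g x : fact_hom b g (fcmap x) = fcmap (fact_hom a g x).
Proof.
have ww' : fcmap (fs (fpk a) (w0%:A : R)) = sb (w0%:A : S) by rewrite fcmapE rmorph_alg.
suff -> : fact_hom b g (fcmap x) = (fact_hom b g \o fcmap) x.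
  apply: (fr_uniq (fP (fpk a)) (g' := fcmap \o fact_hom a g)) => [r|v].
    by rewrite /= fact_hom_str !fcmapE fact_hom_str.
  have E1 : map_mx (fcmap \o fact_hom a g) (fW (fpk a) v) = map_mx fcmap (map_mx (fact_hom a g) (fW (fpk a) v)).
    by apply/matrixP => i j; rewrite !mxE.
  have E2 : map_mx (fact_hom b g \o fcmap) (fW (fpk a) v) = map_mx (fact_hom b g) (map_mx fcmap (fW (fpk a) v)).
    by apply/matrixP => i j; rewrite !mxE.
  rewrite E1 E2 fact_hom_frame fact_map ww'.
  apply: (pgl_eq_r (chmxP u) (s := sb)) => h hh.
  rewrite [in RHS]/fact -scalemxAl fcmapW//.
  have Eh : map_mx sb h = map_mx (fact_hom b g) (map_mx sb h).
    by apply/matrixP => i j; rewrite !mxE fact_hom_str.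
  by rewrite {1}Eh -map_mxM fcmapW// map_mxM -Eh fact_hom_frame /fact scalemxAr.
by [].
Qed.

End Arrow.

Lemma fcmap_comp (R S T : comAlgType C) (f : {lrmorphism R -> S}) (g : {lrmorphism S -> T})
    (h : {lrmorphism R -> T}) (a : cubic R) (b : cubic S) (c : cubic T)
    (v : cubic_hom g c b) (u : cubic_hom f b a) (w : cubic_hom h c a) :
  cubic_comp v u w -> forall x, fcmap w x = fcmap v (fcmap u x).
Proof.
move=> [hfg hm] x; apply: (fcmap_uniq (u := u) (g := fcmap w) (q := fcmap v)) => [r|m y hu].
  by rewrite !fcmapE hfg.
have Em : map_mx (fcmap v \o fs (fpk b)) m = map_mx (fs (fpk c)) (map_mx g m).
  by apply/matrixP => i j; rewrite !mxE /= fcmapE.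
rewrite Em; apply: (pgl_eq_r (chmxP v) (s := fs (fpk c))) => n hn.
rewrite -[RHS]mulmxA (fcmapW y hn) -[LHS]mulmxA -map_mxM (fcmapW y (hm _ _ hu hn)).
by rewrite map_mxM mulmxA.
Qed.

Definition frame_cover : cover (plane_cubics C) :=
  @Cover C (plane_cubics C) (fun R a => fT (fpk a)) (fun R a => fs (fpk a)) fpk_fet
    fcmap fcmapE fcpushout fcmap_comp.

Definition act_map g : cover_map frame_cover frame_cover :=
  @CoverMap C (plane_cubics C) frame_cover frame_cover (fun R a => fact_hom a g)
    (fun R a r => fact_hom_str a g r) (fun R S f b a u x => fcmap_act u g x).

Section Fiber.
Variable x : cubic (C^o : comAlgType C).
Notation Fib := (@fiber C (plane_cubics C) x frame_cover).

Definition fib_act (z : Fib) g : Fib := fiber_map (act_map g) z.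

Lemma fib_actM z g h : fib_act (fib_act z g) h = fib_act z (g * h)%g.
Proof. by apply: fiber_ext => c /=; rewrite fact_homM. Qed.

Lemma fib_act1 z : fib_act z 1%g = z.
Proof. by apply: fiber_ext => c /=; rewrite fact_hom1. Qed.

Lemma fib_act_inj z : injective (fib_act z).
Proof.
move=> g h E; have E' : fib_act z (h * g^-1)%g = z.
  by rewrite -fib_actM -E fib_actM mulgV fib_act1.
have : (h * g^-1)%g = 1%g.
  apply: (fact_hom_free (p := fpt z)) => c.
  by have := congr1 (fun p : Fib => fpt p c) E'.
by move=> e; rewrite -[h](mulgKV g) e mul1g.
Qed.

Definition fib_frame (z : Fib) v : 'M[C^o]_3 := map_mx (fpt z) (fW (fpk x) v).

Lemma fib_frameP z : isf w0 x (idfun : {rmorphism C^o -> C^o}) (fib_frame z).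
Proof. by apply: (isframe_map _ (fr_frame (fP (fpk x)))) => r; rewrite fptE. Qed.

Lemma fib_frame_inj z z' : (forall v, fib_frame z v = fib_frame z' v) -> z = z'.
Proof.
by move=> E; apply: fiber_ext; apply: (fr_uniq (fP (fpk x))) => [r|v]; [rewrite !fptE|exact: E].
Qed.

Lemma fib_act_frame z g v : fib_frame (fib_act z g) v = fact w0 g (fib_frame z) v.
Proof.
have -> : fib_frame (fib_act z g) v = map_mx (fpt z) (map_mx (fact_hom x g) (fW (fpk x) v)).
  by apply/matrixP => i j; rewrite !mxE.
rewrite fact_hom_frame fact_map; congr (fact _ _ _ _).
by apply: etrans (fptE z _) _; exact: mulr1.
Qed.

Lemma fib_act_trans z z' : exists g, z' = fib_act z g.
Proof.
pose D := @Pring C^o C idfun.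
have Dl : plocal D by move=> s s0; exists (s^-1 : C); rewrite mulVf.
have ww : cube_root (w0%:A : C^o) := cube_root_map (in_alg C^o) hw.
have [g hg] := isframe_trans ww (h6A C^o C0) (@tensors_sym _ _ x) (fun k chi => tensors_gen x C0 chi)
  Dl (fib_frameP z) (fib_frameP z').
exists g; apply: fib_frame_inj => v; rewrite fib_act_frame hg.
by congr (fact _ _ _ _); exact: mulr1.
Qed.

Variable z : Fib.

Definition Theta (t : @pi1 C (plane_cubics C) x) : ASL2F3 :=
  sval (cid (fib_act_trans z (@pact C _ _ t frame_cover z))).

Lemma ThetaE t : @pact C _ _ t frame_cover z = fib_act z (Theta t).
Proof. exact: (svalP (cid (fib_act_trans z (@pact C _ _ t frame_cover z)))). Qed.

(** Elements of pi_1 commute with the deck transformations; as the group acts on the right of the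
    fiber, no inverse appears. *)
Lemma ThetaM s t : Theta (s * t)%lg = (Theta s * Theta t)%g.
Proof.
apply: (@fib_act_inj z); rewrite -ThetaE -fib_actM -ThetaE /=.
by rewrite ThetaE (pact_nat s (act_map (Theta t)) z).
Qed.

End Fiber.

End FrameCover.

(** * Sections over an integrally closed ring *)

Definition root_closed (L : fieldType) := forall p : {poly L}, (1 < size p)%N -> exists x, root p x.

Lemma root_closed_split (L : fieldType) (p : {poly L}) : root_closed L -> p \is monic ->
  exists rs, p = \prod_(r <- rs) ('X - r%:P).
Proof.
move=> cl; elim: (size p) {-2}p (leqnn (size p)) => [|n IH] q sq qm.
  by move: sq; rewrite leqn0 size_poly_eq0 => /eqP E; move: (monic_neq0 qm); rewrite E eqxx.
have [s1|s1] := leqP (size q) 1.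
  exists [::]; rewrite big_nil; have := size1_polyC s1 => E.
  by move: qm; rewrite E monicE lead_coefC => /eqP ->.
have [x /factor_theorem[q' E]] := cl q s1.
have qm' : q' \is monic by move: qm; rewrite E monicMr ?monicXsubC.
have [|rs Er] := IH q' _ qm'; last by exists (x :: rs); rewrite big_cons -Er mulrC.
have : (size q' < size q)%N by rewrite E size_Mmonic ?monic_neq0 ?monicXsubC// size_XsubC addn2.
by move/leq_trans => /(_ _ sq); rewrite ltnS.
Qed.

Section CommonEigenvector.
Variables (L : fieldType) (cl : root_closed L) (n : nat).
Implicit Types (A V : 'M[L]_n).

Lemma stable_eigenvector V A : V != 0 -> (V *m A <= V)%MS ->
  exists a, (V :&: eigenspace A a)%MS != 0.
Proof.
move=> V0 VA; pose R := row_base V.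
have rV : (0 < \rank V)%N by rewrite lt0n mxrank_eq0.
have /submxP[M EM] : (R *m A <= R)%MS by rewrite (eqmxMr _ (eq_row_base V)) eq_row_base.
have [|a ra] := cl (p := char_poly M); first by rewrite size_char_poly ltnS.
move: ra; rewrite -eigenvalue_root_char => /eigenvalueP[x Ex x0].
exists a; apply/negP => /eqP E0.
have xR0 : x *m R != 0.
  apply: contraNneq x0 => E; apply/eqP/(row_free_inj (row_base_free V)).
  by rewrite mul0mx.
case/negP: xR0; rewrite -submx0 -E0 sub_capmx -{1}(eq_row_base V) submxMl /=.
by apply/eigenspaceP; rewrite -mulmxA EM mulmxA Ex scalemxAl.
Qed.

Lemma common_eigenvector_closed (As : seq 'M[L]_n) V : V != 0 ->
  (forall A, A \in As -> (V *m A <= V)%MS) ->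
  (forall A B, A \in As -> B \in As -> A *m B = B *m A) ->
  exists v : 'rV_n, [/\ v != 0, (v <= V)%MS & forall A, A \in As -> exists a, v *m A = a *: v].
Proof.
elim: As V => [|A As IH] V V0 hV hC.
  have [i vi] : exists i, row i V != 0.
    apply/existsP; apply: contraNT V0; rewrite negb_exists => /forallP h.
    by apply/eqP/row_matrixP => i; rewrite row0; apply/eqP; move: (h i); rewrite negbK.
  by exists (row i V); split=> //; exact: row_sub.
have [a W0] := stable_eigenvector V0 (hV A (mem_head _ _)).
have [||v [v0 vW hv]] := IH _ W0.
- move=> B hB; have hB' : B \in A :: As by rewrite inE hB orbT.
  rewrite sub_capmx (submx_trans (submxMr B (capmxSl _ _)) (hV B hB')) /=.
  apply: submx_trans (submxMr B (capmxSr _ _)) _.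
  by apply: comm_mx_stable_eigenspace; exact: (hC A B (mem_head _ _) hB').
- by move=> B D hB hD; apply: hC; rewrite inE ?hB ?hD orbT.
move: vW; rewrite sub_capmx => /andP[vV /eigenspaceP vE].
exists v; split=> // B; rewrite inE => /orP[/eqP->|]; last exact: hv.
by exists a.
Qed.

End CommonEigenvector.

Section PullbackModule.
Variables (B T : comPzRingType) (f : {rmorphism B -> T}).
(** [T] as a [B]-module, the target of a derivation; keeping [f] in the type gives each homomorphism
    its own structure. *)
Definition pull_mod : Type := let _ := f in T.
HB.instance Definition _ := GRing.Zmodule.on pull_mod.
Let scale (b : B) (m : pull_mod) : pull_mod := f b * (m : T).
Fact pull_scaleA a b m : scale a (scale b m) = scale (a * b) m.
Proof. by rewrite /scale rmorphM mulrA. Qed.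
Fact pull_scale1 : left_id 1 scale.
Proof. by move=> m; rewrite /scale rmorph1 mul1r. Qed.
Fact pull_scaleDr : right_distributive scale +%R.
Proof. by move=> a x y; exact: mulrDr. Qed.
Fact pull_scaleDl m : {morph scale^~ m : a b / a + b}.
Proof. by move=> a b; rewrite /scale rmorphD; exact: mulrDl. Qed.
HB.instance Definition _ := GRing.Zmodule_isLmodule.Build B pull_mod
  pull_scaleA pull_scale1 pull_scaleDr pull_scaleDl.
End PullbackModule.

Section FiniteEtaleSections.
Variables (A : comNzRingType) (L k : fieldType) (io : {rmorphism A -> L}) (pi : {rmorphism A -> k}).
Hypotheses (ioI : injective io) (cl : root_closed L)
  (int : forall (p : {poly A}) x, p \is monic -> root (map_poly io p) x -> exists a, io a = x).
Variables (B : comPzRingType) (s : {rmorphism A -> B}).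
Hypothesis et : finite_etale s.

(* Modulo the square of the ideal of the p x - q x the map p - q is a
   derivation; it vanishes, and Nakayama's lemma applies. *)
Lemma section_inj (p q : {rmorphism B -> A}) : (forall r, p (s r) = r) -> (forall r, q (s r) = r) ->
  (forall x, pi (p x) = pi (q x)) -> p =1 q.
Proof.
move=> ps qs pq; pose d x := p x - q x.
pose J a := exists l : seq (A * B * B), a = \sum_(t <- l) t.1.1 * d t.1.2 * d t.2.
have J0 : J 0 by exists [::]; rewrite big_nil.
have JD x y : J x -> J y -> J (x + y) by move=> [l ->] [l' ->]; exists (l ++ l'); rewrite big_cat.
have JM a x : J x -> J (a * x).
  move=> [l ->]; exists [seq (a * t.1.1, t.1.2, t.2) | t <- l].
  by rewrite big_map mulr_sumr; apply: eq_bigr => t _; rewrite /= !mulrA.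
pose fd := @FracData A (fun x => x = 1) J erefl (fun x y hx hy => etrans (congr2 *%R hx hy) (mulr1 1)) J0 JD JM.
pose c : {rmorphism A -> fracRing fd} := fconst fd.
pose D x : pull_mod (c \o p) := c (d x).
have dJ x : J (d x).
  have : D x = 0.
    apply: (fet_unramified et) => [y z|y z|r].
    - by rewrite /D -rmorphD; congr (c _); rewrite /d !rmorphD; ring.
    - suff E : c (d (y * z)) = c (p y * d z + p z * d y) by rewrite /D E rmorphD !rmorphM.
      apply/eqP; rewrite -subr_eq0 -rmorphB; apply/eqP/fconst_eq0; exists 1 => //.
      exists [:: (-1, y, z)]; rewrite big_seq1 mul1r /d !rmorphM /=; ring.
    - by rewrite /D /d ps qs subrr; exact: rmorph0.
  by case/fconst_eq0 => _ -> ; rewrite mul1r.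
have [n [b [l [lD lZ lE]]]] := fet_projective et.
have dE x : d x = \sum_i l i x * d (b i).
  rewrite {1}/d {1 2}(lE x) !rmorph_sum -sumrB; apply: eq_bigr => i _.
  by rewrite !rmorphM ps qs mulrBr.
have [m [m0 mE]] : exists m : 'M[A]_n, (forall i j, pi (m i j) = 0) /\
    forall i, d (b i) = \sum_j m i j * d (b j).
  have [F hF] := choice (fun i => dJ (b i)).
  exists (\matrix_(i, j) \sum_(t <- F i) t.1.1 * d t.1.2 * l j t.2); split=> [i j|i].
    rewrite mxE rmorph_sum big1// => t _; rewrite !rmorphM /d rmorphB pq subrr mulr0 mul0r//.
  rewrite hF (eq_bigr (fun t => \sum_j (t.1.1 * d t.1.2 * l j t.2) * d (b j))); last first.
    by move=> t _; rewrite [d t.2]dE mulr_sumr; apply: eq_bigr => j _; rewrite mulrA.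
  by rewrite exchange_big; apply: eq_bigr => j _; rewrite mxE mulr_suml.
have db i : d (b i) = 0.
  pose v : 'cV[A]_n := \col_i d (b i).
  have mv : (1%:M - m) *m v = 0.
    apply/matrixP => i' j; rewrite mulmxBl mul1mx !mxE mE.
    by apply/eqP; rewrite subr_eq0; apply/eqP; apply: eq_bigr => j' _; rewrite mxE.
  have : \det (1%:M - m) *: v = 0 by rewrite -mul_scalar_mx -mul_adj_mx -mulmxA mv mulmx0.
  move/matrixP/(_ i 0); rewrite !mxE => E.
  have d1 : pi (\det (1%:M - m)) != 0.
    rewrite -det_map_mx (_ : map_mx pi _ = 1%:M) ?det1 ?oner_neq0//.
    by apply/matrixP => i' j; rewrite !mxE rmorphB m0 subr0 rmorph_nat.
  apply: ioI; rewrite rmorph0; have := congr1 io E; rewrite rmorphM rmorph0 => /eqP.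
  rewrite mulf_eq0 => /orP[/eqP h|/eqP//]; move: d1.
  by rewrite (ioI (etrans h (esym (rmorph0 io)))) rmorph0 eqxx.
move=> x; apply/eqP; rewrite -subr_eq0 -/(d x) dE big1// => i _.
by rewrite db mulr0.
Qed.

(** [B] acts on itself by commuting matrices, and common eigenvectors over L give characters of [B].
    Eigenvalues are roots of monic polynomials over [A], hence in [A], so these characters are
    sections. If none reduced to [rho], the product [y] of the b_i - mu over the eigenvalues mu with
    the wrong reduction would vanish under all of them, hence be nilpotent, although rho(y) is
    nonzero. *)
Lemma section_surj (rho : {rmorphism B -> k}) : (forall r, rho (s r) = pi r) ->
  exists p : {rmorphism B -> A}, (forall r, p (s r) = r) /\ forall x, pi (p x) = rho x.
Proof.
move=> rs; have [n0 [b [l [lD lZ lE]]]] := fet_projective et.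
case: n0 b l lD lZ lE => [|n] b l lD lZ lE.
  have := lE 1; rewrite big_ord0 => E.
  by have := oner_neq0 k; rewrite -(rmorph1 rho) E rmorph0 eqxx.
have l0 i : l i 0 = 0 by apply: (addrI (l i 0)); rewrite -lD !addr0.
have lsum i (I : finType) (F : I -> B) : l i (\sum_j F j) = \sum_j l i (F j).
  by apply: (big_morph (l i) (lD i)).
(* [B] is only projective, so N(1) is an idempotent that may differ from the identity. *)
pose N x : 'M[A]_n.+1 := \matrix_(i, j) l i (x * b j).
have NM x y : N (x * y) = N x *m N y.
  apply/matrixP => i j; rewrite !mxE -mulrA {1}(lE (y * b j)) mulr_sumr lsum.
  by apply: eq_bigr => m _; rewrite !mxE mulrCA lZ mulrC.
have ND x y : N (x + y) = N x + N y by apply/matrixP => i j; rewrite !mxE mulrDl lD.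
have NZ r x : N (s r * x) = r *: N x by apply/matrixP => i j; rewrite !mxE -mulrA lZ.
have N_eq0 x : N x = 0 -> x = 0.
  move=> E; rewrite -[x]mulr1 (lE 1) mulr_sumr big1// => j _.
  rewrite mulrCA (lE (x * b j)) mulr_sumr big1// => i _.
  by have := congr1 (fun M : 'M_n.+1 => M i j) E; rewrite !mxE => ->; rewrite rmorph0 mul0r mulr0.
pose N' x : 'M[L]_n.+1 := map_mx io (N x).
have NC x y : N' x *m N' y = N' y *m N' x by rewrite /N' -!map_mxM -!NM mulrC.
(* A nonzero eigenvalue puts the eigenvector in the image of N(1), which makes the character
   unital. *)
have eig y mu : mu != 0 -> eigenvalue (N' y) mu -> exists p : {rmorphism B -> A},
    [/\ forall r, p (s r) = r, io (p y) = mu & forall x, eigenvalue (N' x) (io (p x))].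
  move=> mu0 emu.
  have [||v [v0 vV hv]] := @common_eigenvector_closed L cl n.+1 (codom (fun j => N' (b j))) _ emu.
  - by move=> M /codomP[j ->]; apply: comm_mx_stable_eigenspace; exact: NC.
  - by move=> M M' /codomP[j ->] /codomP[j' ->]; exact: NC.
  move/eigenspaceP: vV => vy.
  have vx x : exists a, v *m N' x = a *: v.
    have [c hc] := choice (fun j => hv _ (codom_f (fun j => N' (b j)) j)).
    exists (\sum_j io (l j x) * c j); rewrite scaler_suml.
    have -> : N' x = \sum_j io (l j x) *: N' (b j).
      rewrite /N' {1}(lE x); apply/matrixP => i j; rewrite !mxE summxE mulr_suml lsum rmorph_sum.
      by apply: eq_bigr => m _; rewrite !mxE -mulrA lZ rmorphM.
    by rewrite mulmx_sumr; apply: eq_bigr => j _; rewrite -scalemxAr hc scalerA.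
  have ex x : exists a, v *m N' x = io a *: v.
    have [a Ea] := vx x.
    have [|a' Ea'] := int (p := char_poly (N x)) (x := a) (char_poly_monic _).
      by rewrite map_char_poly -eigenvalue_root_char; apply/eigenvalueP; exists v.
    by exists a'; rewrite Ea'.
  have [p hp] := choice ex.
  have vI a a' : io a *: v = io a' *: v -> a = a'.
    move=> E; apply: ioI; apply/eqP; rewrite -subr_eq0.
    have : (io a - io a') *: v = 0 by rewrite scalerBl E subrr.
    by move/eqP; rewrite scaler_eq0 (negPf v0) orbF.
  have pD : zmod_morphism p.
    move=> x y'; apply: vI; rewrite -hp rmorphB scalerBl -!hp -mulmxBr; congr (_ *m _).
    have -> : N' (x - y') = N' x - N' y'; last by [].
    by apply/eqP; rewrite eq_sym subr_eq /N' -map_mxD -ND subrK.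
  have pM : monoid_morphism p.
    split=> [|x y']; apply: vI; last first.
      by rewrite -hp /N' NM map_mxM mulmxA -/(N' x) hp -scalemxAl -/(N' y') hp scalerA -rmorphM mulrC.
    rewrite -hp rmorph1 scale1r.
    have -> : v = mu^-1 *: (v *m N' y) by rewrite vy scalerA mulVf ?scale1r.
    by rewrite -scalemxAl -mulmxA /N' -map_mxM -NM mulr1.
  pose A1 := GRing.isZmodMorphism.Build B A p pD.
  pose A2 := GRing.isMonoidMorphism.Build B A p pM.
  pose P : {rmorphism B -> A} := HB.pack p A1 A2.
  exists P; split.
  - move=> r; apply: vI; rewrite -[P _]/(p _) -hp -[s r]mulr1 /N' NZ.
    have -> : map_mx io (r *: N 1) = io r *: N' 1 by apply/matrixP => i j; rewrite !mxE rmorphM.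
    by rewrite -scalemxAr hp pM.1 rmorph1 scale1r.
  - apply/eqP; rewrite -subr_eq0; have : (io (p y) - mu) *: v = 0 by rewrite scalerBl -hp vy subrr.
    by move/eqP; rewrite scaler_eq0 (negPf v0) orbF.
  - by move=> x; apply/eigenvalueP; exists v => //; exact: hp.
apply: contrapT => no.
have roots_ex i : exists R : seq A, forall a, eigenvalue (N' (b i)) (io a) -> a \in R.
  have [rs0 Er] := root_closed_split cl (char_poly_monic (N' (b i))).
  have hr r : r \in rs0 -> exists a, io a = r.
    move=> h; apply: (int (p := char_poly (N (b i))) (char_poly_monic _)).
    by rewrite map_char_poly Er root_prod_XsubC.
  have [as0 Eas] : exists as0, rs0 = map io as0.
    elim: rs0 hr {Er} => [|r rs0 IH] hr; first by exists [::].
    have [a Ea] := hr r (mem_head _ _).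
    have [r' h|as0 ->] := IH; first by apply: hr; rewrite inE h orbT.
    by exists (a :: as0); rewrite /= Ea.
  exists as0 => a; rewrite eigenvalue_root_char Er root_prod_XsubC Eas.
  by rewrite mem_map.
have [Rt hRt] := choice roots_ex.
pose y := \prod_i \prod_(mu <- Rt i | pi mu != rho (b i)) (b i - s mu).
have ry : rho y != 0.
  rewrite rmorph_prod; apply/prodf_neq0 => i _; rewrite rmorph_prod prodf_seq_neq0.
  by apply/allP => mu _; apply/implyP => h; rewrite rmorphB rs subr_eq0 eq_sym.
have py (p : {rmorphism B -> A}) : (forall r, p (s r) = r) -> (forall x, eigenvalue (N' x) (io (p x))) -> p y = 0.
  move=> ps pe; have [i pi_i] : exists i, pi (p (b i)) != rho (b i).
    apply: contrapT => N0; apply: no; exists p; split=> // x.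
    rewrite (lE x) !rmorph_sum; apply: eq_bigr => i _; rewrite !rmorphM ps rs; congr (_ * _).
    by apply/eqP; apply: contrapT => /negP h; apply: N0; exists i.
  rewrite /y (bigD1 i)//= rmorphM [X in p X * _](big_rem (p (b i)))/=; last exact: hRt.
  by rewrite pi_i rmorphM rmorphB ps subrr !mul0r.
have nil : N' y ^+ n.+1 = 0.
  have [rs0 Er] := root_closed_split cl (char_poly_monic (N' y)).
  have z r : r \in rs0 -> r = 0.
    move=> h; apply/eqP; apply: contrapT => /negP r0.
    have [|p [ps Ep pe]] := eig y r r0; first by rewrite eigenvalue_root_char Er root_prod_XsubC.
    by move/eqP: r0; apply; rewrite -Ep (py p ps pe) rmorph0.
  have := Cayley_Hamilton (N' y); rewrite Er.
  have sz : size rs0 = n.+1 by apply: succn_inj; rewrite -(size_prod_XsubC _ id) -Er size_char_poly.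
  have -> : \prod_(r <- rs0) ('X - r%:P) = 'X ^+ n.+1.
    rewrite -sz; elim: rs0 z {Er sz} => [|r rs0 IH] z; first by rewrite big_nil expr0.
    rewrite big_cons IH => [|r' h]; last by apply: z; rewrite inE h orbT.
    by rewrite (z r (mem_head _ _)) subr0 exprS.
  by rewrite rmorphXn /= horner_mx_X.
have : y ^+ n.+1 = 0.
  apply: N_eq0; have E m : N' (y ^+ m.+1) = N' y ^+ m.+1.
    elim: m => [|m IH]; first by rewrite !expr1.
    by rewrite exprS [RHS]exprS -IH /N' NM map_mxM.
  have := nil; rewrite -E => /matrixP E0; apply/matrixP => i j.
  by apply: ioI; have := E0 i j; rewrite !mxE rmorph0.
move/(congr1 rho); rewrite rmorphXn rmorph0 => /eqP; apply/negP.
by rewrite expf_neq0.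
Qed.

End FiniteEtaleSections.

(** * The path ring *)

Module AlgOf.
Section AlgebraOf.
Variables (C : comNzRingType) (A : comNzRingType) (f : {rmorphism C -> A}).
Definition alg_of : Type := let _ := f in A.
HB.instance Definition _ := GRing.ComNzRing.on alg_of.
Let scale (c : C) (x : alg_of) : alg_of := f c * (x : A).
Fact alg_scaleA a b m : scale a (scale b m) = scale (a * b) m.
Proof. by rewrite /scale rmorphM mulrA. Qed.
Fact alg_scale1 : left_id 1 scale.
Proof. by move=> m; rewrite /scale rmorph1 mul1r. Qed.
Fact alg_scaleDr : right_distributive scale +%R.
Proof. by move=> a x y; exact: mulrDr. Qed.
Fact alg_scaleDl m : {morph scale^~ m : a b / a + b}.
Proof. by move=> a b; rewrite /scale rmorphD; exact: mulrDl. Qed.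
HB.instance Definition _ := GRing.Zmodule_isLmodule.Build C alg_of
  alg_scaleA alg_scale1 alg_scaleDr alg_scaleDl.
Fact alg_scaleAl (k : C) (x y : alg_of) : k *: (x * y) = (k *: x) * y.
Proof. exact: mulrA. Qed.
HB.instance Definition _ := GRing.Lmodule_isLalgebra.Build C alg_of alg_scaleAl.
HB.instance Definition _ := GRing.Lalgebra_isComAlgebra.Build C alg_of.
Lemma alg_ofE c : c%:A = f c :> alg_of. Proof. exact: mulr1. Qed.
End AlgebraOf.
End AlgOf.
Import AlgOf.

Section MkAlgMorphism.
Variables (C : comNzRingType) (R S : comAlgType C) (f : {rmorphism R -> S}).
Hypothesis fA : forall c : C, f c%:A = c%:A.
Fact mklr_scalable : scalable f.
Proof. by move=> c x; rewrite -mulr_algl rmorphM fA mulr_algl. Qed.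
Definition mklr : {lrmorphism R -> S} := HB.pack (f : R -> S) (GRing.RMorphism.on f)
  (GRing.isScalable.Build C R S *:%R f mklr_scalable).
End MkAlgMorphism.

Lemma rmorph_lift (A : pzRingType) (C k : fieldType) (psi : {rmorphism C -> k}) (chi : {rmorphism A -> k}) :
  (forall x, exists c, chi x = psi c) -> exists pi : {rmorphism A -> C}, forall x, psi (pi x) = chi x.
Proof.
move=> /choice[p hp]; have I := fmorph_inj psi.
have pD : zmod_morphism p by move=> x y; apply: I; rewrite -hp !rmorphB !hp.
have pM : monoid_morphism p by split=> [|x y]; apply: I; rewrite -hp ?rmorph1// !rmorphM !hp.
pose P : {rmorphism A -> C} := HB.pack p (GRing.isZmodMorphism.Build A C p pD)
  (GRing.isMonoidMorphism.Build A C p pM).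
by exists P => x; rewrite hp.
Qed.

Section FunctionField.
Variables (C : closedFieldType) (C0 : char0 C).

(* An ultrapower of C, in which the class of n |-> n is transcendental. *)
Lemma function_field : exists (L : fieldType) (ev : {rmorphism {poly C} -> L}),
  root_closed L /\ injective ev.
Proof.
(* These sequences live on the natural roots of some nonzero polynomial, so modulo [I] every nonzero
   polynomial becomes invertible. *)
pose I (x : nat -> C) := exists2 p : {poly C}, p != 0 & forall n, p.[n%:R] != 0 -> x n = 0.
have I0 : I 0 by exists 1; rewrite ?oner_neq0.
have ID x y : I x -> I y -> I (x + y).
  move=> [p p0 hp] [q q0 hq]; exists (p * q) => [|n]; first by rewrite mulf_neq0.
  by rewrite hornerM mulf_eq0 negb_or => /andP[/hp h1 /hq h2]; rewrite -[LHS]/(x n + y n) h1 h2 addr0.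
have IM a x : I x -> I (a * x).
  by move=> [p p0 hp]; exists p => // n /hp h; rewrite -[LHS]/(a n * x n) h mulr0.
have I1 : ~ I 1.
  move=> [p p0 hp]; have [n /hp] := nat_nonroot C0 p0.
  by move/eqP; rewrite -[X in X == _]/(1 : C) oner_eq0.
have [L [chi [chiI chiS]]] := max_residue I0 ID IM I1.
pose e (p : {poly C}) : nat -> C := fun n => p.[n%:R].
have eD : zmod_morphism e by move=> p q; apply/funext => n; rewrite /e hornerD hornerN.
have eM : monoid_morphism e.
  by split=> [|p q]; apply/funext => n; rewrite /e ?hornerC// hornerM.
pose e' : {rmorphism {poly C} -> (nat -> C)} := HB.pack e (GRing.isZmodMorphism.Build _ _ e eD)
  (GRing.isMonoidMorphism.Build _ _ e eM).
exists L, (chi \o e'); split.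
  move=> p sp; pose d := (size p).-1; pose c := (lead_coef p)^-1.
  have lc : lead_coef p != 0 by rewrite lead_coef_eq0 -size_poly_eq0; case: (size p) sp.
  have [x hx] := choice (fun i => chiS (c * p`_i)).
  (* The coefficients of the normalized polynomial are lifted to sequences, and a root is taken term
     by term. *)
  pose P n : {poly C} := 'X^d + \poly_(i < d) x i n.
  have rP n : exists r, root (P n) r.
    apply/closed_rootP; rewrite /P size_polyDl size_polyXn ?ltnS ?size_poly//.
    by rewrite /d; case: (size p) sp => [|[|]].
  have [r hr] := choice rP; exists (chi r); rewrite /root horner_coef.
  have -> : size p = d.+1 by rewrite /d; case: (size p) sp.
  have E : r ^+ d + \sum_(i < d) x i * r ^+ i = 0.
    apply/funext => n; have := hr n; rewrite /root /P hornerD hornerXn horner_poly => /eqP E1; apply: etrans _ E1.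
    have Xn m : (r ^+ m) n = r n ^+ m by elim: m => // m IH; rewrite !exprS -IH.
    have Sn m (F : 'I_m -> nat -> C) : (\sum_(i < m) F i) n = \sum_(i < m) F i n.
      by apply: (big_morph (fun f : nat -> C => f n)).
    rewrite -[LHS]/((r ^+ d) n + (\sum_(i < d) x i * r ^+ i) n) Xn Sn; congr (_ + _).
    by apply: eq_bigr => i _; rewrite -Xn.
  have := congr1 chi E; rewrite rmorphD rmorphXn rmorph_sum rmorph0 => E'.
  rewrite big_ord_recr /= -[X in X == _]mul1r -(divff lc) -/c -mulrA mulrDr.
  have -> : c * (p`_d * chi r ^+ d) = chi r ^+ d.
    by rewrite mulrA -[p`_d]/(lead_coef p) mulVf// mul1r.
  rewrite addrC mulr_sumr (eq_bigr (fun i : 'I_d => chi (x i * r ^+ i))) ?E' ?mulr0// => i _.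
  by rewrite rmorphM rmorphXn hx mulrA.
move=> p q E; apply/eqP; rewrite -subr_eq0; apply/negPn/negP => pq0.
have E0 : chi (e (p - q)) = 0 by rewrite -[LHS]/((chi \o e') (p - q)) rmorphB E subrr.
have := chiI ((fun n => ((p - q).[n%:R])^-1) * e (p - q) - 1).
rewrite rmorphB rmorphM E0 mulr0 rmorph1 sub0r => h.
suff : (1 : L) == 0 by rewrite oner_eq0.
rewrite -oppr_eq0 h//; exists (p - q) => // n n0.
by rewrite -[LHS]/((p - q).[n%:R]^-1 * (p - q).[n%:R] - 1) mulVf// subrr.
Qed.

End FunctionField.

Section PathRing.
Variables (C : closedFieldType) (L : fieldType) (ev : {rmorphism {poly C} -> L}) (l1 l2 : C).
Hypotheses (cl : root_closed L) (evI : injective ev).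

Definition path_den (q : {poly C}) := (q.[l1] != 0) && (q.[l2] != 0).

(* The integral closure in L of the polynomials localized at l1 and l2. *)
Definition in_path (x : L) := exists2 q, path_den q & integralOver ev (ev q * x).

Lemma path_den1 : path_den 1. Proof. by rewrite /path_den !hornerC oner_neq0. Qed.
Lemma path_denM p q : path_den p -> path_den q -> path_den (p * q).
Proof. by move=> /andP[p1 p2] /andP[q1 q2]; rewrite /path_den !hornerM !mulf_neq0. Qed.
Lemma path_den_ev q : path_den q -> ev q != 0.
Proof.
move=> /andP[q1 _]; apply: contraNneq q1 => E.
by rewrite (evI (etrans E (esym (rmorph0 ev)))) horner0.
Qed.

Lemma in_pathM x y : in_path x -> in_path y -> in_path (x * y).
Proof.
move=> [p hp ix] [q hq iy]; exists (p * q); first exact: path_denM.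
by rewrite rmorphM mulrACA; exact: integral_mul.
Qed.

Lemma in_pathB x y : in_path x -> in_path y -> in_path (x - y).
Proof.
move=> [p hp ix] [q hq iy]; exists (p * q); first exact: path_denM.
have -> : ev (p * q) * (x - y) = ev q * (ev p * x) + ev (- p) * (ev q * y).
  by rewrite rmorphM rmorphN; ring.
by apply: integral_add; apply: integral_mul => //; exact: integral_id.
Qed.

Lemma in_path_ev p : in_path (ev p).
Proof. by exists 1; [exact: path_den1|rewrite rmorph1 mul1r; exact: integral_id]. Qed.

Definition path_pred : pred L := fun x => `[< in_path x >].
Fact path_subring : subring_closed path_pred.
Proof.
split=> [|x y|x y]; rewrite -!topredE /= /path_pred.
- by apply/asboolP; rewrite -(rmorph1 ev); exact: in_path_ev.
- by move=> /asboolP hx /asboolP hy; apply/asboolP; exact: in_pathB.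
- by move=> /asboolP hx /asboolP hy; apply/asboolP; exact: in_pathM.
Qed.
HB.instance Definition _ := GRing.isSubringClosed.Build L path_pred path_subring.

Record path_sort := PathElt { path_val :> L; path_valP : path_val \in path_pred }.
HB.instance Definition _ := [isSub for path_val].
HB.instance Definition _ := [Choice of path_sort by <:].
HB.instance Definition _ := [SubChoice_isSubComNzRing of path_sort by <:].

Let io : {rmorphism path_sort -> L} := val.

Lemma path_ioI : injective io. Proof. exact: val_inj. Qed.

Lemma path_intro x : in_path x -> exists a, io a = x.
Proof. by move=> /asboolP h; exists (PathElt h). Qed.

Lemma path_int (p : {poly path_sort}) x : p \is monic -> root (map_poly io p) x -> exists a, io a = x.
Proof.
move=> pm rx; apply: path_intro.
have [q hq iq] : exists2 q, path_den q & forall i, (i < size p)%N -> integralOver ev (ev q * io p`_i).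
  elim: (size p) => [|n [q hq iq]]; first by exists 1 => //; exact: path_den1.
  have /asboolP[r hr ir] := path_valP p`_n.
  exists (q * r) => [|i]; first exact: path_denM.
  rewrite ltnS leq_eqVlt => /orP[/eqP->|hi]; rewrite rmorphM.
    by rewrite -mulrA; apply: integral_mul => //; exact: integral_id.
  by rewrite mulrC mulrA mulrAC -mulrA mulrC -mulrA mulrC; apply: integral_mul; [exact: iq|exact: integral_id].
exists q => //; pose n := (size p).-1; pose Q := ev q.
have sp : size p = n.+1 by rewrite /n prednK// size_poly_gt0 monic_neq0.
have cm i : (map_poly io p)`_i = io p`_i by exact: coef_map.
have pn1 : io p`_n = 1.
  by rewrite -[n]/(n.+1.-1) -sp -lead_coefE (monicP pm) rmorph1.
(* Multiplying the roots by Q turns the coefficients into Q^(n-i) p_i, which are integral over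
   C[t]. *)
pose P : {poly L} := 'X^n + \poly_(i < n) (Q ^+ (n - i) * io p`_i).
have [Pm sP] := @monic_XnD L n (\poly_(i < n) (Q ^+ (n - i) * io p`_i)) (size_poly _ _).
apply: (integral_root_monic (p := P)) => //.
  rewrite /root /P hornerD hornerXn horner_poly.
  have := rx; rewrite /root horner_coef size_map_poly_id0 ?sp; last first.
    by rewrite (monicP pm) rmorph1 oner_neq0.
  move=> /eqP E; have := congr1 ( *%R (Q ^+ n)) E; rewrite mulr0 mulr_sumr big_ord_recr /=.
  rewrite cm pn1 mul1r -exprMn addrC => E'.
  apply/eqP; apply: etrans E'; congr (_ + _); apply: eq_bigr => i _; rewrite cm exprMn.
  have EQ : Q ^+ n = Q ^+ (n - i) * Q ^+ i by rewrite -exprD subnK// ltnW.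
  by rewrite EQ; exact: mulrACA.
move=> c /(nthP 0)[i hi <-]; rewrite sP in hi.
rewrite /P coefD coefXn coef_poly; case: (ltngtP i n) hi => [hi _|h|-> _]; last first.
- by rewrite addr0 -(rmorph1 ev); exact: integral_id.
- by rewrite ltnS leqNgt h.
  rewrite add0r -[(n - i)%N]prednK ?subn_gt0// exprSr -mulrA; apply: integral_mul.
    by rewrite -rmorphXn; exact: integral_id.
  by apply: iq; rewrite sp ltnS ltnW.
Qed.

Let evA_ex : exists e : {rmorphism {poly C} -> path_sort}, forall p, io (e p) = ev p.
Proof.
have [e he] := choice (fun p => path_intro (in_path_ev p)).
have eD : zmod_morphism e by move=> p q; apply: path_ioI; rewrite rmorphB !he rmorphB.
have eM : monoid_morphism e.
  by split=> [|p q]; apply: path_ioI; rewrite ?rmorph1 ?rmorphM !he ?rmorph1 ?rmorphM.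
pose P : {rmorphism {poly C} -> path_sort} := HB.pack e (GRing.isZmodMorphism.Build _ _ e eD)
  (GRing.isMonoidMorphism.Build _ _ e eM).
by exists P.
Qed.
Definition evA : {rmorphism {poly C} -> path_sort} := sval (cid evA_ex).
Lemma evAE p : io (evA p) = ev p. Proof. exact: (svalP (cid evA_ex)). Qed.

Lemma path_unit q : path_den q -> exists u, u * evA q = 1.
Proof.
move=> hq; have q0 := path_den_ev hq.
have [|u hu] := @path_intro (ev q)^-1.
  by exists q => //; rewrite divff// -(rmorph1 ev); exact: integral_id.
by exists u; apply: path_ioI; rewrite rmorphM hu evAE mulVf// rmorph1.
Qed.

(** Lying over: t - l is not invertible, and the residue field at a maximal ideal containing it is
    algebraic over the algebraically closed field C. *)
Lemma path_spec l : (l == l1) || (l == l2) -> exists pi : {rmorphism path_sort -> C}, forall p, pi (evA p) = p.[l].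
Proof.
move=> hl; have denl q : path_den q -> q.[l] != 0.
  by move=> /andP[h1 h2]; case/orP: hl => /eqP->.
pose z := evA ('X - l%:P).
pose I x := exists y, x = z * y.
have I0 : I 0 by exists 0; rewrite mulr0.
have ID x y : I x -> I y -> I (x + y) by move=> [a ->] [b ->]; exists (a + b); rewrite mulrDr.
have IM a x : I x -> I (a * x) by move=> [b ->]; exists (a * b); rewrite mulrCA.
have dec (x : path_sort) : exists q (p : {poly {poly C}}), [/\ path_den q, p \is monic & (map_poly evA p).[evA q * x] = 0].
  have /asboolP[q hq [p pm rp]] := path_valP x; exists q, p; split=> //.
  have E : map_poly io (map_poly evA p) = map_poly ev p.
    apply/polyP => i; apply: etrans (coef_map io _ _) _; rewrite [RHS]coef_map.
    by apply: etrans (evAE _); congr (io _); exact: coef_map.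
  apply: path_ioI; apply: etrans (esym (horner_map io _ _)) _; rewrite E rmorph0.
  have -> : io (evA q * x) = ev q * io x by apply: etrans (rmorphM io _ _) _; rewrite evAE.
  exact/rootP.
have I1 : ~ I 1.
  move=> [x zx]; have [q [p [hq pm rp]]] := dec x; have ql := denl q hq.
  pose n := (size p).-1; have sp : size p = n.+1 by rewrite /n prednK// size_poly_gt0 monic_neq0.
  (* If (t - l)x = 1, the integral equation of qx times (t - l)^n is a relation over C[t] whose left
     side takes the value q(l)^n at l. *)
  pose G : {poly C} := \sum_(i < n.+1) p`_i * q ^+ i * ('X - l%:P) ^+ (n - i).
  have G0 : evA G = 0.
    rewrite -[RHS](mulr0 (z ^+ n)) -rp horner_coef size_map_poly_id0 ?sp; last first.
      by rewrite (monicP pm) rmorph1 oner_neq0.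
    rewrite rmorph_sum mulr_sumr; apply: eq_bigr => i _.
    rewrite !rmorphM !rmorphXn -/z coef_map exprMn.
    have zxi : z ^+ i * x ^+ i = 1 by rewrite -exprMn -zx expr1n.
    have -> : z ^+ n = z ^+ (n - i) * z ^+ i by rewrite -exprD subnK// -ltnS.
    transitivity (evA p`_i * evA q ^+ i * z ^+ (n - i) * (z ^+ i * x ^+ i)); last by rewrite /=; ring.
    by rewrite zxi mulr1.
  have {}G0 : G = 0 by apply: evI; rewrite -evAE G0 !rmorph0.
  have := congr1 (fun r => r.[l]) G0; rewrite horner0 /G horner_sum big_ord_recr /= big1 ?add0r => [|i _].
    rewrite subnn expr0 mulr1 hornerM horner_exp -[p`_n]/(p`_(n.+1.-1)) -sp -lead_coefE (monicP pm) hornerC mul1r.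
    by apply/eqP; rewrite expf_neq0.
  by rewrite !hornerM !horner_exp hornerXsubC subrr expr0n subn_eq0 leqNgt ltn_ord mulr0.
have [k [chi [chiI _]]] := max_residue I0 ID IM I1.
pose psi : {rmorphism C -> k} := chi \o (evA \o polyC).
have chiev p : chi (evA p) = psi p.[l].
  have /factor_theorem[r Er] : root (p - p.[l]%:P) l by rewrite /root hornerD hornerN hornerC subrr.
  apply/eqP; rewrite -subr_eq0 -[psi _]/(chi (evA p.[l]%:P)) -!rmorphB Er !rmorphM mulf_eq0 orbC.
  by rewrite (chiI (evA ('X - l%:P))) ?eqxx//; exists 1; rewrite mulr1.
have [|pi hpi] := @rmorph_lift path_sort C k psi chi.
  move=> x; have [q [p [hq pm rp]]] := dec x; have ql := denl q hq.
  pose pl : {poly C} := map_poly (horner_eval l) p.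
  have plm : pl \is monic by rewrite monic_map.
  have [rs Er] := closed_field_poly_normal pl; rewrite (monicP plm) scale1r in Er.
  have : (map_poly psi pl).[chi (evA q * x)] = 0.
    have E : map_poly chi (map_poly evA p) = map_poly psi pl.
      apply/polyP => i; rewrite [LHS]coef_map [RHS]coef_map.
      apply: etrans (congr1 chi (coef_map evA p i)) _; apply: etrans (chiev _) _.
      by congr (psi _); apply: esym; exact: coef_map.
    by have := congr1 chi rp; rewrite rmorph0 -horner_map E.
  rewrite Er rmorph_prod horner_prod => /eqP; rewrite prodf_seq_eq0 => /hasP[r _ /=].
  rewrite rmorphB /= map_polyX map_polyC hornerXsubC subr_eq0 rmorphM chiev => /eqP E.
  exists (r / q.[l]); have q0 : psi q.[l] != 0 by rewrite fmorph_eq0.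
  apply: (mulfI q0); apply: etrans E _; apply: etrans (rmorphM psi _ _).
  by congr (psi _); rewrite mulrCA divff ?mulr1.
by exists pi => p; apply: (fmorph_inj psi); rewrite hpi chiev.
Qed.

End PathRing.

Local Notation hom := Defs.hom.

(** * Transport along the Hesse pencil *)

Section PathTransport.
Variables (C : fieldType) (X : prestack C) (x : ob X (C^o : comAlgType C)).
Variables (A : comAlgType C) (L : fieldType) (io : {rmorphism A -> L}).
Hypotheses (ioI : injective io) (cl : root_closed L)
  (int : forall (p : {poly A}) x, p \is monic -> root (map_poly io p) x -> exists a, io a = x).
Variables (D : ob X A) (pi1' pi2' : {lrmorphism A -> (C^o : comAlgType C)}).
Variables (u1 : hom pi1' x D) (u2 : hom pi2' x D).

(** Transport from the first point of [A] to the second along a section. The arrows [u1] and [u2]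
    identify both ends with [x], so that the transport is a loop. *)
Definition path_rel (E : cover X) (p p' : fiber x E) :=
  exists s : {rmorphism cring E D -> A}, [/\ forall r, s (cstr E D r) = r,
    forall c, pi1' (s c) = fpt p (cmap E u1 c) & forall c, pi2' (s c) = fpt p' (cmap E u2 c)].

Lemma fiber_of_point (pi : {lrmorphism A -> (C^o : comAlgType C)}) (u : hom pi x D) (E : cover X)
  (rho : {rmorphism cring E D -> C^o}) : (forall r, rho (cstr E D r) = pi r) ->
  exists p : fiber x E, forall c, rho c = fpt p (cmap E u c).
Proof.
move=> h; have [w [w1 w2 _]] := cpushout u (p := rho) (q := idfun) h.
by exists (Fiber w2) => c; rewrite -w1.
Qed.

Lemma fiber_of_point_uniq (pi : {lrmorphism A -> (C^o : comAlgType C)}) (u : hom pi x D) (E : cover X)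
  (p q : fiber x E) : (forall c, fpt p (cmap E u c) = fpt q (cmap E u c)) -> p = q.
Proof.
move=> h; apply: fiber_ext => c.
have H r : (fpt p \o cmap E u) (cstr E D r) = (idfun : {rmorphism C^o -> C^o}) (pi r).
  by rewrite /= cmapE fptE.
have [w [w1 w2 wu]] := cpushout u (p := fpt p \o cmap E u) (q := idfun) H.
have Ep := wu (fpt p) (fun=> erefl) (fptE p).
by rewrite Ep (wu (fpt q) (fun y => esym (h y)) (fptE q)).
Qed.

Lemma path_rel_ex1 E p : exists p', @path_rel E p p'.
Proof.
have [s [s1 s2]] := @section_surj A L C io pi1' ioI cl int _ _ (cfet E D) (fpt p \o cmap E u1)
  (fun r => etrans (congr1 (fpt p) (cmapE E u1 r)) (fptE p _)).
have [p' hp'] := @fiber_of_point pi2' u2 E (pi2' \o s) (fun r => congr1 pi2' (s1 r)).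
by exists p', s.
Qed.

Lemma path_rel_ex2 E p' : exists p, @path_rel E p p'.
Proof.
have [s [s1 s2]] := @section_surj A L C io pi2' ioI cl int _ _ (cfet E D) (fpt p' \o cmap E u2)
  (fun r => etrans (congr1 (fpt p') (cmapE E u2 r)) (fptE p' _)).
have [p hp] := @fiber_of_point pi1' u1 E (pi1' \o s) (fun r => congr1 pi1' (s1 r)).
by exists p, s.
Qed.

Lemma path_rel_uniq1 E p p' q' : @path_rel E p p' -> path_rel p q' -> p' = q'.
Proof.
move=> [s [s1 s2 s3]] [t [t1 t2 t3]]; apply: (fiber_of_point_uniq (u := u2)) => c.
rewrite -s3 -t3; congr (pi2' _).
by apply: (section_inj (pi := (pi1' : {rmorphism A -> C})) ioI (cfet E D)) => // y; exact: etrans (s2 y) (esym (t2 y)).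
Qed.

Lemma path_rel_uniq2 E p q p' : @path_rel E p p' -> path_rel q p' -> p = q.
Proof.
move=> [s [s1 s2 s3]] [t [t1 t2 t3]]; apply: (fiber_of_point_uniq (u := u1)) => c.
rewrite -s2 -t2; congr (pi1' _).
by apply: (section_inj (pi := (pi2' : {rmorphism A -> C})) ioI (cfet E D)) => // y; exact: etrans (s3 y) (esym (t3 y)).
Qed.

Lemma path_rel_map (E E' : cover X) (m : cover_map E E') p p' :
  path_rel p p' -> path_rel (fiber_map m p) (fiber_map m p').
Proof.
move=> [s [s1 s2 s3]]; exists (s \o cm m D); split=> [r|c|c] /=.
- by rewrite cm_str s1.
- by rewrite s2 cm_nat.
- by rewrite s3 cm_nat.
Qed.

Theorem path_pi1 : exists s : pi1 x, forall E p p', @path_rel E p p' -> @pact C X x s E p = p'.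
Proof.
pose f E p := sval (cid (@path_rel_ex1 E p)); pose g E p := sval (cid (@path_rel_ex2 E p)).
have hf E p : path_rel p (f E p) := svalP (cid (@path_rel_ex1 E p)).
have hg E p : path_rel (g E p) p := svalP (cid (@path_rel_ex2 E p)).
have fg E : cancel (f E) (g E) by move=> p; apply: path_rel_uniq2 (hg _ _) (hf _ _).
have gf E : cancel (g E) (f E) by move=> p; apply: path_rel_uniq1 (hf _ _) (hg _ _).
have nat E E' (m : cover_map E E') (p : fiber x E) : f E' (fiber_map m p) = fiber_map m (f E p).
  by apply: path_rel_uniq1 (hf _ _) (path_rel_map m (hf _ _)).
exists (@Pi1 C X x f (fun E => Bijective (fg E) (gf E)) nat) => E p p' h.
exact: path_rel_uniq1 (hf _ _) h.
Qed.

End PathTransport.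

(** * The Hesse pencil and the surjectivity of the monodromy *)

Lemma line_projective (R : comNzRingType) (V : lmodType R) (v : V) (l : {linear V -> R^o}) :
  l v = 1 -> projective_point (fun x => exists r, x = r *: v).
Proof.
move=> lv; split.
- move=> x [n [c [y [hy ->]]]]; have [r hr] := choice hy.
  exists (\sum_i c i * r i); rewrite scaler_suml; apply: eq_bigr => i _.
  by rewrite {1}hr scalerA.
- have lz (m : {linear V -> R^o}) r : m (r *: v) = (r * m v : R) by exact: linearZ.
  by move=> y y' l1 l2 [r ->] [r' ->]; rewrite !lz; ring.
exists 1%N, (fun=> 1), (fun=> 1); split=> [_|]; last by rewrite big_ord1 scale1r.
by exists l, v; split; [exists 1; rewrite scale1r|rewrite lv].
Qed.

Lemma homog_d3_inj (R : comNzRingType) (i6 : R) (F G : {mpoly R[3]}) : 6%:R * i6 = 1 ->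
  F \is 3.-homog -> G \is 3.-homog -> (forall i j k, d3 F i j k = d3 G i j k) -> F = G.
Proof.
move=> h6 hF hG E; have e1 := homog_eval idfun hF; have e2 := homog_eval idfun hG.
have : 6%:R * F = 6%:R * G by rewrite e1 e2; apply: eq_tri => i j k /=; rewrite E.
have hc (P : {mpoly R[3]}) : i6%:MP * (6%:R * P) = P.
  by rewrite mulrA -mpolyC_nat -mpolyCM [i6 * _]mulrC h6 mpolyC1 mul1r.
by move/(congr1 ( *%R i6%:MP)); rewrite !hc.
Qed.

Lemma XXX_homog (R : comNzRingType) (i j k : 'I_3) : ('X_i * 'X_j * 'X_k : {mpoly R[3]}) \is 3.-homog.
Proof. by rewrite -!mpolyXD dhomogX /= !mdegD !mdeg1. Qed.

Lemma subst_homog (R : comNzRingType) (i6 : R) (F : {mpoly R[3]}) (h : 'M[R]_3) : 6%:R * i6 = 1 ->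
  F \is 3.-homog -> F \mPo [tuple \sum_(b < 3) h a b *: 'X_b | a < 3] \is 3.-homog.
Proof.
move=> h6 hF; set t := [tuple _ | a < 3].
have E := homog_eval (comp_mpoly t : {rmorphism {mpoly R[3]} -> {mpoly R[3]}}) hF.
have hc (P : {mpoly R[3]}) : i6 *: (6%:R * P) = P.
  by rewrite -mul_mpolyC mulrA -mpolyC_nat -mpolyCM [i6 * _]mulrC h6 mpolyC1 mul1r.
rewrite -(hc (F \mPo t)) E; apply: dhomogZ; rewrite /tri.
have ht i : (t`_(i : 'I_3) : {mpoly R[3]}) \is 1.-homog.
  by rewrite -tnth_nth tnth_mktuple; apply: rpred_sum => b _; apply: dhomogZ; rewrite dhomogX /= mdeg1.
do 3!(apply: rpred_sum => ? _); rewrite !mxE /= comp_mpolyC !comp_mpolyXU.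
rewrite mul_mpolyC; apply: dhomogZ.
by apply: (dhomogM (d := 2) (e := 1)) => //; apply: (dhomogM (d := 1) (e := 1)).
Qed.

Section HesseCubic.
Variables (C : fieldType) (C0 : char0 C) (R : comAlgType C) (t u : R).
Hypothesis tu : u * (1 + 8%:R * t ^+ 3) = 1.

Definition hesse_form : {mpoly R[3]} :=
  'X_0 * 'X_0 * 'X_0 + 'X_1 * 'X_1 * 'X_1 + 'X_(2%:R) * 'X_(2%:R) * 'X_(2%:R)
  + (6%:R * t) *: ('X_0 * 'X_1 * 'X_(2%:R)).

Lemma hesse_form_homog : hesse_form \is 3.-homog.
Proof. by rewrite !dhomogD ?dhomogZ ?XXX_homog. Qed.

Lemma d3_hesse i j k : d3 hesse_form i j k = 6%:R * hesse 1 t i j k.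
Proof.
rewrite /hesse_form !d3D d3Z !(d3_prod _ _ _ (@mderivXi R _) (@mderivXi R _) (@mderivXi R _)).
by elim/I3_ind: i; elim/I3_ind: j; elim/I3_ind: k; rewrite /hesse /=; ring.
Qed.

Definition hesse_line : classical_sets.set {mpoly R[3]} := fun F => exists r, F = r *: hesse_form.

Lemma hesse_smooth : smooth_cubic hesse_line.
Proof.
split.
- have ll : linear (fun F : {mpoly R[3]} => (6%:R^-1 : C)%:A * d3 F 0 0 0 : R^o).
    by move=> r F G; rewrite d3D d3Z mulrDr mulrCA.
  apply: (line_projective (l := mklin ll)); rewrite /= d3_hesse /hesse /= mulr1 mulrC; exact: (h6A R C0).
- by move=> F [r ->]; apply: dhomogZ; exact: hesse_form_homog.
move=> k g v [l vl] H; have k0 := alg_char0 C0 g.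
have hg := map_homog g hesse_form_homog.
have [|_ Hd] := H hesse_form; first by exists 1; rewrite scale1r.
pose v' : 'cV[k]_3 := \col_i v i.
have Eg c : tri (hesse 1 (g t)) v' v' (bas c) = 0.
  have := homog_mderiv v' c hg; have -> : (fun i => v' i 0) = v by apply/funext => i; rewrite mxE.
  rewrite Hd mulr0 => /esym/eqP; rewrite mulf_eq0 (negPf (k0 3 isT)) /=.
  have E i j m : 1 * d3 (map_mpoly g hesse_form) i j m = 6%:R * hesse 1 (g t) i j m.
    by rewrite mul1r d3_map d3_hesse rmorphM rmorph_nat hesse_map rmorph1.
  by rewrite -[tri _ _ _ _]mul1r (tri_scale _ _ _ E) mulf_eq0 (negPf (k0 6%N isT)) => /eqP.
have := Eg 0; have := Eg 1; have := Eg 2%:R; rewrite !tri_hesse !mxE /= => e2 e1 e0.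
set X := v 0 in e0 e1 e2; set Y := v 1 in e0 e1 e2; set Z := v 2%:R in e0 e1 e2.
have f0 : X ^+ 2 = - (2%:R * g t * Y * Z) by apply/eqP; rewrite -addr_eq0 -[X in _ == X]e0; apply/eqP; ring.
have f1 : Y ^+ 2 = - (2%:R * g t * X * Z) by apply/eqP; rewrite -addr_eq0 -[X in _ == X]e1; apply/eqP; ring.
have f2 : Z ^+ 2 = - (2%:R * g t * X * Y) by apply/eqP; rewrite -addr_eq0 -[X in _ == X]e2; apply/eqP; ring.
have gu : g u * (1 + 8%:R * g t ^+ 3) = 1.
  by have := congr1 g tu; rewrite rmorphM rmorphD rmorph1 rmorphM rmorphXn rmorph_nat.
(* Multiplying the three equations gives (1 + 8t^3)(XYZ)^2 = 0. *)
have XYZ : X * Y * Z = 0.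
  have e : (X * Y * Z) ^+ 2 = 0; last by move/eqP: e; rewrite expf_eq0 => /eqP.
  rewrite -[_ ^+ 2]mul1r -gu.
  have -> : g u * (1 + 8%:R * g t ^+ 3) * (X * Y * Z) ^+ 2 = g u * (X ^+ 2 * Y ^+ 2 * Z ^+ 2 + 8%:R * g t ^+ 3 * (X * Y * Z) ^+ 2) by ring.
  by rewrite f0 f1 f2; ring.
have z a b : (a : k) ^+ 2 = b -> b = 0 -> a = 0 by move=> E E0; move: E; rewrite E0 => /eqP; rewrite expf_eq0 => /eqP.
case/negP: vl; have [X0 Y0 Z0] : [/\ X = 0, Y = 0 & Z = 0].
  move/eqP: XYZ; rewrite !mulf_eq0 -orbA => /or3P[]/eqP E0.
  - by rewrite E0; split=> //; [apply: z f1 _|apply: z f2 _]; rewrite E0; ring.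
  - by rewrite E0; split=> //; [apply: z f0 _|apply: z f2 _]; rewrite E0; ring.
  - by rewrite E0; split=> //; [apply: z f0 _|apply: z f1 _]; rewrite E0; ring.
by elim/I3_ind: l; apply/eqP.
Qed.

Definition hesse_cubic : cubic R := Cubic hesse_smooth.

End HesseCubic.

Lemma pp_scale (R : comNzRingType) (V : lmodType R) (L : classical_sets.set V) r v :
  projective_point L -> L v -> L (r *: v).
Proof. by move=> pL hv; apply: (pp_submod pL); exists 1%N, (fun=> r), (fun=> v); rewrite big_ord1. Qed.

Section Surjectivity.
Variables (C : closedFieldType) (C0 : char0 C) (w0 : C) (hw : cube_root w0) (x : cubic (C^o : comAlgType C)).
Notation FC := (frame_cover C0 hw).
Notation Fib := (@fiber C (plane_cubics C) x FC).

(** In suitable coordinates the frame [z] is Schroedinger's; normalizing the coefficient of the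
    cubes leaves the parameter l = be / al of the pencil. *)
Lemma fib_hesse (z : Fib) : exists (h h' : 'M[C]_3) (l s r0 : C) F0, [/\ h *m h' = 1%:M, h' *m h = 1%:M,
  forall v, h' *m (fib_frame z v : 'M[C]_3) = weyl0 w0 v *m h', 1 + 8%:R * l ^+ 3 != 0 &
  [/\ ceq x F0, r0 != 0 & forall i j k, tcomp (d3 F0) h i j k = r0 * hesse 1 l i j k]].
Proof.
pose D := @Pring C^o C idfun.
have Dl : plocal D by move=> s s0; exists (s^-1 : C); rewrite mulVf.
have [B0 [s [[F0 hF ->{B0}] s0 _ sm]]] := tensors_gen x C0 (idfun : {rmorphism C^o -> C}).
have h6 : 6%:R * (6%:R^-1 : C) = 1 by rewrite divff// C0.
have h3 : 3%:R * (2%:R * 6%:R^-1 : C) = 1 by rewrite mulrA -natrM.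
have [fW fI] := fib_frameP z.
have ww : (w0%:A : C^o) = w0 by exact: mulr1.
have fr : frame (w0 : D) (d3 F0 : _ -> _ -> _ -> D) (fib_frame z).
  split; first by move: fW; rewrite /= ww.
  by move=> u; apply: (fI (d3 F0)); exists F0.
have [h [h' [al [be [hh hh' hW hB [al0 d0]]]]]] :=
  @frame_local_basis D w0 _ hw h3 Dl (d3 F0) (fib_frame z) (d3_sym F0) (sm C idfun s0) fr.
exists h, h', (be / al), s, al, F0; split=> //.
- move=> v; have := congr1 (fun M => h' *m M *m h') (hW v).
  rewrite -!mulmxA hh mulmx1 => ->; by rewrite [h' *m (h *m _)]mulmxA hh' mul1mx.
- have -> : 1 + 8%:R * (be / al) ^+ 3 = (al ^+ 3 + 8%:R * be ^+ 3) / al ^+ 3 :> C by field.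
  by rewrite mulf_neq0 ?invr_eq0 ?expf_neq0.
split=> // i j k; apply: etrans (hB i j k) _; rewrite /hesse.
by case: ifP => _; [rewrite mulr1|case: ifP => _; rewrite ?mulr0// mulrCA divff ?mulr1].
Qed.

Section Endpoint.
Variables (A : comAlgType C) (t u : A) (tu : u * (1 + 8%:R * t ^+ 3) = 1).
Let D := hesse_cubic C0 tu.
Variables (pi : {lrmorphism A -> (C^o : comAlgType C)}) (z : Fib).
Variables (h h' : 'M[C]_3) (r0 : C) (F0 : {mpoly (C^o)[3]}).
Hypotheses (hh : h *m h' = 1%:M) (hh' : h' *m h = 1%:M)
  (hW : forall v, h' *m (fib_frame z v : 'M[C]_3) = weyl0 w0 v *m h')
  (F0x : ceq x F0) (r00 : r0 != 0)
  (F0h : forall i j k, tcomp (d3 F0) h i j k = r0 * hesse 1 (pi t : C) i j k).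

Definition end_line : classical_sets.set 'M[C^o]_3 := fun M => exists r, M = r *: (h' : 'M[C^o]_3).

Lemma end_pgl3 : pgl3 end_line.
Proof.
have tl : linear (fun M : 'M[C^o]_3 => 3%:R^-1 * \tr (M *m h) : C^o).
  by move=> r M N; rewrite mulmxDl -scalemxAl linearD linearZ /= mulrDr mulrCA.
split.
  apply: (line_projective (l := mklin tl)); rewrite /= hh' mxtrace1; apply: mulVf; exact: C0.
exists 1%N, (fun=> \det h), (fun=> \det h'); split; last first.
  by rewrite big_ord1 [RHS](_ : _ = \det h * \det h')// -det_mulmx hh det1.
by move=> _; exists h'; split=> //; exists 1; rewrite scale1r.
Qed.

Lemma end_cubic F M : ceq D F -> end_line M -> ceq x (subst_form (map_mpoly pi F) M).
Proof.
move=> [r ->] [c ->]; set G := subst_form _ _.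
have h6 := h6A (C^o : comAlgType C) C0.
have hF : map_mpoly pi (r *: hesse_form t) \is 3.-homog by apply: map_homog; apply: dhomogZ; exact: hesse_form_homog.
have hG : G \is 3.-homog by exact: (subst_homog _ h6 hF).
have -> : G = (pi r * c ^+ 3 * 6%:R / r0 : C^o) *: F0.
  apply: (homog_d3_inj h6 hG); first by apply: dhomogZ; exact: ceq_homog F0x.
  move=> i j k; rewrite /G /subst_form (d3_subst _ _ _ h6 hF hG) d3Z.
  have E a b e : d3 (map_mpoly pi (r *: hesse_form t)) a b e = (pi r * 6%:R / r0 : C) * tcomp (d3 F0) h a b e.
    rewrite d3_map d3Z d3_hesse rmorphM rmorphM rmorph_nat hesse_map rmorph1 F0h.
    by rewrite -!mulrA [r0^-1 * _]mulrA mulVf// mul1r.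
  rewrite -(tri_bas (tcomp _ _)) tri_comp -!scalemxAl.
  have -> : tri (d3 (map_mpoly pi (r *: hesse_form t))) (c *: (h' *m bas i)) (c *: (h' *m bas j)) (c *: (h' *m bas k))
     = c ^+ 3 * ((pi r * 6%:R / r0 : C) * tri (tcomp (d3 F0) h) (h' *m bas i) (h' *m bas j) (h' *m bas k)).
    rewrite (triZ3 _ _ _ _ _ _ (@d3_sym _ _)); congr (_ * _); first by rewrite !exprS expr0 mulr1 mulrA.
    apply: etrans (esym (mul1r _)) _; apply: tri_scale => a b e; rewrite mul1r; exact: E.
  rewrite tri_comp !mulmxA hh !mul1mx tri_bas; set d := d3 F0 i j k.
  have key (p q e f m : C) : p * (q * e / f * m) = (q * p * e / f) * m by ring.
  exact: key.
exact: (pp_scale _ (sc_point (ceqP x)) F0x).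
Qed.

Definition end_hom : @cubic_hom C A (C^o : comAlgType C) pi x D := CubicHom end_pgl3 end_cubic.

Lemma end_frame (s : {rmorphism fT (fpk w0 D) -> A}) :
  (forall r, s (fs (fpk w0 D) r) = r) -> (forall v, map_mx s (fW (fpk w0 D) v) = weyl0 (w0%:A : A) v) ->
  forall c, pi (s c) = fpt z (fcmap C0 w0 end_hom c).
Proof.
move=> s1 s2; apply: (fcmap_uniq C0 (u := end_hom) (g := pi \o s) (q := fpt z)) => [r|M v [c ->]].
  by rewrite /= s1 fptE.
have -> : map_mx (fpt z \o fs (fpk w0 x)) (c *: h' : 'M[C^o]_3) = c *: (h' : 'M[C]_3).
  by apply/matrixP => i j; rewrite !mxE /= fptE.
have -> : map_mx (pi \o s) (fW (fpk w0 D) v) = weyl0 w0 v.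
  have -> : map_mx (pi \o s) (fW (fpk w0 D) v) = map_mx pi (map_mx s (fW (fpk w0 D) v)) by exact: map_mx2.
  rewrite s2; apply/matrixP => i j; rewrite !mxE.
  have ww : pi (w0%:A : A) = w0 by rewrite rmorph_alg; exact: mulr1.
  have wv a : pi (wp (w0%:A : A) a) = wp w0 a.
    by apply: etrans (wp_map _ _ _) _; congr (wp _ a); exact: ww.
  by case: ifP => _; [exact: wv|exact: rmorph0].
apply: etrans (esym (scalemxAr c (weyl0 w0 v) h')) _; apply: etrans _ (scalemxAl c h' _).
by congr (_ *: _); exact: esym (hW v).
Qed.

End Endpoint.

Theorem Theta_surj (z : Fib) g : exists s : @pi1 C (plane_cubics C) x, Theta z s = g.
Proof.
have [L [ev [cl evI]]] := function_field C0.
have [h1 [h1' [l1 [s1 [r1 [F1 [hh1 hh1' hW1 d1 [F1x r10 F1h]]]]]]]] := fib_hesse z.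
have [h2 [h2' [l2 [s2 [r2 [F2 [hh2 hh2' hW2 d2 [F2x r20 F2h]]]]]]]] := fib_hesse (fib_act z g).
pose P := path_sort ev l1 l2.
pose eP : {rmorphism {poly C} -> P} := evA ev l1 l2.
pose A := alg_of (eP \o polyC).
pose io : {rmorphism A -> L} := (val : {rmorphism P -> L}).
have mkpi l : (l == l1) || (l == l2) -> exists pi : {lrmorphism A -> (C^o : comAlgType C)}, forall p, pi (eP p) = p.[l].
  move=> hl; have [pi hpi] := path_spec evI hl.
  have pA (c : C) : (pi : {rmorphism A -> C^o}) c%:A = c%:A.
    by rewrite alg_ofE /= hpi hornerC; apply: esym; exact: mulr1.
  by exists (mklr pA).
have [pi1' hpi1] : exists pi : {lrmorphism A -> (C^o : comAlgType C)}, forall p, pi (eP p) = p.[l1] by apply: mkpi; rewrite eqxx.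
have [pi2' hpi2] : exists pi : {lrmorphism A -> (C^o : comAlgType C)}, forall p, pi (eP p) = p.[l2] by apply: mkpi; rewrite eqxx orbT.
pose t : A := eP 'X.
(* The polynomial 1 + 8t^3 is nonzero at both ends, hence invertible in the path ring, and the
   pencil is smooth over it. *)
have [u hu] : exists u : A, u * (1 + 8%:R * t ^+ 3) = 1.
  have [|u hu] := @path_unit C L ev l1 l2 evI (1 + 8%:R * 'X^3).
    have he l : (1 + 8%:R * 'X^3 : {poly C}).[l] = 1 + 8%:R * l ^+ 3.
      by rewrite -polyC_natr -polyC1 hornerD hornerM !hornerC hornerXn.
    by rewrite /path_den !he d1 d2.
  by exists u; rewrite -[RHS]hu -/eP rmorphD rmorph1 rmorphM rmorph_nat rmorphXn.
have t1 : pi1' t = l1 by rewrite hpi1 hornerX.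
have t2 : pi2' t = l2 by rewrite hpi2 hornerX.
rewrite -t1 in F1h; rewrite -t2 in F2h.
pose D := hesse_cubic C0 hu.
pose u1 := end_hom hu hh1 hh1' F1x r10 F1h; pose u2 := end_hom hu hh2 hh2' F2x r20 F2h.
have ww : cube_root (w0%:A : A) := cube_root_map (in_alg A) hw.
have [s [s_str s_fr]] : exists s : {rmorphism fT (fpk w0 D) -> A},
  (forall r, s (fs (fpk w0 D) r) = r) /\ (forall v, map_mx s (fW (fpk w0 D) v) = weyl0 (w0%:A : A) v).
  have [|s [hs1 hs2]] := fr_univ (fP (fpk w0 D)) (f := idfun) (W' := weyl0 (w0%:A : A)); last by exists s.
  split; first exact: weyl0P.
  move=> B [F [r ->] ->] v.
  have h6 := h6A A C0; have h3 : 3%:R * (2%:R * (6%:R^-1 : C)%:A) = 1 :> A by rewrite mulrA -natrM h6.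
  have E : tinv (d3 (r *: hesse_form t)) (weyl0 (w0%:A : A) v).
    have hu1 : invertible (1 : A) by exists 1; rewrite mulr1.
    have hB i j k : 1 * d3 (r *: hesse_form t) i j k = r * 6%:R * hesse 1 t i j k by rewrite mul1r d3Z d3_hesse mulrA.
    apply: (tinv_scale hu1 hB); exact: (hesse_weyl0 ww 1 t v).
  exact: E.
have ioI : injective io by exact: val_inj.
have [a ha] := @path_pi1 C (plane_cubics C) x A L io ioI cl (@path_int C L ev l1 l2) D pi1' pi2' u1 u2.
exists a; apply: (@fib_act_inj _ _ _ _ _ z); rewrite -ThetaE; apply: ha.
exists s; split=> // c; [exact: end_frame|exact: end_frame].
Qed.

End Surjectivity.

(** * Flexes and frames *)

Lemma vec3_eq (S : comPzRingType) (u v : 'cV[S]_3) :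
  u 0 0 = v 0 0 -> u 1 0 = v 1 0 -> u 2%:R 0 = v 2%:R 0 -> u = v.
Proof. by move=> e0 e1 e2; rewrite [u]vec3E [v]vec3E e0 e1 e2. Qed.

Lemma sum_vec2 (V : nmodType) (F : 'cV['F_3]_2 -> V) :
  \sum_u F u = \sum_(a : 'F_3) \sum_(b : 'F_3) F (vec2 a b).
Proof.
rewrite pair_big /=; apply: (reindex (fun p => vec2 p.1 p.2)).
exists (fun u : 'cV['F_3]_2 => (u 0 0, u 1 0)) => [[a b] _|u _] /=; first by rewrite vec2_0 vec2_1.
by rewrite -vec2E.
Qed.

(* For the Schroedinger frame this is e_j |-> e_(-j); its (-1)-eigenline is the flex p_0. *)
Definition parity (S : comPzRingType) (i : S) (W : 'cV['F_3]_2 -> 'M[S]_3) : 'M[S]_3 := i *: \sum_u W u.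

Section Parity.
Variables (S : comPzRingType) (w i3 : S).
Hypotheses (w1 : cube_root w) (h3 : 3%:R * i3 = 1).
Implicit Types W : 'cV['F_3]_2 -> 'M[S]_3.

Lemma sum_wp (c : 'F_3) : \sum_(b : 'F_3) wp w (b * c) = if c == 0 then 3%:R else 0.
Proof.
apply: etrans (sum3 (fun b : 'I_3 => wp w ((b : 'F_3) * c))) _.
elim/F3_ind: c.
- have -> : ((0 : 'I_3) : 'F_3) * 0 = 0 by exact/val_inj.
  have -> : ((1 : 'I_3) : 'F_3) * 0 = 0 by exact/val_inj.
  have -> : ((2%:R : 'I_3) : 'F_3) * 0 = 0 by exact/val_inj.
  by rewrite eqxx wp0; ring.
- have -> : ((0 : 'I_3) : 'F_3) * 1 = 0 by exact/val_inj.
  have -> : ((1 : 'I_3) : 'F_3) * 1 = 1 by exact/val_inj.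
  have -> : ((2%:R : 'I_3) : 'F_3) * 1 = 2%:R by exact/val_inj.
  by rewrite wp0 wp1 (wp2 w1) /=; ring.
have -> : ((0 : 'I_3) : 'F_3) * 2%:R = 0 by exact/val_inj.
have -> : ((1 : 'I_3) : 'F_3) * 2%:R = 2%:R by exact/val_inj.
have -> : ((2%:R : 'I_3) : 'F_3) * 2%:R = 1 by exact/val_inj.
by rewrite wp0 wp1 (wp2 w1) /=; ring.
Qed.

(** Only the first coordinate i - j of u contributes at (i, j), and summing over the second one
    leaves 2i = j, that is, j = -i. *)
Lemma parity_weyl0 : parity i3 (weyl0 w) = mx3 1 0 0 0 0 1 0 1 0.
Proof.
apply/matrixP => i j; rewrite /parity mxE summxE sum_vec2.
have -> : \sum_(a : 'F_3) \sum_(b : 'F_3) weyl0 w (vec2 a b) i j =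
    \sum_(b : 'F_3) wp w (b * (2%:R * (i : 'F_3) - (j : 'F_3))).
  rewrite (bigD1 ((i : 'F_3) - (j : 'F_3)))//= [X in _ + X]big1 ?addr0 => [|a /negPf ne].
    apply: eq_bigr => b _; rewrite mxE vec2_0 vec2_1 addrC subrK eqxx; congr (wp w _).
    by rewrite /GRing.zero /=; ring.
  apply: big1 => b _; rewrite mxE vec2_0; case: eqP => // e; case/eqP: ne.
  by rewrite e addrC addKr.
rewrite sum_wp; elim/I3_ind: i; elim/I3_ind: j; rewrite !mxE /=; by [rewrite mulrC h3|rewrite mulr0].
Qed.

Lemma parity_conj W W' (i : S) (h : 'M[S]_3) : (forall u, W u *m h = h *m W' u) ->
  parity i W *m h = h *m parity i W'.
Proof.
move=> E; rewrite /parity -scalemxAl -scalemxAr mulmx_suml mulmx_sumr; congr (_ *: _).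
by apply: eq_bigr => u _; exact: E.
Qed.

Lemma parity_map (T : comPzRingType) (f : {rmorphism S -> T}) W i :
  map_mx f (parity i W) = parity (f i) (fun u => map_mx f (W u)).
Proof. by rewrite /parity map_mxZ; congr (_ *: _); exact: raddf_sum. Qed.

Definition flexvec : 'cV[S]_3 := vec3 0 1 (-1).

Lemma parity0_flex : parity i3 (weyl0 w) *m flexvec = - flexvec.
Proof. by rewrite parity_weyl0 mx3_mul; apply: vec3_eq; rewrite !mxE /=; ring. Qed.

Variable i2 : S.
Hypothesis h2 : 2%:R * i2 = 1.

(** The factor [c] will be a determinant that is a unit only near a given point. *)
Lemma parity0_ker (v : 'cV[S]_3) c : c *: (parity i3 (weyl0 w) *m v) = - (c *: v) -> c *: v = (c * v 1 0) *: flexvec.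
Proof.
rewrite parity_weyl0 mx3_mul => /matrixP E; have := E 0 0; have := E 1 0; rewrite !mxE /= => e1 e0.
apply: vec3_eq; rewrite !mxE /=; [|by rewrite mulr1|].
  have e : c * v 0 0 = - (c * v 0 0) by rewrite -[RHS]e0; ring.
  rewrite mulr0; transitivity (2%:R * i2 * (c * v 0 0)); first by rewrite h2 mul1r.
  have -> : 2%:R * i2 * (c * v 0 0) = i2 * (c * v 0 0 + c * v 0 0) by ring.
  by rewrite {1}e addNr mulr0.
by apply: etrans (_ : _ = - (c * v 1 0)) _; [rewrite -e1; ring|ring].
Qed.

Variable W : 'cV['F_3]_2 -> 'M[S]_3.
Hypothesis hW : weyl w W.
Notation P := (parity i3 W).

Lemma parity_line (k : fieldType) (chi : {rmorphism S -> k}) : exists h : 'M[S]_3,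
  [/\ forall u, W u *m h = h *m weyl0 w u, chi (\det h) != 0, P *m (h *m flexvec) = - (h *m flexvec)
  & forall v, P *m v = - v -> exists2 c, \det h *: (\adj h *m v) = c *: flexvec & (\det h ^+ 2) *: v = c *: (h *m flexvec)].
Proof.
have [h hh d0] := weyl_coord w1 h3 chi hW.
have hP := parity_conj i3 hh; exists h; split=> //; first by rewrite mulmxA hP -mulmxA parity0_flex mulmxN.
move=> v hv; pose v' := \adj h *m v.
have E : \det h *: v' = (\det h * v' 1 0) *: flexvec.
  apply: parity0_ker; have : h *m (parity i3 (weyl0 w) *m v') = - (h *m v').
    by rewrite mulmxA -hP /v' -mulmxA [h *m (\adj h *m v)]mulmxA mul_mx_adj mul_scalar_mx -scalemxAr hv scalerN.
  move/(congr1 (mulmx (\adj h))); rewrite mulmxN [\adj h *m (h *m v')]mulmxA [\adj h *m (h *m _)]mulmxA.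
  by rewrite mul_adj_mx !mul_scalar_mx.
exists (\det h * v' 1 0) => //; move/(congr1 (mulmx h)): E; rewrite -!scalemxAr => <-.
by rewrite /v' [h *m (\adj h *m v)]mulmxA mul_mx_adj mul_scalar_mx scalerA expr2.
Qed.

Lemma paritysq : P *m P = 1%:M.
Proof.
apply/matrixP => i j; apply/eqP; rewrite -subr_eq0; apply/eqP/local_eq0 => k chi.
have [h hh d0] := weyl_coord w1 h3 chi hW; exists (\det h) => //.
have hP := parity_conj i3 hh.
have E : P *m P *m h = h.
  rewrite -mulmxA hP mulmxA hP -mulmxA parity_weyl0 -[RHS]mulmx1; congr (_ *m _).
  by apply/matrixP => a b; elim/I3_ind: a; elim/I3_ind: b; rewrite !mxE sum3 !mxE /=; ring.
move: E; set Q := P *m P => E.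
have : Q *m (h *m \adj h) = h *m \adj h by rewrite mulmxA E.
rewrite mul_mx_adj mul_mx_scalar => /matrixP/(_ i j); rewrite [LHS]mxE [RHS]mxE => e.
by rewrite mulrBr e !mxE mulr_natr subrr.
Qed.

(** The projector onto the (-1)-eigenline. Its trace 1 shows that the coordinates of eigenvectors
    generate the unit ideal. *)
Definition flexproj : 'M[S]_3 := i2 *: (1%:M - P).

Lemma flexproj_ker (v : 'cV[S]_3) : P *m (flexproj *m v) = - (flexproj *m v).
Proof.
have E : P *m flexproj = - flexproj.
  by rewrite /flexproj -scalemxAr mulmxBr paritysq mulmx1 -scalerN opprB.
by rewrite mulmxA E mulNmx.
Qed.

Lemma flexproj_id (v : 'cV[S]_3) : P *m v = - v -> flexproj *m v = v.
Proof.
move=> hv; rewrite /flexproj -scalemxAl mulmxBl mul1mx hv opprK -mulr2n -scaler_nat scalerA.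
by rewrite mulrC h2 scale1r.
Qed.

Lemma tr_flexproj : \tr flexproj = 1.
Proof.
have trP : \tr P = 1.
  rewrite /parity mxtraceZ raddf_sum /= (bigD1 0)//= [X in \tr _ + X]big1 => [|u u0].
    by rewrite addr0 hW.1 mxtrace1 mulrC.
  exact: (weyl_tr w1 h3 hW u0).
by rewrite mxtraceZ raddfB /= mxtrace1 trP -[RHS]h2; ring.
Qed.

End Parity.

Lemma lin_scale (R : comNzRingType) (V : lmodType R) (m : {linear V -> R^o}) r v : m (r *: v) = (r * m v : R).
Proof. exact: linearZ. Qed.

Section FrameFlex.
Variables (C : fieldType) (C0 : char0 C) (w0 : C) (hw : cube_root w0) (R : comAlgType C) (a : cubic R).
Variable W : 'cV['F_3]_2 -> 'M[R]_3.
Hypothesis hW : isf w0 a idfun W.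
Let wR : R := w0%:A.
Let i6 : R := (6%:R^-1 : C)%:A.
Let i2 : R := 3%:R * i6.
Let i3 : R := 2%:R * i6.
Let h6 : 6%:R * i6 = 1 := h6A R C0.
Let h2 : 2%:R * i2 = 1. Proof. by rewrite mulrA -natrM. Qed.
Let h3 : 3%:R * i3 = 1. Proof. by rewrite mulrA -natrM. Qed.
Let w1 : cube_root wR := cube_root_map (in_alg R) hw.
Notation P := (parity i3 W).
Let hWw : weyl wR W := hW.1.

Definition frame_flex : classical_sets.set 'cV[R]_3 := fun v => P *m v = - v.

Lemma frame_flex_point : projective_point frame_flex.
Proof.
split.
- move=> x [n [c [v [hv ->]]]]; rewrite /frame_flex mulmx_sumr -sumrN; apply: eq_bigr => i _.
  by rewrite -scalemxAr hv scalerN.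
- have cl (m : {linear 'cV[R]_3 -> R^o}) v r : m (r *: v) = r * m v :> R by exact: lin_scale.
  move=> v v' l m hv hv'; apply/eqP; rewrite -subr_eq0; apply/eqP/local_eq0 => k chi.
  have [h [_ d0 _ hl]] := parity_line w1 h3 h2 hWw chi.
  have [c _ E] := hl v hv; have [c' _ E'] := hl v' hv'.
  exists (\det h ^+ 2 * \det h ^+ 2); last by rewrite !rmorphM !mulf_neq0.
  have e1 := congr1 l E; have e2 := congr1 m E; have e3 := congr1 l E'; have e4 := congr1 m E'.
  rewrite !cl in e1 e2 e3 e4.
  have -> : \det h ^+ 2 * \det h ^+ 2 * ((l v : R) * (m v' : R) - (l v' : R) * (m v : R)) =
    (\det h ^+ 2 * (l v : R)) * (\det h ^+ 2 * (m v' : R)) - (\det h ^+ 2 * (l v' : R)) * (\det h ^+ 2 * (m v : R)) by ring.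
  by rewrite e1 e2 e3 e4; ring.
have ll i : linear (fun v : 'cV[R]_3 => v i 0 : R^o) by move=> r p q; rewrite !mxE.
exists 3%N, (fun=> 1), (fun i => (flexproj i3 i2 W *m bas i) i 0); split=> [i|].
  exists (mklin (ll i)), (flexproj i3 i2 W *m bas i); split=> //.
  exact: (flexproj_ker w1 h3 i2 hWw).
rewrite -[LHS](tr_flexproj w1 h3 h2 hWw); apply: eq_bigr => i _.
rewrite scale1r mulmx_bas; move: (flexproj _ _ _) => Q; by rewrite mxE.
Qed.

Lemma contactE F (v w : 'cV[R]_3) i : F \is 3.-homog ->
  (mmap polyC (fun j => (v j 0)%:P + w j 0 *: 'X) F)`_i =
  i6 * nth 0 [:: tri (d3 F) v v v; 3%:R * tri (d3 F) v v w; 3%:R * tri (d3 F) v w w; tri (d3 F) w w w] i.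
Proof. by move=> /(homog_contact v w i) <-; rewrite mulrA [i6 * _]mulrC h6 mul1r. Qed.

Lemma frame_flexP : is_flex (ceq a) frame_flex.
Proof.
have key F (k : fieldType) (chi : {rmorphism R -> k}) : ceq a F -> exists h : 'M[R]_3, [/\ chi (\det h) != 0,
   frame_flex (h *m flexvec R), forall v, frame_flex v -> exists c, (\det h ^+ 2) *: v = c *: (h *m flexvec R)
   & exists al be, forall i j l, tcomp (d3 F) h i j l = hesse al be i j l].
  move=> hF; have [h [hh d0 hf hl]] := parity_line w1 h3 h2 hWw chi.
  exists h; split=> //; first by move=> v /hl[c _ E]; exists c.
  apply: (weyl0_hesse w1 h3 (tsym_comp h (d3_sym F))) => u x y z.
  have hB : tinv (d3 F) (W u) by apply: (hW.2 (d3 F)); exists F.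
  by rewrite !tri_comp !mulmxA -!hh -!mulmxA hB.
have tE (F : {mpoly R[3]}) h al be x y z : (forall i j l, tcomp (d3 F) h i j l = hesse al be i j l) ->
    tri (d3 F) (h *m x) (h *m y) (h *m z) = tri (hesse al be) x y z.
  by move=> E; rewrite -tri_comp; exact: eq_tri.
have sc F x y z (r s t : R) : tri (d3 F) (r *: x) (s *: y) (t *: z) = r * s * t * tri (d3 F) x y z.
  exact: (triZ3 _ _ _ _ _ _ (d3_sym F)).
have van F v : ceq a F -> frame_flex v -> tri (d3 F) v v v = 0.
  move=> hF hv; apply: local_eq0 => k chi; have [h [d0 _ hl [al [be E]]]] := key F k chi hF.
  have [c Ec] := hl v hv; exists (\det h ^+ 2 * \det h ^+ 2 * \det h ^+ 2).
    by rewrite -sc Ec sc (tE _ _ _ _ _ _ _ E) tri_hesse !mxE /=; ring.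
  by rewrite !rmorphM !mulf_neq0.
split; first exact: frame_flex_point.
  by move=> F v hF hv [|i]// _; rewrite contactE ?(ceq_homog hF)//= van ?mulr0.
move=> w hc F v hF hv; have hg := ceq_homog hF.
have h2c v' : frame_flex v' -> 3%:R * tri (d3 F) v' v' w = 0.
  move=> hv'; have := hc F v' hF hv' 1%N isT; rewrite contactE//= => /(congr1 ( *%R 6%:R)).
  by rewrite mulrA h6 mul1r mulr0.
move=> [|[|[|i]]]// _; rewrite contactE//=.
- by rewrite van ?mulr0.
- by rewrite h2c ?mulr0.
(* At the flex p = (0, 1, -1) of a Hesse form F(p, w, w) = (w_1 - w_2) F(p, p, w), so tangency
   implies contact of order three. *)
suff -> : 3%:R * tri (d3 F) v w w = 0 by rewrite mulr0.
apply: local_eq0 => k chi; have [h [d0 hf hl [al [be E]]]] := key F k chi hF.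
have [c Ec] := hl v hv; pose w' := \adj h *m w.
have Ew : h *m w' = \det h *: w by rewrite mulmxA mul_mx_adj mul_scalar_mx.
exists (\det h ^+ 2 * \det h * \det h); last by rewrite !rmorphM !mulf_neq0.
have e1 := h2c _ hf.
have e2 : 3%:R * tri (hesse al be) (flexvec R) (flexvec R) w' = 0.
  rewrite -(tE _ _ _ _ _ _ _ E) Ew -[h *m flexvec R]scale1r sc !mul1r.
  by rewrite mulrCA e1 mulr0.
rewrite mulrCA -sc Ec -Ew -[h *m w']scale1r sc !mulr1 (tE _ _ _ _ _ _ _ E).
have -> : 3%:R * (c * tri (hesse al be) (flexvec R) w' w') =
   c * (w' 1 0 - w' 2%:R 0) * (3%:R * tri (hesse al be) (flexvec R) (flexvec R) w').
  by rewrite !tri_hesse !mxE /=; ring.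
by rewrite e2 mulr0.
Qed.

End FrameFlex.

(** * The Hessian equation of a marked flex *)

Lemma tri_coord (S : comPzRingType) (B : 'I_3 -> 'I_3 -> 'I_3 -> S) a b c : tsym B ->
  tri B a b c = \sum_i c i 0 * tri B a b (bas i).
Proof.
move=> sB; have z x i : tri B a b (x *: bas i) = x * tri B a b (bas i).
  by have := triZ3 1 1 x a b (bas i) sB; rewrite !scale1r !mul1r.
by rewrite {1}[c]col_bas !sum3 !triDr// !z.
Qed.

(** Cross products of [g] with the basis vectors, up to sign; they span the plane orthogonal to [g]
    where a coordinate of [g] is a unit. *)
Definition cross (S : comPzRingType) (g : 'cV[S]_3) (j : 'I_3) : 'cV[S]_3 :=
  if j == 0 then vec3 0 (g 2%:R 0) (- g 1 0)
  else if j == 1 then vec3 (- g 2%:R 0) 0 (g 0 0) else vec3 (g 1 0) (- g 0 0) 0.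

(** A bilinear form in three variables that vanishes on a plane is degenerate; g_m^4 is the squared
    determinant of the basis made of e_m and two cross products. *)
Lemma isotropic_det (S : comPzRingType) (H : 'M[S]_3) (g : 'cV[S]_3) s :
  (forall j k, s * ((cross g j)^T *m H *m cross g k) 0 0 = 0) ->
  forall m, s * g m 0 ^+ 4 * \det H = 0.
Proof.
move=> E m; pose N : 'M[S]_3 := \matrix_(i, j) if j == m then (i == m)%:R else cross g j i 0.
have dN : \det N = g m 0 ^+ 2.
  by elim/I3_ind: m @N => N; rewrite /N det33 !mxE /cross /= ?mxE /=; ring.
have e j k : (N^T *m H *m N) j k = ((col j N)^T *m H *m col k N) 0 0.
  by rewrite [LHS]mxE [RHS]mxE; apply: eq_bigr => l _; rewrite [col k N l 0]mxE; congr (_ * _);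
     rewrite [LHS]mxE [RHS]mxE; apply: eq_bigr => l' _; rewrite !mxE.
have cN j : j != m -> col j N = cross g j.
  by move=> /negPf jm; apply/matrixP => i i'; rewrite !mxE ord1 jm.
have e' j k : j != m -> k != m -> s * (N^T *m H *m N) j k = 0 by move=> jm km; rewrite e !cN.
have : s * \det (N^T *m H *m N) = 0.
  rewrite det33; move: (N^T *m H *m N) e' => Q e'.
  elim/I3_ind: m {N dN e cN} e' => e'.
  - have E1 := e' 1 1 isT isT; have E2 := e' 1 2%:R isT isT; have E3 := e' 2%:R 1 isT isT; have E4 := e' 2%:R 2%:R isT isT.
    set D := _ - _ + _; have -> : s * D = Q 0 0 * (s * Q 1 1 * Q 2%:R 2%:R - s * Q 1 2%:R * Q 2%:R 1)
      - Q 0 1 * (Q 1 0 * (s * Q 2%:R 2%:R) - s * Q 1 2%:R * Q 2%:R 0)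
      + Q 0 2%:R * (Q 1 0 * (s * Q 2%:R 1) - s * Q 1 1 * Q 2%:R 0) by rewrite /D; ring.
    by rewrite E1 E2 E3 E4; ring.
  - have E1 := e' 0 0 isT isT; have E2 := e' 0 2%:R isT isT; have E3 := e' 2%:R 0 isT isT; have E4 := e' 2%:R 2%:R isT isT.
    set D := _ - _ + _; have -> : s * D = s * Q 0 0 * (Q 1 1 * Q 2%:R 2%:R - Q 1 2%:R * Q 2%:R 1)
      - Q 0 1 * (Q 1 0 * (s * Q 2%:R 2%:R) - Q 1 2%:R * (s * Q 2%:R 0))
      + s * Q 0 2%:R * (Q 1 0 * Q 2%:R 1 - Q 1 1 * Q 2%:R 0) by rewrite /D; ring.
    by rewrite E1 E2 E3 E4; ring.
  - have E1 := e' 0 0 isT isT; have E2 := e' 0 1 isT isT; have E3 := e' 1 0 isT isT; have E4 := e' 1 1 isT isT.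
    set D := _ - _ + _; have -> : s * D = s * Q 0 0 * (Q 1 1 * Q 2%:R 2%:R - Q 1 2%:R * Q 2%:R 1)
      - s * Q 0 1 * (Q 1 0 * Q 2%:R 2%:R - Q 1 2%:R * Q 2%:R 0)
      + Q 0 2%:R * (s * Q 1 0 * Q 2%:R 1 - s * Q 1 1 * Q 2%:R 0) by rewrite /D; ring.
    by rewrite E1 E2 E3 E4; ring.
by rewrite !det_mulmx det_tr dN => <-; ring.
Qed.

Lemma polar_mxZ (S : comPzRingType) (B : 'I_3 -> 'I_3 -> 'I_3 -> S) d v : polar_mx B (d *: v) = d *: polar_mx B v.
Proof. by apply/matrixP => i j; rewrite !mxE triZl. Qed.

Lemma hess_hesseE (S : comPzRingType) (al be : S) (p : 'cV[S]_3) : hess (hesse al be) p =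
  (al ^+ 3 + 8%:R * be ^+ 3) * (p 0 0 * p 1 0 * p 2%:R 0) - be ^+ 2 * tri (hesse al be) p p p.
Proof. by rewrite hess_hesse tri_hesse; ring. Qed.

Section FlexLocal.
Variables (C : fieldType) (C0 : char0 C) (w0 : C) (hw : cube_root w0).
Variables (R : comAlgType C) (a : cubic R) (p : classical_sets.set 'cV[R]_3).
Hypothesis hp : is_flex (ceq a) p.
Let i6 : R := (6%:R^-1 : C)%:A.
Let h6 : 6%:R * i6 = 1 := h6A R C0.

Lemma coord_linear i : linear (fun v : 'cV[R]_3 => v i 0 : R^o).
Proof. by move=> r u v; rewrite !mxE. Qed.

Lemma flex_prop u v i j : p u -> p v -> u i 0 * v j 0 = v i 0 * u j 0.
Proof.
have [pp _ _] := hp => hu hv.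
exact: (pp_rank_le1 pp (mklin (coord_linear i)) (mklin (coord_linear j)) hu hv).
Qed.

Lemma flex_gen (k : fieldType) (chi : {rmorphism R -> k}) : exists v0 i, p v0 /\ chi (v0 i 0) != 0.
Proof.
have [pp _ _] := hp; have [r [l [v0 [hv ->]]] r0] := span_ideal chi (pp_rank_ge1 pp).
exists v0; have : chi (\sum_i v0 i 0 * (l (bas i) : R)) != 0.
  suff -> : \sum_i v0 i 0 * (l (bas i) : R) = l v0 by [].
  by rewrite {2}[v0]col_bas linear_sum; apply: eq_bigr => i _; rewrite lin_scale.
rewrite rmorph_sum => ne; apply: contrapT => H; case/eqP: ne; apply: big1 => i _.
apply/eqP; apply: contrapT => /negP ni; apply: H; exists i; move: ni.
by rewrite rmorphM mulf_eq0 negb_or => /andP[].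
Qed.

Lemma flex_tri F v : ceq a F -> p v -> tri (d3 F) v v v = 0.
Proof.
move=> hF hv; have [_ c1 _] := hp; have := c1 F v hF hv 0%N isT.
rewrite (contactE C0)// ?(ceq_homog hF)//= => /(congr1 ( *%R 6%:R)).
by rewrite mulrA h6 mul1r mulr0.
Qed.

(** Turns contact into the Hessian equation: the polar form F(v, ., .) vanishes on the plane of
    tangent directions, hence is degenerate. Scalars that are units at [chi] account for the lack of
    global generators. *)
Lemma flex_local (k : fieldType) (chi : {rmorphism R -> k}) : exists F0 v0 s i,
  [/\ ceq a F0, p v0, chi (v0 i 0) != 0, chi s != 0 &
   smooth3 (tmap chi (d3 F0)) /\ s * hess (d3 F0) v0 = 0].
Proof.
have [B0 [s0 [[F0 hF ->{B0}] s00 gen sm]]] := tensors_gen a C0 chi.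
have [v0 [i [hv v0i]]] := flex_gen chi.
have smk := sm k chi s00; set B := d3 F0.
have sB : tsym B := d3_sym F0.
pose q := v0 i 0; pose g : 'cV[R]_3 := \col_j tri B v0 v0 (bas j).
have [m gm] : exists m, chi (g m 0) != 0.
  have [|c hc] := smk k idfun (map_mx chi v0).
    by apply/eqP => /matrixP/(_ i 0); rewrite !mxE => /eqP; rewrite (negPf v0i).
  apply: contrapT => H; case/eqP: hc.
  have sk : tsym (tmap chi B) by exact: tsym_map.
  rewrite (tri_coord _ _ _ sk); apply: big1 => j _.
  have -> : tri (tmap chi B) (map_mx chi v0) (map_mx chi v0) (bas j) = chi (g j 0).
    by rewrite mxE tri_map map_mx_bas.
  by have [->|gj] := eqVneq (chi (g j 0)) 0; [rewrite mulr0|case: H; exists j].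
have cr j : tri B v0 v0 (cross g j) = 0.
  rewrite (tri_coord _ _ _ sB).
  have -> : \sum_l cross g j l 0 * tri B v0 v0 (bas l) = \sum_l cross g j l 0 * g l 0.
    by apply: eq_bigr => l _; rewrite mxE.
  rewrite sum3; elim/I3_ind: j; rewrite /cross /= !mxE /=; ring.
(* [contact] quantifies over all forms of the line and all vectors of [p]; the factor s0 q^2 reduces
   them to [F0] and [v0]. *)
have c2 xi : tri B v0 v0 xi = 0 -> contact (ceq a) p ((s0 * q ^+ 2) *: xi) 2.
  move=> h0 F v hF' hv' [|[|]]// _; rewrite (contactE C0) ?(ceq_homog hF')//=; first by rewrite flex_tri// mulr0.
  suff -> : tri (d3 F) v v ((s0 * q ^+ 2) *: xi) = 0 by rewrite !mulr0.
  have [r hr] := gen _ (ex_intro2 _ _ F hF' erefl).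
  have hq : q *: v = v i 0 *: v0.
    by apply/matrixP => l l'; rewrite !mxE ord1; exact: flex_prop.
  have -> : tri (d3 F) v v ((s0 * q ^+ 2) *: xi) = s0 * tri (d3 F) (q *: v) (q *: v) xi.
    rewrite -[xi in RHS]scale1r -[v in LHS]scale1r !(triZ3 _ _ _ _ _ _ (d3_sym F)); ring.
  rewrite (tri_scale _ _ _ hr) hq -[xi]scale1r !(triZ3 _ _ _ _ _ _ sB) h0; ring.
pose s := s0 ^+ 2 * q ^+ 4.
have iso xi : tri B v0 v0 xi = 0 -> s * tri B v0 xi xi = 0.
  move=> h0; have [_ _ c3] := hp; have := c3 _ (c2 xi h0) F0 v0 hF hv 2%N isT.
  rewrite (contactE C0) ?(ceq_homog hF)//= -[v0 in tri _ v0 _ _]scale1r (triZ3 _ _ _ _ _ _ sB) => E.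
  transitivity (2%:R * (6%:R * i6 * (3%:R * (1 * (s0 * q ^+ 2) * (s0 * q ^+ 2) * tri B v0 xi xi))) * i6); last first.
    by rewrite -[6%:R * i6 * _]mulrA E !mulr0 mul0r.
  rewrite h6 /s.
  transitivity ((6%:R * i6) * (s0 ^+ 2 * q ^+ 4 * tri B v0 xi xi)); first by rewrite h6 mul1r.
  ring.
have i2 : 2%:R * (3%:R * i6) = 1 by rewrite mulrA -natrM.
exists F0, v0, (s * g m 0 ^+ 4), i; split=> //.
  by rewrite /s ?(rmorphM, rmorphXn) ?(mulf_neq0, expf_neq0).
(* The quadratic form also vanishes on sums of cross products, so twice the bilinear one does, up to
   [s]. *)
split=> //; apply: isotropic_det => j l; rewrite -polar_mxP.
have := iso (cross g j + cross g l); rewrite triDr// !cr addr0 => /(_ erefl).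
rewrite triDm// !triDr// !mulrDr !iso ?cr// add0r addr0 (triA v0 (cross g l) (cross g j) sB) => E.
rewrite -[LHS]mul1r -i2; set X := s * _ in E *.
have -> : 2%:R * (3%:R * i6) * X = 3%:R * i6 * (X + X) by ring.
by rewrite E mulr0.
Qed.

Variables (S : comPzRingType) (f : {rmorphism R -> S}) (W : 'cV['F_3]_2 -> 'M[S]_3).
Hypothesis hW : isf w0 a f W.

(** In the Hesse coordinates of the frame, the equations of the cubic and of its Hessian give xyz =
    0 and x^3 + y^3 + z^3 = 0, because the discriminant is a unit at [chi]. *)
Lemma flex_hesse (k : fieldType) (chi : {rmorphism S -> k}) : exists h v0 i sg,
  let v' := \adj h *m map_mx f v0 in
  [/\ forall u, W u *m h = h *m weyl0 (f w0%:A) u, chi (\det h) != 0, p v0, chi (f (v0 i 0)) != 0 &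
   [/\ chi sg != 0, sg * (v' 0 0 * v' 1 0 * v' 2%:R 0) = 0
    & sg * (v' 0 0 ^+ 3 + v' 1 0 ^+ 3 + v' 2%:R 0 ^+ 3) = 0]].
Proof.
have [F0 [v0 [s [i [hF hv vi s0 [sm hs]]]]]] := flex_local (chi \o f).
have w1 : cube_root (f (w0%:A : R)) := cube_root_map (f \o in_alg R) hw.
have h6' : 6%:R * f i6 = 1 by rewrite -(rmorph_nat f) -rmorphM h6 rmorph1.
have h3 : 3%:R * (2%:R * f i6) = 1 by rewrite mulrA -natrM.
have [h hh d0] := weyl_coord w1 h3 chi hW.1.
set B := tmap f (d3 F0); have sB : tsym B := tsym_map f (d3_sym F0).
have hB u : tinv B (W u) by apply: (hW.2 (d3 F0)); exists F0.
have [al [be E]] : exists al be, forall i j l, tcomp B h i j l = hesse al be i j l.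
  apply: (weyl0_hesse w1 h3 (tsym_comp h sB)) => u x y z.
  by rewrite !tri_comp !mulmxA -!hh -!mulmxA hB.
pose v' := \adj h *m map_mx f v0; have hv' : h *m v' = \det h *: map_mx f v0.
  by rewrite mulmxA mul_mx_adj mul_scalar_mx.
have t0 : tri (hesse al be) v' v' v' = 0.
  rewrite -(eq_tri _ _ _ E) tri_comp hv' (triZ3 _ _ _ _ _ _ sB).
  have -> : tri B (map_mx f v0) (map_mx f v0) (map_mx f v0) = f (tri (d3 F0) v0 v0 v0) by rewrite tri_map.
  by rewrite flex_tri// rmorph0 mulr0.
have H0 : f s * hess (hesse al be) v' = 0.
  have -> : hess (hesse al be) v' = hess (tcomp B h) v' by rewrite /hess; congr (\det _); apply: polar_mx_ext.
  rewrite hess_comp hv' /hess polar_mxZ detZ.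
  have -> : \det (polar_mx B (map_mx f v0)) = f (hess (d3 F0) v0) by exact: esym (hess_map f (d3 F0) v0).
  by rewrite mulrCA [f s * _]mulrCA -rmorphM hs rmorph0 !mulr0.
have [a0 D0] : chi al != 0 /\ chi (al ^+ 3 + 8%:R * be ^+ 3) != 0.
  have smk : smooth3 (tmap chi B) by exact: sm.
  pose hk := map_mx chi h; pose hk' := (\det hk)^-1 *: \adj hk.
  have dk : \det hk != 0 by rewrite det_map_mx.
  have k1 : hk *m hk' = 1%:M by rewrite -scalemxAr mul_mx_adj scale_scalar_mx mulVf.
  have k2 : hk' *m hk = 1%:M by rewrite -scalemxAl mul_adj_mx scale_scalar_mx mulVf.
  have sh : smooth3 (hesse (chi al) (chi be)).
    apply: smooth3_eq (smooth3_comp k1 k2 smk) => x y z.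
    by rewrite -hesse_map -E tcomp_map.
  have [x1 x2] := hesse_units (idfun : {rmorphism k -> k}) sh; split=> //.
  by rewrite rmorphD rmorphM !rmorphXn rmorph_nat.
exists h, v0, i, (f s * (al ^+ 3 + 8%:R * be ^+ 3) * al); split=> //; split.
- by rewrite !rmorphM !mulf_neq0.
- move: H0; rewrite hess_hesseE t0 mulr0 subr0 -/v' => e.
  by rewrite mulrAC -[f s * _ * _]mulrA e mul0r.
move: H0; rewrite hess_hesseE t0 mulr0 subr0 -/v' => e; move: t0; rewrite tri_hesse => t0.
set Sg := _ + _ + _; rewrite -[LHS]subr0 -[X in _ - X](mulr0 (f s * (al ^+ 3 + 8%:R * be ^+ 3))) -{1}t0.
rewrite /Sg; transitivity (- 6%:R * be * (f s * ((al ^+ 3 + 8%:R * be ^+ 3) * (v' 0 0 * v' 1 0 * v' 2%:R 0)))).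
  by ring.
by rewrite e mulr0.
Qed.

End FlexLocal.

(** * The idempotent of a marked flex *)

Lemma map_scale (S : pzSemiRingType) (T : comPzRingType) (f : {rmorphism S -> T}) m n x (A : 'M[S]_(m, n)) :
  map_mx f (x *: A) = f x *: map_mx f A.
Proof. by apply/matrixP => i j; rewrite !mxE rmorphM. Qed.

Section FlexIdempotent.
Variables (C : fieldType) (C0 : char0 C) (w0 : C) (hw : cube_root w0).
Definition third (R : comAlgType C) : R := 2%:R * (6%:R^-1 : C)%:A.

Lemma thirdE R : 3%:R * third R = 1.
Proof. by rewrite mulrA -natrM (h6A R C0). Qed.

Lemma third_lr (R S : comAlgType C) (f : {lrmorphism R -> S}) : f (third R) = third S.
Proof.
by apply: etrans (rmorphM f _ _) _; congr (_ * _); [exact: rmorph_nat|exact: rmorph_alg].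
Qed.

Section OneFlexed.
Variables (R : comAlgType C) (c : flexed_cubic R).
Notation T := (fT (fpk w0 c)).
Notation sT := (fs (fpk w0 c)).
Notation PT := (parity (sT (third R)) (fW (fpk w0 c))).

(** Measures how far the marked flex is from p_0, the (-1)-eigenline of the universal frame. *)
Definition off_flex (v : 'cV[R]_3) : 'cV[T]_3 := PT *m map_mx sT v + map_mx sT v.
Definition flex_ann (e : T) := forall v, fflex c v -> e *: off_flex v = 0.
Definition flex_ideal (x : T) := exists n (r : 'I_n -> 'rV[T]_3) (v : 'I_n -> 'cV[R]_3),
  (forall i, fflex c (v i)) /\ x = \sum_i (r i *m off_flex (v i)) 0 0.

Lemma flex_ideal0 : flex_ideal 0.
Proof. by exists 0%N, (fun=> 0), (fun=> 0); split=> [[]|]//; rewrite big_ord0. Qed.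

Lemma flex_ideal1 (r : 'rV[T]_3) v : fflex c v -> flex_ideal ((r *m off_flex v) 0 0).
Proof. by move=> hv; exists 1%N, (fun=> r), (fun=> v); rewrite big_ord1. Qed.

Lemma flex_idealD x y : flex_ideal x -> flex_ideal y -> flex_ideal (x + y).
Proof.
move=> [n [r [v [hv ->]]]] [m [r' [v' [hv' ->]]]].
exists (n + m)%N, (fun i => match fintype.split i with inl j => r j | inr j => r' j end),
  (fun i => match fintype.split i with inl j => v j | inr j => v' j end); split.
  by move=> i; case: (fintype.split i).
rewrite big_split_ord /=; congr (_ + _); apply: eq_bigr => i _.
  by rewrite (unsplitK (inl i)).
by rewrite (unsplitK (inr i)).
Qed.

Lemma flex_idealM a x : flex_ideal x -> flex_ideal (a * x).
Proof.
move=> [n [r [v [hv ->]]]]; exists n, (fun i => a *: r i), v; split=> //.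
by rewrite mulr_sumr; apply: eq_bigr => i _; rewrite -scalemxAl [in RHS]mxE.
Qed.

Lemma flex_annI e x : flex_ann e -> flex_ideal x -> e * x = 0.
Proof.
move=> he [n [r [v [hv ->]]]]; rewrite mulr_sumr big1// => i _.
have := congr1 (fun M => (r i *m M) 0 0) (he _ (hv i)).
by rewrite mulmx0 -scalemxAr [in RHS]mxE [LHS]mxE.
Qed.

Lemma off_flex_conj (h : 'M[T]_3) v :
  (forall u, fW (fpk w0 c) u *m h = h *m weyl0 (sT w0%:A) u) ->
  \det h *: off_flex v = h *m (parity (sT (third R)) (weyl0 (sT w0%:A)) *m (\adj h *m map_mx sT v)
    + \adj h *m map_mx sT v).
Proof.
move=> hh; have hP := parity_conj (sT (third R)) hh.
set v' := \adj h *m _; have E : h *m v' = \det h *: map_mx sT v.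
  by rewrite mulmxA mul_mx_adj mul_scalar_mx.
by rewrite mulmxDr mulmxA -hP -mulmxA E -scalemxAr -scalerDr.
Qed.

(** The locus where p_0 is the marked flex is open and closed. Where [off_flex] is nonzero its ideal
    is locally everything; where it is zero, the equations of the flexes, having simple solutions,
    make it vanish nearby. *)
Lemma flex_split : exists e, flex_ann e /\ flex_ideal (1 - e).
Proof.
suff [e [x [he [hx E]]]] : exists e x, flex_ann e /\ flex_ideal x /\ 1 = e + x.
  by exists e; split=> //; rewrite E addrC addKr.
pose I (y : T) := exists e x, flex_ann e /\ flex_ideal x /\ y = e + x.
apply: (ideal_unit (I := I)).
- by exists 0, 0; split=> [v _|]; [rewrite scale0r|split; [exact: flex_ideal0|rewrite addr0]].
- move=> x y [e1 [x1 [a1 [i1 ->]]]] [e2 [x2 [a2 [i2 ->]]]]; exists (e1 + e2), (x1 + x2); split.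
    by move=> v hv; rewrite scalerDl a1// a2// addr0.
  by split; [exact: flex_idealD|rewrite addrACA].
- move=> a x [e1 [x1 [a1 [i1 ->]]]]; exists (a * e1), (a * x1); split.
    by move=> v hv; rewrite -scalerA a1// scaler0.
  by split; [exact: flex_idealM|rewrite mulrDr].
move=> k chi.
have [h [v0 [i [sg [hh d0 hv vi [sg0 Ep Ec]]]]]] := flex_hesse C0 hw (fflexP c) (fr_frame (fP (fpk w0 c))) chi.
set v' := \adj h *m map_mx sT v0 in Ep Ec.
have w1 : cube_root (sT (w0%:A : R)) := cube_root_map (sT \o in_alg R) hw.
have h3 : 3%:R * sT (third R) = 1 by rewrite -(rmorph_nat sT) -rmorphM thirdE rmorph1.
have off0 : \det h *: off_flex v0 = h *m (parity (sT (third R)) (weyl0 (sT w0%:A)) *m v' + v').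
  exact: off_flex_conj hh.
rewrite (parity_weyl0 w1 h3) mx3_mul in off0.
have [[j hj]|all0] := pselect (exists j, chi (off_flex v0 j 0) != 0).
  exists (off_flex v0 j 0) => //; exists 0, (off_flex v0 j 0).
  split=> [v _|]; first by rewrite scale0r.
  split; last by rewrite add0r.
  by have := flex_ideal1 (delta_mx 0 j) hv; rewrite -rowE mxE.
have k0 j : chi (off_flex v0 j 0) = 0.
  by apply/eqP; apply: contrapT => /negP ne; apply: all0; exists j.
have C2 : chi 2%:R != 0 by rewrite rmorph_nat; exact: (alg_char0 C0 (chi \o sT)).
have C3 : chi 3%:R != 0 by rewrite rmorph_nat; exact: (alg_char0 C0 (chi \o sT)).
have off1 : \adj h *m (\det h *: off_flex v0) = \det h *: vec3 (v' 0 0 + v' 0 0) (v' 2%:R 0 + v' 1 0) (v' 1 0 + v' 2%:R 0).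
  rewrite off0 mulmxA mul_adj_mx mul_scalar_mx; congr (_ *: _).
  by apply: vec3_eq; rewrite !mxE /=; ring.
have kv (u : 'cV[T]_3) j : (forall l, chi (u l 0) = 0) -> chi ((\adj h *m (\det h *: u)) j 0) = 0.
  move=> ku; rewrite -scalemxAr mxE rmorphM; have -> : chi ((\adj h *m u) j 0) = 0; last by rewrite mulr0.
  by rewrite mxE rmorph_sum big1// => l _; rewrite rmorphM ku mulr0.
have x0 : chi (v' 0 0) = 0.
  have := kv _ 0 k0; rewrite off1 !mxE /= rmorphM => /eqP; rewrite mulf_eq0 (negPf d0) /=.
  by rewrite -mulr2n -mulr_natl rmorphM mulf_eq0 (negPf C2) /= => /eqP.
have x12 : chi (v' 2%:R 0) = - chi (v' 1 0).
  have := kv _ 1 k0; rewrite off1 !mxE /= rmorphM => /eqP; rewrite mulf_eq0 (negPf d0) /=.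
  by rewrite rmorphD addr_eq0 => /eqP.
have x1 : chi (v' 1 0) != 0.
  apply/eqP => z1; have z : forall j, chi (v' j 0) = 0.
    by move=> j; elim/I3_ind: j; rewrite ?x12 ?z1 ?oppr0 ?x0.
  have := congr1 (fun M : 'cV_3 => chi (M i 0)) (mulmxA h (\adj h) (map_mx sT v0)).
  rewrite mul_mx_adj mul_scalar_mx -/v' mxE rmorph_sum big1 => [/esym/eqP|j _]; last by rewrite rmorphM z mulr0.
  by rewrite !mxE rmorphM mulf_eq0 (negPf d0) (negPf vi).
(* Near (0 : 1 : -1) the cofactors yz and y^2 - yz + z^2, the latter equal to 3y^2 at the point, are
   units, and the equations reduce to x = 0 and y + z = 0. *)
pose s1 := sg * v' 1 0 * v' 2%:R 0; pose s2 := s1 * (v' 1 0 ^+ 2 - v' 1 0 * v' 2%:R 0 + v' 2%:R 0 ^+ 2).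
have s10 : chi s1 != 0 by rewrite !rmorphM x12 !mulf_neq0 ?oppr_eq0.
have s20 : chi s2 != 0.
  rewrite rmorphM mulf_neq0//; have -> : chi (v' 1 0 ^+ 2 - v' 1 0 * v' 2%:R 0 + v' 2%:R 0 ^+ 2) = chi 3%:R * chi (v' 1 0) ^+ 2.
    by rewrite rmorphD rmorphB !rmorphM x12 rmorph_nat; ring.
  by rewrite mulf_neq0 ?expf_neq0.
have e0 : s1 * v' 0 0 = 0 by rewrite -Ep /s1; ring.
have e12 : s2 * (v' 1 0 + v' 2%:R 0) = 0.
  have -> : s2 * (v' 1 0 + v' 2%:R 0) = v' 1 0 * v' 2%:R 0 * (sg * (v' 0 0 ^+ 3 + v' 1 0 ^+ 3 + v' 2%:R 0 ^+ 3))
     - (s1 * v' 0 0) * v' 0 0 ^+ 2 by rewrite /s2 /s1; ring.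
  by rewrite Ec e0; ring.
pose s3 := s2 * \det h * sT (v0 i 0); exists s3; last first.
  by rewrite /s3 rmorphM mulf_neq0// rmorphM mulf_neq0.
exists s3, 0; split; last by split; [exact: flex_ideal0|rewrite addr0].
clearbody v'.
have an0 : (s2 * \det h) *: off_flex v0 = 0.
  rewrite -scalerA off0 scalemxAr; suff -> : s2 *: (vec3 (1 * v' 0 0 + 0 * v' 1 0 + 0 * v' 2%:R 0)
     (0 * v' 0 0 + 0 * v' 1 0 + 1 * v' 2%:R 0) (0 * v' 0 0 + 1 * v' 1 0 + 0 * v' 2%:R 0) + v') = 0 by rewrite mulmx0.
  apply: vec3_eq; rewrite !mxE /=.
  - transitivity (2%:R * (v' 1 0 ^+ 2 - v' 1 0 * v' 2%:R 0 + v' 2%:R 0 ^+ 2) * (s1 * v' 0 0)); first by rewrite /s2; ring.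
    by rewrite e0 mulr0.
  - by apply: etrans _ e12; ring.
  - by apply: etrans _ e12; ring.
move=> v hvv; have E : sT (v0 i 0) *: off_flex v = sT (v i 0) *: off_flex v0.
  rewrite /off_flex !scalerDr !scalemxAr; have -> : sT (v0 i 0) *: map_mx sT v = sT (v i 0) *: map_mx sT v0; last by [].
  by apply/matrixP => j l; rewrite !mxE -!rmorphM ord1; congr (sT _); exact: (flex_prop (fflexP c)).
by rewrite -scalerA E scalerA mulrC -scalerA an0 scaler0.
Qed.

Definition flex_idem := sval (cid flex_split).
Lemma flex_idem_ann : flex_ann flex_idem. Proof. exact: (svalP (cid flex_split)).1. Qed.
Lemma flex_idem_ideal : flex_ideal (1 - flex_idem). Proof. exact: (svalP (cid flex_split)).2. Qed.

Lemma flex_idemM : flex_idem * flex_idem = flex_idem.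
Proof.
apply/eqP; rewrite eq_sym -subr_eq0 -{1}[flex_idem]mulr1 -mulrBr; apply/eqP.
exact: flex_annI flex_idem_ann flex_idem_ideal.
Qed.

(** An endomorphism of the pulled back frame cover: the identity where p_0 is the marked flex, g
    elsewhere. As the action is free, for g != 1 its fixed points are the frames of the first kind,
    and naturality makes pi_1(Y) preserve them. *)
Definition idem_act g (x : T) : T := flex_idem * x + (1 - flex_idem) * fact_hom hw c g x.

Fact idem_act_zmod g : zmod_morphism (idem_act g).
Proof. by move=> x y; rewrite /idem_act rmorphB; ring. Qed.
Fact idem_act_monoid g : monoid_morphism (idem_act g).
Proof.
split=> [|x y]; rewrite /idem_act ?rmorph1 ?rmorphM; first by ring.
have ee := flex_idemM; set e := flex_idem in ee *; set al := fact_hom _ _ _.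
have e1 : e * (1 - e) = 0 by rewrite mulrBr ee mulr1 subrr.
have -> : (e * x + (1 - e) * al x) * (e * y + (1 - e) * al y) =
  e * e * (x * y) + (1 - e - e * (1 - e)) * (al x * al y) + e * (1 - e) * (x * al y + al x * y) by ring.
by rewrite ee e1 subr0 mul0r addr0.
Qed.
HB.instance Definition _ g := GRing.isZmodMorphism.Build T T (idem_act g) (idem_act_zmod g).
HB.instance Definition _ g := GRing.isMonoidMorphism.Build T T (idem_act g) (idem_act_monoid g).

Lemma idem_act_str g r : idem_act g (sT r) = sT r.
Proof. by rewrite /idem_act fact_hom_str; ring. Qed.

End OneFlexed.
Arguments off_flex {R} c v.
Arguments flex_ann {R} c e.
Arguments flex_ideal {R} c x.
Arguments idem_act {R} c g x.

Section Natural.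
Variables (R S : comAlgType C) (f : {lrmorphism R -> S}) (b : flexed_cubic S) (a : flexed_cubic R) (u : flexed_hom f b a).
Notation psi := (fcmap C0 w0 u).
Notation sa := (fs (fpk w0 a)).
Notation sb := (fs (fpk w0 b)).
Notation Pa := (parity (sa (third R)) (fW (fpk w0 a))).
Notation Pb := (parity (sb (third S)) (fW (fpk w0 b))).

Let psisa (v : 'cV[R]_3) : map_mx psi (map_mx sa v) = map_mx sb (map_mx f v).
Proof. by apply/matrixP => i j; rewrite !mxE fcmapE. Qed.

Lemma parity_fcmap h : chmx u h -> map_mx psi Pa *m map_mx sb h = map_mx sb h *m Pb.
Proof.
move=> hh; rewrite parity_map fcmapE third_lr; apply: parity_conj => v.
exact: fcmapW.
Qed.

Let off_psi v : map_mx psi (off_flex a v) = map_mx psi Pa *m map_mx sb (map_mx f v) + map_mx sb (map_mx f v).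
Proof. by rewrite /off_flex raddfD /= map_mxM psisa. Qed.

Let off_h h v : chmx u h -> map_mx psi Pa *m map_mx sb (h *m v) + map_mx sb (h *m v) = map_mx sb h *m off_flex b v.
Proof. by move=> hh; rewrite map_mxM mulmxA parity_fcmap// /off_flex mulmxDr mulmxA. Qed.

Lemma flex_ann_fcmap e : flex_ann a e -> flex_ann b (psi e).
Proof.
move=> he v hv; apply: (pgl_inj_l (chmxP u) (s := sb)) => h hh.
rewrite -scalemxAr -off_h//; have [n [c [x [hx ->]]]] := fhom_flex hh hv.
rewrite raddf_sum /= mulmx_sumr -big_split scaler_sumr big1// => i _.
have [y hy <-] := hx i.
have E : psi e *: (map_mx psi Pa *m map_mx sb (c i *: map_mx f y) + map_mx sb (c i *: map_mx f y)) =
    sb (c i) *: map_mx psi (e *: off_flex a y).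
  have -> : map_mx sb (c i *: map_mx f y) = sb (c i) *: map_mx sb (map_mx f y) by exact: map_scale.
  by rewrite map_scale off_psi -scalemxAr -scalerDr !scalerA mulrC.
by apply: etrans E _; rewrite he// raddf0 scaler0.
Qed.

Lemma flex_ann_off e v : flex_ann b e -> fflex a v -> e *: map_mx psi (off_flex a v) = 0.
Proof.
move=> he hv; apply/matrixP => j l; rewrite [RHS]mxE ord1; apply: local_eq0 => k chi.
have [h hh d0] := pgl_unit (chmxP u) (chi \o sb).
have [v0 [i [hv0 v0i]]] := flex_gen (fflexP b) (chi \o sb).
have [m xm] : exists m, chi (sb ((h *m v0) m 0)) != 0.
  apply: contrapT => H; have z m : chi (sb ((h *m v0) m 0)) = 0.
    by apply/eqP; apply: contrapT => /negP ne; apply: H; exists m.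
  have := congr1 (fun M : 'cV_3 => chi (sb (M i 0))) (mulmxA (\adj h) h v0).
  rewrite mul_adj_mx mul_scalar_mx /= [in X in X = _]mxE !rmorph_sum big1 => [/esym/eqP|m _]; last by rewrite !rmorphM z mulr0.
  by rewrite mxE !rmorphM mulf_eq0; move: d0 v0i => /= /negPf-> /negPf->.
exists (sb ((h *m v0) m 0)) => //.
have E : (h *m v0) m 0 *: map_mx f v = f (v m 0) *: (h *m v0).
  have [n [c [x [hx ->]]]] := fhom_flex hh hv0.
  apply/matrixP => r r'; rewrite ord1 !mxE !summxE mulr_suml mulr_sumr; apply: eq_bigr => q _.
  have [y hy <-] := hx q; rewrite !mxE -mulrA -rmorphM (flex_prop (fflexP a) m r hy hv) rmorphM; ring.
have : e *: (sb ((h *m v0) m 0) *: map_mx psi (off_flex a v)) = 0.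
  rewrite off_psi scalerDr scalemxAr -map_scale E map_scale -scalemxAr -scalerDr off_h//.
  by rewrite scalerA mulrC -scalerA scalemxAr he// mulmx0 scaler0.
by move/matrixP/(_ j 0); rewrite !mxE => E0; rewrite mulrCA E0.
Qed.

Lemma flex_ideal_fcmap e x : flex_ann b e -> flex_ideal a x -> e * psi x = 0.
Proof.
move=> he [n [r [v [hv ->]]]]; rewrite rmorph_sum mulr_sumr big1// => i _.
have := congr1 (fun M => (map_mx psi (r i) *m M) 0 0) (flex_ann_off he (hv i)).
rewrite mulmx0 -scalemxAr -map_mxM [LHS]mxE [in X in _ * X = _]mxE [in RHS]mxE => E; exact: E.
Qed.

(** The idempotent is determined by lying in the annihilator while its complement lies in the ideal,
    and arrows are compatible with both. *)
Lemma flex_idem_fcmap : psi (flex_idem a) = flex_idem b.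
Proof.
have h1 := flex_annI (flex_ann_fcmap (@flex_idem_ann _ a)) (@flex_idem_ideal _ b).
have h2 := flex_ideal_fcmap (@flex_idem_ann _ b) (@flex_idem_ideal _ a).
move: h1 h2; rewrite rmorphB rmorph1 !mulrBr !mulr1 => /subr0_eq e1 /subr0_eq e2.
exact: etrans e1 (etrans (mulrC _ _) (esym e2)).
Qed.

Lemma idem_act_fcmap g x : idem_act b g (psi x) = psi (idem_act a g x).
Proof. by rewrite /idem_act fcmap_act rmorphD !rmorphM rmorphB rmorph1 flex_idem_fcmap. Qed.

End Natural.

Notation FY := (pullback (forget_flex C) (frame_cover C0 hw)).

Definition idem_map g : cover_map FY FY :=
  @CoverMap C (flexed_plane_cubics C) FY FY (fun R a => idem_act a g)
    (fun R a r => idem_act_str a g r) (fun R S f b a u x => idem_act_fcmap u g x).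

Variable y : flexed_cubic (C^o : comAlgType C).
Notation Fib := (@fiber C (plane_cubics C) (fcubic y) (frame_cover C0 hw)).

Definition on_flex (z : Fib) := forall v, fflex y v -> parity (third C^o) (fib_frame z) *m v = - v.

Lemma fpt_off (z : Fib) v : map_mx (fpt z) (off_flex y v) = parity (third C^o) (fib_frame z) *m v + v.
Proof.
rewrite /off_flex raddfD /= map_mxM parity_map fptE.
by have -> : map_mx (fpt z) (map_mx (fs (fpk w0 y)) v) = v by apply/matrixP => i j; rewrite !mxE fptE.
Qed.

Lemma on_flexP z : on_flex z <-> fpt z (flex_idem y) = 1.
Proof.
split=> [h|h v hv].
  have [n [r [v [hv E]]]] := @flex_idem_ideal _ y.
  apply/eqP; rewrite eq_sym -subr_eq0 -(rmorph1 (fpt z)) -rmorphB E rmorph_sum big1// => i _.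
  have : map_mx (fpt z) (r i *m off_flex y (v i)) = 0 by rewrite map_mxM fpt_off h// addNr mulmx0.
  by move/matrixP/(_ 0 0); rewrite [LHS]mxE [RHS]mxE.
have := congr1 (map_mx (fpt z)) (@flex_idem_ann _ y v hv); rewrite map_mxZ h scale1r fpt_off raddf0.
by move/eqP; rewrite addr_eq0 => /eqP.
Qed.

Lemma push_on_flex (s : @pi1 C (flexed_plane_cubics C) y) (z : Fib) (g : ASL2F3) : g != 1%g -> on_flex z ->
  on_flex (@pact C (plane_cubics C) (fcubic y) (@pi1_push C _ _ (forget_flex C) y s) (frame_cover C0 hw) z).
Proof.
move=> g1 /on_flexP hz; apply/on_flexP; set z' := pact _ _.
pose zY : @fiber C (flexed_plane_cubics C) y FY := fiber_up (f := forget_flex C) z.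
have Ez : fiber_map (idem_map g) zY = zY.
  by apply: fiber_ext => x /=; rewrite /idem_act rmorphD !rmorphM rmorphB rmorph1 hz subrr mul0r addr0 mul1r.
have Ez' x : fpt z' (idem_act y g x) = fpt z' x.
  have := pact_nat s (idem_map g) zY; rewrite Ez => /(congr1 (fun q : @fiber C (flexed_plane_cubics C) y FY => fpt q x)) E.
  exact: esym E.
apply/eqP; apply: contrapT => /negP ne.
have z0 : fpt z' (flex_idem y) = 0.
  have : fpt z' (flex_idem y) * fpt z' (flex_idem y) = fpt z' (flex_idem y) by rewrite -rmorphM flex_idemM.
  move/eqP; rewrite -subr_eq0 -{3}[fpt z' _]mulr1 -mulrBr mulf_eq0 subr_eq0 (negPf ne) orbF => /eqP; exact.
case/eqP: g1; apply: (fact_hom_free C0 (p := fpt z')) => x.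
by rewrite -[RHS]Ez' /idem_act rmorphD !rmorphM rmorphB rmorph1 z0 mul0r add0r subr0 mul1r.
Qed.

End FlexIdempotent.

(** * Base change of cubics *)

Section Span.
Variables (R : comNzRingType) (V : lmodType R) (A : classical_sets.set V).

Lemma span0 : span A 0.
Proof. by exists 0%N, (fun=> 0), (fun=> 0); split=> [[]|]//; rewrite big_ord0. Qed.

Lemma spanD x y : span A x -> span A y -> span A (x + y).
Proof.
move=> [n [r [v [hv ->]]]] [m [r' [v' [hv' ->]]]].
exists (n + m)%N, (fun i => match fintype.split i with inl j => r j | inr j => r' j end),
  (fun i => match fintype.split i with inl j => v j | inr j => v' j end); split.
  by move=> i; case: (fintype.split i).
rewrite big_split_ord /=; congr (_ + _); apply: eq_bigr => i _.
  by rewrite (unsplitK (inl i)).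
by rewrite (unsplitK (inr i)).
Qed.

Lemma spanZ c x : span A x -> span A (c *: x).
Proof.
move=> [n [r [v [hv ->]]]]; exists n, (fun i => c * r i), v; split=> //.
by rewrite scaler_sumr; apply: eq_bigr => i _; rewrite scalerA.
Qed.

Lemma span1 x : A x -> span A x.
Proof. by move=> hx; exists 1%N, (fun=> 1), (fun=> x); rewrite big_ord1 scale1r. Qed.

End Span.

(* The base change of a line L along f is cut out by its Pluecker relations with L. *)
Section Saturation.
Variables (R S : comNzRingType) (f : {rmorphism R -> S}) (V : lmodType R) (V' : lmodType S) (I : Type).
Variables (e : I -> V -> R) (e' : I -> V' -> S) (phi : V -> V') (L : classical_sets.set V).

Definition sat : classical_sets.set V' := fun v' => forall v i j, L v ->
  e' i v' * f (e j v) = f (e i v) * e' j v'.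

Hypotheses (eL : forall i, linear (e' i : V' -> S^o)) (ephi : forall i v, e' i (phi v) = f (e i v))
  (exp : forall v w : V', exists n (b : 'I_n -> V') (k : 'I_n -> I),
     v = \sum_i e' (k i) v *: b i /\ w = \sum_i e' (k i) w *: b i)
  (Lp : forall v w i j, L v -> L w -> e i v * e j w = e i w * e j v)
  (Lg : forall (k : fieldType) (chi : {rmorphism R -> k}), exists v i, L v /\ chi (e i v) != 0).

Lemma sat_phi v : L v -> sat (phi v).
Proof. by move=> hv w i j hw; rewrite !ephi -!rmorphM Lp. Qed.

(** Both vectors are compared with one vector of L having a coordinate that is a unit at the given
    point. *)
Lemma sat_prop v w i j : sat v -> sat w -> e' i v * e' j w = e' i w * e' j v.
Proof.
move=> hv hw; apply/eqP; rewrite -subr_eq0; apply/eqP/local_eq0 => k chi.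
have [x [l [hx x0]]] := Lg (chi \o f); exists (f (e l x) * f (e l x)); last by rewrite rmorphM mulf_neq0.
have h1 := hv x i l hx; have h2 := hw x j l hx; have h3 := hw x i l hx; have h4 := hv x j l hx.
transitivity ((e' i v * f (e l x)) * (e' j w * f (e l x)) - (e' i w * f (e l x)) * (e' j v * f (e l x))); first by ring.
by rewrite h1 h2 h3 h4; ring.
Qed.

Lemma sat_point : projective_point sat.
Proof.
split.
- move=> x [n [c [v [hv ->]]]] y i j hy.
  have es l : e' l (\sum_i c i *: v i) = \sum_i c i * e' l (v i).
    pose E := mklin (eL l); apply: etrans (linear_sum E _ _ _) _.
    by apply: eq_bigr => q _; exact: (lin_scale E).
  rewrite !es mulr_suml mulr_sumr; apply: eq_bigr => q _.
  by rewrite -mulrA hv// mulrCA.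
- move=> v w l m hv hw; have [n [b [k [Ev Ew]]]] := exp v w.
  have le (l0 : {linear V' -> S^o}) x : x = \sum_i e' (k i) x *: b i -> l0 x = \sum_i e' (k i) x * (l0 (b i) : S).
    by move=> {1}->; rewrite linear_sum; apply: eq_bigr => q _; exact: lin_scale.
  rewrite (le l v Ev) (le l w Ew) (le m v Ev) (le m w Ew) !mulr_suml; apply: eq_bigr => q _.
  rewrite !mulr_sumr; apply: eq_bigr => q' _.
  by rewrite mulrACA sat_prop// mulrACA.
set A := (X in span X); apply: (ideal_unit (I := span (V := S^o) A)).
- exact: span0.
- by move=> x y; exact: spanD.
- by move=> x y; exact: spanZ.
move=> k chi; have [v [i [hv v0]]] := Lg (chi \o f); exists (f (e i v)) => //.
by apply: span1; exists (mklin (eL i)), (phi v); split; [exact: sat_phi|rewrite /= ephi].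
Qed.

End Saturation.

Section Substitution.
Variables (C : fieldType) (C0 : char0 C) (R : comAlgType C).
Implicit Types (F G : {mpoly R[3]}) (h : 'M[R]_3).

Lemma subst_form_homog F h : F \is 3.-homog -> subst_form F h \is 3.-homog.
Proof. by move=> hF; exact: (subst_homog _ (h6A R C0) hF). Qed.

Lemma d3_subst_form F h i j k : F \is 3.-homog -> d3 (subst_form F h) i j k = tcomp (d3 F) h i j k.
Proof. by move=> hF; apply: (d3_subst _ _ _ (h6A R C0) hF); exact: subst_form_homog. Qed.

Lemma homog_eq F G : F \is 3.-homog -> G \is 3.-homog -> (forall i j k, d3 F i j k = d3 G i j k) -> F = G.
Proof. exact: (homog_d3_inj (h6A R C0)). Qed.

Lemma subst_form_scale F h r : F \is 3.-homog -> subst_form F (r *: h) = r ^+ 3 *: subst_form F h.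
Proof.
move=> hF; apply: homog_eq => [||i j k]; [exact: subst_form_homog|by apply: dhomogZ; exact: subst_form_homog|].
rewrite d3Z !d3_subst_form// /tcomp; have cZ l : col l (r *: h) = r *: col l h by apply/matrixP => a b; rewrite !mxE.
by rewrite !cZ (triZ3 _ _ _ _ _ _ (d3_sym F)) !exprS expr0 mulr1 mulrA.
Qed.

Lemma subst_form_scalel F h r : subst_form (r *: F) h = r *: subst_form F h.
Proof. exact: comp_mpolyZ. Qed.

Lemma subst_form1 F : F \is 3.-homog -> subst_form F 1%:M = F.
Proof.
move=> hF; apply: homog_eq => [||i j k]//; first exact: subst_form_homog.
by rewrite d3_subst_form// -(tri_bas (tcomp _ _)) tri_comp !mul1mx tri_bas.
Qed.

Lemma subst_form_map (S : comAlgType C) (f : {rmorphism R -> S}) F h : F \is 3.-homog ->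
  map_mpoly f (subst_form F h) = subst_form (map_mpoly f F) (map_mx f h).
Proof.
move=> hF; apply: (homog_d3_inj (h6A S C0)).
- by apply: map_homog; exact: subst_form_homog.
- by apply: (subst_homog _ (h6A S C0)); exact: map_homog.
move=> i j k; rewrite d3_map d3_subst_form// tcomp_map.
apply: esym; apply: etrans (d3_subst i j k (h6A S C0) (map_homog f hF) _) _.
  by apply: (subst_homog _ (h6A S C0)); exact: map_homog.
by apply: tcomp_ext => x y z; rewrite d3_map.
Qed.

End Substitution.

Section BaseChange.
Variables (C : fieldType) (C0 : char0 C).

Section Objects.
Variables (R S : comAlgType C) (f : {lrmorphism R -> S}).
Notation mc := (fun (m : 'X_{1..3}) (F : {mpoly _[3]}) => F@_m).
Notation me := (fun (p : 'I_3 * 'I_3) (M : 'M_3) => M p.1 p.2).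

Variable a : cubic R.
Definition bc_eq : classical_sets.set {mpoly S[3]} := sat f (mc : _ -> {mpoly R[3]} -> R) (mc : _ -> {mpoly S[3]} -> S) (ceq a).

Lemma cubic_unimod (k : fieldType) (chi : {rmorphism R -> k}) : exists F m, ceq a F /\ chi F@_m != 0.
Proof.
have [r [l [F [hF ->]]] r0] := span_ideal chi (pp_rank_ge1 (sc_point (ceqP a))).
exists F; apply: contrapT => H; case/eqP: r0.
rewrite [F]mpolyE linear_sum rmorph_sum big1// => m _.
have [Fm|Fm] := eqVneq (chi F@_m) 0; last by case: H; exists m.
by rewrite lin_scale rmorphM Fm mul0r.
Qed.

Lemma map_mcoeff (F : {mpoly R[3]}) m : (map_mpoly f F)@_m = f F@_m.
Proof. exact: mcoeff_map_mpoly. Qed.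

Lemma bc_eq_map F : ceq a F -> bc_eq (map_mpoly f F).
Proof. by move=> hF G i j hG; rewrite !map_mcoeff -!rmorphM (cubic_prop i j hF hG). Qed.

Lemma bc_eq_scale G F n : bc_eq G -> ceq a F -> f F@_n *: G = G@_n *: map_mpoly f F.
Proof. by move=> hG hF; apply/mpolyP => m; rewrite !mcoeffZ map_mcoeff mulrC hG// mulrC. Qed.

Lemma bc_eq_homog G : bc_eq G -> G \is 3.-homog.
Proof.
move=> hG; apply/dhomogP => m; rewrite mcoeff_msupp => Gm; apply/eqP; apply: contrapT => /negP ne.
case/eqP: Gm; apply: local_eq0 => k chi; have [F [n [hF F0]]] := cubic_unimod (chi \o f).
exists (f F@_n) => //; rewrite mulrC hG//; have -> : F@_m = 0; last by rewrite rmorph0 mul0r.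
by apply: (dhomog_nemf_coeff (ceq_homog hF)); apply/eqP => E; case/eqP: ne.
Qed.

(** The monomials are infinitely many, but two polynomials involve only finitely many of them. *)
Lemma mpoly_expand (v w : {mpoly S[3]}) : exists n (b : 'I_n -> {mpoly S[3]}) (k : 'I_n -> 'X_{1..3}),
  v = \sum_i v@_(k i) *: b i /\ w = \sum_i w@_(k i) *: b i.
Proof.
pose s := undup (msupp v ++ msupp w).
exists (size s), (fun i => 'X_[tnth (in_tuple s) i]), (fun i => tnth (in_tuple s) i).
have key (u : {mpoly S[3]}) : {subset msupp u <= s} -> u = \sum_i u@_(tnth (in_tuple s) i) *: 'X_[tnth (in_tuple s) i].
  move=> hu; rewrite -(big_tnth _ _ _ predT (fun m => u@_m *: 'X_[m])) {1}[u]mpolyE.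
  rewrite [RHS](bigID (mem (msupp u)))/= [X in _ + X]big1 ?addr0; last first.
    by move=> m; rewrite mcoeff_msupp negbK => /eqP ->; rewrite scale0r.
  rewrite -[RHS]big_filter; apply: perm_big; apply: uniq_perm; rewrite ?msupp_uniq ?filter_uniq ?undup_uniq//.
  by move=> m; rewrite mem_filter; apply/idP/andP => [hm|[]//]; split=> //; exact: hu.
by split; apply: key => m hm; rewrite mem_undup mem_cat hm ?orbT.
Qed.

Lemma bc_smooth : smooth_cubic bc_eq.
Proof.
split; last 2 first.
- by move=> G; exact: bc_eq_homog.
- move=> k g v v0 H; refine (sc_smooth (ceqP a) (g := (g \o f : {rmorphism R -> k})) (v := v) v0 _) => F hF.
  have E : map_mpoly (g \o f) F = map_mpoly g (map_mpoly f F).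
    by apply/mpolyP => m; rewrite !mcoeff_map_mpoly.
  by rewrite E; apply: H; exact: bc_eq_map.
apply: (sat_point (phi := map_mpoly f)).
- by move=> m; exact: mcoeff_linear.
- by move=> m F; exact: map_mcoeff.
- exact: mpoly_expand.
- by move=> F G i j hF hG; exact: (cubic_prop i j hF hG).
- exact: cubic_unimod.
Qed.

Definition bc_cubic : cubic S := Cubic bc_smooth.

Variables (H : classical_sets.set 'M[R]_3) (hH : pgl3 H).
Definition bc_mx : classical_sets.set 'M[S]_3 := sat f (me : _ -> 'M[R]_3 -> R) (me : _ -> 'M[S]_3 -> S) H.

Lemma pgl_unimod (k : fieldType) (chi : {rmorphism R -> k}) : exists h p, H h /\ chi (me p h) != 0.
Proof.
have [h hh d0] := pgl_unit hH chi; exists h; apply: contrapT => E; case/eqP: d0.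
have z i j : chi (h i j) = 0.
  by apply/eqP; apply: contrapT => /negP ne; apply: E; exists (i, j).
by rewrite det33 !(rmorphB, rmorphD, rmorphM) !z; ring.
Qed.

Lemma bc_mx_map h : H h -> bc_mx (map_mx f h).
Proof. by move=> hh h' i j hh'; rewrite !mxE -!rmorphM (pgl_prop hH). Qed.

Lemma bc_mx_scale M h i j : bc_mx M -> H h -> f (h i j) *: M = M i j *: map_mx f h.
Proof. by move=> hM hh; apply/matrixP => i' j'; rewrite !mxE mulrC (hM h (i', j') (i, j) hh) mulrC. Qed.

Lemma bc_pgl3 : pgl3 bc_mx.
Proof.
split; last first.
  have [n [c [d [hd E]]]] := pgl_det hH; exists n, (f \o c), (f \o d); split.
    by move=> i; have [h [hh E0]] := hd i; exists (map_mx f h); split; [exact: bc_mx_map|rewrite /= E0 det_map_mx].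
  apply: etrans (esym (rmorph1 f)) _; apply: etrans (congr1 f E) _.
  rewrite rmorph_sum; apply: eq_bigr => i _; exact: rmorphM.
apply: (sat_point (phi := map_mx f)).
- by move=> p r M N; rewrite !mxE.
- by move=> p M; rewrite mxE.
- move=> v w; exists #|{: 'I_3 * 'I_3}|, (fun i => delta_mx (enum_val i).1 (enum_val i).2), (fun i => enum_val i).
  have key (u : 'M[S]_3) : u = \sum_(i < #|{: 'I_3 * 'I_3}|) u (enum_val i).1 (enum_val i).2 *: delta_mx (enum_val i).1 (enum_val i).2.
    rewrite -(big_enum_val (fun p : 'I_3 * 'I_3 => u p.1 p.2 *: delta_mx p.1 p.2)).
    by rewrite {1}[u]matrix_sum_delta pair_big; apply: eq_bigl => p.
  by split; exact: key.
- by move=> M N p q hM hN; exact: (pgl_prop hH).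
- exact: pgl_unimod.
Qed.

Lemma scalar_pgl3 : @pgl3 C R (fun M => exists r, M = r *: 1%:M).
Proof.
split.
  have tl : linear (fun M : 'M[R]_3 => M 0 0 : R^o) by move=> r M N; rewrite !mxE.
  by apply: (line_projective (l := mklin tl)); rewrite /= mxE.
apply: span1; exists 1%:M; rewrite det1; split=> //; by exists 1; rewrite scale1r.
Qed.

End Objects.

Lemma bc_hom_subproof (R S : comAlgType C) (f : {lrmorphism R -> S}) (a : cubic R) F h :
  ceq a F -> (exists r : S, h = r *: 1%:M) -> ceq (bc_cubic f a) (subst_form (map_mpoly f F) h).
Proof.
move=> hF [r ->]; have hG := map_homog f (ceq_homog hF).
rewrite (subst_form_scale C0)// (subst_form1 C0)//.
exact: (pp_scale _ (sc_point (ceqP (bc_cubic f a))) (bc_eq_map f hF)).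
Qed.

Definition bc_hom (R S : comAlgType C) (f : {lrmorphism R -> S}) (a : cubic R) : cubic_hom f (bc_cubic f a) a :=
  CubicHom (scalar_pgl3 S) (@bc_hom_subproof R S f a).

Section Arrows.
Variables (R S R' S' : comAlgType C) (f : {lrmorphism R -> S}) (s : {lrmorphism R -> R'}) (t : {lrmorphism S -> S'}).
Variables (g : {lrmorphism R' -> S'}) (gs : forall r, g (s r) = t (f r)).
Variables (b : cubic S) (a : cubic R) (u : cubic_hom f b a).

(** Near a point F' and h' are proportional to images of some F and h, to which the arrow [u]
    applies. The unit [c] clears the proportions; it contains a cube because substitution is cubic
    in the matrix. *)
Lemma bc_arrow_subproof F' h' : ceq (bc_cubic s a) F' -> bc_mx t (chmx u) h' ->
  ceq (bc_cubic t b) (subst_form (map_mpoly g F') h').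
Proof.
move=> hF' hh' G m m' hG; apply/eqP; rewrite -subr_eq0; apply/eqP/local_eq0 => k chi.
have [F [n [hF F0]]] := cubic_unimod a (chi \o t \o f).
have [h [[i j] [hh h0]]] := pgl_unimod (chmxP u) (chi \o t).
have hgF' := map_homog g (bc_eq_homog hF').
have hfF := map_homog f (ceq_homog hF).
set X := subst_form _ _; set c := t (f F@_n) * t (h i j) ^+ 3.
have E : c *: X = (g F'@_n * h' i j ^+ 3) *: map_mpoly t (subst_form (map_mpoly f F) h).
  have e1 : t (f F@_n) *: map_mpoly g F' = g F'@_n *: map_mpoly t (map_mpoly f F).
    have e0 q : g (s F@_n) * g F'@_q = g F'@_n * g (s F@_q).
      have := congr1 (fun P : {mpoly R'[3]} => g P@_q) (bc_eq_scale n hF' hF); rewrite !mcoeffZ map_mcoeff => e.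
      exact: etrans (esym (rmorphM g _ _)) (etrans e (rmorphM g _ _)).
    apply/mpolyP => q; rewrite !mcoeffZ !mcoeff_map_mpoly.
    apply: etrans (congr1 (fun x => x * _) (esym (gs _))) _; apply: etrans (e0 q) _; congr (_ * _); exact: gs.
  have e2 := bc_mx_scale i j hh' hh.
  transitivity (subst_form (t (f F@_n) *: map_mpoly g F') (t (h i j) *: h')).
    by rewrite subst_form_scalel (subst_form_scale C0)// scalerA.
  rewrite e1 e2 subst_form_scalel (subst_form_scale C0); last exact: map_homog.
  by rewrite scalerA (subst_form_map C0).
exists c; last by rewrite /c rmorphM mulf_neq0// rmorphXn expf_neq0.
have hX q : c * X@_q = g F'@_n * h' i j ^+ 3 * t (subst_form (map_mpoly f F) h)@_q.
  by rewrite -mcoeffZ E mcoeffZ mcoeff_map_mpoly.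
rewrite mulrBr; apply/eqP; rewrite subr_eq0; apply/eqP.
apply: etrans (mulrA c _ _) _; apply: etrans (congr1 (fun x => x * t G@_m') (hX m)) _.
apply: esym; apply: etrans (mulrCA c _ _) _; apply: etrans (congr1 ( *%R (t G@_m)) (hX m')) _.
apply: etrans (mulrCA _ _ _) _; apply: etrans _ (mulrA _ _ _); congr (_ * _).
have e := cubic_prop m m' (chmx_cubic hF hh) hG.
exact: etrans (esym (rmorphM t _ _)) (etrans (congr1 t (esym e)) (rmorphM t _ _)).
Qed.

Definition bc_arrow : cubic_hom g (bc_cubic t b) (bc_cubic s a) :=
  CubicHom (bc_pgl3 t (chmxP u)) bc_arrow_subproof.

End Arrows.

End BaseChange.

(** * Covers induced from covers of the flexed stack *)

Module ResMod.
Section RestrictedModule.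
Variables (T : pzRingType) (B : pzRingType) (t : {rmorphism T -> B}) (M : lmodType B).
Definition res_mod : Type := let _ := t in M.
HB.instance Definition _ := GRing.Zmodule.on res_mod.
Let scale (c : T) (x : res_mod) : res_mod := t c *: (x : M).
Fact res_scaleA a b m : scale a (scale b m) = scale (a * b) m.
Proof. by rewrite /scale rmorphM scalerA. Qed.
Fact res_scale1 : left_id 1 scale.
Proof. by move=> m; rewrite /scale rmorph1 scale1r. Qed.
Fact res_scaleDr : right_distributive scale +%R.
Proof. by move=> a m n; rewrite /scale scalerDr. Qed.
Fact res_scaleDl m : {morph scale^~ m : a b / a + b}.
Proof. by move=> a b; rewrite /scale rmorphD scalerDl. Qed.
HB.instance Definition _ := GRing.Zmodule_isLmodule.Build T res_mod
  res_scaleA res_scale1 res_scaleDr res_scaleDl.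
End RestrictedModule.
End ResMod.
Import ResMod.

(** Dual bases multiply. A derivation of [B] over [R] vanishes on [T], its restriction being a
    derivation of [T], and is then a derivation over [T]. *)
Lemma finite_etale_comp (R T : comNzRingType) (B : comPzRingType) (s : {rmorphism R -> T}) (t : {rmorphism T -> B}) :
  finite_etale s -> finite_etale t -> finite_etale (t \o s).
Proof.
move=> [[n [b [l [lD lZ lE]]]] su] [[m [b' [l' [lD' lZ' lE']]]] tu]; split.
  pose I : finType := ('I_n * 'I_m)%type.
  exists #|I|, (fun k => t (b (enum_val k).1) * b' (enum_val k).2),
    (fun k x => l (enum_val k).1 (l' (enum_val k).2 x)); split=> [k x x'|k r x|x].
  - by rewrite lD' lD.
  - by rewrite /= lZ' lZ.
  rewrite -(big_enum_val (fun p : I => (t \o s) (l p.1 (l' p.2 x)) * (t (b p.1) * b' p.2))) /=.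
  transitivity (\sum_(i < n) \sum_(j < m) t (s (l i (l' j x))) * (t (b i) * b' j)); last first.
    by rewrite pair_big /=; apply: eq_bigl => p.
  rewrite exchange_big {1}[x]lE'; apply: eq_bigr => j _; rewrite {1}[l' j x]lE rmorph_sum mulr_suml.
  by apply: eq_bigr => i _; rewrite rmorphM mulrA.
move=> M D DD DM D0; apply: tu => // r.
apply: (su (res_mod t M) (D \o t)) => [x y|x y|r'] /=; last exact: D0.
  by rewrite rmorphD DD.
by rewrite rmorphM DM.
Qed.

Section Universal.
Variables (C : fieldType) (C0 : char0 C) (w0 : C) (hw : cube_root w0).

Lemma isf_bc (R S : comAlgType C) (f : {lrmorphism R -> S}) (a : cubic R) W :
  isf w0 a f W -> isf w0 (bc_cubic f a) idfun W.
Proof.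
move=> [h1 h2]; have fw : f (w0%:A : R) = w0%:A :> S by exact: rmorph_alg.
split; first by move: h1; rewrite -[X in weyl X _]/(f (w0%:A : R)) fw.
move=> B [G hG ->] u x y z; apply/eqP; rewrite -subr_eq0; apply/eqP/local_eq0 => k chi.
have [F [n [hF F0]]] := cubic_unimod a (chi \o f); exists (f F@_n) => //.
have E i j l : f F@_n * d3 G i j l = G@_n * f (d3 F i j l).
  by rewrite -d3Z (bc_eq_scale n hG hF) d3Z d3_map.
have hB : tinv (tmap f (d3 F)) (W u) by apply: (h2 (d3 F)); exists F.
by rewrite mulrBr !(tri_scale _ _ _ E) hB subrr.
Qed.

Lemma third_half (R : comAlgType C) : exists i2 : R, 2%:R * i2 = 1.
Proof. by exists (3%:R * (6%:R^-1 : C)%:A); rewrite mulrA -natrM (h6A R C0). Qed.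

(** The projector commutes with base change, so the eigenline over [S] is spanned by images of its
    columns over [R]. *)
Lemma frame_flex_span (R S : comAlgType C) (g : {lrmorphism R -> S}) (a : cubic R) W (hW : isf w0 a idfun W) (y : 'cV[S]_3) :
  parity (third S) (fun u => map_mx g (W u)) *m y = - y ->
  span [set map_mx g x | x in frame_flex W]%classic y.
Proof.
move=> hy; have [i2 h2] := third_half R.
have h2' : 2%:R * g i2 = 1 by rewrite -(rmorph_nat g) -rmorphM h2 rmorph1.
have w1 : cube_root (w0%:A : R) := cube_root_map (in_alg R) hw.
have E : map_mx g (flexproj (third R) i2 W) *m y = y.
  have Ef : map_mx g (flexproj (third R) i2 W) = flexproj (third S) (g i2) (fun u => map_mx g (W u)).
    rewrite /flexproj map_scale; congr (_ *: _); rewrite raddfB /= map_mx1 parity_map; congr (_ - parity _ _).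
    exact: third_lr.
  by rewrite Ef; apply: flexproj_id.
exists 3%N, (fun j => y j 0), (fun j => map_mx g (flexproj (third R) i2 W *m bas j)); split.
  move=> j; exists (flexproj (third R) i2 W *m bas j) => //.
  exact: (flexproj_ker w1 (thirdE C0 R) i2 hW.1).
rewrite -{1}E {1}[y]col_bas mulmx_sumr; apply: eq_bigr => j _; rewrite -scalemxAr; congr (_ *: _).
by rewrite map_mxM map_mx_bas.
Qed.

Section ArrowsOnFrames.
Variables (R S R' S' : comAlgType C) (f : {lrmorphism R -> S}) (s : {lrmorphism R -> R'}) (t : {lrmorphism S -> S'}).
Variables (g : {lrmorphism R' -> S'}) (gs : forall r, g (s r) = t (f r)).
Variables (b : cubic S) (a : cubic R) (u : cubic_hom f b a).
Variables (Wa : 'cV['F_3]_2 -> 'M[R']_3) (Wb : 'cV['F_3]_2 -> 'M[S']_3).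
Hypothesis conj : forall h v, chmx u h -> map_mx g (Wa v) *m map_mx t h = map_mx t h *m Wb v.

Lemma bc_mx_conj h v : bc_mx t (chmx u) h -> map_mx g (Wa v) *m h = h *m Wb v.
Proof.
move=> hh; apply/matrixP => i j; apply/eqP; rewrite -subr_eq0; apply/eqP/local_eq0 => k chi.
have [h0 [[i' j'] [hh0 d0]]] := pgl_unimod (chmxP u) (chi \o t); exists (t (h0 i' j')) => //=.
have E := bc_mx_scale i' j' hh hh0.
have : t (h0 i' j') *: (map_mx g (Wa v) *m h) = t (h0 i' j') *: (h *m Wb v).
  transitivity ((h i' j' *: map_mx t h0) *m Wb v); first by rewrite scalemxAr E -scalemxAr conj// -scalemxAl.
  by rewrite -E -scalemxAl.
by move/matrixP/(_ i j); rewrite [LHS]mxE [RHS]mxE => E'; rewrite mulrBr E' subrr.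
Qed.

Lemma bc_mx_flex h v : isf w0 (bc_cubic s a) idfun Wa -> bc_mx t (chmx u) h -> frame_flex Wb v ->
  span [set map_mx g x | x in frame_flex Wa]%classic (h *m v).
Proof.
move=> hWa hh hv; apply: (frame_flex_span hWa).
have hP := parity_conj (third S') (fun v => bc_mx_conj v hh).
by rewrite mulmxA hP -mulmxA hv mulmxN.
Qed.

Lemma bc_to_subproof F h : ceq a F -> bc_mx t (chmx u) h -> ceq (bc_cubic t b) (subst_form (map_mpoly (t \o f) F) h).
Proof.
move=> hF hh; have -> : map_mpoly (t \o f) F = map_mpoly g (map_mpoly s F).
  by apply/mpolyP => m; rewrite !mcoeff_map_mpoly; exact: esym (gs _).
exact: (bc_arrow_subproof C0 gs (u := u) (bc_eq_map s hF) hh).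
Qed.

Definition bc_to : cubic_hom (t \o f) (bc_cubic t b) a := CubicHom (bc_pgl3 t (chmxP u)) bc_to_subproof.

Lemma bc_to_comp1 : cubic_comp (bc_arrow C0 gs u) (bc_hom C0 s a) bc_to.
Proof.
split=> [r|m n [r ->] hn]; first exact: esym (gs r).
have -> : map_mx g (r *: 1%:M) *m n = g r *: n by rewrite map_scale map_mx1 -scalemxAl mul1mx.
exact: (pp_scale _ (pgl_point (bc_pgl3 t (chmxP u))) hn).
Qed.

Lemma bc_to_comp2 : cubic_comp (bc_hom C0 t b) u bc_to.
Proof.
split=> [r|m n hm [r ->]]; first by [].
have -> : map_mx t m *m (r *: 1%:M) = r *: map_mx t m by rewrite -scalemxAr mulmx1.
exact: (pp_scale _ (pgl_point (bc_pgl3 t (chmxP u))) (bc_mx_map t (chmxP u) hm)).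
Qed.

End ArrowsOnFrames.

Lemma bc_mx_comp (R S T S' T' : comAlgType C) (f : {lrmorphism R -> S}) (g : {lrmorphism S -> T}) (h : {lrmorphism R -> T})
  (s : {lrmorphism S -> S'}) (t : {lrmorphism T -> T'}) (g' : {lrmorphism S' -> T'}) (gs : forall r, g' (s r) = t (g r))
  (a : cubic R) (b : cubic S) (c : cubic T) (v : cubic_hom g c b) (u : cubic_hom f b a) (w : cubic_hom h c a) m n :
  cubic_comp v u w -> bc_mx s (chmx u) m -> bc_mx t (chmx v) n -> bc_mx t (chmx w) (map_mx g' m *m n).
Proof.
move=> [_ hc] hm hn x p q hx; apply/eqP; rewrite -subr_eq0; apply/eqP/local_eq0 => k chi.
have [m0 [[i j] [hm0 d0]]] := pgl_unimod (chmxP u) (chi \o t \o g).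
have [n0 [[i' j'] [hn0 e0]]] := pgl_unimod (chmxP v) (chi \o t).
pose d := t (g (m0 i j)) * t (n0 i' j'); exists d; last by rewrite /d rmorphM mulf_neq0.
pose y : 'M[T']_3 := map_mx g' m *m n.
have E1 : t (g (m0 i j)) *: map_mx g' m = g' (m i j) *: map_mx t (map_mx g m0).
  apply/matrixP => r r'; rewrite !mxE.
  have := congr1 (fun M : 'M_3 => g' (M r r')) (bc_mx_scale i j hm hm0); rewrite !mxE => e1.
  apply: etrans (congr1 (fun x => x * _) (esym (gs _))) _.
  apply: etrans (esym (rmorphM g' _ _)) _; apply: etrans e1 _; apply: etrans (rmorphM g' _ _) _.
  by congr (_ * _); exact: gs.
have E : d *: y = (g' (m i j) * n i' j') *: map_mx t (map_mx g m0 *m n0).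
  transitivity ((t (g (m0 i j)) *: map_mx g' m) *m (t (n0 i' j') *: n)).
    by rewrite -scalemxAl -scalemxAr scalerA.
  by rewrite E1 (bc_mx_scale i' j' hn hn0) -scalemxAl -scalemxAr scalerA map_mxM.
have hy l : d * y l.1 l.2 = g' (m i j) * n i' j' * t ((map_mx g m0 *m n0) l.1 l.2).
  by have /matrixP/(_ l.1 l.2) := E; rewrite [LHS]mxE [RHS]mxE [in X in _ = _ * X]mxE.
rewrite mulrBr; apply/eqP; rewrite subr_eq0; apply/eqP.
apply: etrans (mulrA d _ _) _; apply: etrans (congr1 (fun r => r * t (x q.1 q.2)) (hy p)) _.
apply: esym; apply: etrans (mulrCA d _ _) _; apply: etrans (congr1 ( *%R (t (x p.1 p.2))) (hy q)) _.
apply: etrans (mulrCA _ _ _) _; apply: etrans _ (mulrA _ _ _); congr (_ * _).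
have e := pgl_prop (chmxP w) p.1 p.2 q.1 q.2 (hc _ _ hm0 hn0) hx.
exact: etrans (esym (rmorphM t _ _)) (etrans (congr1 t (esym e)) (rmorphM t _ _)).
Qed.

Section UniversalFlex.
Variables (R : comAlgType C) (a : cubic R).

(** Objects live over nonzero algebras; the frame ring qualifies because R embeds in it. *)
Lemma fT_nz : (1 : fT (fpk w0 a)) != 0.
Proof.
apply/eqP => E; have /eqP : (1 : R) = 0; last by rewrite oner_eq0.
by apply: (fpk_inj C0 hw (a := a)); rewrite rmorph1 rmorph0.
Qed.

Definition fT_emb : {rmorphism C -> nzOf fT_nz} := fs (fpk w0 a) \o in_alg R.
Definition univ_ring : comAlgType C := alg_of fT_emb.

Fact univ_strA c : (fs (fpk w0 a) : {rmorphism R -> univ_ring}) c%:A = c%:A.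
Proof. exact: esym (alg_ofE fT_emb c). Qed.
Definition univ_str : {lrmorphism R -> univ_ring} := mklr univ_strA.

Definition univ_W : 'cV['F_3]_2 -> 'M[univ_ring]_3 := fW (fpk w0 a).

Lemma univ_frame : isf w0 (bc_cubic univ_str a) idfun univ_W.
Proof. apply: isf_bc; exact: (fr_frame (fP (fpk w0 a))). Qed.

Definition univ : flexed_cubic univ_ring := FlexedCubic (frame_flexP C0 hw univ_frame).

Definition univ_rm : {rmorphism R -> univ_ring} := fs (fpk w0 a).
Lemma univ_fet : finite_etale univ_rm.
Proof. by have [h1 h2] := fpk_fet C0 hw a; split; [exact: h1|exact: h2]. Qed.
End UniversalFlex.

Section UniversalArrow.
Variables (R S : comAlgType C) (f : {lrmorphism R -> S}) (b : cubic S) (a : cubic R) (u : cubic_hom f b a).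

Fact univ_mapA c : (fcmap C0 w0 u : {rmorphism univ_ring a -> univ_ring b}) c%:A = c%:A.
Proof.
apply: etrans (congr1 (fcmap C0 w0 u) (alg_ofE (fT_emb a) c)) _; apply: etrans _ (esym (alg_ofE (fT_emb b) c)).
by rewrite /fT_emb /= fcmapE rmorph_alg.
Qed.
Definition univ_map : {lrmorphism univ_ring a -> univ_ring b} := mklr univ_mapA.

Lemma univ_map_str r : univ_map (univ_str a r) = univ_str b (f r).
Proof. exact: fcmapE. Qed.

Lemma univ_conj h v : chmx u h -> map_mx univ_map (univ_W a v) *m map_mx (univ_str b) h = map_mx (univ_str b) h *m univ_W b v.
Proof. exact: fcmapW. Qed.

Lemma univ_hom_flex h v : chmx (bc_arrow C0 univ_map_str u) h -> fflex (univ b) v ->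
  span [set map_mx univ_map x | x in fflex (univ a)]%classic (h *m v).
Proof. by move=> hh hv; exact: (bc_mx_flex univ_conj (univ_frame a) hh hv). Qed.

Definition univ_hom : flexed_hom univ_map (univ b) (univ a) := @FlexedHom C _ _ univ_map (univ b) (univ a) (bc_arrow C0 univ_map_str u) univ_hom_flex.
End UniversalArrow.

Lemma univ_comp (R S T : comAlgType C) (f : {lrmorphism R -> S}) (g : {lrmorphism S -> T})
    (h : {lrmorphism R -> T}) (a : cubic R) (b : cubic S) (c : cubic T)
    (v : cubic_hom g c b) (u : cubic_hom f b a) (w : cubic_hom h c a) :
  cubic_comp v u w -> cubic_comp (univ_hom v) (univ_hom u) (univ_hom w).
Proof.
move=> hc; split=> [r|m n hm hn]; first exact: (fcmap_comp C0 hc).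
exact: (bc_mx_comp (univ_map_str v) hc hm hn).
Qed.

Section Sharp.
Variable E : cover (flexed_plane_cubics C).
Notation X := (plane_cubics C).

Let sstr R (a : cubic R) : {rmorphism R -> cring E (univ a)} := cstr E (univ a) \o univ_rm a.

Let sfet R (a : cubic R) : finite_etale (@sstr R a).
Proof. exact: (finite_etale_comp (univ_fet a) (cfet E (univ a))). Qed.

Let smapE (R S : comAlgType C) (f : {lrmorphism R -> S}) (b : cubic S) (a : cubic R) (u : cubic_hom f b a) r :
  cmap E (univ_hom u) (sstr a r) = sstr b (f r).
Proof. by apply: etrans (cmapE E (univ_hom u) _) _; congr (cstr _ _ _); exact: univ_map_str. Qed.

Let spushout (R S : comAlgType C) (f : {lrmorphism R -> S}) (b : cubic S) (a : cubic R) (u : cubic_hom f b a)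
    (T : comPzRingType) (p : {rmorphism cring E (univ a) -> T}) (q : {rmorphism S -> T}) :
  (forall r, p (sstr a r) = q (f r)) ->
  exists w : {rmorphism cring E (univ b) -> T},
    [/\ forall x, w (cmap E (univ_hom u) x) = p x, forall s, w (sstr b s) = q s
      & forall w' : {rmorphism cring E (univ b) -> T},
          (forall x, w' (cmap E (univ_hom u) x) = p x) -> (forall s, w' (sstr b s) = q s) -> w' =1 w].
Proof.
move=> hpq; have [w1 [e1 e2 e3]] := fcpushout C0 u (p := (p \o cstr E (univ a) : {rmorphism fT (fpk w0 a) -> T})) hpq.
have [w [h1 h2 h3]] := cpushout (univ_hom u : @hom C (flexed_plane_cubics C) _ _ _ (univ b) (univ a)) (p := p) (q := (w1 : {rmorphism univ_ring b -> T})) (fun r => esym (e1 r)).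
exists w; split=> [//|s|w' k1 k2]; first by rewrite /sstr /= h2; exact: e2.
apply: h3 => // s; apply: (e3 (w' \o cstr E (univ b))) => [x|x]; last exact: k2.
by rewrite /= -[fcmap _ _ _ x]/(univ_map u x) -(cmapE E (univ_hom u)) k1.
Qed.

(** The pullback of [E] to the space of frames along frame |-> (cubic, p_0), followed by the finite
    etale map from frames to X. *)
Definition sharp : cover X :=
  @Cover C X (fun R a => cring E (univ a)) sstr sfet (fun R S f b a u => cmap E (univ_hom u))
    smapE spushout (fun R S T f g h a b c v u w hc => @cmap_comp C (flexed_plane_cubics C) E _ _ _ _ _ _ _ _ _ _ _ _ (univ_comp hc)).

End Sharp.

End Universal.

(** * The kernel of the action on frames comes from the flexed stack *)

Section IdentityArrow.
Variables (C : fieldType) (C0 : char0 C) (R : comAlgType C) (a : cubic R).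

Fact id_hom_subproof F h : ceq a F -> (exists r : R, h = r *: 1%:M) ->
  ceq a (subst_form (map_mpoly (idfun : {lrmorphism R -> R}) F) h).
Proof.
move=> hF [r ->]; have -> : map_mpoly (idfun : {lrmorphism R -> R}) F = F.
  by apply/mpolyP => m; rewrite mcoeff_map_mpoly.
rewrite (subst_form_scale C0) ?(ceq_homog hF)// (subst_form1 C0) ?(ceq_homog hF)//.
exact: (pp_scale _ (sc_point (ceqP a)) hF).
Qed.

Definition id_hom : cubic_hom (idfun : {lrmorphism R -> R}) a a := CubicHom (scalar_pgl3 R) id_hom_subproof.

Lemma id_hom_comp : cubic_comp id_hom id_hom id_hom.
Proof.
split=> // m n [r ->] [r' ->]; exists (r * r'); rewrite map_scale map_mx1.
by rewrite -scalemxAl mul1mx scalerA.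
Qed.

(** Covers have no axiom about identities. Since [id_hom] is idempotent, [cmap] along it and the
    identity map both solve the same pushout problem, whose solution is unique. *)
Lemma cmap_id (E : cover (plane_cubics C)) c : cmap E (id_hom : @hom C (plane_cubics C) _ _ _ a a) c = c.
Proof.
set u : @hom C (plane_cubics C) _ _ _ a a := id_hom.
have [w [w1 w2 w3]] := cpushout u (p := cmap E u) (q := cstr E a) (fun r => cmapE E u r).
have -> : cmap E u c = w c.
  apply: w3 => [x|r]; last exact: cmapE.
  by rewrite -(@cmap_comp C (plane_cubics C) E _ _ _ _ _ _ _ _ _ _ _ _ id_hom_comp).
by apply: esym; apply: (w3 idfun).
Qed.

End IdentityArrow.

Section Kernel.
Variables (C : fieldType) (C0 : char0 C) (w0 : C) (hw : cube_root w0) (y : flexed_cubic (C^o : comAlgType C)).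
Notation x := (fcubic y).
Notation X := (plane_cubics C).
Notation Y := (flexed_plane_cubics C).
Notation FC := (frame_cover C0 hw).
Variables (z : @fiber C X x FC) (hz : on_flex z).
Notation T := (univ_ring C0 hw x).
Notation U := (univ C0 hw x).

Fact point_A c : (fpt z : {rmorphism T -> C^o}) c%:A = c%:A.
Proof. exact: etrans (congr1 (fpt z) (alg_ofE (fT_emb C0 hw x) c)) (fptE z _). Qed.
Definition point_map : {lrmorphism T -> (C^o : comAlgType C)} := mklr point_A.

Fact point_cubic F h : ceq U F -> (exists r : C^o, h = r *: 1%:M) -> ceq x (subst_form (map_mpoly point_map F) h).
Proof.
move=> hF [r ->]; have [F0 [n [hF0 n0]]] := cubic_unimod x (idfun : {rmorphism C^o -> C}).
have hG := map_homog point_map (bc_eq_homog hF).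
rewrite (subst_form_scale C0)// (subst_form1 C0)//; apply: (pp_scale _ (sc_point (ceqP x))).
have -> : map_mpoly point_map F = ((F0@_n : C)^-1 * (point_map F@_n : C) : C^o) *: F0.
  apply/mpolyP => q; rewrite mcoeffZ mcoeff_map_mpoly.
  have := congr1 (fun P : {mpoly T[3]} => point_map P@_q) (bc_eq_scale n hF hF0); rewrite !mcoeffZ map_mcoeff => e.
  have e' : (F0@_n : C) * (point_map F@_q : C) = (point_map F@_n : C) * (F0@_q : C).
    apply: etrans (congr1 (fun v => v * _) (esym (fptE z _))) _.
    apply: etrans (esym (rmorphM point_map _ _)) _; apply: etrans e _; apply: etrans (rmorphM point_map _ _) _.
    by congr (_ * _); exact: (fptE z).
  apply: (mulfI (n0 : (F0@_n : C) != 0)); apply: etrans e' _.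
  by rewrite !mulrA mulfV// mul1r.
exact: (pp_scale _ (sc_point (ceqP x)) hF0).
Qed.

Fact point_flex h v : (exists r : C^o, h = r *: 1%:M) -> fflex y v ->
  span [set map_mx point_map u | u in fflex U]%classic (h *m v).
Proof.
move=> [r ->] hv; apply: (frame_flex_span C0 hw (univ_frame C0 hw x)).
rewrite -scalemxAl mul1mx -scalemxAr -scalerN; congr (_ *: _); exact: (hz hv).
Qed.

(** The frame [z] is a point of the frame ring; as its p_0 is the marked flex, it underlies an arrow
    from [y] to the universal flexed cubic. *)
Definition point_hom : flexed_hom point_map y U :=
  @FlexedHom C _ _ point_map y U (CubicHom (scalar_pgl3 _) point_cubic) point_flex.

Lemma point_comp : cubic_comp point_hom (bc_hom C0 (univ_str C0 hw x) x) (id_hom C0 x).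
Proof.
split=> [r|m n [r ->] [r' ->]]; first exact: esym (fptE z r).
by exists (point_map r * r'); rewrite map_scale map_mx1 -scalemxAl mul1mx scalerA.
Qed.

Section OneCover.
Variable E : cover Y.
Notation Esh := (sharp C0 hw E).
Notation P := (point_hom : @hom C Y _ _ _ y U).

Definition sharp_proj : cover_map Esh FC :=
  @CoverMap C X Esh FC (fun R a => (cstr E (univ C0 hw a) : {rmorphism fT (fpk w0 a) -> _}))
    (fun R a r => erefl) (fun R S f b a u c => esym (cmapE E (univ_hom C0 hw u) c)).

Fact sharp_up_subproof (p : @fiber C Y y E) c : (fpt p \o cmap E P) (cstr Esh x c) = c.
Proof.
apply: etrans (congr1 (fpt p) (cmapE E P _)) _; apply: etrans (fptE p _) _; exact: (fptE z).
Qed.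
(** Identifies the fiber of [E] at [y] with the part over [z] of the fiber of the induced cover; an
    element of pi_1(X) fixing [z] preserves this part. *)
Definition sharp_up (p : @fiber C Y y E) : @fiber C X x Esh := @Fiber C X x Esh (fpt p \o cmap E P) (sharp_up_subproof p).

Lemma sharp_up_proj p : fiber_map sharp_proj (sharp_up p) = z.
Proof.
apply: fiber_ext => c; apply: etrans (congr1 (fpt p) (cmapE E P c)) _; exact: (fptE p).
Qed.

Lemma sharp_up_ex (q : @fiber C X x Esh) : fiber_map sharp_proj q = z -> exists p, sharp_up p = q.
Proof.
move=> hq; have [|p hp] := @fiber_of_point C Y y T U point_map P E (fpt q).
  by move=> r; exact: (congr1 (fun s : @fiber C X x FC => fpt s r) hq).
by exists p; apply: fiber_ext => c; exact: esym (hp c).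
Qed.

Lemma sharp_up_inj : injective sharp_up.
Proof.
move=> p q e; apply: (@fiber_of_point_uniq C Y y T U point_map P E) => c.
exact: (congr1 (fun s : @fiber C X x Esh => fpt s c) e).
Qed.

Variable t : @pi1 C X x.
Hypothesis ht : @pact C X x t FC z = z.

Lemma sharp_act_ex p : exists p', sharp_up p' = @pact C X x t Esh (sharp_up p).
Proof.
apply: sharp_up_ex; rewrite -(pact_nat t sharp_proj) sharp_up_proj; exact: ht.
Qed.

Definition sharp_act p := sval (cid (sharp_act_ex p)).
Lemma sharp_actE p : sharp_up (sharp_act p) = @pact C X x t Esh (sharp_up p).
Proof. exact: (svalP (cid (sharp_act_ex p))). Qed.

Lemma sharp_act_bij : bijective sharp_act.
Proof.
have [g gK Kg] := pact_bij t Esh; have [g0 g0K Kg0] := pact_bij t FC.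
have ex q : exists p, sharp_up p = g (sharp_up q).
  apply: sharp_up_ex; apply: (can_inj g0K); by rewrite ht (pact_nat t sharp_proj) Kg sharp_up_proj.
have [k hk] := choice ex; exists k => p; apply: sharp_up_inj.
  by rewrite hk sharp_actE gK.
by rewrite sharp_actE hk Kg.
Qed.

End OneCover.

Section CoverMaps.
Variables (E E' : cover Y) (m : cover_map E E').
Definition sharp_map : cover_map (sharp C0 hw E) (sharp C0 hw E') :=
  @CoverMap C X (sharp C0 hw E) (sharp C0 hw E') (fun R a => cm m (univ C0 hw a))
    (fun R a r => cm_str m (univ C0 hw a) _) (fun R S f b a u c => cm_nat m (univ_hom C0 hw u) c).

Lemma sharp_up_map p : sharp_up (fiber_map m p) = fiber_map sharp_map (sharp_up p).
Proof. by apply: fiber_ext => c /=; rewrite cm_nat. Qed.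
End CoverMaps.

Section Descent.
Variable E : cover X.
Notation PE := (pullback (forget_flex C) E).

Fact sharp_counit_nat (R S : comAlgType C) (f : {lrmorphism R -> S}) (b : cubic S) (a : cubic R)
  (u : @hom C X R S f b a) c :
  cmap E (bc_hom C0 (univ_str C0 hw b) b : @hom C X _ _ _ (univ C0 hw b : cubic _) b) (cmap E u c) =
  cmap (sharp C0 hw PE) u (cmap E (bc_hom C0 (univ_str C0 hw a) a : @hom C X _ _ _ (univ C0 hw a : cubic _) a) c).
Proof.
pose w : @hom C X _ _ _ (univ C0 hw b : cubic _) a := bc_to C0 (univ_map_str C0 hw u) u.
have e1 := @cmap_comp C X E _ _ _ _ _ _ _ _ _ _ _ w (bc_to_comp2 C0 (univ_map_str C0 hw u) u) c.
have e2 := @cmap_comp C X E _ _ _ _ _ _ _ _ _ _ _ w (bc_to_comp1 C0 (univ_map_str C0 hw u) u) c.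
exact: etrans (esym e1) e2.
Qed.

(** The projection of the cover induced from a pullback; through it the action on [E] is recovered
    from that on the induced cover. *)
Definition sharp_counit : cover_map (sharp C0 hw PE) E :=
  @CoverMap C X (sharp C0 hw PE) E
    (fun R a => cmap E (bc_hom C0 (univ_str C0 hw a) a : @hom C X _ _ _ (univ C0 hw a : cubic _) a))
    (fun R a r => cmapE E (bc_hom C0 (univ_str C0 hw a) a : @hom C X _ _ _ (univ C0 hw a : cubic _) a) r)
    sharp_counit_nat.

Lemma sharp_counit_up (p : @fiber C Y y PE) : fiber_map sharp_counit (sharp_up p) = fiber_down (f := forget_flex C) p.
Proof.
apply: fiber_ext => c; change (fpt p (cmap E (mhom (forget_flex C) point_hom) (cmap E (bc_hom C0 (univ_str C0 hw x) x : @hom C X _ _ _ (U : cubic _) x) c)) = fpt p c).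
have e := @cmap_comp C X E _ _ _ _ _ _ _ _ _ _ _ (id_hom C0 x : @hom C X _ _ _ x x) point_comp c.
refine (@f_equal _ _ (fpt p) _ _ (etrans (esym e) (cmap_id C0 c))).
Qed.
End Descent.

Theorem kernel_push_image (t : @pi1 C X x) : @pact C X x t FC z = z -> @push_image C Y X (forget_flex C) y t.
Proof.
move=> ht.
have nat (E E' : cover Y) (m : cover_map E E') (p : @fiber C Y y E) :
    sharp_act ht (fiber_map m p) = fiber_map m (sharp_act ht p).
  apply: sharp_up_inj; rewrite sharp_actE !sharp_up_map sharp_actE; exact: (pact_nat t (sharp_map m)).
pose s : @pi1 C Y y := @Pi1 C Y y (fun E => @sharp_act E t ht) (fun E => @sharp_act_bij E t ht) nat.
exists s; apply: pi1P => E p /=.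
set p1 := fiber_up p; rewrite -(sharp_counit_up (sharp_act ht p1)) sharp_actE.
rewrite -(pact_nat t (sharp_counit E)) sharp_counit_up; congr (pact t _).
exact: (@fiber_upK C Y X (forget_flex C) y E p).
Qed.

End Kernel.

(** * Computation of the monodromy group *)

Lemma fact_hom_fix (C : fieldType) (C0 : char0 C) (w0 : C) (hw : cube_root w0) (R : comAlgType C) (a : cubic R) c :
  (forall g, fact_hom hw a g c = c) -> exists r, fs (fpk w0 a) r = c.
Proof.
exact: (@frameRing_fix R _ _ _ (cube_root_map (in_alg R) hw) (h6A R C0) (fun k chi => alg_char0 C0 chi)
  (@tensors_sym _ _ a) (fun k chi => tensors_gen a C0 chi) _ _ _ (fP (fpk w0 a)) c).
Qed.

Section FiberNonempty.
Variables (C : closedFieldType) (C0 : char0 C) (w0 : C) (hw : cube_root w0) (x : cubic (C^o : comAlgType C)).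
Notation FC := (frame_cover C0 hw).
Notation T := (univ_ring C0 hw x).

(* c is a root of the product over g of X - g c, whose coefficients are invariant, hence scalars. *)
Lemma fiber_nonempty : exists z : @fiber C (plane_cubics C) x FC, True.
Proof.
have [k [chi _]] := @max_residue T (fun c => c = 0) erefl (fun a b ha hb => etrans (congr2 +%R ha hb) (addr0 0))
   (fun a b hb => etrans (congr1 ( *%R a) hb) (mulr0 a)) (fun e => negP (fT_nz C0 hw x) (introT eqP e)).
pose s : {rmorphism C -> T} := fs (fpk w0 x).
pose psi : {rmorphism C -> k} := chi \o s.
pose act g : {rmorphism T -> T} := fact_hom hw x g.
have [|pi hpi] := @rmorph_lift T C k psi chi; last first.
  have pis c : pi (s c) = c by apply: (fmorph_inj psi); rewrite hpi.
  by exists (@Fiber C (plane_cubics C) x FC (pi : {rmorphism fT (fpk w0 x) -> C^o}) pis).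
move=> c; pose P : {poly T} := \prod_(g : ASL2F3) ('X - (act g c)%:P).
have Pi h : map_poly (act h) P = P.
  rewrite rmorph_prod [RHS](reindex_inj (mulgI h)) /=; apply: eq_bigr => g _.
  rewrite rmorphB /= map_polyX map_polyC; congr (_ - _%:P); apply: esym; exact: fact_homM.
have Pc i : exists r, s r = P`_i.
  apply: (@fact_hom_fix C C0 w0 hw _ x P`_i) => h.
  exact: etrans (esym (coef_map (act h) P i)) (congr1 (fun Q : {poly T} => Q`_i) (Pi h)).
have [r hr] := choice Pc; pose p : {poly C} := \poly_(i < size P) r i.
have Ep : map_poly psi p = map_poly chi P.
  apply/polyP => i; rewrite !coef_map coef_poly; case: ltnP => hi; first by rewrite /psi /= hr.
  by rewrite (nth_default _ hi); exact: etrans (rmorph0 psi) (esym (rmorph0 chi)).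
have Pm : P \is monic by apply: monic_prod => g _; exact: monicXsubC.
have p0 : p != 0.
  apply/eqP => e; have : map_poly chi P = 0 by rewrite -Ep e rmorph0.
  by move/eqP; apply/negP; rewrite monic_neq0 ?monic_map.
have rt : root (map_poly psi p) (chi c).
  rewrite Ep /root rmorph_prod horner_prod (bigD1 1%g)//= rmorphB /= map_polyX map_polyC hornerXsubC.
  have -> : act 1%g c = c by exact: fact_hom1.
  by rewrite subrr mul0r.
have [rs Ers] := closed_field_poly_normal p.
move: rt; rewrite Ers map_polyZ rootZ ?fmorph_eq0 ?lead_coef_eq0// rmorph_prod.
rewrite /root horner_prod prodf_seq_eq0 => /hasP[l _ /=].
by rewrite rmorphB /= map_polyX map_polyC hornerXsubC subr_eq0 => /eqP ->; exists l.
Qed.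

End FiberNonempty.

Section FlexTranslates.
Variables (C : fieldType) (C0 : char0 C) (w0 : C) (hw : cube_root w0).
Let i3 : C := 2%:R * (6%:R^-1).
Let h3 : 3%:R * i3 = 1. Proof. by rewrite mulrA -natrM divff// C0. Qed.

Lemma cubes_opp (a b : C) : a ^+ 3 + b ^+ 3 = 0 -> exists e, a = - (wp w0 e * b).
Proof.
have [->|b0] := eqVneq b 0.
  by rewrite expr0n addr0 => /eqP; rewrite expf_eq0 => /eqP ->; exists 0; rewrite mulr0 oppr0.
move=> E; have E' : (- a / b) ^+ 3 = 1.
  have -> : (- a / b) ^+ 3 = - a ^+ 3 / b ^+ 3 by field.
  by move/eqP: E; rewrite addr_eq0 => /eqP ->; rewrite opprK divff ?expf_neq0.
pose D := @Pring C C idfun.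
have Dl : plocal D by move=> s s0; exists (s^-1 : C); rewrite mulVf.
have [e he] := @plocal_cube_root D w0 _ hw h3 Dl (- a / b) E'.
by exists e; rewrite -[wp w0 e]/(wp (w0 : D) e) -he mulfVK ?opprK.
Qed.

Lemma weyl0_flexvec (u : 'cV['F_3]_2) (i : 'I_3) : (weyl0 w0 u *m flexvec C) i 0 =
  (if (i : 'F_3) == 1 + u 0 0 then wp w0 (2%:R * u 0 0 * u 1 0 + u 1 0) else 0)
  - (if (i : 'F_3) == 2%:R + u 0 0 then wp w0 (2%:R * u 0 0 * u 1 0 + u 1 0 * 2%:R) else 0).
Proof.
rewrite mxE sum3 /weyl0 !mxE /= mulr0 add0r mulr1 mulrN1; congr (_ - _).
by case: ifP => // _; congr (wp _ (_ + _)); exact: mulr1.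
Qed.

(** At a flex of a Hesse form one coordinate is 0 and the ratio of the two others is minus a cube
    root of unity; translations move the zero and characters change the ratio. *)
Lemma flexvec_translate (v : 'cV[C]_3) : v 0 0 * v 1 0 * v 2%:R 0 = 0 ->
  v 0 0 ^+ 3 + v 1 0 ^+ 3 + v 2%:R 0 ^+ 3 = 0 -> exists r c, v = r *: (weyl0 w0 c *m flexvec C).
Proof.
have nz x : wp w0 x != 0 by apply/eqP => e; have := wpN hw x; rewrite e mulr0 => /esym/eqP; rewrite oner_eq0.
(* The three cases are cyclic rotations of one another; [j0] is the index of the zero coordinate. *)
have fin (a b : 'F_3) (j1 j2 j0 : 'I_3) : (forall Q : 'I_3 -> Prop, Q j0 -> Q j1 -> Q j2 -> forall i, Q i) ->
   (j1 : 'F_3) = 1 + a -> (j2 : 'F_3) = 2%:R + a -> (j0 : 'F_3) = a ->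
   v j0 0 = 0 -> v j1 0 = - (wp w0 (- b) * v j2 0) -> exists r c, v = r *: (weyl0 w0 c *m flexvec C).
  move=> ind e1 e2 e0 v0 v1.
  have n1 : ((1 + a : 'F_3) == 2%:R + a) = false by rewrite (inj_eq (addIr a)).
  have n2 : ((2%:R + a : 'F_3) == 1 + a) = false by rewrite (inj_eq (addIr a)).
  have n3 : ((a : 'F_3) == 1 + a) = false by rewrite -{1}[a]add0r (inj_eq (addIr a)).
  have n4 : ((a : 'F_3) == 2%:R + a) = false by rewrite -{1}[a]add0r (inj_eq (addIr a)).
  pose q := wp w0 (2%:R * a * b + b * 2%:R); exists (- (v j2 0 / q)), (vec2 a b).
  have qE : wp w0 (2%:R * a * b + b) = wp w0 (- b) * q.
    rewrite /q -wpD//; congr (wp _ _); ring.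
  apply/matrixP => i i'; rewrite ord1 [RHS]mxE weyl0_flexvec vec2_0 vec2_1; move: i; apply: ind.
  - by rewrite v0 e0 n3 n4 subr0 mulr0.
  - by rewrite v1 e1 eqxx n1 subr0 qE; field; exact: nz.
  - by rewrite e2 eqxx n2 sub0r -/q; field; exact: nz.
move=> p s; move/eqP: p; rewrite !mulf_eq0 -orbA => /or3P[]/eqP z0.
- have [e he] : exists e, v 1 0 = - (wp w0 e * v 2%:R 0) by apply: cubes_opp; rewrite -[RHS]s z0; ring.
  apply: (fin 0 (- e) 1 2%:R 0) => //; try exact/val_inj; try (by (move=> Q q0 q1 q2; exact: (I3_ind q0 q1 q2))).
  by rewrite opprK.
- have [e he] : exists e, v 2%:R 0 = - (wp w0 e * v 0 0) by apply: cubes_opp; rewrite -[RHS]s z0; ring.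
  apply: (fin 1 (- e) 2%:R 0 1) => //; try exact/val_inj; try (by (move=> Q q0 q1 q2; exact: (I3_ind q2 q0 q1))).
  by rewrite opprK.
have [e he] : exists e, v 0 0 = - (wp w0 e * v 1 0) by apply: cubes_opp; rewrite -[RHS]s z0; ring.
apply: (fin 2%:R (- e) 0 1 2%:R) => //; try exact/val_inj; try (by (move=> Q q0 q1 q2; exact: (I3_ind q1 q2 q0))).
by rewrite opprK.
Qed.

(** A nonzero shift moves the zero coordinate, and a nontrivial character changes the ratio of the
    two others. *)
Lemma flexvec_fixed c r : weyl0 w0 c *m flexvec C = r *: flexvec C -> c = 0.
Proof.
move=> E; suff [ca cb] : c 0 0 = 0 /\ c 1 0 = 0.
  by rewrite [c]vec2E ca cb; apply/matrixP => i j; rewrite !mxE; case: ifP.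
have nz x : wp w0 x != 0 by apply/eqP => e; have := wpN hw x; rewrite e mulr0 => /esym/eqP; rewrite oner_eq0.
have ww := hw; rewrite /cube_root in ww.
have k3 : (3%:R : C) != 0 by exact: C0.
have e j := etrans (esym (weyl0_flexvec c j)) (congr1 (fun M : 'cV_3 => M j 0) E).
have := e 0; have := e 1; have := e 2%:R; rewrite !mxE /= mulr0 mulr1 mulrN1.
move: (c 0 0) (c 1 0) {E e} => a b; elim/F3_ind: a => e2 e1 e0; last 2 first.
- by move: e0; rewrite /= sub0r => /eqP; rewrite oppr_eq0 (negPf (nz _)).
- by move: e0; rewrite /= subr0 => /eqP; rewrite (negPf (nz _)).
have q : wp w0 b = wp w0 (b * 2%:R).
  move: e1 e2; rewrite /= !mulr0 !mul0r !add0r subr0 => <- /oppr_inj; exact: esym.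
split=> //.
elim/F3_ind: b q {e0 e1 e2} => // q; exfalso; case/eqP: k3.
- have q' : w0 = -1 - w0 by move: q; rewrite mul1r wp1 (wp2 hw).
  have : 1 + 2%:R * w0 = 0 by rewrite mulr_natl mulr2n {1}q'; ring.
  move=> q2; transitivity (4%:R * (1 + w0 + w0 * w0) - (1 + 2%:R * w0) * (1 + 2%:R * w0)); first by ring.
  by rewrite ww q2; ring.
have e1 : (2%:R * 2%:R : 'F_3) = 1 by exact/val_inj.
have q' : w0 = -1 - w0 by move: q; rewrite e1 wp1 (wp2 hw) => ->.
have : 1 + 2%:R * w0 = 0 by rewrite mulr_natl mulr2n {1}q'; ring.
move=> q2; transitivity (4%:R * (1 + w0 + w0 * w0) - (1 + 2%:R * w0) * (1 + 2%:R * w0)); first by ring.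
by rewrite ww q2; ring.
Qed.

End FlexTranslates.

Section FlexFrames.
Variables (C : fieldType) (C0 : char0 C) (w0 : C) (hw : cube_root w0) (y : flexed_cubic (C^o : comAlgType C)).
Notation Fib := (@fiber C (plane_cubics C) (fcubic y) (frame_cover C0 hw)).
Notation PP z := (parity (third C^o) (fib_frame z)).
Let i2 : C^o := 3%:R * (6%:R^-1 : C)%:A.
Let h2 : 2%:R * i2 = 1 :> C^o. Proof. by rewrite mulrA -natrM (h6A C^o C0). Qed.
Let w1 : cube_root (w0%:A : C^o) := cube_root_map (in_alg C^o) hw.
Let h3 : 3%:R * third C^o = 1 := thirdE C0 C^o.
Let wE : (w0%:A : C^o) = w0. Proof. exact: mulr1. Qed.

Lemma fib_weyl (z : Fib) : weyl (w0%:A : C^o) (fib_frame z).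
Proof. exact: (fib_frameP z).1. Qed.

(** The translation 2c twists W(u) by w^(2 det(c, u)), which is conjugation by W(c); the linear part
    only permutes the terms of the sum. *)
Lemma parity_act (z : Fib) c A : PP (fib_act z (2%:R *: c, A)) = fib_frame z c *m PP z *m fib_frame z (- c).
Proof.
rewrite /parity -scalemxAr -scalemxAl; congr (_ *: _); rewrite mulmx_sumr mulmx_suml.
have Ainj : injective (fun u : 'cV['F_3]_2 => val A *m u).
  by move=> u v e; have := congr1 (mulmx (invmx (val A))) e; rewrite !mulmxA !mulVmx ?SL2F3_unit// !mul1mx.
rewrite [RHS](reindex_inj Ainj) /=; apply: eq_bigr => u _.
rewrite fib_act_frame (weyl_conj w1 _ _ (fib_weyl z)) /fact /= det2Zl; congr (wp _ _ *: _).
exact: esym wE.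
Qed.

(** Every translation is 2c for some c, since 2 is its own inverse modulo 3. Then W(-c) fixes p_0,
    and c = 0 follows in Hesse coordinates. *)
Lemma on_flex_stab (z : Fib) g : on_flex z -> on_flex (fib_act z g) -> g.1 = 0.
Proof.
case: g => b A h1 h2' /=; pose c : 'cV['F_3]_2 := 2%:R *: b.
have bE : b = 2%:R *: c by rewrite scalerA (_ : (2%:R * 2%:R : 'F_3) = 1) ?scale1r//; exact/val_inj.
have [v0 [i [hv vi]]] := flex_gen (fflexP y) (idfun : {rmorphism C^o -> C}).
have e1 := h1 v0 hv; have e2 := h2' v0 hv.
rewrite {1}bE parity_act in e2.
have e3 : PP z *m (fib_frame z (- c) *m v0) = - (fib_frame z (- c) *m v0).
  have := congr1 (mulmx (fib_frame z (- c))) e2; rewrite mulmxN !mulmxA.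
  by rewrite (weylK _ (fib_weyl z)) mul1mx.
have [h [hh d0 _ hl]] := parity_line w1 h3 h2 (fib_weyl z) (idfun : {rmorphism C^o -> C}).
have [r1 E1 _] := hl v0 e1; have [r2 E2 _] := hl _ e3.
have hk : h *m \adj h = (\det h)%:M := mul_mx_adj h.
pose d : C := \det h; have dn : d != 0 := d0.
have r10 : (r1 : C) != 0.
  apply/eqP => z1; case/eqP: vi; have := congr1 (mulmx h) E1.
  rewrite z1 scale0r mulmx0 -scalemxAr mulmxA hk mul_scalar_mx scalerA => /matrixP/(_ i 0).
  rewrite !mxE => /eqP; rewrite mulf_eq0 => /orP[|/eqP//]; rewrite mulf_eq0 orbb => /eqP dd.
  by move: dn; rewrite /d dd eqxx.
have E3 : weyl0 (w0 : C^o) (- c) *m flexvec C^o = ((r1 : C)^-1 * r2 : C) *: flexvec C^o.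
  have E4 : \det h *: (\adj h *m (fib_frame z (- c) *m v0)) = weyl0 (w0%:A : C^o) (- c) *m (\det h *: (\adj h *m v0)).
    have e5 : \det h *: v0 = h *m (\adj h *m v0) by rewrite mulmxA hk mul_scalar_mx.
    rewrite -scalemxAr; apply: (scalerI dn); rewrite !scalerA.
    transitivity (\det h *: (\adj h *m (fib_frame z (- c) *m (\det h *: v0)))); first by rewrite -!scalemxAr scalerA.
    by rewrite e5 [fib_frame z _ *m _]mulmxA hh -!mulmxA [\adj h *m (h *m _)]mulmxA mul_adj_mx mul_scalar_mx scalerA.
  rewrite E1 E2 wE -scalemxAr in E4; rewrite -scalerA E4 scalerA mulVf ?scale1r//.
have := flexvec_fixed C0 hw E3 => /eqP; rewrite oppr_eq0 => /eqP c0.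
by rewrite bE c0 scaler0.
Qed.

(** The marked flex is the image under some W(c) of the p_0 of any given frame; acting by the
    translation 2c moves p_0 onto it. *)
Lemma on_flex_ex (z0 : Fib) : exists z : Fib, on_flex z.
Proof.
have [h [v0 [i [sg [hh d0 hv vi [sg0 Ep Ec]]]]]] := flex_hesse C0 hw (fflexP y) (fib_frameP z0) (idfun : {rmorphism C^o -> C}).
set v' := \adj h *m _ in Ep Ec.
have [r [c E]] : exists r c, (v' : 'cV[C]_3) = r *: (weyl0 w0 c *m flexvec C).
  apply: (flexvec_translate C0 hw); [move/eqP: Ep|move/eqP: Ec]; rewrite mulf_eq0 => /orP[/eqP e|/eqP//];
  by move: sg0; rewrite /= e eqxx.
have Ev : map_mx (idfun : {rmorphism C^o -> C^o}) v0 = v0 by apply/matrixP => a b; rewrite mxE.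
have E' : \adj h *m v0 = r *: (weyl0 w0 c *m flexvec C) := etrans (congr1 (mulmx (\adj h)) (esym Ev)) E.
exists (fib_act z0 ((2%:R *: c, asl_one.2) : ASL2F3)) => v hvv.
have hp : PP z0 *m (h *m flexvec C^o) = - (h *m flexvec C^o).
  by rewrite mulmxA (parity_conj (third C^o) hh) -mulmxA (parity0_flex w1 h3) mulmxN.
have E0 : \det h *: v0 = r *: (fib_frame z0 c *m (h *m flexvec C^o)).
  have -> : \det h *: v0 = h *m (\adj h *m v0) by rewrite mulmxA mul_mx_adj mul_scalar_mx.
  rewrite E' -scalemxAr; congr (_ *: _).
  by rewrite [RHS]mulmxA hh -mulmxA; congr (_ *m (weyl0 _ _ *m _)); exact: esym wE.
have key : PP (fib_act z0 ((2%:R *: c, asl_one.2) : ASL2F3)) *m v0 = - v0.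
  apply: (scalerI (d0 : (\det h : C) != 0)); rewrite scalemxAr E0 parity_act -scalemxAr.
  rewrite -!mulmxA [fib_frame z0 (- c) *m _]mulmxA (weylK _ (fib_weyl z0)) mul1mx hp mulmxN scalerN.
  by rewrite scalerN E0.
have Ep' : (v0 i 0 : C) *: v = (v i 0 : C) *: v0 :> 'cV[C]_3.
  by apply/matrixP => j l; rewrite !mxE ord1; exact: (flex_prop (fflexP y)).
apply: (scalerI (vi : (v0 i 0 : C) != 0)); rewrite scalemxAr.
have -> : v0 i 0 *: v = v i 0 *: v0 by exact: Ep'.
rewrite -scalemxAr key !scalerN; congr (- _); exact: esym Ep'.
Qed.

End FlexFrames.

Section MonodromyGroup.
Variables (C : closedFieldType) (C0 : char0 C) (w0 : C) (hw : cube_root w0) (y : flexed_cubic (C^o : comAlgType C)).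
Notation X := (plane_cubics C).
Notation Y := (flexed_plane_cubics C).
Notation FC := (frame_cover C0 hw).
Variables (z : @fiber C X (fcubic y) FC) (hz : on_flex z).
Notation pi := (@pi1 C X (fcubic y)).
Notation Th := (Theta z).
Notation N := (normal_core (@pi1_image C Y X (forget_flex C) y)).

Lemma Theta1 : Th (1%lg : pi) = 1%g.
Proof. by apply: (mulgI (Th 1%lg)); rewrite -ThetaM lg_mul1g mulg1. Qed.

Lemma ThetaV (t : pi) : Th (t^-1)%lg = (Th t)^-1%g.
Proof. by apply: (mulgI (Th t)); rewrite -ThetaM lg_mulgV mulgV Theta1. Qed.

Lemma push_image_stab t : @push_image C Y X (forget_flex C) y t -> (Th t).1 = 0.
Proof.
move=> [s <-]; apply: (on_flex_stab hz); rewrite -ThetaE.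
(* A nontrivial element on which to test naturality: the translation by (1, 1). *)
have g1 : ((const_mx 1, asl_one.2) : ASL2F3) != 1%g.
  by apply/eqP => /(congr1 (fun p : ASL2F3 => p.1 0 0)); rewrite !mxE.
exact: (push_on_flex s g1 hz).
Qed.

Lemma kernel_stab t : Th t = 1%g -> @push_image C Y X (forget_flex C) y t.
Proof. by move=> e; apply: (kernel_push_image hz); rewrite ThetaE e fib_act1. Qed.

Lemma core_Theta (t : pi) : sset N t <-> Th t = 1%g.
Proof.
split=> [/core_setP h|e]; last first.
  by apply/core_setP => g; apply: kernel_stab; rewrite !ThetaM e mulg1 ThetaV mulVg.
have b0 : (Th t).1 = 0 by apply: push_image_stab; have := h 1%lg; rewrite lg_conjg1.
(* Conjugating by the translation by c adds Ac - c to the translation part, which has to remain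
   0. *)
have fix_ (c : 'cV['F_3]_2) : val (Th t).2 *m c = c.
  have [g hg] := Theta_surj z ((c, asl_one.2) : ASL2F3).
  have e := push_image_stab (h g).
  have : (Th g * Th (t ^ g)%lg)%g = (Th t * Th g)%g by rewrite -!ThetaM -lg_mulA lg_mulVKg.
  move/(congr1 (fun p : ASL2F3 => p.1)); rewrite hg.
  change (val asl_one.2 *m (Th (t ^ g)%lg).1 + c = val (Th t).2 *m c + (Th t).1 -> val (Th t).2 *m c = c).
  by rewrite e b0 mulmx0 add0r addr0.
apply: injective_projections => //; apply: val_inj; apply/matrixP => i j.
have := congr1 (fun M : 'cV_2 => M i 0) (fix_ (delta_mx j 0)).
by rewrite -colE !mxE andbT.
Qed.

Lemma Theta_qproj (g : pi) : Th (qrepr (qproj N g)) = Th g.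
Proof.
have /qproj_eqP/core_Theta := qreprK (qproj N g).
by rewrite ThetaM ThetaV => /eqP; rewrite -eq_mulVg1 => /eqP.
Qed.

Theorem monodromy_affine : exists Phi : Mon (forget_flex C) y -> ASL2F3,
  bijective Phi /\ forall s t, Phi (s * t)%lg = (Phi s * Phi t)%g.
Proof.
pose Phi (A : quotient_sort N) := Th (qrepr A).
have [k hk] := choice (fun g => Theta_surj z g).
exists Phi; split; last by move=> s t; rewrite /Phi [LHS]Theta_qproj ThetaM.
exists (fun g => qproj N (k g)) => [A|g]; last by rewrite /Phi Theta_qproj hk.
rewrite -[RHS]qreprK; apply/qproj_eqP/core_Theta.
by rewrite ThetaM ThetaV hk mulVg.
Qed.

End MonodromyGroup.

Theorem proposition2p35 (R : realType)
  (y : ob (flexed_plane_cubics R[i]%C) (R[i]%C)^o) :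
  exists Phi : Mon (forget_flex R[i]%C) y -> ASL2F3,
    bijective Phi /\
    forall s t, Phi (s * t)%lg = (Phi s * Phi t)%g.
Proof.
have C0 : char0 R[i]%C by move=> n n0; rewrite Num.Theory.pnatr_eq0 -lt0n.
have [w0 hw] : exists w0 : R[i]%C, cube_root w0.
  (* A root of X^2 = -1 - X. *)
  have [w0 E] := @solve_monicpoly R[i]%C 2 (fun=> -1) isT; exists w0.
  rewrite /cube_root -expr2 E big_ord_recl big_ord1 /= expr0 expr1; ring.
have [z0 _] := fiber_nonempty C0 hw (fcubic y).
have [z hz] := on_flex_ex z0.
exact: (monodromy_affine hz).
Qed.
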